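(* Let $\mathcal U$ be an open neighbourhood of the identity $e=\mathrm{id}_{\mathbb S^1}$ in $\mathrm{Diff}^2_+(\mathbb S^1)$ such that $G_0\circ\gamma^{-1}\in\tilde L$ for every $\gamma\in\mathcal U$, where $G_0\in\tilde L$ is a fixed initial loop. Let $A:\mathbb S^1\times\mathcal U\to \mathrm M_N(\mathbb C)$ be a function which is $C^1$ with respect to both $\xi\in\mathbb S^1$ and $\gamma\in\mathcal U$ and satisfies $\oint_{\mathbb S^1}A(\xi,\gamma)\,d\xi=0$ for all $\gamma\in\mathcal U$. Consider the family of linear differential systems $$(A_\gamma)\qquad \frac{dY}{dx}=\mathcal A(x,\gamma)Y,\qquad \mathcal A(x,\gamma)=\frac1{2i\pi}\oint_{\mathbb S^1}\frac{A(\xi,\gamma)}{\xi-x}\,d\xi ,\qquad \gamma\in\mathcal U,$$ and set $B_n(\gamma)=\frac{-1}{2i\pi}\oint_{\mathbb S^1}\xi^nA(\xi,\gamma)\,d\xi$ for $n\in\mathbb Z$. Then the family $(A_\gamma)_{\gamma\in\mathcal U}$ admits an $M$-invariant solution $Y(x,\gamma)$ satisfying $Y(\infty,\gamma)=\mathrm I_N$ if and only if the coefficients $B_n(\gamma)$ ($n\in\mathbb Z$) satisfy the following nonlinear differential system: for all $m,n\in\mathbb Z$ with $n\ge 1$, $$L_m\cdot B_n=\sum_{k=0}^{n-1}[B_k,B_{m+n-k}]+nB_{m+n},$$ $$L_m\cdot B_{-n}=-\sum_{k=-n}^{-1}[B_k,B_{m-n-k}]-nB_{m-n}.$$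
   Context: Notation. $\mathbb P^1=\mathbb C\cup\{\infty\}$; $\mathbb S^1$ is the unit circle; $\mathbb D^+$ is the open unit disk and $\mathbb D^-=\mathbb P^1\setminus\overline{\mathbb D^+}$. For a function $F$ on $\mathbb P^1\setminus\mathbb S^1$, $F^\pm(\xi)$ denote the limits of $F(x)$ as $x\to\xi\in\mathbb S^1$ with $x\in\mathbb D^\pm$. Loops. $L=C^2(\mathbb S^1,\mathrm{GL}_N(\mathbb C))$, and $\tilde L\subset L$ is the open dense subset of loops of the form $G=(Z^-)^{-1}Y^+$ on $\mathbb S^1$, where $Y:\mathbb D^+\to\mathrm{GL}_N(\mathbb C)$ and $Z:\mathbb D^-\to\mathrm{GL}_N(\mathbb C)$ are analytic, extend to $\mathbb S^1$ with boundary values in $L$, and $Z(\infty)=\mathrm I_N$. Diffeomorphisms. $\mathrm{Diff}^2_+(\mathbb S^1)$ is the group of orientation preserving $C^2$-diffeomorphisms of $\mathbb S^1$, with the topology of uniform convergence of the maps and of their first two derivatives; it is a Banach manifold modeled on the space of $C^2$ vector fields on $\mathbb S^1$. Vectors tangent to $\mathbb S^1\subset\mathbb C$ are viewed as complex numbers, so the complexified tangent space at $\gamma$ is identified with the $C^2$ functions $\mathbb S^1\to\mathbb C$. For $m\in\mathbb Z$, $L_m$ is the complex vector field on $\mathrm{Diff}^2_+(\mathbb S^1)$ given by $(L_m)_\gamma(\xi)=\gamma(\xi)^{m+1}$. For a function $\Phi$ of $\gamma$, $L_m\cdot\Phi$ is the (complex-linearly extended) Lie derivative of $\Phi$ along $L_m$.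 Coefficients. The $B_n$ are the coefficients of the expansions $\mathcal A(x,\gamma)=\sum_{m\ge1}B_m(\gamma)x^{-m-1}$ for $|x|>1$ and $\mathcal A(x,\gamma)=-\sum_{m\ge1}B_{-m}(\gamma)x^{m-1}$ for $|x|<1$; $B_0=0$ by the assumption on $A$. Solutions. A fundamental solution of the family $(A_\gamma)$ is a function $Y:(\mathbb P^1\setminus\mathbb S^1)\times\mathcal U\to\mathrm{GL}_N(\mathbb C)$, analytic in $x$ on $\mathbb D^+$ and $\mathbb D^-$ and solving $(A_\gamma)$ there for each $\gamma$ (it is tacitly taken differentiable in $\gamma$, so that $L_m\cdot Y$ makes sense). Its limits $Y^\pm(\xi,\gamma)$ exist and are invertible, and its monodromy is $G(\xi,\gamma)=Y^-(\xi,\gamma)^{-1}Y^+(\xi,\gamma)$, $(\xi,\gamma)\in\mathbb S^1\times\mathcal U$. The solution $Y$ is called $M$-invariant if $G(\xi,\gamma)=G(\gamma^{-1}(\xi),e)$ for all $(\xi,\gamma)\in\mathbb S^1\times\mathcal U$.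
   Formalization: The neighbourhood U is assumed connected; for disconnected U the ''if'' direction fails (e.g. N=1, G_0=1, A=0 near the identity and A = d/dξ of γ^{-1}(ξ) on another component). *)

(* Defs.v *)
From HB Require Import structures.
From mathcomp Require Import all_boot all_order all_algebra.
From mathcomp Require Import complex.
From mathcomp Require Import all_classical all_reals all_analysis.

Set Implicit Arguments.
Unset Strict Implicit.
Unset Printing Implicit Defensive.

Import Order.TTheory GRing.Theory Num.Theory.
Import numFieldNormedType.Exports.

Local Open Scope ring_scope.
Local Open Scope complex_scope.
Local Open Scope classical_set_scope.

#[warnings="-redundant-canonical-projection", non_forgetful_inheritance]
HB.instance Definition _ (R : rcfType) := NormedModule.copy R[i] R[i]^o.

Section circle.
Context {R : realType}.
Local Notation C := R[i].

Record circle := Circle { circle_val :> C ; _ : `|circle_val| == 1 }.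
HB.instance Definition _ := [isSub for circle_val].

Fact cis_subproof (t : R) : `|cos t +i* sin t : C| == 1.
Proof. by rewrite normc_def /= cos2Dsin2 sqrtr1. Qed.
Definition cis (t : R) : circle := Circle (cis_subproof t).

Fact cmul_subproof (a b : circle) : `|(a : C) * (b : C)| == 1.
Proof. by case: a b => [a /= /eqP a1] [b /= /eqP b1]; rewrite normrM a1 b1 mul1r. Qed.
Definition cmul (a b : circle) : circle := Circle (cmul_subproof a b).

Definition C2 (g : R -> R) :=
  [/\ forall t, derivable g t 1,
      forall t, derivable g^`() t 1 &
      continuous g^`(2)].

Definition lin (a : R) (f g : R -> R) : R -> R := fun t => a * f t + g t.

Lemma derive_lin (a : R) (f g : R -> R) : (forall t, derivable f t 1) ->
  (forall t, derivable g t 1) ->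
  (forall t, derivable (lin a f g) t 1) /\
  derive1 (lin a f g) = lin a (derive1 f) (derive1 g).
Proof.
move=> df dg.
have H t : is_derive t (1 : R) (lin a f g) (lin a (derive1 f) (derive1 g) t).
  have ? : is_derive t (1 : R) f (derive1 f t).
    by rewrite derive1E; exact/derivableP.
  have ? : is_derive t (1 : R) g (derive1 g t).
    by rewrite derive1E; exact/derivableP.
  exact: is_deriveD.
split=> [t|]; first exact: (@ex_derive _ _ _ _ _ _ _ (H t)).
by apply/funext => t; rewrite derive1E; exact: (@derive_val _ _ _ _ _ _ _ (H t)).
Qed.

Lemma derive1n_lin (a : R) (f g : R -> R) k : C2 f -> C2 g -> (k <= 2)%N ->
  derive1n k (lin a f g) = lin a (derive1n k f) (derive1n k g).
Proof.
move=> [f1 f2 f3] [g1 g2 g3].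
have [_ E1] := derive_lin a f1 g1; have [_ E2] := derive_lin a f2 g2.
case: k => [_|[_|[_|k k2]]]; first exact: erefl.
  exact: E1.
  exact: etrans (congr1 (fun h : R -> R => derive1 h) E1) E2.
by exfalso.
Qed.

Lemma C2_lin (a : R) (f g : R -> R) : C2 f -> C2 g -> C2 (lin a f g).
Proof.
move=> Cf Cg; have E2 := derive1n_lin a Cf Cg (leqnn 2).
case: Cf Cg => [f1 f2 f3] [g1 g2 g3].
have [h1 E1] := derive_lin a f1 g1; have [h2 _] := derive_lin a f2 g2.
split; first exact: h1.
  by move=> t; rewrite E1; exact: h2.
rewrite E2 => t; apply: cvgD; last exact: g3.
by apply: cvgM; [exact: cvg_cst|exact: f3].
Qed.

Definition C2_circle (f : circle -> C) :=
  C2 (fun t => complex.Re (f (cis t))) /\ C2 (fun t => complex.Im (f (cis t))).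

(* k-th derivative of t |-> f(e^{it}), at t. *)
Definition angular (k : nat) (f : circle -> C) (t : R) : C :=
  (fun s => complex.Re (f (cis s)))^`(k) t +i* (fun s => complex.Im (f (cis s)))^`(k) t.

(* The inverse of g when g is bijective. *)
Definition cinv (g : circle -> circle) : circle -> circle := 'pinv_id setT g.

(* The last clause is preservation of the orientation: i g(e^{it}) is the
   positively oriented unit tangent vector at g(e^{it}), and 0 < z on R[i]
   means that z is a positive real number. *)
Definition diffeo2 (g : circle -> circle) :=
  [/\ bijective g, C2_circle g, C2_circle (cinv g) &
      forall t, 0 < angular 1 g t / (('i : C) * g (cis t))].

Record Diff2 := MkDiff2 {
  Diff2_val :> circle -> circle ; _ : `[< diffeo2 Diff2_val >] }.
HB.instance Definition _ := [isSub for Diff2_val].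
HB.instance Definition _ := gen_eqMixin Diff2.
HB.instance Definition _ := gen_choiceMixin Diff2.

(* Topology of uniform convergence of the maps and of their first two angular
   derivatives. *)
Definition Diff2_ball (g : Diff2) (e : R) (h : Diff2) :=
  forall (k : nat) (t : R), (k <= 2)%N ->
    `|angular k (Diff2_val g) t - angular k (Diff2_val h) t| < e%:C.

Definition Diff2_ent : set_system (Diff2 * Diff2) := entourage_ Diff2_ball.
Definition Diff2_nbhs (g : Diff2) : set_system Diff2 := nbhs_ Diff2_ent g.

HB.instance Definition _ := hasNbhs.Build Diff2 Diff2_nbhs.

Fact Diff2_ball_center g (e : R) : 0 < e -> Diff2_ball g e g.
Proof. by move=> e0 k t _; rewrite subrr normr0 ltcR. Qed.

Fact Diff2_ball_sym g h (e : R) : Diff2_ball g e h -> Diff2_ball h e g.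
Proof. by move=> gh k t k2; rewrite distrC; exact: gh. Qed.

Fact Diff2_ball_triangle g h l (e1 e2 : R) :
  Diff2_ball g e1 h -> Diff2_ball h e2 l -> Diff2_ball g (e1 + e2) l.
Proof.
move=> gh hl k t k2; rewrite rmorphD /=.
rewrite (le_lt_trans (ler_distD (angular k (Diff2_val h) t) _ _))//.
by rewrite ltrD// ?gh ?hl.
Qed.

Fact Diff2_entE : Diff2_ent = entourage_ Diff2_ball. Proof. by []. Qed.
Fact Diff2_nbhsE : Diff2_nbhs = nbhs_ Diff2_ent. Proof. by []. Qed.

HB.instance Definition _ := @Nbhs_isPseudoMetric.Build R Diff2 Diff2_ent
  Diff2_nbhsE Diff2_ball Diff2_ball_center Diff2_ball_sym Diff2_ball_triangle
  Diff2_entE.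


(* C2fun is the Banach space of real C^2 functions on the circle. *)
Definition C2pred : {pred circle -> R} := fun u => `[< C2 (u \o cis) >].

Record C2fun := MkC2fun {
  C2fun_val :> circle -> R ; _ : C2fun_val \in C2pred }.
HB.instance Definition _ := [isSub for C2fun_val].
HB.instance Definition _ := gen_eqMixin C2fun.
HB.instance Definition _ := gen_choiceMixin C2fun.

Lemma C2_0 : C2 (0 : R -> R).
Proof.
have d0 : (0 : R -> R)^`() = 0.
  by apply/funext => t; rewrite derive1_cst.
by split=> [t|t|]; rewrite ?derive1nS ?derive1n0 ?d0; try exact: derivable_cst;
  move=> t; exact: cvg_cst.
Qed.

Lemma C2pred_submod : submod_closed C2pred.
Proof.
split=> [|a u v /asboolP u2 /asboolP v2]; first exact/asboolP/C2_0.
by apply/asboolP; exact: (C2_lin a u2 v2).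
Qed.
HB.instance Definition _ := GRing.isSubmodClosed.Build R (circle -> R) C2pred C2pred_submod.
HB.instance Definition _ := [SubChoice_isSubLmodule of C2fun by <:].

Lemma cis_surj (z : circle) : exists t, cis t = z.
Proof.
case: z => [[x y] xy1].
have xy : x ^+ 2 + y ^+ 2 = 1.
  move: (xy1); rewrite normc_def /= => /eqP [/(congr1 (fun r => r ^+ 2))].
  by rewrite sqr_sqrtr ?expr1n// addr_ge0 ?sqr_ge0.
have x1 : -1 <= x <= 1.
  rewrite -ler_norml -(@expr_le1 _ 2)// -normrX ger0_norm ?sqr_ge0//.
  by rewrite -xy lerDl sqr_ge0.
have sy : sin (acos x) = `|y|.
  by rewrite sin_acos// -xy addrAC subrr add0r sqrtr_sqr.
have cx : cos (acos x) = x by rewrite acosK.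
have [y0|y0] := leP 0 y.
  exists (acos x); apply/val_inj => /=.
  by rewrite cx sy ger0_norm.
exists (- acos x); apply/val_inj => /=.
by rewrite cosN sinN cx sy ltr0_norm// opprK.
Qed.

Lemma derive1_periodic (f : R -> R) (T : R) :
  periodic f T -> periodic (derive1 f) T.
Proof.
move=> fT t; rewrite /derive1.
suff -> : (fun h : R => h^-1 *: (f (h + (t + T)) - f (t + T))) =
  (fun h : R => h^-1 *: (f (h + t) - f t)) by [].
by apply/funext => h; rewrite addrA !fT.
Qed.

Lemma periodic_bounded (f : R -> R) : periodic f (pi *+ 2) -> continuous f ->
  exists M, forall t, `|f t| <= M.
Proof.
move=> fT cf.
have pi0 : 0 < pi *+ 2 :> R by rewrite pmulrn_lgt0 ?pi_gt0.
have cn : {within `[0, pi *+ 2], continuous (fun t => `|f t|)}.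
  by apply: continuous_subspaceT => t; apply: cvg_norm; exact: cf.
have [c _ cM] := EVT_max (ltW pi0) cn.
exists `|f c| => t.
have /andP[nt tn] := floor_itv (t / (pi *+ 2)).
move: nt tn; rewrite ler_pdivlMr// ltr_pdivrMr//.
case: (Num.floor _) => n.
  rewrite intrD mulrDl mul1r -pmulrn mulr_natl => nt tn.
  rewrite -[t](subrK (pi *+ 2 *+ n)) periodicn//; apply: cM.
  by rewrite in_itv/= subr_ge0 nt lerBlDl ltW.
rewrite NegzE intrD mulrNz mulrDl mul1r mulNr -pmulrn mulr_natl => nt tn.
rewrite -(periodicn fT n.+1); apply: cM.
rewrite in_itv/= -lerBlDr sub0r nt/= -lerBrDr.
by rewrite addrC ltW.
Qed.

Lemma C2fun_bounded (u : C2fun) k : (k <= 2)%N ->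
  exists M, forall t, `|derive1n k (C2fun_val u \o cis) t| <= M.
Proof.
case: u => u /= /asboolP[u1 u2 u3] k2.
have pu : periodic (u \o cis) (pi *+ 2).
  by move=> t /=; congr u; apply: val_inj; rewrite /= cosD2pi sinD2pi.
apply: periodic_bounded.
  by elim: k {k2} => [//|k IH]; rewrite derive1nS; exact: derive1_periodic.
case: k k2 => [_|[_|[_|k k2]]].
- by move=> t; apply: differentiable_continuous; exact/derivable1_diffP/u1.
- by move=> t; apply: differentiable_continuous; exact/derivable1_diffP/u2.
- exact: u3.
- by exfalso.
Qed.

Definition C2norm_part (u : C2fun) (k : nat) : R :=
  sup (range (fun t => `|derive1n k (C2fun_val u \o cis) t|)).

Definition C2norm (u : C2fun) : R := \sum_(k < 3) C2norm_part u k.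

Lemma C2norm_part_ge u k t : (k <= 2)%N ->
  `|derive1n k (C2fun_val u \o cis) t| <= C2norm_part u k.
Proof.
move=> k2; apply: ub_le_sup; last by exists t.
by have [M uM] := C2fun_bounded u k2; exists M => _ [s _ <-].
Qed.

Lemma C2norm_part_le u k M :
  (forall t, `|derive1n k (C2fun_val u \o cis) t| <= M) -> C2norm_part u k <= M.
Proof.
move=> uM; apply: ge_sup; last by move=> _ [t _ <-].
by eexists; exists 0.
Qed.

Lemma C2fun_linE (a : R) (u v : C2fun) :
  C2fun_val (a *: u + v) \o cis = lin a (C2fun_val u \o cis) (C2fun_val v \o cis).
Proof. by []. Qed.

Lemma C2norm_part_lin (a : R) (u v : C2fun) k : (k <= 2)%N ->
  C2norm_part (a *: u + v) k <= `|a| * C2norm_part u k + C2norm_part v k.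
Proof.
move=> k2; apply: C2norm_part_le => t.
rewrite C2fun_linE (derive1n_lin a _ _ k2); last 2 first.
- by case: u => u /= /asboolP.
- by case: v => v /= /asboolP.
rewrite (le_trans (ler_normD _ _))// normrM lerD//.
  by rewrite ler_wpM2l// C2norm_part_ge.
exact: C2norm_part_ge.
Qed.

Lemma C2norm_lin (a : R) (u v : C2fun) :
  C2norm (a *: u + v) <= `|a| * C2norm u + C2norm v.
Proof.
rewrite mulr_sumr -big_split/= ler_sum// => k _.
by apply: C2norm_part_lin; rewrite -ltnS.
Qed.

Lemma C2norm_part0 u k : (k <= 2)%N -> 0 <= C2norm_part u k.
Proof. by move=> k2; rewrite (le_trans _ (C2norm_part_ge u 0 k2)). Qed.

Lemma C2norm0 : C2norm 0 = 0.
Proof.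
rewrite /C2norm big1// => k _; have k2 : (k <= 2)%N by rewrite -ltnS.
apply/eqP; rewrite eq_le C2norm_part0// andbT; apply: C2norm_part_le => t.
have E := derive1n_lin (-1) C2_0 C2_0 k2.
have L0 : lin (-1) 0 0 = C2fun_val 0 \o cis.
  by apply/funext => s; rewrite /lin mulN1r addNr.
by rewrite -L0 E /lin mulN1r addNr normr0.
Qed.

Lemma C2norm_triangle u v : C2norm (u + v) <= C2norm u + C2norm v.
Proof. by have := C2norm_lin 1 u v; rewrite scale1r normr1 mul1r. Qed.

Lemma C2norm_eq0 u : C2norm u = 0 -> u = 0.
Proof.
move=> /eqP; rewrite psumr_eq0 => [|k _]; last by rewrite C2norm_part0// -ltnS.
move=> /allP/(_ ord0 (mem_index_enum _)) /= /eqP u0.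
apply: val_inj; apply/funext => z; have [t <-] := cis_surj z.
apply/eqP; rewrite -normr_le0 -[leRHS]u0.
exact: (@C2norm_part_ge u 0%N t).
Qed.

Lemma C2normZ (l : R) u : C2norm (l *: u) = `|l| * C2norm u.
Proof.
have le a v : C2norm (a *: v) <= `|a| * C2norm v.
  by have := C2norm_lin a v 0; rewrite C2norm0 !addr0.
have [->|l0] := eqVneq l 0; first by rewrite scale0r normr0 mul0r C2norm0.
apply/eqP; rewrite eq_le le/=.
have := le l^-1 (l *: u); rewrite scalerA mulVf// scale1r normfV.
by rewrite mulrC ler_pdivlMr ?normr_gt0// mulrC.
Qed.

HB.instance Definition _ := @Lmodule_isNormed.Build R C2fun C2norm
  C2norm_triangle C2normZ C2norm_eq0.

End circle.
Arguments circle : clear implicits.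
Arguments Diff2 : clear implicits.
Arguments C2fun : clear implicits.

Section diff2.
Context {R : realType}.
Local Notation C := R[i].
Local Notation circle := (circle R).
Local Notation Diff2 := (Diff2 R).
Local Notation C2fun := (C2fun R).

Lemma cinv_id : cinv (id : circle -> circle) = id.
Proof.
apply/funext => z; have inj : {in [set: circle] &, injective (id : circle -> circle)} by [].
exact: (@pinvKV _ _ id setT id inj z (mem_set I)).
Qed.

Lemma C2_cos : C2 (@cos R) /\ C2 (@sin R).
Proof.
have dc : (@cos R)^`() = - sin.
  by apply/funext => t; rewrite derive1E derive_val.
have ds : (@sin R)^`() = cos.
  by apply/funext => t; rewrite derive1E derive_val.
have dNs : (- (@sin R : R -> R))^`() = - cos.
  by apply/funext => t; rewrite derive1E derive_val.
split; split.
- exact: derivable_cos.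
- by move=> t; rewrite dc; exact/derivableN/derivable_sin.
- rewrite /derive1n/= dc dNs => t; apply: cvgN; exact: continuous_cos.
- exact: derivable_sin.
- by move=> t; rewrite ds; exact: derivable_cos.
- rewrite /derive1n/= ds dc => t; apply: cvgN; exact: continuous_sin.
Qed.

Lemma diffeo2_id : diffeo2 (id : circle -> circle).
Proof.
have C2id : C2_circle (fun z : circle => z : C) by exact: C2_cos.
split=> [||| t].
- by exists id.
- exact: C2id.
- by rewrite cinv_id; exact: C2id.
rewrite /angular /= (_ : (_ +i* _) = ('i : C) * cis t).
  rewrite divff ?ltr01// mulf_eq0 negb_or; apply/andP; split.
    by rewrite eq_complex /= negb_and oner_eq0 orbT.
  by rewrite -normr_gt0; case: (cis t) => z /= /eqP ->.
by apply/eqP; rewrite eq_complex /= !mul0r !mul1r sub0r ?add0r !derive1E !derive_val !eqxx.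
Qed.

Definition Diff2_id : Diff2 := MkDiff2 (asboolT diffeo2_id).

(* Chart of Diff2 centred at g: the real C^2 function u is sent to g e^{iu},
   with velocity i g u, so that u is the coordinate of the tangent vector i g u
   at g.  This is a diffeomorphism for u small; insubd returns g otherwise,
   which does not affect the germ at u = 0.  Since
   (g e^{iu}) e^{iv} = g e^{i(u+v)}, the differential at u of a function read in
   the chart at g is its differential at 0 in the chart at g e^{iu}. *)
Definition chart (g : Diff2) (u : C2fun) : Diff2 :=
  insubd g (fun z => cmul (g z) (cis (u z))).

Definition differentiable_Diff2 (F : Diff2 -> C) (g : Diff2) :=
  differentiable (fun u : C2fun => complex.Re (F (chart g u))) (0 : C2fun) /\
  differentiable (fun u : C2fun => complex.Im (F (chart g u))) (0 : C2fun).

Definition diff_Diff2 (F : Diff2 -> C) (g : Diff2) (u : C2fun) : C :=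
  'd (fun v : C2fun => complex.Re (F (chart g v))) (0 : C2fun) u
  +i* 'd (fun v : C2fun => complex.Im (F (chart g v))) (0 : C2fun) u.

(* A complexified tangent vector w : circle -> C at g is a + i b with a and b
   tangent to the circle along g; their coordinates are the real and imaginary
   parts of w / (i g), and w Phi = a Phi + i (b Phi).  The default value 0 is
   taken only when w is not of class C^2. *)
Definition tangent_Re (g : Diff2) (w : circle -> C) : C2fun :=
  insubd (0 : C2fun) (fun z => complex.Re (w z / (('i : C) * g z))).
Definition tangent_Im (g : Diff2) (w : circle -> C) : C2fun :=
  insubd (0 : C2fun) (fun z => complex.Im (w z / (('i : C) * g z))).

Definition lie_derivative (X : Diff2 -> circle -> C) (F : Diff2 -> C)
    (g : Diff2) : C :=
  diff_Diff2 F g (tangent_Re g (X g)) + ('i : C) * diff_Diff2 F g (tangent_Im g (X g)).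

Definition L_ (m : int) : Diff2 -> circle -> C := fun g z => (g z : C) ^ (m + 1).

Definition lie_mx N (X : Diff2 -> circle -> C) (F : Diff2 -> 'M[C]_N) (g : Diff2)
  : 'M[C]_N := \matrix_(a, b) lie_derivative X (fun h => F h a b) g.

(* f read in the product chart centred at (e^{it}, g). *)
Definition rep (f : circle -> Diff2 -> R) (t : R) (g : Diff2)
    (v : R * C2fun) : R :=
  f (cis (t + v.1)) (chart g v.2).

(* Joint C^1 regularity on circle x U: Frechet differentiability, and continuity
   of the differential for the operator norm. *)
Definition C1_on (U : set Diff2) (f : circle -> Diff2 -> R) :=
  forall t g, U g ->
    differentiable (rep f t g) (0 : (R * C2fun)%type) /\
    forall e : R, 0 < e -> \forall p \near (t, g), forall v : R * C2fun,
      `|'d (rep f p.1 p.2) (0 : (R * C2fun)%type) v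
        - 'd (rep f t g) (0 : (R * C2fun)%type) v| <= e * `|v|.

Definition C1_on_mx N (U : set Diff2) (A : circle -> Diff2 -> 'M[C]_N) :=
  forall a b, C1_on U (fun z g => complex.Re (A z g a b)) /\
              C1_on U (fun z g => complex.Im (A z g a b)).

(* Contour integral over the circle, with z = e^{it} and dz = i e^{it} dt. *)
Definition contour (f : circle -> C) : C :=
  let F t : C := f (cis t) * ('i * (cis t : C)) in
  (\int[lebesgue_measure]_(t in `[0, pi *+ 2]) complex.Re (F t))
  +i* (\int[lebesgue_measure]_(t in `[0, pi *+ 2]) complex.Im (F t)).

Definition contour_mx N (F : circle -> 'M[C]_N) : 'M[C]_N :=
  \matrix_(a, b) contour (fun z => F z a b).

Definition twoipi : C := 2 * 'i * pi%:C.

Definition calA N (A : circle -> Diff2 -> 'M[C]_N) (x : C) (g : Diff2) : 'M[C]_N :=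
  twoipi^-1 *: contour_mx (fun z => ((z : C) - x)^-1 *: A z g).

Definition Bcoef N (A : circle -> Diff2 -> 'M[C]_N) (n : int) (g : Diff2) : 'M[C]_N :=
  (- twoipi^-1) *: contour_mx (fun z => (z : C) ^ n *: A z g).

Definition P1 := one_point_compactification C.
Definition infty : P1 := None.
Definition affine_pt (x : C) : P1 := Some x.
Definition D_plus : set P1 := affine_pt @` [set x : C | `|x| < 1].
Definition D_minus : set P1 := infty |` affine_pt @` [set x : C | 1 < `|x|].

(* At infinity, holomorphy is taken in the coordinate w = 1/x. *)
Definition holomorphic_at N (F : P1 -> 'M[C]_N) (p : P1) : Prop :=
  if p is Some x then derivable (fun y : C => F (affine_pt y)) x 1
  else derivable (fun w : C => F (if w == 0 then infty else affine_pt w^-1)) 0 1.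

Definition analytic_on N (D : set P1) (F : P1 -> 'M[C]_N) :=
  forall p, D p -> holomorphic_at F p.

(* The boundary value at z is the limit of F(x) as x tends to z with x in D;
   bv is meaningful only when bv_cvg holds. *)
Definition bv_cvg N (D : set P1) (F : P1 -> 'M[C]_N) (z : circle) :=
  cvg (F x @[x --> within D (nbhs (affine_pt z))]).
Definition bv N (D : set P1) (F : P1 -> 'M[C]_N) (z : circle) : 'M[C]_N :=
  lim (F x @[x --> within D (nbhs (affine_pt z))]).


Definition loop_C2 N (G : circle -> 'M[C]_N) :=
  (forall z, G z \in unitmx) /\ forall a b, C2_circle (fun z => G z a b).

Definition loop_factor N (D : set P1) (F : P1 -> 'M[C]_N) :=
  [/\ forall p, D p -> F p \in unitmx, analytic_on D F,
      forall z, bv_cvg D F z & loop_C2 (bv D F)].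

Definition loop_tilde N (G : circle -> 'M[C]_N) :=
  loop_C2 G /\
  exists Y Z : P1 -> 'M[C]_N,
    [/\ loop_factor D_plus Y, loop_factor D_minus Z, Z infty = 1%:M &
        forall z, G z = invmx (bv D_minus Z z) *m bv D_plus Y z].

Definition fundamental_solution N (A : circle -> Diff2 -> 'M[C]_N)
    (U : set Diff2) (Y : P1 -> Diff2 -> 'M[C]_N) :=
  forall g, U g ->
  [/\ forall p, (D_plus `|` D_minus) p -> Y p g \in unitmx,
      analytic_on (D_plus `|` D_minus) (Y ^~ g),
      forall x : C, (D_plus `|` D_minus) (affine_pt x) ->
        derive1 (fun y : C => Y (affine_pt y) g) x = calA A x g *m Y (affine_pt x) g,
      forall p, (D_plus `|` D_minus) p ->
        forall a b, differentiable_Diff2 (fun h => Y p h a b) g &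
      forall D, D = D_plus \/ D = D_minus -> forall z,
        bv_cvg D (Y ^~ g) z /\ bv D (Y ^~ g) z \in unitmx].

Definition monodromy N (Y : P1 -> Diff2 -> 'M[C]_N) (z : circle) (g : Diff2) :=
  invmx (bv D_minus (Y ^~ g) z) *m bv D_plus (Y ^~ g) z.

Definition M_invariant N (U : set Diff2) (Y : P1 -> Diff2 -> 'M[C]_N) :=
  forall z g, U g -> monodromy Y z g = monodromy Y (cinv g z) Diff2_id.

Definition commutator N (P Q : 'M[C]_N) : 'M[C]_N := P *m Q - Q *m P.

End diff2.

(* Main.v *)
Require Import Defs.
From HB Require Import structures.
From mathcomp Require Import all_boot all_order all_algebra.
From mathcomp Require Import complex.
From mathcomp Require Import all_classical all_reals all_analysis.
Import Order.TTheory GRing.Theory Num.Theory.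
Import numFieldNormedType.Exports.
Local Open Scope ring_scope.
Local Open Scope complex_scope.
Local Open Scope classical_set_scope.
From mathcomp Require Import zify ring lra.

Set Implicit Arguments.
Unset Strict Implicit.
Unset Printing Implicit Defensive.

(* The matrix A enters only through its moments B_n. By Cauchy's formula the system is
   x Y' = - b^+(x) Y in the disk, with b^+(x) = sum_k B_(-k) x^k, and w Y' = - b^-(w) Y
   in w = 1/x outside, with b^-(w) = sum_k B_k w^k. The solutions equal to 1 at 0 and at
   infinity are power series Y^+(x), Y^-(1/x), with coefficients given by the recursion
   n y_n = - sum_k b_k y_(n-k). As A is C^1, the B_n are summable against a weight which
   the recursion preserves, so both series converge on the closed disk and depend
   differentiably on gamma.

   A solution Y with Y(infinity) = 1 is Y^+ C(gamma) inside and Y^- outside; with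
   P(xi, gamma) = (Y^-)^-1 Y^+ at the point gamma(xi), M-invariance says that
   P(xi, gamma) C(gamma) does not depend on gamma. Differentiating along L_m and
   comparing Fourier coefficients on the circle, this forces the logarithmic derivatives
   w^+ of Y^+ C and w^- of Y^- to be w^+_n = B_(m-n) and w^-_n = - B_(m+n). Since they
   satisfy n w_n = - L_m b_n + (w * b - b * w)_n, these are the stated equations.
   Conversely the equations determine w^+ and w^- by this recursion, so that
   L_m P = - P B_m for all m. Hence P(xi, gamma) P(eta, gamma)^-1 has zero derivative
   along every L_m, so along every vector field by density of trigonometric polynomials,
   and is constant on the connected set U. One takes C = P(xi0, gamma)^-1 P(xi0, e). *)

(** * Norms of complex matrices *)

(** The delicate point is differentiability in gamma on the circle itself, at the moving point
    gamma(xi). Moving the point turns b_n into n b_n, and the variation of b_n with gamma is only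
    known to be square summable, A being merely C^1. Both become summable against the weight after
    division by n, and this division is what the recursion n d_n = f_n - (b * d)_n performs. Hence
    two kinds of bounds: [wbd] for coefficients and solutions, [fbd] for right-hand sides. The
    weight is unbounded so that differentiability of each single B_n gives differentiability of the
    series: the tails are uniformly small. The monodromy is followed at gamma(xi) because
    M-invariance freezes it there, and because L_m moves this point with logarithmic velocity
    gamma(xi)^m. The motion thus multiplies b^+ and b^- by the m-th power of the variable on the
    circle, and both sides of the jump relation remain Laurent series whose coefficients can be
    compared. *)

Section norms.
Context {R : realType}.
Local Notation C := R[i].

Definition nc (z : C) : R := Normc.normc z.

Lemma normE (z : C) : `|z| = (nc z)%:C.
Proof. by rewrite normc_def; case: z. Qed.

Lemma nc_ge0 (z : C) : 0 <= nc z.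
Proof. by rewrite -lecR -normE normr_ge0. Qed.

Lemma nc0 : nc 0 = 0. Proof. exact: Normc.normc0. Qed.
Lemma nc1 : nc 1 = 1. Proof. exact: Normc.normc1. Qed.

Lemma nc_eq0 (z : C) : (nc z == 0) = (z == 0).
Proof.
apply/idP/idP => [/eqP|/eqP ->]; last by rewrite nc0.
by move=> /Normc.eq0_normc ->.
Qed.

Lemma ncM (x y : C) : nc (x * y) = nc x * nc y.
Proof. exact: Normc.normcM. Qed.

Lemma ncD (x y : C) : nc (x + y) <= nc x + nc y.
Proof. exact: le_normcD. Qed.

Lemma ncN (x : C) : nc (- x) = nc x.
Proof. exact: normcN. Qed.

Lemma ncB (x y : C) : nc (x - y) <= nc x + nc y.
Proof. by rewrite (le_trans (ncD _ _))// ncN. Qed.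

Lemma ncBC (x y : C) : nc (x - y) = nc (y - x).
Proof. by rewrite -ncN opprB. Qed.

Lemma ncV (x : C) : nc x^-1 = (nc x)^-1.
Proof. exact: Normc.normcV. Qed.

Lemma ncX (x : C) n : nc (x ^+ n) = nc x ^+ n.
Proof. by elim: n => [|n IH]; rewrite ?expr0 ?nc1// !exprS ncM IH. Qed.

Lemma nc_real (x : R) : nc x%:C = `|x|.
Proof. by rewrite /nc /= expr0n addr0 sqrtr_sqr. Qed.

Lemma nc_nat n : nc n%:R = n%:R.
Proof. by rewrite -(rmorph_nat (real_complex R)) nc_real ger0_norm. Qed.

Lemma nc_iC : nc ('i%C : C) = 1.
Proof. by rewrite /nc /= expr0n expr1n add0r sqrtr1. Qed.

Lemma nc_i : nc ('i%R : C) = 1.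
Proof. exact: nc_iC. Qed.

Lemma nc_Re (z : C) : `|complex.Re z| <= nc z.
Proof. by rewrite -lecR -normE normc_ge_Re. Qed.

Lemma nc_Im (z : C) : `|complex.Im z| <= nc z.
Proof.
case: z => a b /=; rewrite /nc /= -sqrtr_sqr ler_sqrt ?lerDr ?sqr_ge0//.
by rewrite addr_ge0// sqr_ge0.
Qed.

Lemma nc_le (z : C) : nc z <= `|complex.Re z| + `|complex.Im z|.
Proof.
rewrite [in leLHS](complexE z) (le_trans (ncD _ _))// ncM nc_iC mul1r.
by rewrite !nc_real.
Qed.

Lemma nc_sum I (r : seq I) (P : pred I) (F : I -> C) :
  nc (\sum_(i <- r | P i) F i) <= \sum_(i <- r | P i) nc (F i).
Proof.
elim/big_ind2: _ => [|x1 x2 y1 y2 h1 h2|//]; first by rewrite nc0.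
by rewrite (le_trans (ncD _ _))// lerD.
Qed.

Lemma nc_circle (z : circle R) : nc z = 1.
Proof. by case: z => z /= /eqP; rewrite normE => -[]. Qed.

(** The entrywise sum is submultiplicative and dominates each entry, so that matrix estimates reduce
    to finite sums of moduli. *)
Definition mnorm m n (A : 'M[C]_(m, n)) : R := \sum_i \sum_j nc (A i j).

Lemma mnorm_ge0 m n (A : 'M[C]_(m, n)) : 0 <= mnorm A.
Proof. by apply: sumr_ge0 => i _; apply: sumr_ge0 => j _; exact: nc_ge0. Qed.

Lemma mnorm0 m n : mnorm (0 : 'M[C]_(m, n)) = 0.
Proof. by rewrite /mnorm big1// => i _; rewrite big1// => j _; rewrite mxE nc0. Qed.

Lemma mnormD m n (A B : 'M[C]_(m, n)) : mnorm (A + B) <= mnorm A + mnorm B.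
Proof.
rewrite /mnorm -big_split; apply: ler_sum => i _ /=.
by rewrite -big_split; apply: ler_sum => j _ /=; rewrite mxE ncD.
Qed.

Lemma mnormZ m n (c : C) (A : 'M[C]_(m, n)) : mnorm (c *: A) = nc c * mnorm A.
Proof.
rewrite /mnorm mulr_sumr; apply: eq_bigr => i _.
by rewrite mulr_sumr; apply: eq_bigr => j _; rewrite mxE ncM.
Qed.

Lemma mnormN m n (A : 'M[C]_(m, n)) : mnorm (- A) = mnorm A.
Proof. by rewrite -scaleN1r mnormZ ncN nc1 mul1r. Qed.

Lemma mnormB m n (A B : 'M[C]_(m, n)) : mnorm (A - B) <= mnorm A + mnorm B.
Proof. by rewrite (le_trans (mnormD _ _))// mnormN. Qed.

Lemma mnormBC m n (A B : 'M[C]_(m, n)) : mnorm (A - B) = mnorm (B - A).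
Proof. by rewrite -mnormN opprB. Qed.

Lemma mnorm_tr m n (A : 'M[C]_(m, n)) : mnorm A^T = mnorm A.
Proof.
by rewrite /mnorm exchange_big/=; apply: eq_bigr => i _; apply: eq_bigr => j _; rewrite mxE.
Qed.

Lemma mnorm_entry m n (A : 'M[C]_(m, n)) i j : nc (A i j) <= mnorm A.
Proof.
rewrite /mnorm (bigD1 i)//= (bigD1 j)//= -addrA lerDl addr_ge0// sumr_ge0// => k _.
  exact: nc_ge0.
by apply: sumr_ge0 => l _; exact: nc_ge0.
Qed.

Lemma mnorm_eq0 m n (A : 'M[C]_(m, n)) : mnorm A <= 0 -> A = 0.
Proof.
move=> A0; apply/matrixP => i j; rewrite mxE; apply/eqP.
by rewrite -nc_eq0 eq_le nc_ge0 andbT (le_trans (mnorm_entry _ _ _)).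
Qed.

Lemma mnorm_sum m n I (r : seq I) (P : pred I) (F : I -> 'M[C]_(m, n)) :
  mnorm (\sum_(i <- r | P i) F i) <= \sum_(i <- r | P i) mnorm (F i).
Proof.
elim/big_ind2: _ => [|x1 x2 y1 y2 h1 h2|//]; first by rewrite mnorm0.
by rewrite (le_trans (mnormD _ _))// lerD.
Qed.

Lemma mnormM m n p (A : 'M[C]_(m, n)) (B : 'M[C]_(n, p)) :
  mnorm (A *m B) <= mnorm A * mnorm B.
Proof.
rewrite /mnorm mulr_suml; apply: ler_sum => i _.
apply: (@le_trans _ _ (\sum_k \sum_j nc (A i j) * nc (B j k))).
  apply: ler_sum => k _; rewrite mxE (le_trans (nc_sum _ _ _))//.
  by apply: ler_sum => j _; rewrite ncM.
rewrite exchange_big/= mulr_suml; apply: ler_sum => j _.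
rewrite -mulr_sumr ler_wpM2l ?nc_ge0//.
rewrite (bigD1 j)//= lerDl sumr_ge0// => k _.
by apply: sumr_ge0 => l _; exact: nc_ge0.
Qed.

Lemma mnorm_le_entries m n (A : 'M[C]_(m, n)) (c : R) :
  (forall i j, nc (A i j) <= c) -> mnorm A <= (m * n)%:R * c.
Proof.
move=> Ac; apply: (@le_trans _ _ (\sum_(i < m) \sum_(j < n) c)).
  by apply: ler_sum => i _; apply: ler_sum => j _.
by rewrite !sumr_const !card_ord -mulrnA mulr_natl mulnC.
Qed.

End norms.

(** * Weighted summable sequences of matrices *)

Section weight.
Context {R : realType}.

(* This weight is submultiplicative and unbounded, and the sum of wt n ^+ 2 / n ^ 2
   converges, so that a C^1 function has Fourier coefficients summable against wt. *)
Definition wt (n : nat) : R := Num.sqrt (Num.sqrt n.+1%:R).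

Lemma wt_ge1 n : 1 <= wt n.
Proof. by rewrite /wt -[leLHS]sqrtr1 ler_sqrt// -[leLHS]sqrtr1 ler_sqrt// ler1n. Qed.

Lemma wt_gt0 n : 0 < wt n.
Proof. exact: lt_le_trans (wt_ge1 n). Qed.

Lemma wt_ge0 n : 0 <= wt n. Proof. exact: ltW (wt_gt0 n). Qed.

Lemma le_wt m n : (m <= n)%N -> wt m <= wt n.
Proof. by move=> mn; rewrite /wt ler_sqrt ?sqrtr_ge0// ler_sqrt// ler_nat ltnS. Qed.

Lemma wtD m n : wt (m + n) <= wt m * wt n.
Proof.
rewrite /wt -sqrtrM ?sqrtr_ge0// ler_sqrt ?mulr_ge0 ?sqrtr_ge0//.
rewrite -sqrtrM// ler_sqrt ?mulr_ge0// -natrM ler_nat; nia.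
Qed.

Lemma wt_large (M : R) : exists n, M <= wt n.
Proof.
exists (Num.truncn (M ^+ 4)).+1.
have [M0|M0] := leP M 0; first by rewrite (le_trans M0)// wt_ge0.
rewrite -[leLHS]ger0_norm ?(ltW M0)// -[leLHS]sqrtr_sqr /wt ler_sqrt ?sqrtr_ge0//.
rewrite -[leLHS]ger0_norm ?sqr_ge0// -[leLHS]sqrtr_sqr ler_sqrt// -exprM.
rewrite ltW// (lt_le_trans (truncnS_gt _))// ler_nat.
by rewrite leqnSn.
Qed.

(** Stands for the limit K -> infinity in estimates of series, whose rates below have the form c /
    [wt K]. *)
Lemma le_div_wt (x c : R) : (forall K, x <= c / wt K) -> x <= 0.
Proof.
move=> xc; rewrite leNgt; apply/negP => x0.
have [n cn] := wt_large (c / x + 1).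
have := xc n; rewrite ler_pdivlMr ?wt_gt0//.
have : (c / x + 1) * x <= wt n * x by rewrite ler_wpM2r// ltW.
rewrite mulrDl divfK ?gt_eqF// mul1r mulrC => h2 h3; lra.
Qed.

End weight.

Section sequences.
Context {R : realType} {N : nat}.
Local Notation C := R[i].
Local Notation M := 'M[C]_N.
Implicit Types (p q r : nat -> M) (c : R).

Lemma seqDE p q n : (p + q) n = p n + q n. Proof. by []. Qed.
Lemma seqBE p q n : (p - q) n = p n - q n. Proof. by []. Qed.
Lemma seqNE p n : (- p) n = - p n. Proof. by []. Qed.
Definition seqE := (seqBE, seqDE, seqNE).

(** A bound on all partial sums plays the role of a weighted l^1 norm; no limit has to be formed to
    add, multiply or compare such bounds. *)
Definition wbd p c := forall K, \sum_(n < K) wt n * mnorm (p n) <= c.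

Lemma wbd_ge0 p c : wbd p c -> 0 <= c.
Proof. by move=> /(_ 0%N); rewrite big_ord0. Qed.

Lemma wbd_le p c c' : wbd p c -> c <= c' -> wbd p c'.
Proof. by move=> pc cc K; exact: le_trans (pc K) cc. Qed.

Lemma wbd_mono p q c : (forall n, mnorm (p n) <= mnorm (q n)) -> wbd q c -> wbd p c.
Proof.
move=> pq qc K; apply: le_trans (qc K); apply: ler_sum => n _.
by rewrite ler_wpM2l ?wt_ge0.
Qed.

Lemma wbdD p q c c' : wbd p c -> wbd q c' -> wbd (p + q) (c + c').
Proof.
move=> pc qc K; apply: le_trans (lerD (pc K) (qc K)).
rewrite -big_split; apply: ler_sum => n _ /=.
by rewrite -mulrDr ler_wpM2l ?wt_ge0// mnormD.
Qed.

Lemma wbdN p c : wbd p c -> wbd (- p) c.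
Proof. by apply: wbd_mono => n; rewrite mnormN. Qed.

Lemma wbdB p q c c' : wbd p c -> wbd q c' -> wbd (p - q) (c + c').
Proof. by move=> pc qc; apply: wbdD => //; exact: wbdN. Qed.

Lemma wbdZ (a : nat -> C) p c d : (forall n, nc (a n) <= d) -> wbd p c ->
  wbd (fun n => a n *: p n) (d * c).
Proof.
move=> ad pc K; have d0 : 0 <= d by apply: le_trans (ad 0%N); exact: nc_ge0.
apply: le_trans (ler_wpM2l d0 (pc K)); rewrite mulr_sumr; apply: ler_sum => n _.
by rewrite mnormZ mulrCA ler_wpM2r// mulr_ge0 ?wt_ge0 ?mnorm_ge0.
Qed.

(** Beyond index K the weight is at least [wt K], so dividing by it bounds the unweighted tail. *)
Lemma wbd_tail p c K K' : wbd p c -> (K <= K')%N ->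
  mnorm (\sum_(n < K') p n - \sum_(n < K) p n) <= c / wt K.
Proof.
move=> pc KK; rewrite -!(big_mkord xpredT p) (big_cat_nat _ KK)//= [X in X - _]addrC addrK.
rewrite (le_trans (mnorm_sum _ _ _))// ler_pdivlMr ?wt_gt0//.
apply: le_trans (pc K'); rewrite -(big_mkord xpredT (fun n => wt n * mnorm (p n))).
rewrite [leRHS](big_cat_nat _ KK)//= mulr_suml.
rewrite -[leLHS]add0r lerD//.
  by apply: sumr_ge0 => n _; rewrite mulr_ge0 ?wt_ge0 ?mnorm_ge0.
rewrite big_seq [leRHS]big_seq; apply: ler_sum => n.
rewrite mem_index_iota => /andP[Kn _]; rewrite mulrC ler_wpM2r ?mnorm_ge0//.
exact: le_wt.
Qed.

(** Convergence with the rate that [wbd_tail] provides. Keeping the rate makes sums, products and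
    uniqueness of limits plain estimates. *)
Definition cvgs p (s : M) (c : R) := forall K, mnorm (\sum_(n < K) p n - s) <= c / wt K.

Definition msum p : M := \matrix_(i, j)
  ((limn (series (fun n => complex.Re (p n i j))))
   +i* limn (series (fun n => complex.Im (p n i j)))).

Lemma wbd_cvg_entry (f : {additive C -> R}) p c i j : (forall z, `|f z| <= nc z) -> wbd p c ->
  cvgn (series (fun n => f (p n i j))).
Proof.
move=> fz pc; apply: normed_cvg; apply: nondecreasing_is_cvgn.
  by apply: nondecreasing_series => n _ _; exact: normr_ge0.
exists c => _ [K _ <-]; apply: le_trans (pc K).
rewrite /normed_series_of seriesEord /=; apply: ler_sum => n _.
rewrite (le_trans (fz _))// (le_trans (mnorm_entry _ _ _))//.
by rewrite -[leLHS]mul1r ler_wpM2r ?mnorm_ge0 ?wt_ge1.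
Qed.

Lemma entry_tail (f : {additive C -> R}) p c i j K : (forall z, `|f z| <= nc z) -> wbd p c ->
  `|f ((\sum_(n < K) p n) i j) - limn (series (fun n => f (p n i j)))| <= c / wt K.
Proof.
move=> fz pc; have cv := wbd_cvg_entry fz pc (i := i) (j := j).
set u := series _ in cv *.
have : (`|f ((\sum_(n < K) p n) i j) - u K'| @[K' --> \oo] -->
   `|f ((\sum_(n < K) p n) i j) - limn u|).
  by apply: cvg_norm; apply: cvgB; [exact: cvg_cst|exact: cv].
move=> H; rewrite -(cvg_lim _ H)//; apply: limr_le; first by apply/cvg_ex; eexists; exact: H.
near=> K'; have KK : (K <= K')%N by near: K'; exists K.
have -> : u K' = f ((\sum_(n < K') p n) i j).
  by rewrite /u /series /= big_mkord summxE raddf_sum.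
rewrite -raddfB (le_trans (fz _))//.
apply: le_trans (wbd_tail pc KK).
have -> : (\sum_(n < K) p n) i j - (\sum_(n < K') p n) i j =
  - ((\sum_(n < K') p n - \sum_(n < K) p n) i j) by rewrite !mxE opprB.
by rewrite ncN mnorm_entry.
Unshelve. all: by end_near.
Qed.

Lemma msumP p c : wbd p c -> cvgs p (msum p) ((N * N)%:R * (2 * c)).
Proof.
move=> pc K; rewrite -mulrA; apply: mnorm_le_entries => i j.
rewrite (le_trans (nc_le _))// mulr_natl mulr2n mulrDl lerD//.
  have := entry_tail i j K (f := @complex.Re R) (@nc_Re R) pc.
  by rewrite !mxE raddfB.
have := entry_tail i j K (f := @complex.Im R) (@nc_Im R) pc.
by rewrite !mxE raddfB.
Qed.

Lemma cvgs_uniq p s s' c c' : cvgs p s c -> cvgs p s' c' -> s = s'.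
Proof.
move=> ps ps'; apply/eqP; rewrite -subr_eq0; apply/eqP/mnorm_eq0.
apply: (@le_div_wt _ _ (c + c')) => K.
have -> : s - s' = (\sum_(n < K) p n - s') - (\sum_(n < K) p n - s).
  by apply/matrixP => i j; rewrite !mxE; ring.
by rewrite (le_trans (mnormB _ _))// mulrDl addrC lerD.
Qed.

Lemma msum_cvgs p s c c' : wbd p c -> cvgs p s c' -> msum p = s.
Proof. by move=> pc ps; exact: cvgs_uniq (msumP pc) ps. Qed.

Lemma mnorm_msum p c : wbd p c -> mnorm (msum p) <= c.
Proof.
move=> pc; rewrite -subr_le0; apply: (@le_div_wt _ _ ((N * N)%:R * (2 * c))) => K.
rewrite lerBlDr; apply: le_trans (lerD (msumP pc K) _) ; last exact: (pc K).
rewrite -lerBlDl mnormBC; apply: (@le_trans _ _ (mnorm (\sum_(n < K) p n))).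
  rewrite lerBlDr -[X in mnorm X <= _](subrK (\sum_(n < K) p n)).
  by rewrite [leRHS]addrC mnormD.
rewrite (le_trans (mnorm_sum _ _ _))//; apply: ler_sum => n _.
by rewrite -[leLHS]mul1r ler_wpM2r ?mnorm_ge0 ?wt_ge1.
Qed.

Lemma cvgsD p q s s' c c' : cvgs p s c -> cvgs q s' c' -> cvgs (p + q) (s + s') (c + c').
Proof.
move=> ps qs K; rewrite mulrDl; apply: le_trans (lerD (ps K) (qs K)).
by rewrite [X in mnorm (X - _)]big_split/= opprD addrACA mnormD.
Qed.

Lemma msumD p q c c' : wbd p c -> wbd q c' -> msum (p + q) = msum p + msum q.
Proof.
move=> pc qc; apply: msum_cvgs (wbdD pc qc) _.
exact: cvgsD (msumP pc) (msumP qc).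
Qed.

Lemma msum_lmul (A : M) p c : wbd p c -> msum (fun n => A *m p n) = A *m msum p.
Proof.
move=> pc.
have Ap : wbd (fun n => A *m p n) (mnorm A * c).
  move=> K; apply: le_trans (ler_wpM2l (mnorm_ge0 A) (pc K)); rewrite mulr_sumr.
  by apply: ler_sum => n _; rewrite mulrCA ler_wpM2l ?wt_ge0// mnormM.
apply: (@msum_cvgs _ _ _ (mnorm A * ((N * N)%:R * (2 * c)))) Ap _ => K.
rewrite -mulmx_sumr -mulmxBr -mulrA (le_trans (mnormM _ _))//.
by rewrite ler_wpM2l ?mnorm_ge0// msumP.
Qed.

Lemma msumZ (a : C) p c : wbd p c -> msum (fun n => a *: p n) = a *: msum p.
Proof.
move=> pc; rewrite -[RHS]mul_scalar_mx -(msum_lmul _ pc); congr msum.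
by apply/funext => n; rewrite mul_scalar_mx.
Qed.

Lemma msumN p c : wbd p c -> msum (- p) = - msum p.
Proof.
move=> pc; rewrite -[RHS]scaleN1r -(msumZ _ pc); congr msum.
by apply/funext => n; rewrite scaleN1r.
Qed.

Lemma msumB p q c c' : wbd p c -> wbd q c' -> msum (p - q) = msum p - msum q.
Proof. by move=> pc qc; rewrite (msumD pc (wbdN qc)) (msumN qc). Qed.

Lemma wbd_tr p c : wbd p c -> wbd (fun n => (p n)^T) c.
Proof. by apply: wbd_mono => n; rewrite mnorm_tr. Qed.

(* The coefficients of the constant power series A. *)
Definition cst (A : M) (n : nat) : M := if n == 0%N then A else 0.

Lemma wbd_cst A : wbd (cst A) (mnorm A).
Proof.
move=> [|K]; first by rewrite big_ord0 mnorm_ge0.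
rewrite big_ord_recl big1 ?addr0 => [|n _]; last by rewrite /cst /= mnorm0 mulr0.
by rewrite /cst/= /wt !sqrtr1 mul1r.
Qed.

Lemma msum_cst A : msum (cst A) = A.
Proof.
apply: (@msum_cvgs _ _ _ (mnorm A)) (wbd_cst A) _ => -[|K].
  by rewrite big_ord0 sub0r mnormN /wt !sqrtr1 divr1.
rewrite big_ord_recl big1 ?addr0 => [|n _]; last by rewrite /cst.
by rewrite /cst subrr mnorm0 divr_ge0 ?mnorm_ge0 ?wt_ge0.
Qed.

Definition conv p q (n : nat) : M := \sum_(i < n.+1) p i *m q (n - i)%N.
(** The Euler operator x d/dx on coefficients; [theta_conv] is its Leibniz rule. *)
Definition theta p (n : nat) : M := n%:R *: p n.

Lemma conv_rev p q n : conv p q n = \sum_(i < n.+1) p (n - i)%N *m q i.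
Proof.
rewrite /conv (reindex_inj rev_ord_inj)/=; apply: eq_bigr => i _.
by rewrite subSS subKn// -ltnS.
Qed.

Lemma convA p q r : conv p (conv q r) = conv (conv p q) r.
Proof.
apply/funext => n; rewrite [RHS]conv_rev /conv.
pose F j i := p j *m q (n - j - i)%N *m r i.
transitivity (\sum_(j < n.+1) \sum_(i < n.+1 | (i <= n - j)%N) F j i).
  apply: eq_bigr => -[j jn] _ /=; rewrite -/(conv q r _) conv_rev mulmx_sumr.
  rewrite (big_ord_narrow_leq (leq_subr _ _)) /=.
  by apply: eq_bigr => i _; rewrite mulmxA.
transitivity (\sum_(i < n.+1) \sum_(j < n.+1 | (j <= n - i)%N) F j i).
  rewrite (exchange_big_dep predT) //=; apply: eq_bigr => i _.
  apply: eq_bigl => j; apply/idP/idP; have := ltn_ord i; have := ltn_ord j; lia.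
apply: eq_bigr => -[i ni] _ /=; rewrite mulmx_suml.
rewrite (big_ord_narrow_leq (leq_subr _ _)) /=.
by apply: eq_bigr => j _; rewrite /F subnAC.
Qed.

Lemma convDl p q r : conv (p + q) r = conv p r + conv q r.
Proof.
apply/funext => n; rewrite -[RHS]/(conv p r n + conv q r n) /conv -big_split.
by apply: eq_bigr => i _ /=; rewrite -mulmxDl.
Qed.

Lemma convDr p q r : conv p (q + r) = conv p q + conv p r.
Proof.
apply/funext => n; rewrite -[RHS]/(conv p q n + conv p r n) /conv -big_split.
by apply: eq_bigr => i _ /=; rewrite -mulmxDr.
Qed.

Lemma convNl p q : conv (- p) q = - conv p q.
Proof.
apply/funext => n; rewrite -[RHS]/(- conv p q n) /conv -sumrN.
by apply: eq_bigr => i _ /=; rewrite mulNmx.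
Qed.

Lemma convNr p q : conv p (- q) = - conv p q.
Proof.
apply/funext => n; rewrite -[RHS]/(- conv p q n) /conv -sumrN.
by apply: eq_bigr => i _ /=; rewrite mulmxN.
Qed.

Lemma convBl p q r : conv (p - q) r = conv p r - conv q r.
Proof. by rewrite convDl convNl. Qed.

Lemma convBr p q r : conv p (q - r) = conv p q - conv p r.
Proof. by rewrite convDr convNr. Qed.

Lemma conv_cstr A p : conv p (cst A) = fun n => p n *m A.
Proof.
apply/funext => n; rewrite conv_rev big_ord_recl big1 => [|i _]; last first.
  by rewrite /cst /= mulmx0.
by rewrite /cst /= addr0 subn0.
Qed.

Lemma conv1r p : conv p (cst 1%:M) = p.
Proof. by rewrite conv_cstr; apply/funext => n; rewrite mulmx1. Qed.

Lemma convZl (a : C) p q : conv (a *: p) q = a *: conv p q.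
Proof.
apply/funext => n; rewrite !fctE /conv scaler_sumr; apply: eq_bigr => i _ /=.
by rewrite -scalemxAl.
Qed.

Lemma convZr (a : C) p q : conv p (a *: q) = a *: conv p q.
Proof.
apply/funext => n; rewrite !fctE /conv scaler_sumr; apply: eq_bigr => i _ /=.
by rewrite -scalemxAr.
Qed.

Lemma conv_tr p q : conv (fun n => (q n)^T) (fun n => (p n)^T) = fun n => (conv p q n)^T.
Proof.
apply/funext => n; rewrite conv_rev /conv linear_sum/=; apply: eq_bigr => i _.
by rewrite trmx_mul.
Qed.

Lemma thetaD p q : theta (p + q) = theta p + theta q.
Proof. by apply/funext => n; rewrite /theta !fctE scalerDr. Qed.

Lemma thetaN p : theta (- p) = - theta p.
Proof. by apply/funext => n; rewrite /theta !fctE scalerN. Qed.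

Lemma theta_conv p q : theta (conv p q) = conv (theta p) q + conv p (theta q).
Proof.
apply/funext => n; rewrite fctE /theta /conv -big_split scaler_sumr; apply: eq_bigr => i _ /=.
rewrite -scalemxAl -scalemxAr -scalerDl -natrD subnKC//.
by rewrite -ltnS.
Qed.

Lemma triangle_sum (V : nmodType) (F : nat -> nat -> V) K :
  \sum_(n < K) \sum_(i < n.+1) F i (n - i)%N =
  \sum_(i < K) \sum_(j < K | (i + j < K)%N) F i j.
Proof.
transitivity (\sum_(n < K) \sum_(i < K | (i < n.+1)%N) F i (n - i)%N).
  by apply: eq_bigr => -[n nK] _; rewrite (big_ord_narrow nK).
rewrite (exchange_big_dep predT) //=; apply: eq_bigr => -[i iK] _ /=.
rewrite -(big_mkord (fun n => i <= n)%N (fun n => F i (n - i)%N)).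
rewrite (big_cat_nat (n := i))//=; last exact: ltnW.
rewrite big_nat_cond big_pred0 ?add0r => [|n]; last by apply/negbTE; lia.
rewrite -[X in \sum_(X <= _ < _ | _) _]add0n big_addn.
rewrite -[in RHS](big_mkord (fun j => i + j < K)%N (fun j => F i j)).
rewrite [RHS](big_cat_nat (n := (K - i)%N))//= ?leq_subr//.
rewrite [X in _ = _ + X]big_nat_cond [X in _ = _ + X]big_pred0 ?addr0 => [|n]; last first.
  by apply/negbTE; lia.
rewrite big_nat_cond [RHS]big_nat_cond; apply: eq_big => [j|j]; first lia.
by rewrite addnK.
Qed.

Lemma triangle_le (F : nat -> nat -> R) K : (forall i j, 0 <= F i j) ->
  \sum_(n < K) \sum_(i < n.+1) F i (n - i)%N <= \sum_(i < K) \sum_(j < K) F i j.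
Proof.
move=> F0; rewrite triangle_sum; apply: ler_sum => i _; rewrite big_mkcond.
by apply: ler_sum => j _; case: ifP.
Qed.

Lemma wbd_conv p q c d : wbd p c -> wbd q d -> wbd (conv p q) (c * d).
Proof.
move=> pc qd K; have c0 := wbd_ge0 pc.
pose F i j : R := (wt i * mnorm (p i)) * (wt j * mnorm (q j)).
have F0 i j : 0 <= F i j by rewrite !mulr_ge0 ?wt_ge0 ?mnorm_ge0.
apply: (@le_trans _ _ (\sum_(n < K) \sum_(i < n.+1) F i (n - i)%N)).
  apply: ler_sum => n _; rewrite /conv.
  apply: le_trans (ler_wpM2l (wt_ge0 n) (mnorm_sum _ _ _)) _.
  rewrite mulr_sumr; apply: ler_sum => i _.
  rewrite /F mulrACA ler_pM ?wt_ge0 ?mnorm_ge0 ?mnormM//.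
  by rewrite -[X in wt X <= _](@subnKC i n) ?wtD// -ltnS.
apply: le_trans (triangle_le _ F0) _.
rewrite /F; under eq_bigr do rewrite -mulr_sumr.
rewrite -mulr_suml; apply: ler_pM => //.
- by apply: sumr_ge0 => i _; rewrite mulr_ge0 ?wt_ge0 ?mnorm_ge0.
- by apply: sumr_ge0 => i _; rewrite mulr_ge0 ?wt_ge0 ?mnorm_ge0.
Qed.

(* The terms p_i q_j of index i, j < K which are missing in the K first terms of
   the convolution have i + j >= K, hence total norm at most c d / w_K. *)
Lemma msum_conv p q c d : wbd p c -> wbd q d -> msum (conv p q) = msum p *m msum q.
Proof.
move=> pc qd; have c0 := wbd_ge0 pc; have d0 := wbd_ge0 qd.
set NN := (N * N)%:R * 2 : R.
apply: (@msum_cvgs _ _ _ (c * d + ((N * N)%:R * (2 * c) * d + c * ((N * N)%:R * (2 * d)))))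
  (wbd_conv pc qd) _ => K.
set P := \sum_(n < K) p n; set Q := \sum_(n < K) q n.
have -> : \sum_(n < K) conv p q n - msum p *m msum q =
  (\sum_(n < K) conv p q n - P *m Q) + ((P - msum p) *m Q + msum p *m (Q - msum q)).
  by rewrite mulmxBl mulmxBr [X in _ = _ + X]addrA subrK addrA subrK.
have Qd : mnorm Q <= d.
  rewrite (le_trans (mnorm_sum _ _ _))//; apply: le_trans (qd K); apply: ler_sum => n _.
  by rewrite -[leLHS]mul1r ler_wpM2r ?mnorm_ge0 ?wt_ge1.
rewrite (le_trans (mnormD _ _))// mulrDl lerD//; last first.
  rewrite (le_trans (mnormD _ _))// mulrDl lerD//.
    rewrite (le_trans (mnormM _ _))// mulrAC ler_pM ?mnorm_ge0//.
    exact: msumP.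
  rewrite (le_trans (mnormM _ _))// -mulrA ler_pM ?mnorm_ge0//.
    exact: mnorm_msum.
  exact: msumP.
pose F i j : R := (wt i * mnorm (p i)) * (wt j * mnorm (q j)).
have F0 i j : 0 <= F i j by rewrite !mulr_ge0 ?wt_ge0 ?mnorm_ge0.
rewrite ler_pdivlMr ?wt_gt0//.
apply: (@le_trans _ _ (\sum_(i < K) \sum_(j < K) F i j)); last first.
  rewrite /F; under eq_bigr do rewrite -mulr_sumr.
  rewrite -mulr_suml; apply: ler_pM => //.
  - by apply: sumr_ge0 => i _; rewrite mulr_ge0 ?wt_ge0 ?mnorm_ge0.
  - by apply: sumr_ge0 => i _; rewrite mulr_ge0 ?wt_ge0 ?mnorm_ge0.
have -> : \sum_(n < K) conv p q n - P *m Q =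
   - \sum_(i < K) \sum_(j < K | (K <= i + j)%N) p i *m q j.
  rewrite /P /Q mulmx_suml /conv (triangle_sum (fun i j => p i *m q j)).
  rewrite -sumrB -sumrN; apply: eq_bigr => i _; rewrite mulmx_sumr.
  rewrite [X in _ - X](bigID (fun j : 'I_K => (i + j < K)%N))/= opprD addrA subrr add0r.
  by congr (- _); apply: eq_bigl => j; rewrite -leqNgt.
rewrite mnormN mulrC.
apply: le_trans (ler_wpM2l (wt_ge0 K) (mnorm_sum _ _ _)) _.
rewrite mulr_sumr; apply: ler_sum => i _.
apply: le_trans (ler_wpM2l (wt_ge0 K) (mnorm_sum _ _ _)) _.
rewrite mulr_sumr big_mkcond; apply: ler_sum => j _; case: ifP => // Kij.
rewrite /F mulrACA ler_pM ?wt_ge0 ?mnorm_ge0 ?mnormM//.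
exact: le_trans (le_wt Kij) (wtD _ _).
Qed.

(** * The linear recursion of power series solutions *)

(** Course-of-values recursion: stage n is a sequence whose entries up to n are final, so that entry
    n + 1 may use all earlier ones; [gsol] is the diagonal. *)
Fixpoint gsolf (b f : nat -> M) (n : nat) : nat -> M :=
  if n is n'.+1 then
    let d := gsolf b f n' in fun m =>
    if m == n then n%:R^-1 *: (f n - \sum_(k < n) b k.+1 *m d (n' - k)%N) else d m
  else cst (f 0%N).

Definition gsol b f n := gsolf b f n n.

Lemma gsolf_stable b f n m : (m <= n)%N -> gsolf b f n m = gsol b f m.
Proof.
elim: n => [|n IH]; first by rewrite leqn0 => /eqP ->.
rewrite leq_eqVlt => /orP[/eqP -> //|mn] /=.
by rewrite ltn_eqF// IH.
Qed.

(** At index 0 the recursion is void when b_0 = 0, so f_0 carries the initial value d_0. *)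
Definition solves b f d := d 0%N = f 0%N /\
  forall n, (0 < n)%N -> theta d n + conv b d n = f n.

Lemma gsolP b f : b 0%N = 0 -> solves b f (gsol b f).
Proof.
move=> b0; split=> // -[//|n] _; rewrite /conv big_ord_recl b0 mul0mx add0r.
rewrite /theta {1}/gsol /= eqxx scalerA divff ?pnatr_eq0// scale1r.
apply/eqP; rewrite addrC eq_sym -subr_eq opprB addrC subrK; apply/eqP.
apply: eq_bigr => k _; rewrite /bump /= add1n subSS gsolf_stable//.
by rewrite leq_subr.
Qed.

Lemma solves_uniq b f d d' : b 0%N = 0 -> solves b f d -> solves b f d' -> d = d'.
Proof.
move=> b0 [d0 dn] [d0' dn']; apply/funext => n.
elim/ltn_ind: n => -[|n] IH; first by rewrite d0 d0'.
have := dn n.+1 isT; rewrite -(dn' n.+1 isT) /conv 2!(big_ord_recl n.+1) b0 !mul0mx !add0r.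
rewrite (eq_bigr (fun i : 'I_n.+1 => b (lift ord0 i) *m d' (n.+1 - lift ord0 i)%N)); last first.
  by move=> i _; rewrite IH// lift0 subSS ltnS leq_subr.
move/addIr; rewrite /theta => /(congr1 (fun A => n.+1%:R^-1 *: A)).
by rewrite !scalerA mulVf ?pnatr_eq0// !scale1r.
Qed.

Lemma gsol_uniq b f d : b 0%N = 0 -> solves b f d -> gsol b f = d.
Proof. by move=> b0 bd; apply: solves_uniq b0 (gsolP f b0) bd. Qed.

Definition ysol b := gsol b (cst 1%:M).
(** The inverse of Y satisfies x Z' = Z b, and transposition turns this into the equation of [ysol]
    for the coefficients - b^T. The bounds on [ysol] then apply to the inverse as well. *)
Definition yinv b := fun n => (ysol (fun k => - (b k)^T) n)^T.

Lemma ysol0 b : ysol b 0%N = 1%:M. Proof. by []. Qed.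
Lemma yinv0 b : yinv b 0%N = 1%:M. Proof. by rewrite /yinv ysol0 trmx1. Qed.

Lemma theta_ysol b : b 0%N = 0 -> theta (ysol b) = - conv b (ysol b).
Proof.
move=> b0; apply/funext => n; rewrite fctE; apply/eqP; rewrite -addr_eq0; apply/eqP.
have [] := gsolP (cst 1%:M) b0; case: n => [_ _|n _ H]; last exact: H.
by rewrite /theta scale0r add0r /conv big_ord1 b0 mul0mx.
Qed.

Lemma theta_yinv b : b 0%N = 0 -> theta (yinv b) = conv (yinv b) b.
Proof.
move=> b0; pose b' k := - (b k)^T; have b0' : b' 0%N = 0 by rewrite /b' b0 trmx0 oppr0.
apply/funext => n; have := congr1 (fun f => (f n)^T) (theta_ysol b0').
rewrite /theta linearZ/= -/(yinv b n) => ->.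
rewrite -convNl.
have -> : - b' = (fun k => (b k)^T) by apply/funext => k; rewrite fctE opprK.
have -> : ysol b' = (fun k => (yinv b k)^T) by apply/funext => k; rewrite /yinv trmxK.
by rewrite conv_tr trmxK.
Qed.

Lemma theta_cst A : theta (cst A) = 0.
Proof. by apply/funext => -[|n]; rewrite /theta /cst/= ?scale0r ?scaler0. Qed.

(** The product e satisfies theta e = e * b - b * e. As b_0 = 0, coefficient n + 1 of the right-hand
    side only involves e_0, ..., e_n, which by induction are scalar and commute with b. *)
Lemma ysolK b : b 0%N = 0 -> conv (ysol b) (yinv b) = cst 1%:M.
Proof.
move=> b0; set e := conv _ _.
have te : theta e = conv e b - conv b e.
  by rewrite theta_conv theta_ysol// theta_yinv// convNl /e !convA addrC.
apply/funext => n; elim/ltn_ind: n => -[|n] IH.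
  by rewrite /e /conv big_ord1 ysol0 yinv0 mulmx1.
have : theta e n.+1 = 0.
  rewrite te -[LHS]/(conv e b n.+1 - conv b e n.+1) conv_rev /conv -sumrB.
  rewrite big_ord_recl b0 mulmx0 mul0mx subrr add0r big1// => i _.
  rewrite IH; last by rewrite lift0 subSS ltnS leq_subr.
  by rewrite /cst; case: ifP => _; rewrite ?mul1mx ?mulmx1 ?mul0mx ?mulmx0 subrr.
move=> /(congr1 (fun A => n.+1%:R^-1 *: A)).
by rewrite /theta scalerA mulVf ?pnatr_eq0// scale1r scaler0.
Qed.

End sequences.

(** * A Gronwall inequality for convolutions *)

Section volterra.
Context {R : realType}.

(** Let J = floor(2 beta) + 1. Terms of index at least J are damped by 1 / J, and beta / J < 1/2
    lets them be absorbed; the first J terms sum to at most gamma (1 + beta)^J. Solving S <= gamma +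
    beta gamma (1 + beta)^J + S / 2 for S gives this constant. *)
Definition vc (beta : R) : R :=
  2 + 2 * beta * (1 + beta) ^+ (Num.truncn (2 * beta)).+1.

(* The factor 1 / n is at most 1 / J when n - i >= J, and with J > 2 beta the
   sum over these terms is absorbed in the left-hand side. *)
Lemma volterra_bound (a c e : nat -> R) (beta gamma : R) :
  (forall n, 0 <= a n) -> (forall n, 0 <= e n) -> a 0%N = 0 ->
  (forall K, \sum_(n < K) a n <= beta) -> (forall K, \sum_(n < K) c n <= gamma) ->
  (forall n, e n <= c n + (\sum_(i < n.+1) a i * e (n - i)%N) / (maxn 1 n)%:R) ->
  forall K, \sum_(n < K) e n <= vc beta * gamma.
Proof.
move=> a0 e0 a00 ab cg ee K.
have b0 : 0 <= beta by have := ab 0%N; rewrite big_ord0.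
have g0 : 0 <= gamma by have := cg 0%N; rewrite big_ord0.
have E0 k : 0 <= \sum_(n < k) e n by apply: sumr_ge0 => i _.
(* The factor 1 / n is dropped here. Since a_0 = 0, the convolutions of index n <= k only involve
   e_j with j < k. *)
have step k : \sum_(n < k.+1) e n <= gamma + beta * \sum_(n < k) e n.
  apply: (@le_trans _ _ (\sum_(n < k.+1) (c n + \sum_(i < n.+1) a i * e (n - i)%N))).
    apply: ler_sum => n _; apply: (le_trans (ee n)); rewrite lerD2l.
    rewrite ler_pdivrMr ?ltr0n ?leq_max// ler_peMr ?ler1n ?leq_max//.
    by apply: sumr_ge0 => i _; rewrite mulr_ge0.
  rewrite big_split/=; apply: lerD; first exact: cg.
  have -> : \sum_(n < k.+1) \sum_(i < n.+1) a i * e (n - i)%N =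
    \sum_(i < k.+1) \sum_(j < k.+1 | (i + j < k.+1)%N) a i * e j.
    exact: (triangle_sum (fun i j => a i * e j)).
  rewrite big_ord_recl a00 big1 ?add0r => [|j _]; last by rewrite mul0r.
  apply: (@le_trans _ _ (\sum_(i < k) a (lift ord0 i) * \sum_(j < k) e j)).
    apply: ler_sum => i _; rewrite mulr_sumr.
    rewrite big_mkcond big_ord_recr/= [X in _ + X]ifF ?addr0; last first.
      by apply/negbTE; rewrite /bump; lia.
    by apply: ler_sum => j _; case: ifP => // _; rewrite mulr_ge0.
  rewrite -mulr_suml ler_wpM2r//; apply: le_trans (ab k.+1).
  by rewrite big_ord_recl a00 add0r.
have geo k : \sum_(n < k) e n <= gamma * (1 + beta) ^+ k.
  elim: k => [|k IH]; first by rewrite big_ord0 expr0 mulr1.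
  apply: le_trans (step k) _; rewrite exprS.
  have h1 : gamma <= gamma * (1 + beta) ^+ k.
    by rewrite ler_peMr// exprn_ege1// lerDl.
  have h2 : beta * \sum_(n < k) e n <= beta * (gamma * (1 + beta) ^+ k).
    by rewrite ler_wpM2l.
  by apply: le_trans (lerD h1 h2) _; rewrite le_eqVlt; apply/orP; left; apply/eqP; ring.
set J := (Num.truncn (2 * beta)).+1.
have J2 : 2 * beta < J%:R by exact: truncnS_gt.
have J0 : 0 < J%:R :> R by rewrite ltr0n.
(* With j = n - i, the factor 1 / max(1, n) is at most [j < J] + 1 / J: either j is small, or n >= j
   >= J. *)
have main : \sum_(n < K) e n <=
    gamma + beta * (\sum_(n < J) e n + (\sum_(n < K) e n) / J%:R).
  apply: (@le_trans _ _ (\sum_(n < K) (c n + \sum_(i < n.+1)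
     a i * (e (n - i)%N * ((n - i < J)%N%:R + J%:R^-1))))).
    apply: ler_sum => n _; apply: (le_trans (ee n)); rewrite lerD2l mulr_suml.
    apply: ler_sum => i _; rewrite -mulrA ler_wpM2l// ler_wpM2l//.
    have [_|nJ] := ltnP (n - i)%N J.
      rewrite (@le_trans _ _ 1) ?lerDl ?invr_ge0 ?(ltW J0)//.
      by rewrite invf_le1 ?ler1n ?ltr0n ?leq_max.
    rewrite add0r lef_pV2 ?posrE ?ltr0n ?leq_max// ler_nat; lia.
  rewrite big_split/=; apply: lerD; first exact: cg.
  apply: le_trans (triangle_le _ (F := fun i j => a i * (e j * ((j < J)%N%:R + J%:R^-1))) _) _.
    by move=> i j; rewrite !mulr_ge0// addr_ge0// invr_ge0 ltW.
  under [leLHS]eq_bigr do rewrite -mulr_sumr.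
  rewrite -mulr_suml; apply: ler_pM => //; first exact: sumr_ge0.
    by apply: sumr_ge0 => i _; rewrite !mulr_ge0// addr_ge0// invr_ge0 ltW.
  under [leLHS]eq_bigr do rewrite mulrDr.
  rewrite big_split/= -mulr_suml lerD//.
  have [JK|KJ] := leqP J K.
    rewrite [leRHS](big_ord_widen K e JK) [leRHS]big_mkcond/=.
    by apply: ler_sum => j _; case: ifP; rewrite ?mulr1 ?mulr0.
  rewrite [leRHS](_ : _ = \sum_(n < J) e n)//.
  rewrite -!(big_mkord xpredT e) -(big_mkord xpredT (fun i => e i * (i < J)%N%:R)).
  rewrite [leRHS](big_cat_nat _ (ltnW KJ))//= -[leLHS]addr0 lerD//; last first.
    by apply: sumr_ge0 => i _.
  rewrite ler_sum// => i _; case: (_ < _)%N; rewrite ?mulr1 ?mulr0//.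
have : beta * ((\sum_(n < K) e n) / J%:R) <= (\sum_(n < K) e n) / 2.
  rewrite mulrCA ler_wpM2l// ler_pdivrMr//.
  by rewrite mulrC ler_pdivlMr// mulrC ltW.
have := ler_wpM2l b0 (geo J).
rewrite /vc -/J; move: main; set S := \sum_(n < K) e n; set SJ := \sum_(n < J) e n.
set X := (1 + beta) ^+ J.
move=> h1 h2 h3.
have : S <= gamma + beta * SJ + S / 2 by lra.
move=> h4; have : S <= 2 * gamma + 2 * (beta * SJ) by lra.
move=> h5; apply: le_trans h5 _.
have -> : (2 + 2 * beta * X) * gamma = 2 * gamma + 2 * (beta * (gamma * X)) by ring.
lra.
Qed.

End volterra.

(** * Bounds and first variation of the solutions of the recursion *)

Section bounds.
Context {R : realType} {N : nat}.
Local Notation C := R[i].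
Local Notation M := 'M[C]_N.
Implicit Types (b f p q : nat -> M) (w : nat -> R).

(** The weight is a parameter because smallness is only obtained for the weight 1: [fbd_small]
    spends the weight [wt] to make the tails small. *)
Definition nbd w p c := forall K, \sum_(n < K) w n * mnorm (p n) <= c.

(* Norms of the right-hand sides f of the recursion n d_n = f_n - (b * d)_n. *)
Definition fbd w f c := forall K, \sum_(n < K) w n * mnorm (f n) / (maxn 1 n)%:R <= c.

Definition weight w := (forall n, 0 <= w n) /\ (forall m n, w (m + n)%N <= w m * w n).

Lemma weight_wt : weight (@wt R).
Proof. by split; [exact: wt_ge0|exact: wtD]. Qed.

Lemma weight1 : weight (fun=> 1).
Proof. by split=> // m n; rewrite mulr1. Qed.

Lemma wbd_nbd1 p c : wbd p c -> nbd (fun=> 1) p c.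
Proof.
move=> pc K; apply: le_trans (pc K); apply: ler_sum => n _.
by rewrite ler_wpM2r ?mnorm_ge0 ?wt_ge1.
Qed.

Lemma mnorm_msum1 p c d : wbd p c -> nbd (fun=> 1) p d -> mnorm (msum p) <= d.
Proof.
move=> pc pd; rewrite -subr_le0; apply: (@le_div_wt _ _ ((N * N)%:R * (2 * c))) => K.
rewrite lerBlDr; apply: le_trans (lerD (msumP pc K) (pd K)).
rewrite -lerBlDl mnormBC; apply: (@le_trans _ _ (mnorm (\sum_(n < K) p n))).
  rewrite lerBlDr -[X in mnorm X <= _](subrK (\sum_(n < K) p n)).
  by rewrite [leRHS]addrC mnormD.
rewrite (le_trans (mnorm_sum _ _ _))//; apply: ler_sum => n _.
by rewrite mul1r.
Qed.

Lemma fbd_ge0 w f c : fbd w f c -> 0 <= c.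
Proof. by move=> /(_ 0%N); rewrite big_ord0. Qed.

Lemma fbd_le w f c c' : fbd w f c -> c <= c' -> fbd w f c'.
Proof. by move=> fc cc K; exact: le_trans (fc K) cc. Qed.

Lemma fbd_mono w f p c : weight w -> (forall n, mnorm (f n) <= mnorm (p n)) -> fbd w p c -> fbd w f c.
Proof.
move=> [w0 _] fp pc K; apply: le_trans (pc K); apply: ler_sum => n _.
by rewrite ler_wpM2r ?invr_ge0// ler_wpM2l.
Qed.

Lemma fbdN w f c : weight w -> fbd w f c -> fbd w (- f) c.
Proof. by move=> ww; apply: fbd_mono => // n; rewrite mnormN. Qed.

Lemma fbdD w f p c c' : weight w -> fbd w f c -> fbd w p c' -> fbd w (f + p) (c + c').
Proof.
move=> [w0 _] pc qc K; apply: le_trans (lerD (pc K) (qc K)).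
rewrite -big_split; apply: ler_sum => n _ /=.
by rewrite -mulrDl -mulrDr ler_wpM2r ?invr_ge0// ler_wpM2l// mnormD.
Qed.

Lemma fbd_wt1 f c : fbd wt f c -> fbd (fun=> 1) f c.
Proof.
move=> fc K; apply: le_trans (fc K); apply: ler_sum => n _.
by rewrite ler_wpM2r ?invr_ge0// ler_wpM2r ?mnorm_ge0 ?wt_ge1.
Qed.

Lemma nbd_fbd w f c : weight w -> nbd w f c -> fbd w f c.
Proof.
move=> [w0 _] fc K; apply: le_trans (fc K); apply: ler_sum => n _.
rewrite ler_pdivrMr ?ltr0n ?leq_max// ler_peMr ?mulr_ge0 ?mnorm_ge0//.
by rewrite ler1n leq_max.
Qed.

(** For i <= n the divisor max(1, n) is at least max(1, i), so the division can be transferred to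
    the first factor. *)
Lemma fbd_conv w p q c d : weight w -> fbd w p c -> nbd w q d -> fbd w (conv p q) (c * d).
Proof.
move=> [w0 wD] pc qd K; have c0 := fbd_ge0 pc.
pose F i j : R := (w i * mnorm (p i) / (maxn 1 i)%:R) * (w j * mnorm (q j)).
have F0 i j : 0 <= F i j by rewrite !mulr_ge0 ?mnorm_ge0 ?invr_ge0.
apply: (@le_trans _ _ (\sum_(n < K) \sum_(i < n.+1) F i (n - i)%N)).
  apply: ler_sum => n _; rewrite /conv.
  apply: le_trans (ler_wpM2r _ (ler_wpM2l (w0 n) (mnorm_sum _ _ _))) _.
    by rewrite invr_ge0.
  rewrite mulr_sumr mulr_suml; apply: ler_sum => i _.
  rewrite /F [leRHS]mulrAC ler_pM ?mulr_ge0 ?mnorm_ge0 ?invr_ge0//.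
    rewrite mulrACA ler_pM ?mnorm_ge0 ?mnormM//.
    by rewrite -[X in w X <= _](@subnKC i n) ?wD// -ltnS.
  rewrite lef_pV2 ?posrE ?ltr0n ?leq_max// ler_nat.
  have := ltn_ord i; lia.
apply: le_trans (triangle_le _ F0) _.
rewrite /F; under eq_bigr do rewrite -mulr_sumr.
rewrite -mulr_suml; apply: ler_pM => //.
- by apply: sumr_ge0 => i _; rewrite !mulr_ge0 ?mnorm_ge0 ?invr_ge0.
- by apply: sumr_ge0 => i _; rewrite mulr_ge0 ?mnorm_ge0.
Qed.

Lemma gsol_bd w b f beta c : weight w -> b 0%N = 0 -> nbd w b beta -> fbd w f c ->
  nbd w (gsol b f) (vc beta * c).
Proof.
move=> [w0 wD] b0 bb fc.
apply: (@volterra_bound _ (fun n => w n * mnorm (b n))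
  (fun n => w n * mnorm (f n) / (maxn 1 n)%:R) (fun n => w n * mnorm (gsol b f n))) => //.
- by move=> n; rewrite mulr_ge0 ?mnorm_ge0.
- by move=> n; rewrite mulr_ge0 ?mnorm_ge0.
- by rewrite b0 mnorm0 mulr0.
have [g0 gn] := gsolP f b0; case=> [|n].
  by rewrite g0 divr1 lerDl divr_ge0// sumr_ge0// => i _; rewrite !mulr_ge0 ?mnorm_ge0.
have -> : gsol b f n.+1 = n.+1%:R^-1 *: (f n.+1 - conv b (gsol b f) n.+1).
  by rewrite -(gn n.+1 isT) addrK /theta scalerA mulVf ?pnatr_eq0// scale1r.
rewrite mnormZ ncV nc_nat mulrCA mulrC (_ : maxn 1 n.+1 = n.+1); last lia.
rewrite -mulrDl ler_wpM2r ?invr_ge0//.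
apply: le_trans (ler_wpM2l (w0 _) (mnormB _ _)) _; rewrite mulrDr lerD2l.
apply: le_trans (ler_wpM2l (w0 _) (mnorm_sum _ _ _)) _.
rewrite mulr_sumr; apply: ler_sum => i _.
rewrite mulrACA ler_pM ?mnorm_ge0 ?mnormM//.
by rewrite -[X in w X <= _](@subnKC i n.+1) ?wD// -ltnS.
Qed.

Lemma gsol_wbd b f beta c : b 0%N = 0 -> wbd b beta -> fbd wt f c ->
  wbd (gsol b f) (vc beta * c).
Proof. exact: (gsol_bd weight_wt). Qed.

Definition yc (beta : R) : R := vc beta * mnorm (1%:M : M).

Lemma ysol_bd b beta : b 0%N = 0 -> wbd b beta -> wbd (ysol b) (yc beta).
Proof.
move=> b0 bb; apply: gsol_wbd => //.
exact/(nbd_fbd weight_wt)/wbd_cst.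
Qed.

Lemma yinv_bd b beta : b 0%N = 0 -> wbd b beta -> wbd (yinv b) (yc beta).
Proof.
move=> b0 bb; apply: wbd_tr; apply: ysol_bd; first by rewrite b0 trmx0 oppr0.
by apply: wbd_mono bb => n; rewrite mnormN mnorm_tr.
Qed.

Lemma msum_ysolK b beta : b 0%N = 0 -> wbd b beta ->
  msum (ysol b) *m msum (yinv b) = 1%:M.
Proof.
by move=> b0 bb; rewrite -(msum_conv (ysol_bd b0 bb) (yinv_bd b0 bb)) ysolK// msum_cst.
Qed.

Lemma msum_ysol_unit b beta : b 0%N = 0 -> wbd b beta -> msum (ysol b) \in unitmx.
Proof. by move=> b0 bb; have [] := mulmx1_unit (msum_ysolK b0 bb). Qed.

Lemma msum_yinvE b beta : b 0%N = 0 -> wbd b beta -> msum (yinv b) = invmx (msum (ysol b)).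
Proof.
move=> b0 bb; have u := msum_ysol_unit b0 bb.
by rewrite -[RHS]mulmx1 -(msum_ysolK b0 bb) mulKmx.
Qed.

(* The derivative of ysol at b in the direction f. *)
Definition dsol b f := gsol b (- conv f (ysol b)).

Lemma dsol_wbd b f beta c : b 0%N = 0 -> wbd b beta -> fbd wt f c ->
  wbd (dsol b f) (vc beta * (c * yc beta)).
Proof.
move=> b0 bb fc; apply: gsol_wbd => //; apply: (fbdN weight_wt).
by apply: (fbd_conv weight_wt) => //; exact: ysol_bd.
Qed.

Lemma solvesB b f p d e : solves b f d -> solves b p e -> solves b (f - p) (d - e).
Proof.
move=> [d0 dn] [e0 en]; split; first by rewrite !seqE d0 e0.
move=> n n0; rewrite seqBE -(dn n n0) -(en n n0) thetaD thetaN convDr convNr.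
by rewrite !seqE opprD addrACA.
Qed.

(** A resolvent identity: d = y' - y satisfies theta d + b * d = - (b' - b) * y'. It turns
    differences of coefficients into differences of solutions. *)
Lemma ysolB b b' : b 0%N = 0 -> b' 0%N = 0 ->
  ysol b' - ysol b = gsol b (- conv (b' - b) (ysol b')).
Proof.
move=> b0 b0'; apply/esym/gsol_uniq => //; split.
  by rewrite !seqE !ysol0 subrr /conv big_ord1 !seqE b0 b0' subrr mul0mx oppr0.
move=> n _; rewrite thetaD thetaN !theta_ysol// convBr convBl opprB.
by rewrite !seqE; apply/matrixP => i j; rewrite !mxE; ring.
Qed.

Lemma ysolB_bd b b' beta c : b 0%N = 0 -> b' 0%N = 0 -> wbd b beta -> wbd b' beta ->
  fbd wt (b' - b) c -> wbd (ysol b' - ysol b) (vc beta * (c * yc beta)).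
Proof.
move=> b0 b0' bb bb' fc; rewrite ysolB//; apply: gsol_wbd => //.
apply: (fbdN weight_wt); apply: (fbd_conv weight_wt) => //; exact: ysol_bd.
Qed.

Lemma vc_ge0 (beta : R) : 0 <= beta -> 0 <= vc beta.
Proof. by move=> b0; rewrite /vc addr_ge0// !mulr_ge0// exprn_ge0// addr_ge0. Qed.

Lemma yc_ge0 (beta : R) : 0 <= beta -> 0 <= yc beta.
Proof. by move=> b0; rewrite /yc mulr_ge0 ?vc_ge0 ?mnorm_ge0. Qed.

(** The first K terms are small one by one, each at most e / (2 (K + 1)); the others are at most 1 /
    [wt K] times the weighted bound. This is the step which needs an unbounded weight. *)
Lemma fbd_small (T : Type) (F : set_system T) {FF : Filter F} (rho : T -> R)
    (eta : T -> nat -> M) (c : R) : 0 <= c -> (forall x, 0 <= rho x) ->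
  (\forall x \near F, fbd wt (eta x) (c * rho x)) ->
  (forall k e, 0 < e -> \forall x \near F, mnorm (eta x k) <= e * rho x) ->
  forall e, 0 < e -> \forall x \near F, fbd (fun=> 1) (eta x) (e * rho x).
Proof.
move=> c0 rho0 bd sm e e0.
have [K0 hK0] := wt_large (2 * c / e); set K := K0.
have sK : \forall x \near F, forall k : 'I_K, mnorm (eta x k) <= e / (2 * K.+1%:R) * rho x.
  by apply: filter_forall => k; apply: sm; rewrite divr_gt0// mulr_gt0// ltr0Sn.
near=> x => K'.
have h1 : fbd wt (eta x) (c * rho x) by near: x.
have h2 : forall k : 'I_K, mnorm (eta x k) <= e / (2 * K.+1%:R) * rho x by near: x.
have wK := wt_gt0 K (R := R).
apply: (@le_trans _ _ (\sum_(n < K') ((n < K)%N%:R * (e / (2 * K.+1%:R) * rho x) +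
  (wt n * mnorm (eta x n) / (maxn 1 n)%:R) / wt K))).
  apply: ler_sum => n _; rewrite mul1r.
  have [nK|Kn] := ltnP n K.
    rewrite mul1r -[leLHS]addr0 lerD//; last first.
      by rewrite !divr_ge0 ?mulr_ge0 ?wt_ge0 ?mnorm_ge0.
    apply: le_trans (h2 (Ordinal nK)).
    by rewrite ler_pdivrMr ?ltr0n ?leq_max// ler_peMr ?mnorm_ge0// ler1n leq_max.
  rewrite mul0r add0r ler_pdivlMr// mulrAC ler_wpM2r ?invr_ge0// mulrC.
  by rewrite ler_wpM2r ?mnorm_ge0// le_wt.
rewrite big_split/= -!mulr_suml.
have s1 : \sum_(n < K') (n < K)%N%:R <= K%:R :> R.
  rewrite -natr_sum ler_nat.
  elim: (K') => [|k IH]; first by rewrite big_ord0.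
  have aux m : (\sum_(i < m) (i < K) = minn m K)%N.
    elim: m => [|m IHm]; first by rewrite big_ord0 min0n.
    by rewrite big_ord_recr/= IHm; case: ltnP; lia.
  by rewrite aux geq_minr.
have K10 : 0 < K.+1%:R :> R by rewrite ltr0n.
have r0 := rho0 x.
have p1 : (\sum_(n < K') (n < K)%N%:R) * (e / (2 * K.+1%:R) * rho x) <= e / 2 * rho x.
  apply: le_trans (ler_wpM2r _ s1) _.
    by rewrite mulr_ge0// divr_ge0 ?mulr_ge0// ltW.
  rewrite mulrA ler_wpM2r// mulrCA ler_wpM2l// ?(ltW e0)//.
  rewrite invfM mulrCA ler_piMr ?invr_ge0//.
  by rewrite ler_pdivrMr// mul1r ler_nat leqnSn.
have p2 : (\sum_(i < K') wt i * mnorm (eta x i) / (maxn 1 i)%:R) / wt K <= e / 2 * rho x.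
  rewrite ler_pdivrMr//; apply: le_trans (h1 K') _.
  rewrite mulrAC ler_wpM2r//.
  by move: hK0; rewrite ler_pdivrMr// -/K; lra.
apply: le_trans (lerD p1 p2) _; lra.
Unshelve. all: by end_near.
Qed.

(** With eta = b - b0 - f, the remainder y - y0 - dy solves the recursion for b0 with right-hand
    side - (eta * y0 + (b - b0) * (y - y0)). The first product is o(rho) by [fbd_small]. The second
    is quadratic in rho, since b - b0 is bounded in [fbd] and y - y0 in the stronger sense of
    [wbd]. *)
Lemma ysol_diff (T : Type) (F : set_system T) {FF : Filter F} (rho : T -> R)
    (b f : T -> nat -> M) (b0 : nat -> M) (beta c : R) :
  b0 0%N = 0 -> (forall x, b x 0%N = 0) -> (forall x, f x 0%N = 0) ->
  0 <= c -> (forall x, 0 <= rho x) ->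
  (forall e, 0 < e -> \forall x \near F, rho x <= e) ->
  wbd b0 beta -> (\forall x \near F, wbd (b x) beta) ->
  (\forall x \near F, fbd wt (b x - b0) (c * rho x)) ->
  (\forall x \near F, fbd wt (f x) (c * rho x)) ->
  (forall k e, 0 < e -> \forall x \near F, mnorm (b x k - b0 k - f x k) <= e * rho x) ->
  forall e, 0 < e -> \forall x \near F,
    mnorm (msum (ysol (b x)) - msum (ysol b0) - msum (dsol b0 (f x))) <= e * rho x.
Proof.
move=> b00 bx0 fx0 c0 rho0 rhoe b0b bb bd fd sm e e0.
have beta0 := wbd_ge0 b0b.
have V0 := vc_ge0 beta0; have Y0 := yc_ge0 beta0.
pose eta x := b x - b0 - f x.
have etab : \forall x \near F, fbd wt (eta x) ((c + c) * rho x).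
  near=> x; rewrite mulrDl /eta; apply: (fbdD weight_wt); first by near: x.
  by apply: (fbdN weight_wt); near: x.
(* Z rho^2 bounds the contribution of (b - b0) * (y - y0); [e1] and [e2] are chosen to leave e / 2
   to each of the two products. *)
set Z := vc beta * (c * (vc beta * (c * yc beta))).
have Z0 : 0 <= Z by rewrite /Z (mulr_ge0 V0)// (mulr_ge0 c0)// (mulr_ge0 V0)// (mulr_ge0 c0).
pose e1 := e / (2 * (vc beta * yc beta + 1)).
pose e2 := e / (2 * (Z + 1)).
have e10 : 0 < e1 by rewrite divr_gt0// mulr_gt0// ltr_wpDl// mulr_ge0.
have e20 : 0 < e2 by rewrite divr_gt0// mulr_gt0// ltr_wpDl.
have c20 : 0 <= c + c by rewrite addr_ge0.
have etas := @fbd_small T F FF rho eta _ c20 rho0 etab sm _ e10.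
near=> x.
have h1 : wbd (b x) beta by near: x.
have h2 : fbd wt (b x - b0) (c * rho x) by near: x.
have h3 : fbd wt (f x) (c * rho x) by near: x.
have h4 : fbd (fun=> 1) (eta x) (e1 * rho x) by near: x.
have h5 : rho x <= e2 by near: x; exact: rhoe.
have y1 := ysol_bd b00 b0b; have y2 := ysol_bd (bx0 x) h1.
have y3 := dsol_wbd b00 b0b h3.
have y21 := ysolB_bd b00 (bx0 x) b0b h1 h2.
rewrite -(msumB y2 y1) -(msumB (wbdB y2 y1) y3).
apply: le_trans (mnorm_msum1 (wbdB (wbdB y2 y1) y3) (d :=
   vc beta * (e1 * rho x * yc beta + c * rho x * (vc beta * (c * rho x * yc beta)))) _) _.
  have -> : ysol (b x) - ysol b0 - dsol b0 (f x) =
     gsol b0 (- (conv (eta x) (ysol b0) + conv (b x - b0) (ysol (b x) - ysol b0))).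
    apply/esym/gsol_uniq => //.
    have -> : - (conv (eta x) (ysol b0) + conv (b x - b0) (ysol (b x) - ysol b0)) =
      - conv (b x - b0) (ysol (b x)) - (- conv (f x) (ysol b0)).
      rewrite /eta; apply/funext => n; rewrite convBr 2!convBl.
      by rewrite !seqE; apply/matrixP => i j; rewrite !mxE; ring.
    by rewrite ysolB// /dsol; apply: solvesB; exact: gsolP.
  apply: (gsol_bd weight1) => //; first exact: wbd_nbd1.
  apply: (fbdN weight1); apply: (fbdD weight1).
    by apply: (fbd_conv weight1) => //; exact: wbd_nbd1.
  by apply: (fbd_conv weight1); [exact: fbd_wt1|exact: wbd_nbd1].
have r0 := rho0 x.
have p1 : vc beta * yc beta * e1 <= e / 2.
  set X := vc beta * yc beta; have X0 : 0 <= X by rewrite mulr_ge0.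
  rewrite /e1 -/X mulrA ler_pdivrMr ?mulr_gt0 ?ltr_wpDl//.
  have -> : e / 2 * (2 * (X + 1)) = X * e + e by field.
  by rewrite lerDl ltW.
have p2 : Z * rho x <= e / 2.
  apply: le_trans (ler_wpM2l Z0 h5) _; rewrite /e2.
  rewrite mulrA ler_pdivrMr ?mulr_gt0 ?ltr_wpDl//.
  have : 0 <= Z * e by rewrite mulr_ge0// ltW.
  lra.
have -> : vc beta * (e1 * rho x * yc beta + c * rho x * (vc beta * (c * rho x * yc beta))) =
  (vc beta * yc beta * e1 + Z * rho x) * rho x by rewrite /Z; ring.
by rewrite ler_wpM2r//; apply: le_trans (lerD p1 p2) _; lra.
Unshelve. all: by end_near.
Qed.

End bounds.

(** * Convergence in terms of moduli and [mnorm] *)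

Section topology.
Context {R : realType} {N : nat}.
Local Notation C := R[i].
Local Notation M := 'M[C]_N.

Lemma pos_complex (e : C) : 0 < e -> exists2 r : R, 0 < r & e = r%:C.
Proof.
case: e => a b; rewrite ltcE /= => /andP[/eqP b0 a0]; exists a => //.
by rewrite b0.
Qed.

Lemma nc_lt (z : C) (e : R) : (`|z| < e%:C) = (nc z < e).
Proof. by rewrite normE ltcR. Qed.

Lemma near0_nc (e : R) : 0 < e -> \forall h \near (0 : C), nc h < e.
Proof.
move=> e0; have e0' : 0 < e%:C by rewrite ltcR.
by near do rewrite -nc_lt; apply: nbhs0_lt.
Unshelve. all: by end_near. Qed.

Lemma nearC_nc (x : C) (e : R) : 0 < e -> \forall y \near x, nc (y - x) < e.
Proof.
move=> e0; have e0' : 0 < e%:C by rewrite ltcR.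
have xx : id y @[y --> x] --> x by exact: cvg_id.
by have /cvgr_distC_lt/(_ _ e0') := xx; apply: filterS => y; rewrite -nc_lt.
Qed.

Lemma nearC_ex (x : C) (P : set C) : (\forall y \near x, P y) <->
  exists2 d : R, 0 < d & forall y, nc (y - x) < d -> P y.
Proof.
split=> [/nbhs_ballP[e /= e0 eP]|[d d0 dP]]; last first.
  by apply: filterS (nearC_nc x d0).
have [r r0 er] := pos_complex e0; exists r => // y yx; apply: eP.
by rewrite -ball_normE /= er nc_lt ncBC.
Qed.

Lemma mx_cvgP (T : Type) (F : set_system T) {FF : Filter F} (f : T -> M) (L : M) :
  (f @ F --> L) <-> forall e : R, 0 < e -> \forall x \near F, mnorm (f x - L) <= e.
Proof.
split=> [/cvg_ballP fL e e0|H].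
  pose e' := e / (N * N).+1%:R; have e'0 : 0 < e'%:C by rewrite ltcR divr_gt0.
  apply: filterS (fL _ e'0) => x /= Lx.
  apply: (@le_trans _ _ ((N * N)%:R * e')).
    apply: mnorm_le_entries => i j; have [_] := Lx.
    move=> /(_ i j); rewrite -ball_normE /= nc_lt !mxE ncBC; exact: ltW.
  rewrite /e' mulrCA ger_pMr// ler_pdivrMr// mul1r ler_nat; exact: leqnSn.
apply/cvg_ballP => _ /pos_complex[r r0 ->].
apply: filterS (H (r / 2) _) => [x Lx|]; last by rewrite divr_gt0.
split; first by rewrite ltcR.
move=> i j; rewrite -ball_normE /= nc_lt ncBC.
have -> : f x i j - L i j = (f x - L) i j by rewrite !mxE.
by rewrite (le_lt_trans (mnorm_entry _ _ _))// (le_lt_trans Lx)// gtr_pMr// invf_lt1// ltr1n.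
Qed.

End topology.

(** * First order expansions along a filter *)

Section lapp.
Context {R : realType} {N : nat} {T : Type} (F : set_system T) {FF : Filter F}.
Variables (rho : T -> R).
Local Notation C := R[i].
Local Notation M := 'M[C]_N.

(* f = f0 + L + o(rho) *)
Definition lapp (f : T -> M) (f0 : M) (L : T -> M) := forall e : R, 0 < e ->
  \forall x \near F, mnorm (f x - f0 - L x) <= e * rho x.

Definition lbd (L : T -> M) := exists2 c : R, 0 < c & \forall x \near F, mnorm (L x) <= c * rho x.

Hypothesis rho0 : forall x, 0 <= rho x.
Hypothesis rhoe : forall e : R, 0 < e -> \forall x \near F, rho x <= e.

Lemma lapp_cst A : lapp (fun=> A) A (fun=> 0).
Proof.
move=> e e0; apply: nearW => x.
by rewrite subrr subr0 mnorm0 mulr_ge0// ltW.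
Qed.

Lemma lapp_ext f g f0 L : (\forall x \near F, f x = g x) -> lapp f f0 L -> lapp g f0 L.
Proof.
move=> fg fL e e0; near=> x; rewrite -(_ : f x = g x); last by near: x.
by near: x; exact: fL.
Unshelve. all: by end_near. Qed.

Lemma lapp_lip f f0 L : lapp f f0 L -> lbd L ->
  exists2 c : R, 0 < c & \forall x \near F, mnorm (f x - f0) <= c * rho x.
Proof.
move=> fL [c c0 Lc]; exists (c + 1); first by rewrite addr_gt0.
near=> x; rewrite -[f x - f0](subrK (L x)) (le_trans (mnormD _ _))// addrC mulrDl lerD//.
  by near: x.
by near: x; apply: fL.
Unshelve. all: by end_near. Qed.

Lemma lappM f g f0 g0 L K : lapp f f0 L -> lbd L -> lapp g g0 K -> lbd K ->
  lapp (fun x => f x *m g x) (f0 *m g0) (fun x => L x *m g0 + f0 *m K x).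
Proof.
move=> fL Lb gK Kb e e0.
have [c c0 cf] := lapp_lip fL Lb; have [d d0 dg] := lapp_lip gK Kb.
pose e1 := e / (3 * (mnorm g0 + 1)); pose e2 := e / (3 * (mnorm f0 + 1)).
pose e3 := e / (3 * (c * d)).
have g00 : 0 < mnorm g0 + 1 by rewrite ltr_wpDl// mnorm_ge0.
have f00 : 0 < mnorm f0 + 1 by rewrite ltr_wpDl// mnorm_ge0.
have e10 : 0 < e1 by rewrite divr_gt0 ?mulr_gt0.
have e20 : 0 < e2 by rewrite divr_gt0 ?mulr_gt0.
have e30 : 0 < e3 by rewrite divr_gt0 ?mulr_gt0.
near=> x.
have r0 := rho0 x.
have h1 : mnorm (f x - f0 - L x) <= e1 * rho x by near: x; exact: fL.
have h2 : mnorm (g x - g0 - K x) <= e2 * rho x by near: x; exact: gK.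
have h3 : rho x <= e3 by near: x; exact: rhoe.
have h4 : mnorm (f x - f0) <= c * rho x by near: x.
have h5 : mnorm (g x - g0) <= d * rho x by near: x.
have -> : f x *m g x - f0 *m g0 - (L x *m g0 + f0 *m K x) =
  (f x - f0 - L x) *m g0 + f0 *m (g x - g0 - K x) + (f x - f0) *m (g x - g0).
  rewrite !mulmxBl !mulmxBr.
  by apply/matrixP => i j; rewrite !mxE; ring.
rewrite (le_trans (mnormD _ _))//.
apply: (@le_trans _ _ ((e1 * rho x * (mnorm g0 + 1) + (mnorm f0 + 1) * (e2 * rho x)) +
  c * rho x * (d * rho x))).
  apply: lerD; last by rewrite (le_trans (mnormM _ _))// ler_pM ?mnorm_ge0.
  rewrite (le_trans (mnormD _ _))// lerD// (le_trans (mnormM _ _))//.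
    by rewrite ler_pM ?mnorm_ge0// lerDl.
  by rewrite ler_pM ?mnorm_ge0// lerDl.
have q1 : e1 * rho x * (mnorm g0 + 1) = e / 3 * rho x.
  by rewrite /e1; field; rewrite gt_eqF.
have q2 : (mnorm f0 + 1) * (e2 * rho x) = e / 3 * rho x.
  by rewrite /e2; field; rewrite gt_eqF.
have q3 : c * rho x * (d * rho x) <= e / 3 * rho x.
  have -> : c * rho x * (d * rho x) = c * d * rho x * rho x by ring.
  rewrite ler_wpM2r//; apply: (@le_trans _ _ (c * d * e3)).
    by rewrite ler_wpM2l// mulr_ge0 ?(ltW c0) ?(ltW d0).
  by rewrite /e3 le_eqVlt; apply/orP; left; apply/eqP; field; rewrite !gt_eqF.
rewrite q1 q2; apply: le_trans (lerD (lexx _) q3) _.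
by rewrite le_eqVlt; apply/orP; left; apply/eqP; field.
Unshelve. all: by end_near. Qed.

Lemma lapp_rmul A f f0 L : lapp f f0 L -> lapp (fun x => f x *m A) (f0 *m A) (fun x => L x *m A).
Proof.
move=> fL e e0; have A0 : 0 < mnorm A + 1 by rewrite ltr_wpDl// mnorm_ge0.
near=> x; rewrite -!mulmxBl (le_trans (mnormM _ _))//.
apply: (@le_trans _ _ ((e / (mnorm A + 1) * rho x) * (mnorm A + 1))).
  rewrite ler_pM ?mnorm_ge0 ?lerDl//; near: x; apply: fL.
  by rewrite divr_gt0.
by rewrite mulrAC divfK// gt_eqF.
Unshelve. all: by end_near. Qed.

(* g - g0 + g0 L g0 = - g0 (f - f0 - L) g - g0 L (g - g0) *)
Lemma lapp_inv f g f0 g0 L (c : R) : lapp f f0 L -> lbd L ->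
  (\forall x \near F, f x *m g x = 1%:M) -> g0 *m f0 = 1%:M ->
  (\forall x \near F, mnorm (g x) <= c) ->
  lapp g g0 (fun x => - (g0 *m L x *m g0)).
Proof.
move=> fL Lb fg gf gc.
have [d d0 df] := lapp_lip fL Lb; have [a a0 La] := Lb.
pose h := `|c| + 1; have h0 : 0 < h by rewrite ltr_wpDl.
pose m := mnorm g0 + 1; have m0 : 0 < m by rewrite ltr_wpDl// mnorm_ge0.
move=> e e0.
pose e1 := e / (2 * (m * h)); have e10 : 0 < e1 by rewrite divr_gt0 ?mulr_gt0.
pose e2 := e / (2 * (m * a * (m * d * h))); have e20 : 0 < e2 by rewrite divr_gt0 ?mulr_gt0.
near=> x.
have r0 := rho0 x.
have h1 : mnorm (f x - f0 - L x) <= e1 * rho x by near: x; exact: fL.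
have h2 : rho x <= e2 by near: x; exact: rhoe.
have h3 : mnorm (f x - f0) <= d * rho x by near: x.
have h4 : mnorm (L x) <= a * rho x by near: x.
have h5 : mnorm (g x) <= h.
  by rewrite /h (@le_trans _ _ c)//; [near: x|rewrite (le_trans (ler_norm _))// lerDl].
have h6 : mnorm g0 <= m by rewrite lerDl.
have fgx : f x *m g x = 1%:M by near: x.
have gB : g x - g0 = - (g0 *m (f x - f0) *m g x).
  by rewrite mulmxBr gf mulmxBl -mulmxA fgx mulmx1 mul1mx opprB.
have h7 : mnorm (g x - g0) <= m * d * h * rho x.
  rewrite gB mnormN (le_trans (mnormM _ _))//.
  apply: (@le_trans _ _ (m * (d * rho x) * h)).
    by rewrite ler_pM ?mnorm_ge0// (le_trans (mnormM _ _))// ler_pM ?mnorm_ge0.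
  by rewrite le_eqVlt; apply/orP; left; apply/eqP; ring.
have -> : g x - g0 - - (g0 *m L x *m g0) =
   - (g0 *m (f x - f0 - L x) *m g x) - g0 *m L x *m (g x - g0).
  rewrite opprK {1}gB !mulmxBr !mulmxBl.
  by apply/matrixP => i j; rewrite !mxE; ring.
rewrite (le_trans (mnormB _ _))// mnormN.
apply: (@le_trans _ _ (m * (e1 * rho x) * h + m * (a * rho x) * (m * d * h * rho x))).
  apply: lerD; rewrite (le_trans (mnormM _ _))// ler_pM ?mnorm_ge0//.
    by rewrite (le_trans (mnormM _ _))// ler_pM ?mnorm_ge0.
  by rewrite (le_trans (mnormM _ _))// ler_pM ?mnorm_ge0.
have -> : m * (e1 * rho x) * h = e / 2 * rho x.
  by rewrite /e1; field; rewrite !gt_eqF.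
have -> : m * (a * rho x) * (m * d * h * rho x) = (m * a * (m * d * h) * rho x) * rho x by ring.
rewrite -mulrDl ler_wpM2r// [leRHS]splitr lerD2l.
apply: (@le_trans _ _ (m * a * (m * d * h) * e2)).
  by rewrite ler_wpM2l// !mulr_ge0 ?(ltW m0) ?(ltW a0) ?(ltW d0) ?(ltW h0).
by rewrite /e2 le_eqVlt; apply/orP; left; apply/eqP; field; rewrite !gt_eqF.
Unshelve. all: by end_near. Qed.

End lapp.

(** * Sums of power series solutions in the closed unit disk *)

Section powers.
Context {R : realType}.
Local Notation C := R[i].

Lemma ncX_le1 (x : C) n : nc x <= 1 -> nc (x ^+ n) <= 1.
Proof. by move=> x1; rewrite ncX exprn_ile1// nc_ge0. Qed.

Lemma nc_pow_lip (x y : C) n : nc x <= 1 -> nc y <= 1 ->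
  nc (y ^+ n - x ^+ n) <= n%:R * nc (y - x).
Proof.
move=> x1 y1; elim: n => [|n IH]; first by rewrite !expr0 subrr nc0 mul0r.
have -> : y ^+ n.+1 - x ^+ n.+1 = y * (y ^+ n - x ^+ n) + (y - x) * x ^+ n.
  by rewrite !exprS; ring.
rewrite (le_trans (ncD _ _))// !ncM -natr1 mulrDl mul1r lerD//.
  by apply: le_trans IH; rewrite ler_piMl// nc_ge0.
by rewrite ler_piMr ?nc_ge0// ncX_le1.
Qed.

(** The remainder r_n obeys r_(n+1) = (x + h) r_n + n x^(n-1) h^2, and 0 + 1 + ... + (n - 1) <= n^2.
    The growth in n is harmless, as the bound serves for one n at a time. *)
Lemma nc_pow_diff (x h : C) n : nc x <= 1 -> nc (x + h) <= 1 ->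
  nc ((x + h) ^+ n - x ^+ n - n%:R * x ^+ n.-1 * h) <= n%:R ^+ 2 * nc h ^+ 2.
Proof.
move=> x1 y1; elim: n => [|n IH].
  by rewrite !expr0 subrr mul0r mul0r subrr nc0 expr0n mul0r.
have -> : (x + h) ^+ n.+1 - x ^+ n.+1 - n.+1%:R * x ^+ n.+1.-1 * h =
  (x + h) * ((x + h) ^+ n - x ^+ n - n%:R * x ^+ n.-1 * h) + n%:R * x ^+ n.-1 * h ^+ 2.
  case: n {IH} => [|n]; first by rewrite !expr0 !expr1 /=; ring.
  by rewrite /= !exprS -!natr1; ring.
rewrite (le_trans (ncD _ _))// (ncM (x + h)) (ncM (n%:R * _)) (ncM n%:R) nc_nat !ncX.
apply: (@le_trans _ _ (n%:R ^+ 2 * nc h ^+ 2 + n%:R * nc h ^+ 2)).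
  apply: lerD; first by apply: le_trans IH; rewrite ler_piMl// nc_ge0.
  rewrite ler_wpM2r ?exprn_ge0 ?nc_ge0// ler_piMr//.
  by rewrite -ncX ncX_le1.
rewrite -mulrDl ler_wpM2r ?exprn_ge0 ?nc_ge0//.
by rewrite -!natrX -natrD ler_nat; nia.
Qed.

End powers.

Section dil.
Context {R : realType} {N : nat}.
Local Notation C := R[i].
Local Notation M := 'M[C]_N.
Implicit Types (b f p q : nat -> M) (x y : C).

(** Coefficients of t |-> p(t x), so that the value of a power series at x is the [msum] of a
    dilated sequence. Dilation commutes with products, with [theta] and with the recursion, and
    keeps [wbd] bounds when |x| <= 1; points of the unit circle need no separate treatment. *)
Definition dil x p (n : nat) : M := x ^+ n *: p n.
Definition shiftseq p (n : nat) : M := p n.+1.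

Lemma dil0 x p : p 0%N = 0 -> dil x p 0%N = 0.
Proof. by move=> p0; rewrite /dil p0 scaler0. Qed.

Lemma conv_dil x p q : conv (dil x p) (dil x q) = dil x (conv p q).
Proof.
apply/funext => n; rewrite /conv /dil scaler_sumr; apply: eq_bigr => i _.
by rewrite -scalemxAl -scalemxAr scalerA -exprD subnKC// -ltnS.
Qed.

Lemma theta_dil x p : theta (dil x p) = dil x (theta p).
Proof. by apply/funext => n; rewrite /theta /dil !scalerA mulrC. Qed.

Lemma gsol_dil x b f : b 0%N = 0 -> gsol (dil x b) (dil x f) = dil x (gsol b f).
Proof.
move=> b0; have [g0 gn] := gsolP f b0.
apply: gsol_uniq; first exact: dil0.
split; first by rewrite /dil g0.
by move=> n n0; rewrite theta_dil conv_dil /dil -scalerDr gn.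
Qed.

Lemma scl_cst x A : dil x (cst A) = cst A.
Proof. by apply/funext => -[|n]; rewrite /dil /cst/= ?scale1r ?scaler0. Qed.

Lemma ysol_dil x b : b 0%N = 0 -> ysol (dil x b) = dil x (ysol b).
Proof. by move=> b0; rewrite /ysol -gsol_dil// scl_cst. Qed.

Lemma wbd_dil x b c : nc x <= 1 -> wbd b c -> wbd (dil x b) c.
Proof.
move=> x1; apply: wbd_mono => n; rewrite /dil mnormZ ler_piMl ?mnorm_ge0//.
exact: ncX_le1.
Qed.

(** A factor of size n, as produced by differentiating x^n, costs exactly the division by n
    contained in [fbd]. *)
Lemma fbd_factor (a : nat -> C) b (c d : R) : 0 <= d -> (forall n, nc (a n) <= n%:R * d) ->
  wbd b c -> fbd wt (fun n => a n *: b n) (c * d).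
Proof.
move=> d0 ad bc K; apply: le_trans (ler_wpM2r d0 (bc K)); rewrite mulr_suml.
apply: ler_sum => n _; rewrite mnormZ ler_pdivrMr ?ltr0n ?leq_max//.
rewrite -!mulrA ler_wpM2l ?wt_ge0// mulrC ler_wpM2l ?mnorm_ge0//.
apply: le_trans (ad n) _; rewrite mulrC ler_wpM2l// ler_nat.
exact: leq_maxr.
Qed.

Lemma fbd_dil x y b c : nc x <= 1 -> nc y <= 1 -> wbd b c ->
  fbd wt (dil y b - dil x b) (c * nc (y - x)).
Proof.
move=> x1 y1 bc.
have -> : dil y b - dil x b = fun n => (y ^+ n - x ^+ n) *: b n.
  by apply/funext => n; rewrite seqE /dil scalerBl.
by apply: fbd_factor => // [|n]; [exact: nc_ge0|exact: nc_pow_lip].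
Qed.

(* The solution at x of x Y' = - (sum_k b_k x^k) Y which is 1 at 0. *)
Definition Ysum b x := msum (ysol (dil x b)).

Lemma Ysum0 b : b 0%N = 0 -> Ysum b 0 = 1%:M.
Proof.
move=> b0; rewrite /Ysum ysol_dil// -[RHS]msum_cst; congr msum.
by apply/funext => -[|n]; rewrite /dil /cst/= ?ysol0 ?scale1r// exprS mul0r scale0r.
Qed.

Lemma Ysum_unit b c x : b 0%N = 0 -> wbd b c -> nc x <= 1 -> Ysum b x \in unitmx.
Proof.
move=> b0 bc x1; apply: (@msum_ysol_unit _ _ _ c); first exact: dil0.
exact: wbd_dil.
Qed.

Lemma Ysum_lip b c x y : b 0%N = 0 -> wbd b c -> nc x <= 1 -> nc y <= 1 ->
  mnorm (Ysum b y - Ysum b x) <= vc c * (c * nc (y - x) * @yc R N c).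
Proof.
move=> b0 bc x1 y1.
have [bx bxc] := (dil0 x b0, wbd_dil x1 bc); have [bY bYc] := (dil0 y b0, wbd_dil y1 bc).
rewrite /Ysum -(msumB (ysol_bd bY bYc) (ysol_bd bx bxc)).
apply: mnorm_msum; apply: ysolB_bd => //; exact: fbd_dil.
Qed.

Lemma wbd_shift p c : wbd p c -> wbd (shiftseq p) c.
Proof.
move=> pc K; apply: le_trans (pc K.+1); rewrite big_ord_recl.
rewrite -[leLHS]add0r lerD ?mulr_ge0 ?wt_ge0 ?mnorm_ge0//.
by apply: ler_sum => n _; rewrite ler_wpM2r ?mnorm_ge0// le_wt// lift0.
Qed.

Lemma msum_shift p c : wbd p c -> p 0%N = 0 -> msum (shiftseq p) = msum p.
Proof.
move=> pc p0; apply: (msum_cvgs (wbd_shift pc)) => K.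
have -> : \sum_(n < K) shiftseq p n = \sum_(n < K.+1) p n.
  by rewrite big_ord_recl p0 add0r.
apply: le_trans (msumP pc K.+1) _; apply: ler_wpM2l; last first.
  by rewrite lef_pV2 ?posrE ?wt_gt0// le_wt.
by rewrite mulr_ge0// mulr_ge0// (wbd_ge0 pc).
Qed.

Lemma dsolZ (a : C) b f : b 0%N = 0 -> dsol b (fun n => a *: f n) = fun n => a *: dsol b f n.
Proof.
move=> b0; rewrite /dsol; have [d0 dn] := gsolP (- conv f (ysol b)) b0.
have E : conv (fun n => a *: f n) (ysol b) = a *: conv f (ysol b) by rewrite -convZl.
apply: gsol_uniq => //; split.
  by rewrite E d0 !seqE -[(a *: _) 0%N]/(a *: (conv f (ysol b) 0%N)) scalerN.
move=> n n0; rewrite E seqE -[(a *: _) n]/(a *: (conv f (ysol b) n)) -scalerN.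
rewrite -[- conv f (ysol b) n]/((- conv f (ysol b)) n) -dn// scalerDr.
congr (_ + _); first by rewrite /theta !scalerA mulrC.
by rewrite -[LHS]/(conv b (a *: _) n) convZr.
Qed.

Definition cdiff (G : C -> M) x (D : M) :=
  lapp (nbhs (0 : C)) nc (fun h => G (x + h)) (G x) (fun h => h *: D).

Lemma nc_small (e : R) : 0 < e -> \forall h \near (0 : C), nc h <= e.
Proof. by move=> e0; apply: filterS (near0_nc e0) => h /ltW. Qed.

Lemma lbdZ (D : M) : lbd (nbhs (0 : C)) nc (fun h => h *: D).
Proof.
exists (mnorm D + 1); first by rewrite ltr_wpDl// mnorm_ge0.
apply: nearW => h; rewrite mnormZ mulrC ler_wpM2r ?nc_ge0//.
by rewrite lerDl.
Qed.

(** Moving x by h varies x^n b_n by h n x^(n-1) b_n to first order, and [ysol_diff] applies with rho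
    = |h|. The linearized recursion is solved explicitly by n x^(n-1) y_n. The sequence [shiftseq b]
    is the series b(x) / x, which gives the equation a meaning at x = 0. *)
Lemma Ysum_cdiff b c x : b 0%N = 0 -> wbd b c -> nc x < 1 ->
  cdiff (Ysum b) x (- (msum (dil x (shiftseq b)) *m Ysum b x)).
Proof.
move=> b0 bc x1; have x1' := ltW x1.
have bx0 := dil0 x b0; have bxc := wbd_dil x1' bc.
pose f1 n := (n%:R * x ^+ n.-1) *: b n.
have f1b : fbd wt f1 (c * 1).
  apply: fbd_factor => // n; rewrite ncM nc_nat mulr1 ler_piMr//.
  by rewrite ncX_le1.
have near1 : \forall h \near (0 : C), nc (x + h) <= 1.
  have d0 : 0 < 1 - nc x by rewrite subr_gt0.
  apply: filterS (near0_nc d0) => h hx; rewrite (le_trans (ncD _ _))//.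
  by rewrite -lerBrDl ltW.
pose d := dsol (dil x b) f1.
have dE : d = fun n => (n%:R * x ^+ n.-1) *: ysol b n.
  apply: gsol_uniq => //; split.
    by rewrite seqE /conv big_ord1 /f1 !mul0r !scale0r mul0mx oppr0.
  move=> n n0; rewrite seqE.
  have yn : n%:R *: ysol b n = - conv b (ysol b) n.
    by have := congr1 (fun f => f n) (theta_ysol b0).
  rewrite /theta scalerA.
  have -> : (n%:R * (n%:R * x ^+ n.-1)) *: ysol b n = (n%:R * x ^+ n.-1) *: (n%:R *: ysol b n).
    by rewrite scalerA; congr (_ *: _); ring.
  rewrite yn /conv scalerN scaler_sumr -sumrN -big_split -sumrN; apply: eq_bigr => i _ /=.
  rewrite /dil /f1 ysol_dil// /dil -!scalemxAl -!scalemxAr !scalerA.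
  set W := b i *m _; rewrite -!(scaleNr _ W) -scalerDl; congr (_ *: _).
  have : (i <= n)%N by rewrite -ltnS ltn_ord.
  clear W; move: (nat_of_ord i) => k kn.
  have -> : n%:R = k%:R + (n - k)%N%:R :> C by rewrite -natrD subnKC.
  (* The predecessor truncates at 0, which makes k = 0 and k = n separate cases. *)
  have [k0|k0] := posnP k.
    by rewrite k0 expr0 subn0 !mul0r add0r oppr0 mul1r addNr.
  have [nk0|nk0] := posnP (n - k)%N.
    have -> : n = k :> nat by lia.
    by rewrite subnn !mul0r mulr0 !addr0 expr0 mulr1.
  have -> : x ^+ n.-1 = x ^+ k.-1 * x ^+ (n - k).-1 * x.
    by rewrite -exprD -exprSr; congr (_ ^+ _); lia.
  have -> : x ^+ k = x * x ^+ k.-1 by rewrite -exprS prednK.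
  have -> : x ^+ (n - k) = x * x ^+ (n - k).-1 by rewrite -exprS prednK.
  by ring.
have dwb : wbd d _ := dsol_wbd bx0 bxc f1b.
have dS : msum d = - (msum (dil x (shiftseq b)) *m Ysum b x).
  rewrite -(msum_shift dwb); last by rewrite dE mul0r scale0r.
  have sb := wbd_dil x1' (wbd_shift bc).
  have yb := ysol_bd bx0 bxc.
  rewrite /Ysum -(msum_conv sb yb) -(msumN (wbd_conv sb yb)); congr msum.
  apply/funext => n; rewrite /shiftseq dE seqE ysol_dil// conv_dil /dil /= mulrC -scalerA.
  have := congr1 (fun f => f n.+1) (theta_ysol b0); rewrite /theta => ->.
  rewrite seqE scalerN; congr (- (_ *: _)).
  by rewrite /conv big_ord_recl b0 mul0mx add0r.
have H := @ysol_diff R N C (nbhs (0 : C)) _ nc (fun h => dil (x + h) b)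
  (fun h n => h *: f1 n) (dil x b) c c bx0.
move=> e e0.
have E h : h *: - (msum (dil x (shiftseq b)) *m Ysum b x) =
    msum (dsol (dil x b) (fun n => h *: f1 n)).
  by rewrite dsolZ// (msumZ _ dwb) dS.
suff S : \forall h \near (0 : C), mnorm (msum (ysol (dil (x + h) b)) - msum (ysol (dil x b)) -
    msum (dsol (dil x b) (fun n => h *: f1 n))) <= e * nc h.
  by apply: filterS S => h; rewrite -E.
apply: (H _ (fun h => dil0 (x + h) b0) _ (wbd_ge0 bc) (@nc_ge0 R) nc_small bxc _ _ _ _ e e0).
- by move=> h; rewrite /f1 mul0r scale0r scaler0.
- by apply: filterS near1 => h hx; exact: wbd_dil.
- apply: filterS near1 => h hx.
  have := fbd_dil x1' hx bc; by rewrite addrAC subrr add0r.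
- apply: nearW => h.
  have -> : (fun n => h *: f1 n) = (fun n => (h * (n%:R * x ^+ n.-1)) *: b n).
    by apply/funext => n; rewrite /f1 scalerA.
  apply: fbd_factor => // [|n]; first exact: nc_ge0.
  rewrite !ncM nc_nat mulrC -mulrA ler_wpM2l// ler_piMl ?nc_ge0//.
  exact: ncX_le1.
- move=> k e' e'0.
  pose K := k%:R ^+ 2 * mnorm (b k) + 1.
  have K0 : 0 < K by rewrite ltr_wpDl// mulr_ge0 ?exprn_ge0 ?mnorm_ge0.
  have d0 : 0 < e' / K by rewrite divr_gt0.
  near=> h.
  have hx : nc (x + h) <= 1 by near: h.
  have he : nc h <= e' / K by near: h; exact: nc_small.
  have -> : dil (x + h) b k - dil x b k - h *: f1 k =
    ((x + h) ^+ k - x ^+ k - k%:R * x ^+ k.-1 * h) *: b k.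
    by rewrite /dil /f1 scalerA !scalerBl [h * _]mulrC.
  rewrite mnormZ; apply: (@le_trans _ _ (k%:R ^+ 2 * nc h ^+ 2 * mnorm (b k))).
    by rewrite ler_wpM2r ?mnorm_ge0// nc_pow_diff.
  have -> : k%:R ^+ 2 * nc h ^+ 2 * mnorm (b k) = (k%:R ^+ 2 * mnorm (b k)) * nc h * nc h by ring.
  rewrite ler_wpM2r ?nc_ge0//.
  apply: (@le_trans _ _ (K * nc h)); first by rewrite ler_wpM2r ?nc_ge0// lerDl.
  by rewrite mulrC -ler_pdivlMr.
Unshelve. all: by end_near. Qed.

Lemma cdiff_derive (G : C -> M) x D : cdiff G x D ->
  derivable G x 1 /\ derive1 G x = D.
Proof.
move=> GD.
have H : h^-1 *: (G (h + x) - G x) @[h --> (0 : C)^'] --> D.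
  apply/mx_cvgP => e e0; have := GD e e0; rewrite /dnbhs near_withinE.
  apply: filterS => h hG h0.
  have -> : h^-1 *: (G (h + x) - G x) - D = h^-1 *: (G (x + h) - G x - h *: D).
    by rewrite [RHS]scalerBr scalerA mulVf// scale1r addrC [h + x]addrC addrC.
  rewrite mnormZ ncV mulrC ler_pdivrMr//.
  by rewrite lt_neqAle nc_ge0 andbT eq_sym nc_eq0.
split; last by rewrite /derive1; apply: (cvg_lim _ H).
rewrite /derivable.
have -> : (fun h : C => h^-1 *: ((G \o shift x) (h *: 1) - G x)) =
  (fun h => h^-1 *: (G (h + x) - G x)).
  by apply/funext => h /=; rewrite /shift /= [h *: 1](mulr1 h).
by apply/cvg_ex; exists D.
Qed.

Lemma derive_cdiff (G : C -> M) x : derivable G x 1 -> cdiff G x (derive1 G x).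
Proof.
rewrite /derivable.
have -> : (fun h : C => h^-1 *: ((G \o shift x) (h *: 1) - G x)) =
  (fun h => h^-1 *: (G (h + x) - G x)).
  by apply/funext => h /=; rewrite /shift /= [h *: 1](mulr1 h).
move=> /mx_cvgP H e e0; have := H e e0; rewrite /dnbhs near_withinE -/(derive1 G x).
apply: filterS => h hG.
have [->|h0] := eqVneq h 0; first by rewrite addr0 subrr scale0r subr0 mnorm0 nc0 mulr0.
have := hG h0; rewrite -[h^-1 *: _ - _](scalerK h0).
have -> : h *: (h^-1 *: (G (h + x) - G x) - derive1 G x) = G (x + h) - G x - h *: derive1 G x.
  by rewrite scalerBr scalerA divff// scale1r [h + x]addrC.
rewrite mnormZ ncV mulrC ler_pdivrMr//.
by rewrite lt_neqAle nc_ge0 andbT eq_sym nc_eq0.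
Qed.

End dil.

(** * Derivatives of real functions *)

Section real_derivative.
Context {R : realType}.

Lemma is_derive_eps (g : R -> R) (t d : R) :
  (forall e : R, 0 < e -> \forall s \near (0 : R), `|g (t + s) - g t - s * d| <= e * `|s|) ->
  is_derive t 1 g d.
Proof.
move=> gd.
have H : h^-1 *: ((g \o shift t) (h *: 1) - g t) @[h --> (0 : R)^'] --> d.
  apply/cvgrPdist_le => e e0; have := gd e e0; rewrite /dnbhs near_withinE.
  apply: filterS => h hG h0 /=; rewrite /shift/= [h *: 1]mulr1 distrC.
  have -> : h^-1 *: (g (h + t) - g t) - d = h^-1 * (g (t + h) - g t - h * d).
    by rewrite mulrBr mulKf// addrC [h + t]addrC addrC.
  by rewrite normrM normfV mulrC ler_pdivrMr ?normr_gt0.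
apply: DeriveDef; first by apply/cvg_ex; exists d.
exact: (cvg_lim _ H).
Qed.

Lemma near0_abs (e : R) : 0 < e -> \forall s \near (0 : R), `|s| < e.
Proof. by move=> e0; exact: nbhs0_lt. Qed.

Lemma is_derive0_cst (g : R -> R) (a b : R) : a < b ->
  (forall t, t \in `]a, b[%R -> is_derive t 1 g 0) -> {within `[a, b], continuous g} ->
  g b = g a.
Proof.
move=> ab dg cg; have [c _] := MVT ab dg cg.
by rewrite mul0r => /eqP; rewrite subr_eq0 => /eqP.
Qed.

End real_derivative.

(** * Boundary values, radial uniqueness and the coordinate at infinity *)

Section disks.
Context {R : realType} {N : nat}.
Local Notation C := R[i].
Local Notation M := 'M[C]_N.

Lemma D_plusE (x : C) : D_plus (affine_pt x) <-> nc x < 1.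
Proof.
rewrite -nc_lt; split=> [[y /= y1 [<-]]|x1]; first exact: y1.
by exists x.
Qed.

Lemma D_minusE (x : C) : D_minus (affine_pt x) <-> 1 < nc x.
Proof.
have -> : (1 < nc x) = (1 < `|x|) by rewrite normE -ltcR.
by split=> [[//|[y /= y1 [<-]]]|x1]; [exact: y1|right; exists x].
Qed.

(** The first hypothesis makes the restricted neighbourhood filter proper, so that the limit is
    unique and [bv] is determined by convergence. *)
Lemma bv_within (D : set (P1 (R := R))) (F : P1 -> M) (z : circle R) (L : M) :
  (forall d : R, 0 < d -> exists x : C, D (affine_pt x) /\ nc (x - (z : C)) < d) ->
  (forall e : R, 0 < e -> exists2 d : R, 0 < d & forall x : C, D (affine_pt x) ->
     nc (x - (z : C)) < d -> mnorm (F (affine_pt x) - L) <= e) ->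
  bv_cvg D F z /\ bv D F z = L.
Proof.
move=> Dz FL.
have PF : ProperFilter (within D (nbhs (affine_pt (z : C)))).
  split=> [|]; last exact: within_filter.
  (* Neighbourhoods of a finite point of the one-point compactification unfold to neighbourhoods in
     the plane. *)
  move=> H; have : \forall x \near (z : C), ~ D (affine_pt x) by exact: H.
  by move=> /nearC_ex[d d0 dD]; have [x [Dx xd]] := Dz d d0; exact: (dD x).
have cv : F x @[x --> within D (nbhs (affine_pt (z : C)))] --> L.
  apply/mx_cvgP => e e0; have [d d0 dF] := FL e e0; rewrite near_withinE.
  suff : \forall x \near (z : C), D (affine_pt x) -> mnorm (F (affine_pt x) - L) <= e by [].
  by apply: filterS (nearC_nc (z : C) d0) => x xd Dx; exact: dF.
split; first by apply/cvg_ex; exists L.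
exact: (cvg_lim _ cv).
Qed.

Lemma D_plus_adh (z : circle R) (d : R) : 0 < d ->
  exists x : C, D_plus (affine_pt x) /\ nc (x - (z : C)) < d.
Proof.
move=> d0; pose r := Num.min (d / 2) (1 / 2).
have r0 : 0 < r by rewrite lt_min !divr_gt0.
have r1 : r <= 1 / 2 by rewrite ge_min lexx orbT.
have rd : r <= d / 2 by rewrite ge_min lexx.
exists ((1 - r)%:C * (z : C)); split.
  by apply/D_plusE; rewrite ncM nc_circle mulr1 nc_real ger0_norm; lra.
have -> : (1 - r)%:C * (z : C) - (z : C) = - (r%:C * (z : C)) by rewrite rmorphB /=; ring.
by rewrite ncN ncM nc_circle mulr1 nc_real ger0_norm; lra.
Qed.

Lemma D_minus_adh (z : circle R) (d : R) : 0 < d ->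
  exists x : C, D_minus (affine_pt x) /\ nc (x - (z : C)) < d.
Proof.
move=> d0; pose r := d / 2; have r0 : 0 < r by rewrite divr_gt0.
exists ((1 + r)%:C * (z : C)); split.
  by apply/D_minusE; rewrite ncM nc_circle mulr1 nc_real ger0_norm; lra.
have -> : (1 + r)%:C * (z : C) - (z : C) = r%:C * (z : C) by rewrite rmorphD /=; ring.
by rewrite ncM nc_circle mulr1 nc_real ger0_norm /r; lra.
Qed.

Lemma nc_inv_diff (x z : C) : nc z = 1 -> 1 < nc x -> nc (x^-1 - z^-1) <= nc (x - z).
Proof.
move=> z1 x1.
have x0 : x != 0 by rewrite -nc_eq0 gt_eqF// (lt_trans ltr01).
have z0 : z != 0 by rewrite -nc_eq0 z1 oner_eq0.
have -> : x^-1 - z^-1 = (z - x) * (x^-1 * z^-1) by field; rewrite x0 z0.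
rewrite ncM ncBC ler_piMr ?nc_ge0// ncM !ncV z1 invr1 mulr1 invf_le1 ?ltW//.
exact: lt_trans x1.
Qed.

Lemma lip_small (K e : R) : 0 <= K -> 0 < e -> exists2 d : R, 0 < d &
  forall t, 0 <= t -> t < d -> K * t <= e.
Proof.
move=> K0 e0; exists (e / (K + 1)); first by rewrite divr_gt0// ltr_wpDl.
move=> t t0 td; have K1 : 0 < K + 1 by rewrite ltr_wpDl.
move: td; rewrite ltr_pdivlMr// => td.
rewrite mulrC; apply: le_trans (ltW td); by rewrite ler_wpM2l// lerDl.
Qed.

(** [Ysum b] is Lipschitz on the closed disk, hence its limit at a boundary point is its value
    there. *)
Lemma bv_plus b c (F : P1 -> M) (A : M) (z : circle R) : b 0%N = 0 -> wbd b c ->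
  (forall x : C, nc x < 1 -> F (affine_pt x) = Ysum b x *m A) ->
  bv_cvg D_plus F z /\ bv D_plus F z = Ysum b (z : C) *m A.
Proof.
move=> b0 bc FE; apply: bv_within; first exact: D_plus_adh.
move=> e e0; pose K := vc c * (c * @yc R N c) * mnorm A.
have c0 := wbd_ge0 bc.
have K0 : 0 <= K by rewrite !mulr_ge0 ?vc_ge0 ?yc_ge0 ?mnorm_ge0.
have [d d0 dK] := lip_small K0 e0; exists d => // x /D_plusE x1 xz.
rewrite FE// -mulmxBl (le_trans (mnormM _ _))//.
apply: le_trans (dK _ (nc_ge0 _) xz).
have := Ysum_lip b0 bc (x := (z : C)) (y := x); rewrite nc_circle => /(_ (lexx _) (ltW x1)) H.
apply: le_trans (ler_wpM2r (mnorm_ge0 A) H) _.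
by rewrite /K le_eqVlt; apply/orP; left; apply/eqP; ring.
Qed.

Lemma bv_minus b c (F : P1 -> M) (z : circle R) : b 0%N = 0 -> wbd b c ->
  (forall x : C, 1 < nc x -> F (affine_pt x) = Ysum b x^-1) ->
  bv_cvg D_minus F z /\ bv D_minus F z = Ysum b (z : C)^-1.
Proof.
move=> b0 bc FE; apply: bv_within; first exact: D_minus_adh.
move=> e e0; pose K := vc c * (c * @yc R N c).
have c0 := wbd_ge0 bc.
have K0 : 0 <= K by rewrite !mulr_ge0 ?vc_ge0 ?yc_ge0 ?mnorm_ge0.
have [d d0 dK] := lip_small K0 e0; exists d => // x /D_minusE x1 xz.
rewrite FE//; apply: le_trans (dK _ (nc_ge0 _) xz).
have x1' : nc x^-1 <= 1 by rewrite ncV invf_le1 ?ltW// (lt_trans ltr01).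
have z1 : nc (z : C)^-1 <= 1 by rewrite ncV nc_circle invr1.
apply: le_trans (Ysum_lip b0 bc z1 x1') _.
rewrite (_ : K * _ = vc c * (c * nc (x - (z : C)) * @yc R N c)); last by rewrite /K; ring.
rewrite ler_wpM2l ?vc_ge0// ler_wpM2r ?yc_ge0// ler_wpM2l//.
exact: nc_inv_diff (nc_circle z) x1.
Qed.

(** On the radius t |-> t x the real and imaginary parts of the entries have zero derivative for t >
    0. At 0 only continuity is assumed, since 0 will also stand for infinity, where the differential
    equation is not given. *)
Lemma cdiff0_cst (Z : C -> M) :
  (forall x, 0 < nc x < 1 -> cdiff Z x 0) ->
  (forall e : R, 0 < e -> \forall h \near (0 : C), mnorm (Z h - Z 0) <= e) ->
  forall x, nc x < 1 -> Z x = Z 0.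
Proof.
move=> dZ cZ x x1; have [->//|x0] := eqVneq x 0.
have nx0 : 0 < nc x by rewrite lt_neqAle nc_ge0 andbT eq_sym nc_eq0.
have tx t : 0 <= t -> nc (t%:C * x) = t * nc x by move=> t0; rewrite ncM nc_real ger0_norm.
suff key (f : {additive C -> R}) (fz : forall z, `|f z| <= nc z) i j : f (Z x i j) = f (Z 0 i j).
  apply/matrixP => i j; apply/eqP; rewrite eq_complex; apply/andP; split; apply/eqP.
    exact: (key (@complex.Re R) (@nc_Re R)).
  exact: (key (@complex.Im R) (@nc_Im R)).
pose g (t : R) := f (Z (t%:C * x) i j).
have g1 : g 1 = f (Z x i j) by rewrite /g rmorph1 mul1r.
have g0 : g 0 = f (Z 0 i j) by rewrite /g rmorph0 mul0r.
rewrite -g1 -g0; have dist s t : `|g s - g t| <= mnorm (Z (s%:C * x) - Z (t%:C * x)).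
  rewrite /g -raddfB (le_trans (fz _))//.
  by have := mnorm_entry (Z (s%:C * x) - Z (t%:C * x)) i j; rewrite !mxE.
have dg t : 0 < t -> t * nc x < 1 -> is_derive t 1 g 0.
  move=> t0 t1; apply: is_derive_eps => e e0.
  have tx1 : 0 < nc (t%:C * x) < 1 by rewrite tx ?(ltW t0)// mulr_gt0.
  have e1 : 0 < e / nc x by rewrite divr_gt0.
  have /nearC_ex[d d0 dP] := dZ _ tx1 _ e1.
  have d1 : 0 < d / nc x by rewrite divr_gt0.
  apply: filterS (near0_abs d1) => s sd; rewrite mulr0 subr0.
  apply: le_trans (dist _ _) _.
  have sx : nc (s%:C * x) < d by rewrite ncM nc_real -ltr_pdivlMr.
  have := dP (s%:C * x); rewrite subr0 => /(_ sx).
  rewrite scaler0 subr0 -mulrDl -rmorphD /= => /le_trans; apply.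
  by rewrite ncM nc_real mulrCA mulrC mulfVK// gt_eqF.
have cg0 : g s @[s --> (0 : R)] --> g 0.
  apply/cvgrPdist_le => e e0; have /nearC_ex[d d0 dP] := cZ _ e0.
  have d1 : 0 < d / nc x by rewrite divr_gt0.
  apply: filterS (near0_abs d1) => s sd; rewrite distrC.
  apply: le_trans (dist _ _) _; rewrite [0%:C]rmorph0 mul0r; apply: dP.
  by rewrite subr0 ncM nc_real -ltr_pdivlMr.
apply: is_derive0_cst => //.
  move=> t; rewrite in_itv/= => /andP[t0 t1]; apply: dg => //.
  by rewrite (lt_trans _ x1)// gtr_pMl.
apply/continuous_within_itvP => //; split.
- move=> t; rewrite in_itv/= => /andP[t0 t1].
  apply: differentiable_continuous; apply/derivable1_diffP.
  have tt : t * nc x < 1 by rewrite (lt_trans _ x1)// gtr_pMl.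
  have := dg t t0 tt; by case.
- exact: cvg_at_right_filter.
- apply: cvg_at_left_filter.
  apply: differentiable_continuous; apply/derivable1_diffP.
  have tt : 1 * nc x < 1 by rewrite mul1r.
  by have := dg 1 ltr01 tt; case.
Qed.

(** The expansion of G at w^-1 is applied to k = (w + h)^-1 - w^-1, and k + h / w^2 = h^2 / (w^2 (w
    + h)) is quadratic in h. The factors 2 in the bounds come from |w + h| >= |w| / 2. *)
Lemma cdiff_inv (G : C -> M) (w : C) (D : M) : w != 0 -> cdiff G w^-1 D ->
  cdiff (fun v => G v^-1) w (- (w ^- 2 *: D)).
Proof.
move=> w0 GD e e0.
have nw : 0 < nc w by rewrite lt_neqAle nc_ge0 andbT eq_sym nc_eq0.
pose e1 := e / 2 * nc w ^+ 2 / 2.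
have e10 : 0 < e1 by rewrite !divr_gt0 ?mulr_gt0 ?exprn_gt0 ?divr_gt0.
have /nearC_ex[d d0 dP] := GD e1 e10.
pose K := 2 * mnorm D / nc w ^+ 3 + 1.
have K0 : 0 < K by rewrite ltr_wpDl// divr_ge0 ?mulr_ge0 ?mnorm_ge0 ?exprn_ge0 ?nc_ge0.
have q1 : 0 < nc w / 2 by rewrite divr_gt0.
have q2 : 0 < d * nc w ^+ 2 / 2 by rewrite divr_gt0 ?mulr_gt0 ?exprn_gt0.
have q3 : 0 < e / 2 / K by rewrite !divr_gt0.
near=> h.
have h1 : nc h < nc w / 2 by near: h; exact: near0_nc.
have h2 : nc h < d * nc w ^+ 2 / 2 by near: h; exact: near0_nc.
have h3 : nc h < e / 2 / K by near: h; exact: near0_nc.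
have nh := nc_ge0 h.
have wh : nc w / 2 <= nc (w + h).
  have : nc w <= nc (w + h) + nc h by rewrite -[X in nc X <= _](addrK h w) ncB.
  lra.
have wh0 : 0 < nc (w + h) by lra.
have wh0' : w + h != 0 by rewrite -nc_eq0 gt_eqF.
pose k := (w + h)^-1 - w^-1.
have kE : k = - (h / (w * (w + h))) by rewrite /k; field; rewrite w0 wh0'.
have kn : nc k <= 2 / nc w ^+ 2 * nc h.
  rewrite kE ncN ncM ncV ncM mulrC ler_wpM2r//.
  rewrite -[leRHS]invrK lef_pV2 ?posrE ?mulr_gt0 ?invr_gt0 ?divr_gt0 ?exprn_gt0//.
  rewrite invf_div expr2 -mulrA ler_wpM2l ?(ltW nw)//; lra.
have kd : nc k < d.
  apply: le_lt_trans kn _; rewrite mulrAC ltr_pdivrMr ?exprn_gt0//; lra.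
have := dP k; rewrite subr0 => /(_ kd).
have -> : w^-1 + k = (w + h)^-1 by rewrite /k addrC subrK.
move=> H.
have -> : G (w + h)^-1 - G w^-1 - h *: - (w ^- 2 *: D) =
  (G (w + h)^-1 - G w^-1 - k *: D) + (k + h / w ^+ 2) *: D.
  by apply/matrixP => i j; rewrite !mxE; ring.
have r2 : nc (k + h / w ^+ 2) <= 2 / nc w ^+ 3 * nc h * nc h.
  have -> : k + h / w ^+ 2 = h ^+ 2 / (w ^+ 2 * (w + h)) by rewrite kE; field; rewrite w0 wh0'.
  rewrite ncM ncV ncM !ncX mulrC -mulrA -expr2 ler_wpM2r ?exprn_ge0//.
  rewrite -[leRHS]invrK lef_pV2 ?posrE ?mulr_gt0 ?invr_gt0 ?divr_gt0 ?exprn_gt0//.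
  by rewrite invf_div exprSr -mulrA ler_wpM2l ?exprn_ge0 ?(ltW nw)//.
rewrite (le_trans (mnormD _ _))// mnormZ.
have s1 : mnorm (G (w + h)^-1 - G w^-1 - k *: D) <= e / 2 * nc h.
  apply: le_trans H _; apply: le_trans (ler_wpM2l (ltW e10) kn) _.
  rewrite /e1 le_eqVlt; apply/orP; left; apply/eqP; field.
  by rewrite gt_eqF.
have s2 : nc (k + h / w ^+ 2) * mnorm D <= e / 2 * nc h.
  apply: le_trans (ler_wpM2r (mnorm_ge0 D) r2) _.
  have -> : 2 / nc w ^+ 3 * nc h * nc h * mnorm D = (2 * mnorm D / nc w ^+ 3) * nc h * nc h.
    by field; rewrite gt_eqF.
  rewrite ler_wpM2r//; apply: (@le_trans _ _ (K * nc h)).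
    by rewrite ler_wpM2r// lerDl.
  by rewrite mulrC -ler_pdivlMr// ltW.
by apply: le_trans (lerD s1 s2) _; rewrite -mulrDl -splitr.
Unshelve. all: by end_near. Qed.

End disks.

(** * Complex valued functions of a real variable *)

Section curves.
Context {R : realType}.
Local Notation C := R[i].
Implicit Types (F G : R -> C).

Definition cder F (t : R) (D : C) :=
  is_derive t (1 : R) (fun s => complex.Re (F s)) (complex.Re D) /\
  is_derive t (1 : R) (fun s => complex.Im (F s)) (complex.Im D).

Definition ccont F := continuous (fun t => complex.Re (F t)) /\
  continuous (fun t => complex.Im (F t)).

Lemma ReD (x y : C) : complex.Re (x + y) = complex.Re x + complex.Re y.
Proof. by case: x; case: y. Qed.
Lemma ImD (x y : C) : complex.Im (x + y) = complex.Im x + complex.Im y.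
Proof. by case: x; case: y. Qed.
Lemma ReN (x : C) : complex.Re (- x) = - complex.Re x. Proof. by case: x. Qed.
Lemma ImN (x : C) : complex.Im (- x) = - complex.Im x. Proof. by case: x. Qed.
Lemma ReM (x y : C) :
  complex.Re (x * y) = complex.Re x * complex.Re y - complex.Im x * complex.Im y.
Proof. by case: x; case: y. Qed.
Lemma ImM (x y : C) :
  complex.Im (x * y) = complex.Re x * complex.Im y + complex.Im x * complex.Re y.
Proof. by case: x; case: y. Qed.

Lemma Re_i : complex.Re ('i%R : C) = 0. Proof. by []. Qed.
Lemma Im_i : complex.Im ('i%R : C) = 1. Proof. by []. Qed.
Lemma sqri : ('i%R : C) * 'i%R = -1. Proof. exact: (sqr_i R). Qed.
Lemma i_neq0 : ('i%R : C) != 0. Proof. by rewrite -nc_eq0 nc_i oner_eq0. Qed.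
Lemma invi : ('i%R : C)^-1 = - 'i%R.
Proof. by apply: (mulfI i_neq0); rewrite mulfV ?i_neq0// mulrN sqri opprK. Qed.

Lemma complex_eqP (x y : C) :
  complex.Re x = complex.Re y -> complex.Im x = complex.Im y -> x = y.
Proof. by case: x => a b; case: y => c d /= -> ->. Qed.

Lemma cder_ext F G t D : F =1 G -> cder F t D -> cder G t D.
Proof. by move=> /funext ->. Qed.

Lemma cder_cst (c : C) t : cder (fun=> c) t 0.
Proof. by split; exact: is_derive_cst. Qed.

Lemma cderD F G t D E : cder F t D -> cder G t E -> cder (fun s => F s + G s) t (D + E).
Proof.
move=> [f1 f2] [g1 g2]; split; rewrite ?ReD ?ImD.
  have -> : (fun s => complex.Re (F s + G s)) =
    (fun s => complex.Re (F s)) + (fun s => complex.Re (G s)) by apply/funext => s; rewrite ReD.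
  exact: is_deriveD.
have -> : (fun s => complex.Im (F s + G s)) =
  (fun s => complex.Im (F s)) + (fun s => complex.Im (G s)) by apply/funext => s; rewrite ImD.
exact: is_deriveD.
Qed.

Lemma is_deriveMr (f g : R -> R) (t a b : R) : is_derive t (1 : R) f a -> is_derive t (1 : R) g b ->
  is_derive t (1 : R) (fun s => f s * g s) (a * g t + f t * b).
Proof.
move=> fa gb; have -> : a * g t + f t * b = f t *: b + g t *: a.
  by rewrite /GRing.scale /=; ring.
exact: (@is_deriveM _ _ f g t 1 a b fa gb).
Qed.

Lemma cderM F G t D E : cder F t D -> cder G t E ->
  cder (fun s => F s * G s) t (D * G t + F t * E).
Proof.
move=> [f1 f2] [g1 g2]; split; rewrite ?ReD ?ImD ?ReM ?ImM.
  have -> : (fun s => complex.Re (F s * G s)) =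
    (fun s => complex.Re (F s) * complex.Re (G s)) -
    (fun s => complex.Im (F s) * complex.Im (G s)) by apply/funext => s; rewrite ReM.
  apply: is_derive_eq (is_deriveB (is_deriveMr f1 g1) (is_deriveMr f2 g2)) _.
  by ring.
have -> : (fun s => complex.Im (F s * G s)) =
  (fun s => complex.Re (F s) * complex.Im (G s)) +
  (fun s => complex.Im (F s) * complex.Re (G s)) by apply/funext => s; rewrite ImM.
apply: is_derive_eq (is_deriveD (is_deriveMr f1 g2) (is_deriveMr f2 g1)) _.
by ring.
Qed.

Lemma cderZ (c : C) F t D : cder F t D -> cder (fun s => c * F s) t (c * D).
Proof.
by move=> FD; have := cderM (cder_cst c t) FD; rewrite mul0r add0r.
Qed.

Lemma cder_real (f : R -> R) t d : is_derive t (1 : R) f d -> cder (fun s => (f s)%:C) t d%:C.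
Proof. by move=> fd; split => //=; exact: is_derive_cst. Qed.

Lemma cder_uniq F t D E : cder F t D -> cder F t E -> D = E.
Proof.
move=> [f1 f2] [g1 g2]; apply: complex_eqP.
  by rewrite -(@derive_val _ _ _ _ _ _ _ f1) -(@derive_val _ _ _ _ _ _ _ g1).
by rewrite -(@derive_val _ _ _ _ _ _ _ f2) -(@derive_val _ _ _ _ _ _ _ g2).
Qed.

Lemma is_derive_continuous (f : R -> R) (t d : R) : is_derive t (1 : R) f d ->
  {for t, continuous f}.
Proof.
by move=> [fd _]; apply: differentiable_continuous; exact/derivable1_diffP.
Qed.

Lemma cder_ccont F (D : R -> C) : (forall t, cder F t (D t)) -> ccont F.
Proof.
by move=> FD; split=> t; have [f1 f2] := FD t; apply: is_derive_continuous; eassumption.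
Qed.

Lemma ccontD F G : ccont F -> ccont G -> ccont (fun t => F t + G t).
Proof.
move=> [f1 f2] [g1 g2]; split=> t.
  have -> : (fun s => complex.Re (F s + G s)) =
    (fun s => complex.Re (F s) + complex.Re (G s)) by apply/funext => s; rewrite ReD.
  by apply: cvgD; [exact: f1|exact: g1].
have -> : (fun s => complex.Im (F s + G s)) =
  (fun s => complex.Im (F s) + complex.Im (G s)) by apply/funext => s; rewrite ImD.
by apply: cvgD; [exact: f2|exact: g2].
Qed.

Lemma ccontM F G : ccont F -> ccont G -> ccont (fun t => F t * G t).
Proof.
move=> [f1 f2] [g1 g2]; split=> t.
  have -> : (fun s => complex.Re (F s * G s)) = (fun s => complex.Re (F s) * complex.Re (G s) -
    complex.Im (F s) * complex.Im (G s)) by apply/funext => s; rewrite ReM.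
  by apply: cvgB; apply: cvgM; [exact: f1|exact: g1|exact: f2|exact: g2].
have -> : (fun s => complex.Im (F s * G s)) = (fun s => complex.Re (F s) * complex.Im (G s) +
    complex.Im (F s) * complex.Re (G s)) by apply/funext => s; rewrite ImM.
by apply: cvgD; apply: cvgM; [exact: f1|exact: g2|exact: f2|exact: g1].
Qed.

Lemma ccont_cst (c : C) : ccont (fun=> c).
Proof. by split=> t; exact: cvg_cst. Qed.

Lemma ccontZ (c : C) F : ccont F -> ccont (fun t => c * F t).
Proof. by move=> Fc; apply: ccontM => //; exact: ccont_cst. Qed.

Lemma ccont_sum I (r : seq I) (P : pred I) (F : I -> R -> C) : (forall i, ccont (F i)) ->
  ccont (fun t => \sum_(i <- r | P i) F i t).
Proof.
move=> Fc; elim: r => [|i r IH].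
  by have -> : (fun t => \sum_(i <- [::] | P i) F i t) = fun=> 0
    by [apply/funext => t; rewrite big_nil]; exact: ccont_cst.
have [Pi|Pi] := boolP (P i).
  have -> : (fun t => \sum_(j <- i :: r | P j) F j t) =
    (fun t => F i t + \sum_(j <- r | P j) F j t) by apply/funext => t; rewrite big_cons Pi.
  exact: ccontD.
have -> // : (fun t => \sum_(j <- i :: r | P j) F j t) = (fun t => \sum_(j <- r | P j) F j t).
by apply/funext => t; rewrite big_cons (negbTE Pi).
Qed.

Lemma ccont_conj F : ccont F -> ccont (fun t => (conjc (F t))).
Proof.
move=> [f1 f2]; split=> t.
  have -> : (fun s => complex.Re (conjc (F s))) = (fun s => complex.Re (F s)).
    by apply/funext => s; case: (F s).
  exact: f1.
have -> : (fun s => complex.Im (conjc (F s))) = (fun s => - complex.Im (F s)).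
  by apply/funext => s; case: (F s).
by apply: cvgN; exact: f2.
Qed.

Lemma is_derive_comp (f v : R -> R) (t d e : R) : is_derive (v t) (1 : R) f e ->
  is_derive t (1 : R) v d -> is_derive t (1 : R) (fun s => f (v s)) (e * d).
Proof.
by move=> fe vd; exact: is_derive1_comp.
Qed.

Lemma cder_cis_comp (v : R -> R) (t d : R) : is_derive t (1 : R) v d ->
  cder (fun s => (cis (v s) : C)) t ('i%R * d%:C * (cis (v t) : C)).
Proof.
move=> vd; split; rewrite ?ReM ?ImM ?Re_i ?Im_i /=.
  apply: is_derive_eq (is_derive_comp (is_derive_cos (v t)) vd) _.
  by ring.
apply: is_derive_eq (is_derive_comp (is_derive_sin (v t)) vd) _.
by ring.
Qed.

Lemma is_derive_mull (a t : R) : is_derive t (1 : R) (fun s => a * s) a.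
Proof.
apply: is_derive_eq (is_deriveMr (is_derive_cst a t 1) (is_derive_id t 1)) _.
by rewrite mul0r add0r mulr1.
Qed.

Lemma cder_cis (a t : R) : cder (fun s => (cis (a * s) : C)) t ('i%R * a%:C * (cis (a * t) : C)).
Proof. exact: cder_cis_comp (is_derive_mull a t). Qed.

Lemma cisD (a b : R) : (cis (a + b) : C) = (cis a : C) * (cis b : C).
Proof. by apply: complex_eqP; rewrite ?ReM ?ImM /= ?cosD ?sinD; ring. Qed.

Lemma cis0 : (cis 0 : circle R) = 1 :> C.
Proof. by apply: complex_eqP; rewrite /= ?cos0 ?sin0. Qed.

Lemma cis_neq0 (t : R) : (cis t : C) != 0.
Proof. by rewrite -nc_eq0 nc_circle oner_eq0. Qed.

Lemma circle_neq0 (z : circle R) : (z : C) != 0.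
Proof. by rewrite -nc_eq0 nc_circle oner_eq0. Qed.

Lemma cisN (a : R) : (cis (- a) : C) = (cis a : C)^-1.
Proof.
apply: (mulIf (cis_neq0 a)); rewrite mulVf ?cis_neq0// -cisD addNr.
exact: cis0.
Qed.

Lemma cisXn (t : R) (n : nat) : (cis t : C) ^+ n = (cis (n%:R * t) : C).
Proof.
elim: n => [|n IH]; first by rewrite expr0 mul0r cis0.
by rewrite exprS IH -cisD -natr1 mulrDl mul1r addrC.
Qed.

Lemma cisX (t : R) (n : int) : (cis t : C) ^ n = (cis (n%:~R * t) : C).
Proof.
case: n => n; first by rewrite -exprnP cisXn.
by rewrite NegzE -exprnN cisXn -cisN mulrNz mulNr.
Qed.

Lemma cis_2pi (n : int) : (cis (n%:~R * (pi *+ 2)) : C) = 1.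
Proof.
rewrite -cisX; have -> : (cis (pi *+ 2) : C) = 1.
  by apply: complex_eqP; rewrite /= ?cos2pi ?sin2pi.
by rewrite expfz_eq1 // exp1rz || rewrite exp1rz.
Qed.

Lemma cis_per (t : R) : cis (t + pi *+ 2) = cis t.
Proof. by apply: val_inj => /=; rewrite cosD2pi sinD2pi. Qed.

Lemma circle_inv (z : circle R) : (z : C)^-1 = (conjc (z : C)).
Proof.
apply: (mulfI (circle_neq0 z)); rewrite divff ?circle_neq0// -sqr_normc normE nc_circle.
by rewrite expr1n.
Qed.

End curves.

(** * Integrals over a period and Fourier coefficients *)

Section integrals.
Context {R : realType}.
Local Notation C := R[i].
Local Notation mu := (@lebesgue_measure R).
Implicit Types (F G : R -> C).

Definition rint (f : R -> R) : R := \int[mu]_(t in `[0, pi *+ 2]) f t.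

Definition cint F : C := rint (fun t => complex.Re (F t)) +i* rint (fun t => complex.Im (F t)).

Lemma twopi_gt0 : 0 < pi *+ 2 :> R.
Proof. by rewrite pmulrn_lgt0 ?pi_gt0. Qed.

Lemma cont_integrable (f : R -> R) : continuous f ->
  mu.-integrable `[0, pi *+ 2] (EFin \o f).
Proof.
move=> cf; apply: continuous_compact_integrable; first exact: segment_compact.
exact: continuous_subspaceT.
Qed.

Lemma rint_cst (c : R) : rint (fun=> c) = c * (pi *+ 2).
Proof.
rewrite /rint Rintegral_cst//= lebesgue_measure_itv /= lte_fin twopi_gt0 /=.
by rewrite subr0.
Qed.

Lemma rintD (f g : R -> R) : continuous f -> continuous g ->
  rint (fun t => f t + g t) = rint f + rint g.
Proof. by move=> cf cg; rewrite /rint RintegralD//; exact: cont_integrable. Qed.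

Lemma rintZ (c : R) (f : R -> R) : continuous f -> rint (fun t => c * f t) = c * rint f.
Proof. by move=> cf; rewrite /rint RintegralZl//; exact: cont_integrable. Qed.

Lemma le_rint (f g : R -> R) : continuous f -> continuous g -> (forall t, f t <= g t) ->
  rint f <= rint g.
Proof.
by move=> cf cg fg; apply: le_Rintegral => //; exact: cont_integrable.
Qed.

Lemma rint_ge0 (f : R -> R) : (forall t, 0 <= f t) -> 0 <= rint f.
Proof. by move=> f0; apply: Rintegral_ge0. Qed.

Lemma rint_derive (f g : R -> R) : continuous g -> (forall t, is_derive t (1 : R) f (g t)) ->
  rint g = f (pi *+ 2) - f 0.
Proof.
move=> cg fg; rewrite /rint /Rintegral.
rewrite (@continuous_FTC2 _ g f) ?twopi_gt0//.
- exact: continuous_subspaceT.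
- split.
  + by move=> t _; have [] := fg t.
  + by apply: cvg_at_right_filter; exact: is_derive_continuous (fg _).
  + by apply: cvg_at_left_filter; exact: is_derive_continuous (fg _).
- by move=> t _; rewrite derive1E; exact: (@derive_val _ _ _ _ _ _ _ (fg t)).
Qed.

Lemma cintD F G : ccont F -> ccont G -> cint (fun t => F t + G t) = cint F + cint G.
Proof.
move=> [f1 f2] [g1 g2]; apply: complex_eqP; rewrite ?ReD ?ImD /=.
  by rewrite -rintD//; congr rint; apply/funext => t; rewrite ReD.
by rewrite -rintD//; congr rint; apply/funext => t; rewrite ImD.
Qed.

Lemma cintZ (c : C) F : ccont F -> cint (fun t => c * F t) = c * cint F.
Proof.
move=> [f1 f2]; apply: complex_eqP; rewrite ?ReM ?ImM /=.
  rewrite -rintZ// -mulNr -rintZ// -rintD; last 2 first.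
  - by move=> t; apply: cvgM; [exact: cvg_cst|exact: f1].
  - by move=> t; apply: cvgM; [exact: cvg_cst|exact: f2].
  by congr rint; apply/funext => t; rewrite ReM mulNr.
rewrite -rintZ// -rintZ// -rintD; last 2 first.
- by move=> t; apply: cvgM; [exact: cvg_cst|exact: f2].
- by move=> t; apply: cvgM; [exact: cvg_cst|exact: f1].
by congr rint; apply/funext => t; rewrite ImM.
Qed.

Lemma cintN F : ccont F -> cint (fun t => - F t) = - cint F.
Proof.
move=> Fc; rewrite -mulN1r -cintZ//; congr cint; apply/funext => t.
by rewrite mulN1r.
Qed.

Lemma cintB F G : ccont F -> ccont G -> cint (fun t => F t - G t) = cint F - cint G.
Proof.
move=> Fc Gc; rewrite cintD// ?cintN//.
have -> : (fun t => - G t) = (fun t => -1 * G t) by apply/funext => t; rewrite mulN1r.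
exact: ccontZ.
Qed.

Lemma cint_sum I (r : seq I) (P : pred I) (F : I -> R -> C) : (forall i, ccont (F i)) ->
  cint (fun t => \sum_(i <- r | P i) F i t) = \sum_(i <- r | P i) cint (F i).
Proof.
move=> Fc; elim: r => [|i r IH].
  rewrite big_nil; have -> : (fun t => \sum_(i <- [::] | P i) F i t) = fun=> 0.
    by apply/funext => t; rewrite big_nil.
  by apply: complex_eqP => /=; rewrite rint_cst mul0r.
rewrite big_cons; case: ifP => Pi; last first.
  by rewrite -IH; congr cint; apply/funext => t; rewrite big_cons Pi.
rewrite -IH -cintD//; last exact: ccont_sum.
by congr cint; apply/funext => t; rewrite big_cons Pi.
Qed.

Lemma cint_bound F (m : R) : ccont F -> (forall t, nc (F t) <= m) ->
  nc (cint F) <= 2 * (pi *+ 2) * m.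
Proof.
move=> [f1 f2] Fm.
have aux (f : R -> R) : continuous f -> (forall t, `|f t| <= m) -> `|rint f| <= pi *+ 2 * m.
  move=> cf fm; rewrite ler_norml; apply/andP; split.
    rewrite -mulrN mulrC -rint_cst; apply: le_rint => // [t|t]; first exact: cvg_cst.
    by have := fm t; rewrite ler_norml => /andP[].
  rewrite mulrC -rint_cst; apply: le_rint => // [t|t]; first exact: cvg_cst.
  by have := fm t; rewrite ler_norml => /andP[].
rewrite (le_trans (nc_le _))//= -mulrA mulr_natl mulr2n lerD// aux// => t.
  exact: le_trans (nc_Re _) (Fm t).
exact: le_trans (nc_Im _) (Fm t).
Qed.

Lemma cint_derive F (D : R -> C) : ccont D -> (forall t, cder F t (D t)) ->
  cint D = F (pi *+ 2) - F 0.
Proof.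
move=> [d1 d2] FD; apply: complex_eqP; rewrite ?ReD ?ImD ?ReN ?ImN /=.
  by apply: (@rint_derive (fun t => complex.Re (F t))) => // t; have [] := FD t.
by apply: (@rint_derive (fun t => complex.Im (F t))) => // t; have [] := FD t.
Qed.

Definition ek (n : int) (t : R) : C := (cis (n%:~R * t) : C).

Lemma ccont_ek n : ccont (ek n).
Proof. by apply: cder_ccont => t; exact: cder_cis. Qed.

Lemma ekD m n t : ek (m + n) t = ek m t * ek n t.
Proof. by rewrite /ek intrD mulrDl cisD. Qed.

Lemma ek0 t : ek 0 t = 1. Proof. by rewrite /ek mul0r cis0. Qed.

Lemma ekJ n t : (conjc (ek n t)) = ek (- n) t.
Proof. by rewrite /ek -circle_inv -cisN mulrNz mulNr. Qed.

Lemma nc_ek n t : nc (ek n t) = 1. Proof. exact: nc_circle. Qed.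

Lemma ek_per n t : ek n (t + pi *+ 2) = ek n t.
Proof. by rewrite /ek mulrDr cisD cis_2pi mulr1. Qed.

Lemma cint_ek n : cint (ek n) = if n == 0 then (pi *+ 2)%:C else 0.
Proof.
case: eqP => [->|/eqP n0].
  have -> : ek 0 = fun=> 1 by apply/funext => t; rewrite ek0.
  by apply: complex_eqP => /=; rewrite rint_cst ?mul1r ?mul0r.
have c0 : 'i%R * (n%:~R : R)%:C != 0 :> C.
  by rewrite -nc_eq0 ncM nc_i mul1r nc_real normr_eq0 intr_eq0.
apply: (mulfI c0); rewrite mulr0 -cintZ; last exact: ccont_ek.
rewrite (@cint_derive (ek n)).
- by rewrite /ek cis_2pi mulr0 cis0 subrr.
- exact: ccontZ (ccont_ek n).
- by move=> t; exact: cder_cis.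
Qed.

(** The pairing is with e^(int), hence [fc F n] is the usual Fourier coefficient of index - n. With
    this sign B_n is the opposite of [fc] of the density of A at the same index, see [Bcoef_fc]. *)
Definition fc F (n : int) : C := ((pi *+ 2)%:C)^-1 * cint (fun t => F t * ek n t).

Lemma twopiC_neq0 : (pi *+ 2 : R)%:C != 0.
Proof. by rewrite -nc_eq0 nc_real normr_eq0 gt_eqF ?twopi_gt0. Qed.

(** Integration by parts over a full period; the boundary terms cancel. *)
Lemma fc_derive F (D : R -> C) n : ccont D -> (forall t, cder F t (D t)) ->
  F (pi *+ 2) = F 0 -> fc D n = - ('i%R * n%:~R) * fc F n.
Proof.
move=> Dc FD Fp; have Fc := cder_ccont FD.
rewrite /fc mulrCA; congr (_ * _).
have nE : (n%:~R : C) = (n%:~R : R)%:C by rewrite rmorph_int.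
have H t : cder (fun s => F s * ek n s) t (D t * ek n t + F t * ('i%R * (n%:~R : R)%:C * ek n t)).
  by apply: cderM => //; exact: cder_cis.
have c1 : ccont (fun t => D t * ek n t) by apply: ccontM => //; exact: ccont_ek.
have c2 : ccont (fun t => F t * ek n t) by apply: ccontM => //; exact: ccont_ek.
have c3 : ccont (fun t => F t * ('i%R * (n%:~R : R)%:C * ek n t)).
  by apply: ccontM => //; apply: ccontZ; exact: ccont_ek.
have := cint_derive (ccontD c1 c3) H.
have e0 : ek n 0 = 1 by rewrite /ek mulr0 cis0.
rewrite cintD// [ek n (pi *+ 2)]cis_2pi e0 Fp subrr => /eqP; rewrite addr_eq0 => /eqP ->.
rewrite mulNr -nE; congr (- _); rewrite -cintZ//; congr cint; apply/funext => t.
by rewrite /ek nE; ring.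
Qed.

Lemma fcD F G n : ccont F -> ccont G -> fc (fun t => F t + G t) n = fc F n + fc G n.
Proof.
move=> Fc Gc; rewrite /fc -mulrDr -cintD; last 2 first.
- by apply: ccontM => //; exact: ccont_ek.
- by apply: ccontM => //; exact: ccont_ek.
by congr (_ * _); congr cint; apply/funext => t; rewrite mulrDl.
Qed.

Lemma fcB F G n : ccont F -> ccont G -> fc (fun t => F t - G t) n = fc F n - fc G n.
Proof.
move=> Fc Gc; rewrite /fc -mulrBr -cintB; last 2 first.
- by apply: ccontM => //; exact: ccont_ek.
- by apply: ccontM => //; exact: ccont_ek.
by congr (_ * _); congr cint; apply/funext => t; rewrite mulrBl.
Qed.

Lemma fcZ (c : C) F n : ccont F -> fc (fun t => c * F t) n = c * fc F n.
Proof.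
move=> Fc; rewrite /fc [RHS]mulrCA -(@cintZ c); last by apply: ccontM => //; exact: ccont_ek.
by congr (_ * _); congr cint; apply/funext => t; rewrite mulrA.
Qed.

Lemma fc_bound F (m : R) n : ccont F -> (forall t, nc (F t) <= m) -> nc (fc F n) <= 2 * m.
Proof.
move=> Fc Fm; rewrite /fc ncM ncV nc_real ger0_norm ?(ltW twopi_gt0)//.
rewrite mulrC ler_pdivrMr ?twopi_gt0// mulrAC; apply: cint_bound.
  by apply: ccontM => //; exact: ccont_ek.
by move=> t; rewrite ncM nc_ek mulr1.
Qed.

Lemma nc_sqr (z : C) : ((nc z) ^+ 2)%:C = z * conjc z.
Proof. by rewrite -sqr_normc normE rmorphXn. Qed.

(* 0 <= int |F - sum_k c_k e^{-i nu_k t}|^2 = int |F|^2 - 2 pi sum_k |c_k|^2 *)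
Lemma bessel F (m : R) (K : nat) (nu : nat -> int) : injective nu -> ccont F ->
  (forall t, nc (F t) <= m) -> \sum_(k < K) nc (fc F (nu k)) ^+ 2 <= m ^+ 2.
Proof.
move=> inj Fc Fm.
pose c k := fc F (nu k).
pose p t : C := \sum_(k < K) c k * ek (- nu k) t.
pose S : R := \sum_(k < K) nc (c k) ^+ 2.
have pc : ccont p by apply: ccont_sum => k; apply: ccontZ; exact: ccont_ek.
have pJ t : (conjc (p t)) = \sum_(k < K) (conjc (c k)) * ek (nu k) t.
  rewrite /p rmorph_sum; apply: eq_bigr => k _.
  by rewrite rmorphM; congr (_ * _); rewrite [LHS]ekJ opprK.
have Fp : cint (fun t => F t * (conjc (p t))) = (pi *+ 2)%:C * S%:C.
  have -> : (fun t => F t * (conjc (p t))) = (fun t => \sum_(k < K) (conjc (c k)) * (F t * ek (nu k) t)).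
    by apply/funext => t; rewrite pJ mulr_sumr; apply: eq_bigr => k _; rewrite mulrCA.
  have cc k : ccont (fun t => F t * ek (nu k) t) by apply: ccontM => //; exact: ccont_ek.
  rewrite cint_sum => [|k]; last exact: ccontZ.
  rewrite /S rmorph_sum mulr_sumr; apply: eq_bigr => k _.
  transitivity ((pi *+ 2)%:C * (c k * conjc (c k))); last by rewrite -nc_sqr.
  rewrite cintZ//.
  by rewrite mulrA [RHS]mulrC; congr (_ * _); rewrite /c /fc mulVKf ?twopiC_neq0.
have pp : cint (fun t => p t * (conjc (p t))) = (pi *+ 2)%:C * S%:C.
  have -> : (fun t => p t * (conjc (p t))) =
     (fun t => \sum_(k < K) \sum_(l < K) (c k * (conjc (c l))) * ek (nu l - nu k) t).
    apply/funext => t; rewrite pJ /p mulr_suml; apply: eq_bigr => k _.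
    by rewrite mulr_sumr; apply: eq_bigr => l _; rewrite addrC ekD mulrACA.
  rewrite cint_sum => [|k]; last by apply: ccont_sum => l; apply: ccontZ; exact: ccont_ek.
  rewrite /S rmorph_sum mulr_sumr; apply: eq_bigr => k _.
  rewrite cint_sum => [|l]; last by apply: ccontZ; exact: ccont_ek.
  rewrite (bigD1 k)//= big1 ?addr0 => [|l lk].
    rewrite cintZ; last exact: ccont_ek.
    transitivity ((pi *+ 2)%:C * (c k * conjc (c k))); last by rewrite -nc_sqr.
    by rewrite cint_ek subrr eqxx mulrC.
  rewrite cintZ; last exact: ccont_ek.
  rewrite cint_ek subr_eq0; case: eqP => [/inj/ord_inj lk'|]; last by rewrite mulr0.
  by rewrite lk' eqxx in lk.
have FJ := ccont_conj Fc; have pJc := ccont_conj pc.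
have pF : cint (fun t => p t * (conjc (F t))) = (pi *+ 2)%:C * S%:C.
  have -> : (fun t => p t * (conjc (F t))) = (fun t => (conjc (F t * (conjc (p t))))).
    by apply/funext => t; rewrite rmorphM /= conjcK mulrC.
  have cJ (H : R -> C) : ccont H -> cint (fun t => (conjc (H t))) = (conjc (cint H)).
    move=> [h1 h2]; apply: complex_eqP => /=.
      by congr rint; apply/funext => t; case: (H t).
    rewrite -mulN1r -rintZ//; congr rint; apply/funext => t.
    by rewrite mulN1r; case: (H t).
  rewrite cJ ?Fp; last exact: ccontM.
  by apply: complex_eqP => /=; ring.
have re0 t : complex.Re ((F t - p t) * (conjc (F t - p t))) >= 0.
  by rewrite -nc_sqr /= exprn_ge0 ?nc_ge0.
have := rint_ge0 re0.
have -> : rint (fun t => complex.Re ((F t - p t) * (conjc (F t - p t)))) =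
  complex.Re (cint (fun t => (F t - p t) * (conjc (F t - p t)))) by [].
have -> : (fun t => (F t - p t) * (conjc (F t - p t))) =
  (fun t => (F t * (conjc (F t)) - F t * (conjc (p t))) - (p t * (conjc (F t)) - p t * (conjc (p t)))).
  by apply/funext => t; rewrite rmorphB /=; ring.
have B F' G' : ccont F' -> ccont G' -> ccont (fun t => F' t - G' t).
  move=> h1 h2; have -> : (fun t => F' t - G' t) = (fun t => F' t + -1 * G' t).
    by apply/funext => t; rewrite mulN1r.
  by apply: ccontD => //; exact: ccontZ.
rewrite !cintB ?Fp ?pF ?pp ?subrr ?subr0; [|solve [auto using ccontM]..].
rewrite ReD ReN -rmorphM /= subr_ge0 => h.
rewrite -/(S) -(ler_pM2l twopi_gt0); apply: le_trans h _.
rewrite mulrC -rint_cst; apply: le_rint.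
- by case: (ccontM Fc FJ).
- by move=> t; exact: cvg_cst.
- move=> t; rewrite -nc_sqr /= ler_pXn2r// ?nnegrE ?nc_ge0//.
  by rewrite (le_trans (nc_ge0 (F t))).
Qed.

End integrals.

(** * Functions of class C^2 on the circle *)

Section c2.
Context {R : realType}.
Local Notation C := R[i].
Local Notation circle := (circle R).

Lemma is_derive_fun (g g1 : R -> R) : (forall t, is_derive t (1 : R) g (g1 t)) ->
  (forall t, derivable g t 1) /\ g^`() = g1.
Proof.
move=> gg; split=> [t|]; first by case: (gg t).
by apply/funext => t; rewrite derive1E; case: (gg t).
Qed.

Lemma C2_der (g : R -> R) : C2 g ->
  [/\ forall t, is_derive t (1 : R) g (g^`() t), forall t, is_derive t (1 : R) g^`() (g^`(2) t) &
    continuous g^`(2)].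
Proof.
move=> [g1 g2 g3]; split; last exact: g3.
  by move=> t; exact: DeriveDef (g1 t) (esym (derive1E g t)).
by move=> t; exact: DeriveDef (g2 t) (esym (derive1E g^`() t)).
Qed.

Lemma der_C2 (g g1 g2 : R -> R) : (forall t, is_derive t (1 : R) g (g1 t)) ->
  (forall t, is_derive t (1 : R) g1 (g2 t)) -> continuous g2 ->
  [/\ C2 g, g^`() = g1 & g^`(2) = g2].
Proof.
move=> h1 h2 h3; have [d1 e1] := is_derive_fun h1; have [d2 e2] := is_derive_fun h2.
have e : g^`(2) = g2 by rewrite -e2 -e1.
split; [split; [exact: d1|rewrite e1; exact: d2|rewrite e; exact: h3]|exact: e1|exact: e].
Qed.

Lemma C2c_cder (f : circle -> C) : C2_circle f ->
  [/\ forall t, cder (fun s => f (cis s)) t (angular 1 f t),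
      forall t, cder (angular 1 f) t (angular 2 f t) & ccont (angular 2 f)].
Proof.
move=> [/C2_der[r1 r2 r3] /C2_der[i1 i2 i3]].
split=> [t|t|]; split; [exact: r1|exact: i1|exact: r2|exact: i2|exact: r3|exact: i3].
Qed.

Lemma cder_C2c (f : circle -> C) (F1 F2 : R -> C) :
  (forall t, cder (fun s => f (cis s)) t (F1 t)) -> (forall t, cder F1 t (F2 t)) -> ccont F2 ->
  [/\ C2_circle f, angular 1 f = F1 & angular 2 f = F2].
Proof.
move=> f1 f2 [f3 f4].
have [r1 r2 r3] := der_C2 (fun t => proj1 (f1 t)) (fun t => proj1 (f2 t)) f3.
have [i1 i2 i3] := der_C2 (fun t => proj2 (f1 t)) (fun t => proj2 (f2 t)) f4.
split; first by split; [exact: r1|exact: i1].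
  apply/funext => t; rewrite /angular -[_^`(1)]/(_^`()) r2 -[X in _ +i* X t]/(_^`()) i2.
  by case: (F1 t).
by apply/funext => t; rewrite /angular r3 i3; case: (F2 t).
Qed.

Lemma angular0 (f : circle -> C) t : angular 0 f t = f (cis t).
Proof. by rewrite /angular /=; case: (f (cis t)). Qed.

Lemma C2_real (u : circle -> R) : C2 (u \o cis) -> C2_circle (fun z => (u z)%:C).
Proof. by move=> u2; split; [exact: u2|exact: C2_0]. Qed.

Lemma C2_circle_real (u : circle -> R) : C2_circle (fun z => (u z)%:C) -> C2 (u \o cis).
Proof. by move=> [h _]; exact: h. Qed.

Lemma angular_real k (u : circle -> R) t :
  angular k (fun z => (u z)%:C) t = (derive1n k (u \o cis) t)%:C.
Proof.
rewrite /angular /=; congr (_ +i* _).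
suff -> : derive1n k (fun _ : R => 0 : R) = (fun=> 0) by [].
elim: k => [//|k IH]; rewrite derive1nS IH.
by apply/funext => s; exact: derive1_cst.
Qed.

Lemma C2c_bounded (f : circle -> C) k : C2_circle f -> (k <= 2)%N ->
  exists2 m : R, 0 < m & forall t, nc (angular k f t) <= m.
Proof.
move=> fC; have := C2c_cder fC => -[c1 c2 c3] k2.
have cc : ccont (angular k f).
  case: k k2 => [_|[_|[_|k k2]]]; last by exfalso.
  - have -> : angular 0 f = (fun s => f (cis s)) by apply/funext => s; exact: angular0.
    exact: cder_ccont c1.
  - exact: cder_ccont c2.
  - exact: c3.
have per (g : R -> R) : periodic g (pi *+ 2) -> periodic g^`(k) (pi *+ 2).
  move=> gp; elim: k {k2 cc} => [//|k IH]; rewrite derive1nS; exact: derive1_periodic.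
have [m1 h1] := periodic_bounded (per (fun s => complex.Re (f (cis s)))
  (fun t => congr1 (fun z => complex.Re (f z)) (cis_per t))) (proj1 cc).
have [m2 h2] := periodic_bounded (per (fun s => complex.Im (f (cis s)))
  (fun t => congr1 (fun z => complex.Im (f z)) (cis_per t))) (proj2 cc).
have m10 : 0 <= m1 by apply: le_trans (h1 0).
have m20 : 0 <= m2 by apply: le_trans (h2 0).
exists (m1 + m2 + 1) => [|t]; first by rewrite ltr_wpDl// addr_ge0.
apply: le_trans (nc_le _) _; apply: (@le_trans _ _ (m1 + m2)); last by rewrite lerDl.
by apply: lerD; [exact: h1|exact: h2].
Qed.

Lemma cder_near (F G : R -> C) t D : (\forall s \near t, F s = G s) -> cder F t D -> cder G t D.
Proof.
move=> FG [f1 f2]; split.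
  by apply: near_eq_is_derive f1 => //; apply: filterS FG => s ->.
by apply: near_eq_is_derive f2 => //; apply: filterS FG => s ->.
Qed.

Lemma cder_comp (F : R -> C) (v : R -> R) t d D : cder F (v t) D -> is_derive t (1 : R) v d ->
  cder (fun s => F (v s)) t (D * d%:C).
Proof.
move=> [f1 f2] vd; split; rewrite ?ReM ?ImM /= mulr0 ?subr0 ?add0r ?addr0.
  exact: (is_derive_comp f1 vd).
exact: (is_derive_comp f2 vd).
Qed.

Lemma asin0 : asin (0 : R) = 0.
Proof.
rewrite -{1}(@sin0 R) sinK// in_itv/=.
by rewrite oppr_le0 divr_ge0 ?pi_ge0.
Qed.

Lemma cis_asin (q : circle) : 0 < complex.Re (q : C) -> cis (asin (complex.Im (q : C))) = q.
Proof.
case: q => [[x y] /= q1] x0; have xy : x ^+ 2 + y ^+ 2 = 1.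
  move: q1; rewrite normc_def /= => /eqP [/(congr1 (fun r => r ^+ 2))].
  by rewrite sqr_sqrtr ?expr1n// addr_ge0 ?sqr_ge0.
have y1 : -1 <= y <= 1.
  rewrite -ler_norml -(@expr_le1 _ 2)// -normrX ger0_norm ?sqr_ge0//.
  by rewrite -xy lerDr sqr_ge0.
apply: val_inj; apply: complex_eqP => /=; last by rewrite asinK.
rewrite cos_asin//; have -> : 1 - y ^+ 2 = x ^+ 2 by rewrite -xy addrK.
by rewrite sqrtr_sqr gtr0_norm.
Qed.

Definition cdiv (a b : circle) : circle := insubd (cis 0) ((a : C) / (b : C)).

Lemma cdivE (a b : circle) : (cdiv a b : C) = (a : C) / (b : C).
Proof.
rewrite /cdiv insubdK//; rewrite unfold_in /= normE ncM ncV !nc_circle divr1.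
by rewrite -[X in X == _]/(1%:C) rmorph1.
Qed.

(* Near t0 the function k(e^{it}) / k(e^{it0}) has positive real part, and the
   arcsine of its imaginary part is a local branch of its argument. *)
Lemma circle_lift (k : circle -> circle) (t0 : R) (D : C) :
  cder (fun s => (k (cis s) : C)) t0 D -> exists2 v : R -> R,
  (\forall s \near t0, k (cis s) = cmul (k (cis t0)) (cis (v s))) &
  v t0 = 0 /\ is_derive t0 (1 : R) v (complex.Im (D / (k (cis t0) : C))).
Proof.
move=> kD; set K0 : C := k (cis t0); have K00 : K0 != 0 by exact: circle_neq0.
pose q s := cdiv (k (cis s)) (k (cis t0)).
have qE s : (q s : C) = K0^-1 * (k (cis s) : C) by rewrite /q cdivE mulrC.
have dq : cder (fun s => (q s : C)) t0 (D / K0).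
  by apply: (cder_ext (fun s => esym (qE s))); rewrite mulrC; exact: cderZ.
have q0 : (q t0 : C) = 1 by rewrite qE mulVf.
exists (fun s => asin (complex.Im (q s : C))); last first.
  split; first by rewrite q0 /= asin0.
  have h : is_derive (complex.Im (q t0 : C)) (1 : R) (@asin R) 1.
    rewrite q0 /=; apply: is_derive_eq; first by apply: is_derive1_asin; rewrite ltrN10 ltr01.
    by rewrite expr0n subr0 sqrtr1 invr1.
  by have := is_derive_comp h dq.2; rewrite mul1r.
have cq : {for t0, continuous (fun s => complex.Re (q s : C))} by exact: is_derive_continuous dq.1.
have : \forall s \near t0, 0 < complex.Re (q s : C).
  by apply: (cvgr_gt _ cq); rewrite q0 /= ltr01.
apply: filterS => s qs; apply: val_inj.
have E : (cis (asin (complex.Im (q s : C))) : C) = q s by rewrite cis_asin.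
rewrite -[RHS]/(K0 * (cis (asin (complex.Im (q s : C))) : C)) E qE.
by rewrite mulVKf.
Qed.

Lemma cmul_cis (a b : R) : cmul (cis a) (cis b) = cis (a + b).
Proof. by apply: val_inj; exact: esym (cisD a b). Qed.

(** Near t0 the point k(e^(is)) is e^(i(a + v(s))), with v from [circle_lift]; this reduces the
    claim to the chain rule in a real variable. *)
Lemma chain_circle (f : circle -> C) (k : circle -> circle) (t0 a : R) (D E : C) :
  cis a = k (cis t0) -> cder (fun s => (k (cis s) : C)) t0 D ->
  cder (fun s => f (cis s)) a E ->
  cder (fun s => f (k (cis s))) t0 (E * (complex.Im (D / (k (cis t0) : C)))%:C).
Proof.
move=> ak kD fE; have [v vk [v0 vd]] := circle_lift kD.
have H : is_derive t0 (1 : R) (fun s => a + v s) (complex.Im (D / (k (cis t0) : C))).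
  apply: is_derive_eq (is_deriveD (is_derive_cst a t0 1) vd) _.
  by rewrite add0r.
apply: (@cder_near (fun s => f (cis (a + v s)))).
  by apply: filterS vk => s ->; rewrite -ak cmul_cis.
by apply: (@cder_comp (fun s => f (cis s))) H; rewrite v0 addr0.
Qed.

Lemma ccont_circle (f : circle -> C) (k : circle -> circle) :
  ccont (fun s => f (cis s)) -> (forall t, exists D, cder (fun s => (k (cis s) : C)) t D) ->
  ccont (fun s => f (k (cis s))).
Proof.
move=> [f1 f2] kD; split=> t; have [D kt] := kD t; have [v vk [v0 vd]] := circle_lift kt;
  have [a ak] := cis_surj (k (cis t)); have cv := is_derive_continuous vd;
  have cav : {for t, continuous (fun s => a + v s)} by
    [apply: cvgD; [exact: cvg_cst|exact: cv]|].
- rewrite /continuous_at /=; have -> : f (k (cis t)) = f (cis (a + v t)).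
    by rewrite v0 addr0 ak.
  apply: (@cvg_trans _ (complex.Re (f (cis (a + v s))) @[s --> t])).
    apply: near_eq_cvg; apply: filterS vk => s ->.
    by rewrite -ak cmul_cis.
  exact: (cvg_comp _ _ cav (f1 _)).
- rewrite /continuous_at /=; have -> : f (k (cis t)) = f (cis (a + v t)).
    by rewrite v0 addr0 ak.
  apply: (@cvg_trans _ (complex.Im (f (cis (a + v s))) @[s --> t])).
    apply: near_eq_cvg; apply: filterS vk => s ->.
    by rewrite -ak cmul_cis.
  exact: (cvg_comp _ _ cav (f2 _)).
Qed.

(** Some angle of z, without any continuity: it is used inside periodic functions, where only its
    class modulo 2 pi matters. *)
Definition arg (z : circle) : R := xget 0 [set t | cis t = z].

Lemma argK (z : circle) : cis (arg z) = z.
Proof. by rewrite /arg; case: xgetP => // H; have [t] := cis_surj z; move/(H t). Qed.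

Definition circ (F : R -> C) (z : circle) : C := F (arg z).

Lemma periodicz (T : Type) (F : R -> T) : (forall t, F (t + pi *+ 2) = F t) ->
  forall (n : int) t, F (t + n%:~R * (pi *+ 2)) = F t.
Proof.
move=> Fp; have Fn n t : F (t + n%:R * (pi *+ 2)) = F t.
  elim: n t => [|n IH] t; first by rewrite mul0r addr0.
  by rewrite -natr1 mulrDl mul1r addrA Fp IH.
case=> n t; first exact: Fn.
by rewrite -(Fn n.+1); congr F; rewrite NegzE mulrNz mulNr subrK.
Qed.

(** The difference reduced to r in [0, 2 pi[ satisfies cos r = 1, hence sin (r / 2) = 0 with r / 2
    in [0, pi[, and r = 0. *)
Lemma cis_eq (a b : R) : cis a = cis b -> exists n : int, a = b + n%:~R * (pi *+ 2).
Proof.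
move=> ab; have T0 := @twopi_gt0 R.
pose n := Num.floor ((a - b) / (pi *+ 2)); exists n.
pose r := a - b - n%:~R * (pi *+ 2).
have /andP[nt tn] := floor_itv ((a - b) / (pi *+ 2)).
have r0 : 0 <= r by rewrite subr_ge0 -ler_pdivlMr.
have r1 : r < pi *+ 2.
  move: tn; rewrite ltr_pdivrMr// intrD mulrDl mul1r -/n => tn.
  by rewrite /r ltrBlDr; rewrite [ltRHS]addrC.
have cr : (cis r : C) = 1.
  rewrite /r -mulNr -mulrNz; rewrite !cisD cisN ab divff ?cis_neq0// mul1r.
  exact: cis_2pi.
have : cos r = 1 by have := congr1 (@complex.Re R) cr.
have -> : r = r / 2 + r / 2 by rewrite -splitr.
rewrite cosD -!expr2 cos2sin2 => h.
have /eqP : sin (r / 2) ^+ 2 = 0 by lra.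
rewrite sqrf_eq0 => /eqP s0.
have : r = 0.
  apply/eqP; rewrite eq_le r0 andbT leNgt; apply/negP => rp.
  have : 0 < sin (r / 2) by apply: sin_gt0_pi; apply/andP; split; lra.
  by rewrite s0 ltxx.
by rewrite /r => /eqP; rewrite subr_eq add0r subr_eq addrC => /eqP.
Qed.

Lemma circ_cis (F : R -> C) : (forall t, F (t + pi *+ 2) = F t) ->
  forall t, circ F (cis t) = F t.
Proof.
move=> Fp t; rewrite /circ; have [n ->] := cis_eq (argK (cis t)).
exact: periodicz.
Qed.

Lemma angular_per k (f : circle -> C) t : angular k f (t + pi *+ 2) = angular k f t.
Proof.
have per (g : R -> R) : periodic g (pi *+ 2) -> periodic g^`(k) (pi *+ 2).
  move=> gp; elim: k => [//|k IH]; rewrite derive1nS; exact: derive1_periodic.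
rewrite /angular; congr (_ +i* _).
  exact: (per (fun s => complex.Re (f (cis s))) (fun t => congr1 (fun z => complex.Re (f z)) (cis_per t))).
exact: (per (fun s => complex.Im (f (cis s))) (fun t => congr1 (fun z => complex.Im (f z)) (cis_per t))).
Qed.

(** If k(e^(it)) = e^(i phi(t)), then k' / k = i phi', so this is phi', obtained without a global
    choice of the angle. Below, [speed'] is its derivative, 1 / k being the conjugate of k on the
    circle. *)
Definition speed (k : circle -> circle) (t : R) : R :=
  complex.Im (angular 1 (fun z => k z : C) t / (k (cis t) : C)).

Definition speed' (k : circle -> circle) (t : R) : R :=
  complex.Im (angular 2 (fun z => k z : C) t * conjc (k (cis t) : C) +
  angular 1 (fun z => k z : C) t * conjc (angular 1 (fun z => k z : C) t)).

(** The angular derivatives of f are turned into functions on the circle by [circ], so that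
    [chain_circle] can be applied a second time. *)
Lemma C2_circle_comp (f : circle -> C) (k : circle -> circle) :
  C2_circle f -> C2_circle (fun z => k z : C) ->
  [/\ C2_circle (fun z => f (k z)),
  forall t, angular 1 (fun z => f (k z)) t = angular 1 f (arg (k (cis t))) * (speed k t)%:C &
  forall t, angular 2 (fun z => f (k z)) t =
    angular 2 f (arg (k (cis t))) * (speed k t)%:C * (speed k t)%:C +
    angular 1 f (arg (k (cis t))) * (speed' k t)%:C].
Proof.
move=> fC kC; have [f1 f2 f3] := C2c_cder fC; have [k1 k2 k3] := C2c_cder kC.
pose g1 := circ (angular 1 f); pose g2 := circ (angular 2 f).
have g1E t : g1 (cis t) = angular 1 f t by apply: circ_cis => s; exact: angular_per.
have g2E t : g2 (cis t) = angular 2 f t by apply: circ_cis => s; exact: angular_per.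
have d1 t : cder (fun s => f (k (cis s))) t (g1 (k (cis t)) * (speed k t)%:C).
  by apply: (chain_circle (a := arg (k (cis t)))) (k1 t) (f1 _); exact: argK.
have d2 t : cder (fun s => g1 (k (cis s))) t (g2 (k (cis t)) * (speed k t)%:C).
  apply: (chain_circle (a := arg (k (cis t)))) (k1 t) _; first exact: argK.
  by apply: (cder_ext (fun s => esym (g1E s))); exact: f2.
pose K s : C := k (cis s).
have KV s : (K s)^-1 = conjc (K s) by exact: circle_inv.
have cderJ (F : R -> C) t D : cder F t D -> cder (fun s => conjc (F s)) t (conjc D).
  move=> [h1 h2]; split.
    have -> : (fun s => complex.Re (conjc (F s))) = (fun s => complex.Re (F s)).
      by apply/funext => s; case: (F s).
    by case: (D) h1.
  have -> : (fun s => complex.Im (conjc (F s))) = - (fun s => complex.Im (F s)).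
    by apply/funext => s; rewrite fctE; case: (F s).
  by apply: is_derive_eq (is_deriveN h2) _; case: (D).
pose w s := angular 1 (fun z => k z : C) s * conjc (K s).
pose w' s := angular 2 (fun z => k z : C) s * conjc (K s) +
  angular 1 (fun z => k z : C) s * conjc (angular 1 (fun z => k z : C) s).
have dw s : cder w s (w' s) by apply: cderM => //; apply: cderJ; exact: k1.
have cw' : ccont w'.
  have c0 : ccont K by exact: cder_ccont k1.
  have c1 : ccont (angular 1 (fun z => k z : C)) by exact: cder_ccont k2.
  by apply: ccontD; apply: ccontM => //; exact: ccont_conj.
have speedE s : speed k s = complex.Im (w s) by rewrite /speed -/(K s) KV.
have ds t : cder (fun s => (speed k s)%:C) t (complex.Im (w' t))%:C.
  apply: cder_real; have -> : speed k = (fun s => complex.Im (w s)).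
    by apply/funext => s; rewrite speedE.
  by have [] := dw t.
have d12 t := cderM (d2 t) (ds t).
have c12 : ccont (fun t => g2 (k (cis t)) * (speed k t)%:C * (speed k t)%:C +
    g1 (k (cis t)) * (complex.Im (w' t))%:C).
  have cs : ccont (fun t => (speed k t)%:C) by exact: cder_ccont ds.
  have kD t : exists D, cder (fun s => (k (cis s) : C)) t D by exists (angular 1 (fun z => k z : C) t).
  apply: ccontD; apply: ccontM.
  - apply: ccontM; last exact: cs.
    apply: (ccont_circle _ kD).
    by have -> : (fun s => g2 (cis s)) = angular 2 f by apply/funext => s; exact: g2E.
  - exact: cs.
  - exact: (cder_ccont d2).
  - by split; [exact: cw'.2|move=> t; exact: cvg_cst].
have [h1 h2 h3] := cder_C2c (f := fun z => f (k z)) d1 d12 c12.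
split; first exact: h1.
  by move=> t; rewrite h2 /g1 /circ.
by move=> t; rewrite h3 /g1 /g2 /circ.
Qed.

End c2.

(** * Charts of the diffeomorphism group *)

Section geometry.
Context {R : realType}.
Local Notation C := R[i].
Local Notation circle := (circle R).
Local Notation Diff2 := (Diff2 R).
Local Notation C2fun := (C2fun R).

Lemma cisN_pi (w w1 w2 : R -> R) : (forall t, is_derive t (1 : R) w (w1 t)) ->
  (forall t, is_derive t (1 : R) w1 (w2 t)) -> continuous w2 ->
  [/\ forall t, cder (fun s => (cis (w s) : C)) t ('i%R * (w1 t)%:C * (cis (w t) : C)),
    forall t, cder (fun t => 'i%R * (w1 t)%:C * (cis (w t) : C)) t
      (('i%R * (w2 t)%:C - ((w1 t) ^+ 2)%:C) * (cis (w t) : C)) &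
    ccont (fun t => ('i%R * (w2 t)%:C - ((w1 t) ^+ 2)%:C) * (cis (w t) : C))].
Proof.
move=> h1 h2 h3; have d1 t := cder_cis_comp (h1 t).
have d2 t : cder (fun t => 'i%R * (w1 t)%:C * (cis (w t) : C)) t
      (('i%R * (w2 t)%:C - ((w1 t) ^+ 2)%:C) * (cis (w t) : C)).
  have := cderM (cderZ ('i%R : C) (cder_real (h2 t))) (d1 t).
  set X := (_ + _ : C); have -> // : X = ('i%R * (w2 t)%:C - ((w1 t) ^+ 2)%:C) * (cis (w t) : C).
  rewrite /X mulrBl; congr (_ + _); rewrite rmorphXn /= expr2.
  by rewrite mulrA mulrACA sqri mulN1r mulNr.
split; [exact: d1|exact: d2|].
have cw1 : continuous w1 by move=> t; exact: is_derive_continuous (h2 t).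
apply: ccontM; last exact: cder_ccont d1.
have -> : (fun t => 'i%R * (w2 t)%:C - ((w1 t) ^+ 2)%:C) = (fun t => (- (w1 t ^+ 2)) +i* w2 t).
  by apply/funext => t; apply: complex_eqP; rewrite /=; ring.
split=> t; last exact: h3.
by apply: cvgN; rewrite expr2; apply: cvgM; exact: cw1.
Qed.

Lemma C2c_cis (u : circle -> R) : C2 (u \o cis) ->
  [/\ C2_circle (fun z => (cis (u z) : C)),
    forall t, angular 1 (fun z => (cis (u z) : C)) t =
      'i%R * (derive1n 1 (u \o cis) t)%:C * (cis (u (cis t)) : C) &
    forall t, angular 2 (fun z => (cis (u z) : C)) t =
      ('i%R * (derive1n 2 (u \o cis) t)%:C - ((derive1n 1 (u \o cis) t) ^+ 2)%:C) *
      (cis (u (cis t)) : C)].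
Proof.
move=> /C2_der[u1 u2 u3]; have [d1 d2 d3] := cisN_pi u1 u2 u3.
have [h1 h2 h3] := cder_C2c (f := fun z => (cis (u z) : C)) d1 d2 d3.
by split=> [|t|t]; [exact: h1|rewrite h2|rewrite h3].
Qed.

Lemma C2c_mul (f g : circle -> C) : C2_circle f -> C2_circle g ->
  [/\ C2_circle (fun z => f z * g z),
    forall t, angular 1 (fun z => f z * g z) t =
      angular 1 f t * g (cis t) + f (cis t) * angular 1 g t &
    forall t, angular 2 (fun z => f z * g z) t =
      angular 2 f t * g (cis t) + 2 * (angular 1 f t * angular 1 g t) + f (cis t) * angular 2 g t].
Proof.
move=> /C2c_cder[f1 f2 f3] /C2c_cder[g1 g2 g3].
have d1 t := cderM (f1 t) (g1 t).
have d2 t := cderD (cderM (f2 t) (g1 t)) (cderM (f1 t) (g2 t)).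
have cf := cder_ccont f1; have cg := cder_ccont g1.
have cf1 := cder_ccont f2; have cg1 := cder_ccont g2.
have c2 := ccontD (ccontD (ccontM f3 cg) (ccontM cf1 cg1)) (ccontD (ccontM cf1 cg1) (ccontM cf g3)).
have [h1 h2 h3] := cder_C2c (f := fun z => f z * g z) d1 d2 c2.
split=> [|t|t]; [exact: h1|by rewrite h2|rewrite h3].
by rewrite mulr_natl mulr2n !addrA.
Qed.

Lemma C2c_conj (f : circle -> C) : C2_circle f ->
  C2_circle (fun z => conjc (f z)) /\ forall k t, (k <= 2)%N ->
    angular k (fun z => conjc (f z)) t = conjc (angular k f t).
Proof.
move=> /C2c_cder[f1 f2 f3].
have cJ (F : R -> C) t D : cder F t D -> cder (fun s => conjc (F s)) t (conjc D).
  move=> [h1 h2]; split.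
    have -> : (fun s => complex.Re (conjc (F s))) = (fun s => complex.Re (F s)).
      by apply/funext => s; case: (F s).
    by case: (D) h1.
  have -> : (fun s => complex.Im (conjc (F s))) = - (fun s => complex.Im (F s)).
    by apply/funext => s; rewrite fctE; case: (F s).
  by apply: is_derive_eq (is_deriveN h2) _; case: (D).
have [h1 h2 h3] := cder_C2c (f := fun z => conjc (f z)) (fun t => cJ _ _ _ (f1 t))
  (fun t => cJ _ _ _ (f2 t)) (ccont_conj f3).
split; first exact: h1.
case=> [|[|[|k]]] t k2; last by exfalso.
- by rewrite !angular0.
- by rewrite h2.
- by rewrite h3.
Qed.

Lemma C2c_sub (f g : circle -> C) : C2_circle f -> C2_circle g ->
  C2_circle (fun z => f z - g z) /\ forall k t, (k <= 2)%N ->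
    angular k (fun z => f z - g z) t = angular k f t - angular k g t.
Proof.
move=> /C2c_cder[f1 f2 f3] /C2c_cder[g1 g2 g3].
have cN (F : R -> C) t D : cder F t D -> cder (fun s => - F s) t (- D).
  move=> FD; rewrite -mulN1r; apply: (cder_ext (F := fun s => -1 * F s)).
    by move=> s; rewrite mulN1r.
  exact: cderZ.
have d1 t := cderD (f1 t) (cN _ _ _ (g1 t)).
have d2 t := cderD (f2 t) (cN _ _ _ (g2 t)).
have cc : ccont (fun t => angular 2 f t - angular 2 g t).
  apply: ccontD; first exact: f3.
  have -> : (fun t => - angular 2 g t) = (fun t => -1 * angular 2 g t).
    by apply/funext => t; rewrite mulN1r.
  exact: ccontZ.
have [h1 h2 h3] := cder_C2c (f := fun z => f z - g z) d1 d2 cc.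
split; first exact: h1.
case=> [|[|[|k]]] t k2; last by exfalso.
- by rewrite !angular0.
- by rewrite h2.
- by rewrite h3.
Qed.

Lemma lipR (f f1 : R -> R) (K a b : R) : (forall t, t \in `[a, b]%R -> is_derive t (1 : R) f (f1 t)) ->
  (forall t, t \in `[a, b]%R -> `|f1 t| <= K) -> a <= b -> `|f b - f a| <= K * (b - a).
Proof.
move=> fd fK; rewrite le_eqVlt => /predU1P[->|ab]; first by rewrite !subrr normr0 mulr0.
have cf : {within `[a, b], continuous f}.
  apply/continuous_within_itvP => //.
  have aab : a \in `[a, b]%R by rewrite in_itv/= lexx ltW.
  have bab : b \in `[a, b]%R by rewrite in_itv/= lexx ltW.
  split=> [t tab||].
  - apply: is_derive_continuous; apply: fd; move: tab; rewrite !in_itv/=.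
    by move=> /andP[h1 h2]; rewrite !ltW.
  - by apply: cvg_at_right_filter; exact: is_derive_continuous (fd _ aab).
  - by apply: cvg_at_left_filter; exact: is_derive_continuous (fd _ bab).
have oc t : t \in `]a, b[%R -> t \in `[a, b]%R.
  by rewrite !in_itv/= => /andP[h1 h2]; rewrite !ltW.
have [c cab ->] := MVT ab (fun t tab => fd t (oc t tab)) cf.
rewrite normrM [X in _ * X]gtr0_norm ?subr_gt0// ler_wpM2r ?subr_ge0 ?(ltW ab)//.
exact: fK (oc _ cab).
Qed.

Lemma lipR_sym (f f1 : R -> R) (K a b : R) : (forall t, is_derive t (1 : R) f (f1 t)) ->
  (forall t, `|f1 t| <= K) -> `|f b - f a| <= K * `|b - a|.
Proof.
move=> fd fK; have [ab|/ltW ba] := leP a b.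
  rewrite [X in _ * X]ger0_norm ?subr_ge0//; exact: (lipR (fun t _ => fd t) (fun t _ => fK t)).
rewrite distrC [X in _ * X]distrC [X in _ * X]ger0_norm ?subr_ge0//.
exact: (lipR (fun t _ => fd t) (fun t _ => fK t)).
Qed.

Lemma nc_cis_sub1 (s : R) : nc ((cis s : C) - 1) <= 2 * `|s|.
Proof.
apply: le_trans (nc_le _) _; rewrite ReD ImD ReN ImN /= oppr0 addr0.
rewrite mulr_natl mulr2n; apply: lerD.
  have := @lipR_sym cos (fun t => - sin t) 1 0 s (fun t => is_derive_cos t).
  rewrite cos0 subr0 mul1r; apply => t; rewrite normrN; exact: sin_max.
have := @lipR_sym sin cos 1 0 s (fun t => is_derive_sin t).
rewrite sin0 !subr0 mul1r; apply => t; exact: cos_max.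
Qed.

Lemma C2fun_C2 (u : C2fun) : C2 (C2fun_val u \o cis).
Proof. by case: u => u /= /asboolP h; exact: h. Qed.

Lemma C2fun_le (u : C2fun) k t : (k <= 2)%N -> `|derive1n k (C2fun_val u \o cis) t| <= `|u|.
Proof.
move=> k2; apply: le_trans (C2norm_part_ge u t k2) _.
have k3 : (k < 3)%N by [].
rewrite -[leRHS]/(C2norm u) /C2norm (bigD1 (Ordinal k3))//= lerDl sumr_ge0// => i _.
by apply: C2norm_part0; rewrite -ltnS.
Qed.

Lemma C2fun_ge (u : C2fun) (m : R) :
  (forall k t, (k <= 2)%N -> `|derive1n k (C2fun_val u \o cis) t| <= m) -> `|u| <= 3 * m.
Proof.
move=> um; rewrite -[leLHS]/(C2norm u) /C2norm.
apply: (@le_trans _ _ (\sum_(k < 3) m)); last by rewrite sumr_const card_ord mulr_natl.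
apply: ler_sum => k _; apply: C2norm_part_le => t; apply: um.
by rewrite -ltnS.
Qed.

Definition mulcis (g : circle -> circle) (u : circle -> R) (z : circle) : circle :=
  cmul (g z) (cis (u z)).

Lemma cinvK (g : circle -> circle) : bijective g -> cancel g (cinv g) /\ cancel (cinv g) g.
Proof.
move=> bg; have inj : injective g by exact: bij_inj.
have gK : cancel g (cinv g).
  move=> z; have inj' : {in [set: circle] &, injective g} by move=> x y _ _; exact: inj.
  exact: (@pinvKV _ _ id setT g inj' z (mem_set I)).
split=> // z; case: bg => h _ hK.
by rewrite -{2}(hK z) -{1}(hK z) gK.
Qed.

Lemma cinv_uniq (g h : circle -> circle) : cancel g h -> cancel h g -> cinv g = h.
Proof.
move=> gh hg; have bg : bijective g by exists h.
have [gK _] := cinvK bg; apply/funext => z.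
by rewrite -{1}(hg z) gK.
Qed.

(** The lift l(t) = t + v(e^(it)) has derivative at least 1/2, hence is increasing; it is onto by
    the intermediate value theorem because v is bounded. Its inverse is C^2 and commutes with the
    translation by 2 pi, so it descends to the circle. *)
Lemma rotation_diffeo (v : circle -> R) : C2 (v \o cis) ->
  (forall t, `|derive1n 1 (v \o cis) t| <= 1 / 2) ->
  exists r : circle -> circle, [/\ cancel (mulcis id v) r, cancel r (mulcis id v) &
    C2_circle (fun z => r z : C)].
Proof.
move=> vC v12; have [v1 v2 v3] := C2_der vC.
set w1 := (v \o cis)^`() in v1 v2; set w2 := derive1n 2 (v \o cis) in v2 v3.
have w12 t : `|w1 t| <= 1 / 2 by exact: v12.
pose l t := t + v (cis t).
have dl t : is_derive t (1 : R) l (1 + w1 t).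
  exact: (is_deriveD (is_derive_id t 1) (v1 t)).
have l1 t : 1 / 2 <= 1 + w1 t by have := w12 t; rewrite ler_norml => /andP[]; lra.
have cl : continuous l by move=> t; exact: is_derive_continuous (dl t).
have lper t : l (t + pi *+ 2) = l t + pi *+ 2 by rewrite /l cis_per addrAC.
have linc a b : a < b -> l a < l b.
  move=> ab; have cab : {within `[a, b], continuous l} by exact: continuous_subspaceT.
  have [c _ lc] := MVT ab (fun t _ => dl t) cab.
  by rewrite -subr_gt0 lc mulr_gt0 ?subr_gt0//; have := l1 c; lra.
have linj : injective l.
  move=> a b ab; apply/eqP; rewrite eq_le !leNgt; apply/andP; split; apply/negP => /linc.
    by rewrite ab ltxx.
  by rewrite ab ltxx.
have [m vm] := periodic_bounded (fun t => congr1 v (cis_per t))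
  (fun t => is_derive_continuous (v1 t)).
have lsurj s : exists t, l t = s.
  have m0 : 0 <= m by apply: le_trans (vm 0).
  have ab : s - m <= s + m by lra.
  have cab : {within `[s - m, s + m], continuous l} by exact: continuous_subspaceT.
  have h1 : l (s - m) <= s by have := vm (s - m); rewrite ler_norml /l => /andP[_]; lra.
  have h2 : s <= l (s + m) by have := vm (s + m); rewrite ler_norml /l => /andP[]; lra.
  have [|t _ lt] := IVT ab cab (v := s); last by exists t.
  by rewrite ge_min h1 le_max h2 orbT.
pose mu s := xget 0 [set t | l t = s].
have lmu s : l (mu s) = s.
  by rewrite /mu; case: xgetP => // H; have [t lt] := lsurj s; case: (H t).
have mul t : mu (l t) = t by apply: linj; rewrite lmu.
have dmu s : is_derive s (1 : R) mu (1 + w1 (mu s))^-1.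
  have n0 : 1 + w1 (mu s) != 0 by rewrite gt_eqF//; have := l1 (mu s); lra.
  have lmus : \forall x \near mu s, mu (l x) = x by apply: filterE => x; exact: mul.
  have lcs : \forall x \near mu s, {for x, continuous l} by apply: filterE => x; exact: cl.
  have := is_derive_inverse lmus lcs (dl (mu s)) n0.
  by rewrite lmu.
have n0 s : 1 + w1 (mu s) != 0 by rewrite gt_eqF//; have := l1 (mu s); lra.
pose m2 s := - (1 + w1 (mu s)) ^- 2 * (w2 (mu s) * (1 + w1 (mu s))^-1).
have dmu2 s : is_derive s (1 : R) (fun s => (1 + w1 (mu s))^-1) (m2 s).
  have h : is_derive s (1 : R) (fun s => 1 + w1 (mu s)) (w2 (mu s) * (1 + w1 (mu s))^-1).
    apply: is_derive_eq (is_deriveD (is_derive_cst (1 : R) s 1) (is_derive_comp (v2 _) (dmu s))) _.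
    by rewrite add0r.
  exact: is_derive_eq (is_deriveV (f := fun s => 1 + w1 (mu s)) (n0 s) h) _.
have cmu : continuous mu by move=> s; exact: is_derive_continuous (dmu s).
have cm2 : continuous m2.
  have c1 : continuous (fun s => (1 + w1 (mu s))^-1).
    by move=> s; exact: is_derive_continuous (dmu2 s).
  have c2 : continuous (fun s => w2 (mu s)) by move=> s; exact: (cvg_comp _ _ (cmu s) (v3 _)).
  move=> s; rewrite /m2; apply: cvgM; last by apply: cvgM; [exact: c2|exact: c1].
  apply: cvgN; have -> : (fun s => (1 + w1 (mu s)) ^- 2) =
    (fun s => (1 + w1 (mu s))^-1 * (1 + w1 (mu s))^-1).
    by apply/funext => x; rewrite expr2 invfM.
  by rewrite expr2 invfM; apply: cvgM; exact: c1.
have muper s : mu (s + pi *+ 2) = mu s + pi *+ 2 by apply: linj; rewrite lper !lmu.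
pose r z := cis (mu (arg z)).
have rE s : r (cis s) = cis (mu s).
  rewrite /r; have [n ->] := cis_eq (argK (cis s)).
  by apply: (@periodicz _ _ (fun s => cis (mu s))) => t; rewrite muper cis_per.
exists r; split.
- move=> z; have [t <-] := cis_surj z; rewrite /mulcis cmul_cis rE.
  by rewrite -/(l t) mul.
- by move=> z; rewrite /mulcis /r cmul_cis -/(l _) lmu argK.
have [d1 d2 d3] := cisN_pi dmu dmu2 cm2.
have d1' t : cder (fun s => (r (cis s) : C)) t ('i%R * ((1 + w1 (mu t))^-1)%:C * (cis (mu t) : C)).
  by apply: (cder_ext _ (d1 t)) => s; rewrite rE.
by have [] := cder_C2c (f := fun z => (r z : C)) d1' d2 d3.
Qed.

Lemma Diff2_diffeo (g : Diff2) : diffeo2 (Diff2_val g).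
Proof. by case: g => g /= /asboolP h; exact: h. Qed.

(** The quotient is positive pointwise, by the definition of [diffeo2]. Its inverse is continuous
    and periodic, hence bounded by some M, and 1 / M is the uniform lower bound. *)
Lemma ratio_bound (g : Diff2) : exists2 m : R, 0 < m & forall t : R,
  exists2 p : R, m <= p & angular 1 (fun z => g z : C) t / ('i%R * (g (cis t) : C)) = p%:C.
Proof.
have [bg gC giC g0] := Diff2_diffeo g; have [g1 g2 g3] := C2c_cder gC.
pose P t := angular 1 (fun z => g z : C) t / ('i%R * (g (cis t) : C)).
have PE t : P t = (complex.Re (P t))%:C.
  have : 0 < P t by exact: g0.
  by rewrite ltcE => /andP[/eqP h _]; apply: complex_eqP.
have P0 t : 0 < complex.Re (P t).
  have : 0 < P t by exact: g0.
  by rewrite ltcE => /andP[].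
have cP : ccont P.
  have -> : P = fun t => - 'i%R * (angular 1 (fun z => g z : C) t * conjc (g (cis t) : C)).
    by apply/funext => t; rewrite /P invfM invi circle_inv; ring.
  apply: ccontZ; apply: ccontM; first exact: cder_ccont g2.
  by apply: ccont_conj; exact: cder_ccont g1.
pose f t := (complex.Re (P t))^-1.
have cf : continuous f by move=> t; apply: cvgV; [rewrite gt_eqF|exact: cP.1].
have fp : periodic f (pi *+ 2).
  by move=> t; rewrite /f /P angular_per cis_per.
have [M fM] := periodic_bounded fp cf.
have M0 : 0 < M.
  apply: lt_le_trans (fM 0); rewrite normr_gt0 /f invr_neq0// gt_eqF//.
exists M^-1; first by rewrite invr_gt0.
move=> t; exists (complex.Re (P t)); last exact: PE.
have := fM t; rewrite /f ger0_norm ?invr_ge0 ?(ltW (P0 t))//.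
by rewrite -[X in _ -> _ <= X]invrK lef_pV2 ?posrE ?invr_gt0.
Qed.

(** g e^(iu) is g followed by z |-> z e^(iv(z)), with v = u o g^-1. Its orientation quotient is that
    of g plus u'. The radius m keeps this quotient positive, and (2 M)^-1 gives |v'| <= 1/2 as
    [rotation_diffeo] requires. *)
Lemma mulcis_diffeo (g : Diff2) : exists2 d : R, 0 < d & forall u : C2fun, `|u| < d ->
  diffeo2 (mulcis g (C2fun_val u)).
Proof.
have [bg gC giC _] := Diff2_diffeo g; have [gK gV] := cinvK bg.
have [m m0 gm] := ratio_bound g.
have [M M0 gM] := C2c_bounded giC (k := 1) isT.
exists (Num.min m (2 * M)^-1); first by rewrite lt_min m0 invr_gt0 mulr_gt0.
move=> u; rewrite lt_min => /andP[um uM].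
have uC := C2fun_C2 u; set U := C2fun_val u in uC *.
pose v z := U (cinv g z).
have [vC v1 _] := C2_circle_comp (C2_real uC) giC.
have {}vC : C2 (v \o cis) by exact: (C2_circle_real vC).
have v12 t : `|derive1n 1 (v \o cis) t| <= 1 / 2.
  have := v1 t; rewrite !angular_real -rmorphM => -[E].
  have -> : derive1n 1 (v \o cis) t = derive1n 1 (U \o cis) (arg (cinv g (cis t))) *
    speed (cinv g) t by exact: E.
  rewrite normrM; apply: (@le_trans _ _ (`|u| * M)).
    rewrite ler_pM//; first exact: (C2fun_le u _ (k := 1)).
    apply: le_trans (nc_Im _) _; rewrite ncM ncV nc_circle invr1 mulr1.
    exact: gM.
  move: uM; rewrite -[X in _ < X]mul1r ltr_pdivlMr ?mulr_gt0//.
  by lra.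
have [r [rK rV rC]] := rotation_diffeo vC v12.
have hE : mulcis g U = mulcis id v \o g.
  by apply/funext => z; rewrite /= /mulcis /v gK.
pose hi := cinv g \o r.
have hK : cancel (mulcis g U) hi by move=> z; rewrite hE /hi /= rK gK.
have hV : cancel hi (mulcis g U) by move=> z; rewrite hE /hi /= gV rV.
have [cC c1 c2] := C2c_cis uC.
have [hC h1 h2] := C2c_mul gC cC.
split.
- by exists hi.
- exact: hC.
- rewrite (cinv_uniq hK hV); by have [] := C2_circle_comp giC rC.
move=> t; have [p pm pE] := gm t.
have -> : angular 1 (fun z => mulcis g U z : C) t / ('i%R * (mulcis g U (cis t) : C)) =
  (p + derive1n 1 (U \o cis) t)%:C.
  have -> : (p + derive1n 1 (U \o cis) t)%:C = p%:C + (derive1n 1 (U \o cis) t)%:C :> C.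
    exact: rmorphD.
  rewrite -pE.
  rewrite -[angular 1 _ t]/(angular 1 (fun z => (g z : C) * (cis (U z) : C)) t) h1 c1.
  rewrite -[(mulcis g U (cis t) : C)]/((g (cis t) : C) * (cis (U (cis t)) : C)).
  have n1 : (g (cis t) : C) != 0 by exact: circle_neq0.
  have n2 : (cis (U (cis t)) : C) != 0 by exact: circle_neq0.
  have n3 := @i_neq0 R.
  by field; rewrite n1 n2 n3.
rewrite ltcR; have := C2fun_le u t (k := 1) isT; rewrite -/U ler_norml => /andP[+ _].
by lra.
Qed.

Lemma val_chart (g : Diff2) (u : C2fun) : diffeo2 (mulcis g (C2fun_val u)) ->
  Diff2_val (chart g u) = mulcis g (C2fun_val u).
Proof. by move=> h; rewrite /chart insubdK//; apply/asboolP; exact: h. Qed.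

Lemma chart0 (g : Diff2) : chart g 0 = g.
Proof.
have E : mulcis g (C2fun_val 0) = Diff2_val g.
  by apply/funext => z; apply: val_inj; rewrite /= cos0 sin0 mulr1.
apply: val_inj => /=; rewrite val_chart E//; exact: Diff2_diffeo.
Qed.

Lemma chart_chart (g : Diff2) (u w : C2fun) : diffeo2 (mulcis g (C2fun_val u)) ->
  diffeo2 (mulcis g (C2fun_val (u + w))) -> chart (chart g u) w = chart g (u + w).
Proof.
move=> h1 h2; have E : mulcis (chart g u) (C2fun_val w) = mulcis g (C2fun_val (u + w)).
  rewrite val_chart//; apply/funext => z; apply: val_inj.
  rewrite -[LHS]/((g z : C) * (cis (C2fun_val u z) : C) * (cis (C2fun_val w z) : C)).
  by rewrite -mulrA -cisD.
by apply: val_inj => /=; rewrite val_chart E// val_chart.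
Qed.

Lemma Diff2_nbhsP (g : Diff2) (A : set Diff2) : nbhs g A <->
  exists2 e : R, 0 < e & forall h, Diff2_ball g e h -> A h.
Proof.
split=> [/nbhs_ballP[e /= e0 eA]|[e e0 eA]].
  by exists e => // h; exact: eA.
by apply/nbhs_ballP; exists e.
Qed.

Lemma chart_near (g : Diff2) (e : R) : 0 < e -> exists2 d : R, 0 < d &
  forall u : C2fun, `|u| < d -> Diff2_ball g e (chart g u).
Proof.
move=> e0; have [d d0 gd] := mulcis_diffeo g.
have [bg gC giC _] := Diff2_diffeo g.
have [M1 M10 gM1] := C2c_bounded gC (k := 1) isT.
have [M2 M20 gM2] := C2c_bounded gC (k := 2) isT.
(* K |u| dominates the derivatives up to order 2 of g (e^(iu) - 1); the condition |u| < 1 makes the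
   term (u')^2 linear. *)
pose K := 2 * M2 + 2 * M1 + 2 * M1 + 4.
have K0 : 0 < K by rewrite /K; lra.
exists (Num.min d (Num.min 1 (e / K))); first by rewrite !lt_min d0 ltr01 divr_gt0.
move=> u; rewrite !lt_min => /and3P[ud u1 uK] k t k2.
rewrite nc_lt; have uC := C2fun_C2 u; rewrite val_chart; last exact: gd.
set V := C2fun_val u in uC *.
have [cC c1 c2] := C2c_cis uC; have [hC h1 h2] := C2c_mul gC cC.
have b1 : nc ((cis (V (cis t)) : C) - 1) <= 2 * `|u|.
  apply: le_trans (nc_cis_sub1 _) _; rewrite ler_wpM2l//.
  exact: (C2fun_le u t (k := 0)).
have b2 : `|derive1n 1 (V \o cis) t| <= `|u| by exact: (C2fun_le u t (k := 1)).
have b3 : `|derive1n 2 (V \o cis) t| <= `|u| by exact: (C2fun_le u t (k := 2)).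
have u0 := normr_ge0 u.
suff H : nc (angular k (fun z => g z : C) t - angular k (fun z => mulcis g V z : C) t) <= K * `|u|.
  by apply: le_lt_trans H _; rewrite mulrC -ltr_pdivlMr.
rewrite ncBC; case: k k2 => [|[|[|k]]] k2; last by exfalso.
- rewrite !angular0 -[(mulcis g V (cis t) : C)]/((g (cis t) : C) * (cis (V (cis t)) : C)).
  rewrite -[X in _ * _ - X]mulr1 -mulrBr ncM nc_circle mul1r.
  apply: le_trans b1 _; rewrite ler_wpM2r// /K; lra.
- rewrite -[angular 1 (fun z => mulcis _ _ z : C) t]/(angular 1 (fun z => (g z : C) * (cis (V z) : C)) t).
  rewrite h1 c1; set F1 := angular 1 (fun z => g z : C) t.
  have -> : F1 * (cis (V (cis t)) : C) + (g (cis t) : C) * ('i%R * (derive1n 1 (V \o cis) t)%:C * (cis (V (cis t)) : C)) - F1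
    = F1 * ((cis (V (cis t)) : C) - 1) + (g (cis t) : C) * ('i%R * (derive1n 1 (V \o cis) t)%:C * (cis (V (cis t)) : C)) by ring.
  apply: le_trans (ncD _ _) _; rewrite !ncM !nc_circle nc_i nc_real !mul1r mulr1.
  apply: (@le_trans _ _ (M1 * (2 * `|u|) + `|u|)).
    apply: lerD; last exact: b2.
    by apply: ler_pM; [exact: nc_ge0|exact: nc_ge0|exact: gM1|exact: b1].
  have -> : M1 * (2 * `|u|) + `|u| = (2 * M1 + 1) * `|u| by ring.
  by rewrite ler_wpM2r// /K; lra.
- rewrite -[angular 2 (fun z => mulcis _ _ z : C) t]/(angular 2 (fun z => (g z : C) * (cis (V z) : C)) t).
  rewrite h2 c1 c2; set F1 := angular 1 (fun z => g z : C) t; set F2 := angular 2 (fun z => g z : C) t.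
  set E := (cis (V (cis t)) : C); set a := derive1n 1 (V \o cis) t; set b := derive1n 2 (V \o cis) t.
  have -> : F2 * E + 2 * (F1 * ('i%R * a%:C * E)) + (g (cis t) : C) * (('i%R * b%:C - (a ^+ 2)%:C) * E) - F2
    = F2 * (E - 1) + (2 * (F1 * ('i%R * a%:C * E)) + (g (cis t) : C) * (('i%R * b%:C - (a ^+ 2)%:C) * E)) by ring.
  apply: le_trans (ncD _ _) _.
  apply: (@le_trans _ _ (M2 * (2 * `|u|) + (2 * (M1 * `|u|) + (`|u| + `|u|)))); last first.
    have -> : M2 * (2 * `|u|) + (2 * (M1 * `|u|) + (`|u| + `|u|)) =
      (2 * M2 + 2 * M1 + 2) * `|u| by ring.
    by rewrite ler_wpM2r// /K; lra.
  apply: lerD; first by rewrite ncM; apply: ler_pM; [exact: nc_ge0|exact: nc_ge0|exact: gM2|exact: b1].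
  apply: le_trans (ncD _ _) _; apply: lerD.
    rewrite !ncM nc_nat nc_i nc_real nc_circle mul1r mulr1 ler_wpM2l//.
    by apply: ler_pM; [exact: nc_ge0|exact: normr_ge0|exact: gM1|exact: b2].
  rewrite !ncM !nc_circle mul1r mulr1; apply: le_trans (ncB _ _) _.
  rewrite ncM nc_i mul1r !nc_real; apply: lerD => //.
  rewrite normrX expr2; apply: le_trans (ler_pM _ _ b2 b2) _ => //.
  by rewrite ler_piMl// ltW.
Qed.

End geometry.

(** * Surjectivity of charts and constancy of flat functions *)

Section geometry2.
Context {R : realType}.
Local Notation C := R[i].
Local Notation circle := (circle R).
Local Notation Diff2 := (Diff2 R).
Local Notation C2fun := (C2fun R).

Lemma asin_bound (y : R) : `|y| <= 1 / 2 -> `|asin y| <= 2 * `|y|.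
Proof.
move=> y2; have d (t : R) : `|t| <= 1 / 2 -> is_derive t (1 : R) (@asin R) (Num.sqrt (1 - t ^+ 2))^-1.
  by move=> t2; apply: is_derive1_asin; rewrite -ltr_norml; apply: le_lt_trans t2 _; lra.
have b (t : R) : `|t| <= 1 / 2 -> `|(Num.sqrt (1 - t ^+ 2))^-1| <= 2.
  move=> t2; have t4 : t ^+ 2 <= (1 / 2) ^+ 2.
    by rewrite -real_normK ?num_real// lerXn2r// nnegrE; lra.
  have s2 : 1 / 2 <= Num.sqrt (1 - t ^+ 2).
    have -> : 1 / 2 = Num.sqrt ((1 / 2) ^+ 2) :> R by rewrite sqrtr_sqr ger0_norm//; lra.
    by rewrite ler_sqrt; lra.
  rewrite ger0_norm ?invr_ge0 ?sqrtr_ge0// -[leRHS]invrK lef_pV2 ?posrE ?invr_gt0//; last lra.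
  by rewrite -div1r.
have [y0|/ltW y0] := leP 0 y.
  have := @lipR R (@asin R) (fun t => (Num.sqrt (1 - t ^+ 2))^-1) 2 0 y.
  rewrite asin0 !subr0 (ger0_norm y0); rewrite ger0_norm// in y2; apply=> // t; rewrite in_itv/= => /andP[t0 ty].
    by apply: d; rewrite ger0_norm//; lra.
  by apply: b; rewrite ger0_norm//; lra.
have := @lipR R (@asin R) (fun t => (Num.sqrt (1 - t ^+ 2))^-1) 2 y 0.
rewrite asin0 !sub0r normrN (ler0_norm y0); rewrite ler0_norm// in y2; apply=> // t; rewrite in_itv/= => /andP[t0 ty].
  by apply: d; rewrite ler0_norm//; lra.
by apply: b; rewrite ler0_norm//; lra.
Qed.

Lemma circle_sqr (z : circle) : complex.Re (z : C) ^+ 2 + complex.Im (z : C) ^+ 2 = 1.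
Proof.
case: z => [[x y] /= q1]; move: q1; rewrite normc_def /= => /eqP [/(congr1 (fun r => r ^+ 2))].
by rewrite sqr_sqrtr ?expr1n// addr_ge0 ?sqr_ge0.
Qed.

(** For h close to g the quotient h / g = 1 + E has E small together with two derivatives; then u =
    arcsin (Im (h / g)) is a small C^2 argument of the quotient, and h = g e^(iu). *)
Lemma local_surj (g : Diff2) (d : R) : 0 < d -> exists2 e : R, 0 < e &
  forall h, Diff2_ball g e h -> exists2 u : C2fun, `|u| < d & chart g u = h.
Proof.
move=> d0; have [bg gC giC _] := Diff2_diffeo g.
have [M1 M10 gM1] := C2c_bounded gC (k := 1) isT.
have [M2 M20 gM2] := C2c_bounded gC (k := 2) isT.
pose K := 1 + 2 * M1 + M2; have K0 : 0 < K by rewrite /K; lra.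
(* The number s = K e will bound E and its two derivatives. The first term gives s <= 1/2, which
   keeps Re (h / g) >= 1/2; the second gives 24 s < d, where 24 = 3 * 8 stands for three orders of
   derivatives of u, each at most 8 s. *)
pose e := Num.min ((2 * K)^-1) (d / (25 * K)).
have e0 : 0 < e by rewrite lt_min invr_gt0 divr_gt0 ?mulr_gt0.
exists e => // h gh; have [bh hC hiC _] := Diff2_diffeo h.
pose s := K * e; have s0 : 0 < s by rewrite mulr_gt0.
have s2 : s <= 1 / 2.
  have : e <= (2 * K)^-1 by rewrite ge_min lexx.
  by rewrite -[X in _ <= X]mul1r ler_pdivlMr ?mulr_gt0// /s; lra.
have sd : 24 * s < d.
  have : e <= d / (25 * K) by rewrite ge_min lexx orbT.
  by rewrite ler_pdivlMr ?mulr_gt0// /s; move: s0; rewrite /s; lra.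
pose E (z : circle) : C := ((h z : C) - (g z : C)) * conjc (g z : C).
have [gJ gJ1] := C2c_conj gC; have [hg hg1] := C2c_sub hC gC.
have [EC E1 E2] := C2c_mul hg gJ.
have ncJ (z : C) : nc (conjc z) = nc z by case: z => a b; rewrite /nc /= sqrrN.
have b0 k t : (k <= 2)%N -> nc (angular k (fun z => (h z : C) - (g z : C)) t) <= e.
  move=> k2; rewrite hg1// ncBC; have := gh k t k2.
  by rewrite nc_lt => /ltW.
have e1 : e * M1 <= s /\ e <= s /\ e + e * M1 <= s /\ e + 2 * (e * M1) + e * M2 <= s.
  have := mulr_ge0 (ltW e0) (ltW M10); have := mulr_ge0 (ltW e0) (ltW M20).
  by rewrite /s /K; nra.
have hE k t : (k <= 2)%N -> nc (angular k E t) <= s.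
  have [e1a [e1b [e1c e1d]]] := e1.
  case: k => [|[|[|k]]] k2; last by exfalso.
  - rewrite angular0 ncM ncJ nc_circle mulr1.
    by apply: le_trans e1b; have := b0 0%N t k2; rewrite angular0.
  - rewrite /E E1; apply: le_trans e1c; apply: le_trans (ncD _ _) _.
    rewrite !ncM gJ1// !ncJ nc_circle mulr1; apply: lerD; first exact: b0.
    apply: ler_pM; [exact: nc_ge0|exact: nc_ge0| |exact: gM1].
    by have := b0 0%N t isT; rewrite angular0.
  - rewrite /E E2; apply: le_trans e1d; apply: le_trans (ncD _ _) _.
    apply: lerD.
      apply: le_trans (ncD _ _) _; rewrite !ncM gJ1// !ncJ nc_circle mulr1 nc_nat.
      apply: lerD; first exact: b0.
      rewrite ler_wpM2l//; apply: ler_pM; [exact: nc_ge0|exact: nc_ge0|exact: b0|exact: gM1].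
    rewrite ncM gJ1// ncJ; apply: ler_pM; [exact: nc_ge0|exact: nc_ge0| |exact: gM2].
    by have := b0 0%N t isT; rewrite angular0.
have hE0 z : nc (E z) <= s by have [t <-] := cis_surj z; have := hE 0%N t isT; rewrite angular0.
have qE z : (cdiv (h z) (g z) : C) = E z + 1.
  by rewrite cdivE /E -circle_inv mulrBl divff ?circle_neq0// subrK.
pose x t := complex.Re (E (cis t)) + 1; pose y t := complex.Im (E (cis t)).
have x2 t : 1 / 2 <= x t.
  by have := le_trans (nc_Re _) (hE0 (cis t)); rewrite ler_norml /x => /andP[]; lra.
have x0 t : 0 < x t by apply: lt_le_trans (x2 t); lra.
have xn t : x t != 0 by rewrite gt_eqF.
have qRe t : complex.Re (cdiv (h (cis t)) (g (cis t)) : C) = x t by rewrite qE ReD.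
have qIm t : complex.Im (cdiv (h (cis t)) (g (cis t)) : C) = y t by rewrite qE ImD addr0.
have xy t : x t ^+ 2 + y t ^+ 2 = 1 by rewrite -qRe -qIm circle_sqr.
have [c1 c2 c3] := C2c_cder EC.
pose E1' := angular 1 E; pose E2' := angular 2 E.
have dx t : is_derive t (1 : R) x (complex.Re (E1' t)).
  apply: is_derive_eq (is_deriveD (c1 t).1 (is_derive_cst (1 : R) t 1)) _.
  by rewrite addr0.
have dy t : is_derive t (1 : R) y (complex.Im (E1' t)) by exact: (c1 t).2.
have dxi t : is_derive t (1 : R) (fun s => (x s)^-1) (- (x t) ^- 2 * complex.Re (E1' t)).
  exact: is_derive_eq (is_deriveV (f := x) (xn t) (dx t)) _.
pose U z := asin (complex.Im (E z)).
have dU t : is_derive t (1 : R) (U \o cis) ((x t)^-1 * complex.Im (E1' t)).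
  have h' : is_derive (y t) (1 : R) (@asin R) (x t)^-1.
    have -> : x t = Num.sqrt (1 - y t ^+ 2) by rewrite -(xy t) addrK sqrtr_sqr gtr0_norm.
    apply: is_derive1_asin; rewrite -ltr_norml; apply: le_lt_trans (nc_Im _) _.
    by apply: le_lt_trans (hE0 _) _; lra.
  exact: (is_derive_comp h' (dy t)).
pose U2 t := - (x t) ^- 2 * complex.Re (E1' t) * complex.Im (E1' t) + (x t)^-1 * complex.Im (E2' t).
have dU2 t : is_derive t (1 : R) (fun t => (x t)^-1 * complex.Im (E1' t)) (U2 t).
  exact: (is_deriveMr (dxi t) (c2 t).2).
have cU2 : continuous U2.
  have cxi : continuous (fun s => (x s)^-1) by move=> t; exact: is_derive_continuous (dxi t).
  have cR : continuous (fun s => complex.Re (E1' s)) by move=> t; exact: is_derive_continuous (c2 t).1.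
  have cI : continuous (fun s => complex.Im (E1' s)) by move=> t; exact: is_derive_continuous (c2 t).2.
  have -> : U2 = fun t => - ((x t)^-1 * (x t)^-1) * complex.Re (E1' t) * complex.Im (E1' t) + (x t)^-1 * complex.Im (E2' t).
    by apply/funext => t; rewrite /U2 expr2 invfM.
  move=> t; apply: cvgD; last by apply: cvgM; [exact: cxi|exact: c3.2].
  apply: cvgM; last exact: cI.
  apply: cvgM; last exact: cR.
  by apply: cvgN; apply: cvgM; exact: cxi.
have [UC U1E U2E] := der_C2 dU dU2 cU2.
have Uin : U \in C2pred by exact/asboolP.
pose u : C2fun := MkC2fun Uin; exists u.
  apply: le_lt_trans sd; have -> : 24 * s = 3 * (8 * s) by ring.
  apply: C2fun_ge => k t k2.
  have xi2 : `|(x t)^-1| <= 2.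
    rewrite ger0_norm ?invr_ge0 ?(ltW (x0 t))// -[leRHS]invrK lef_pV2 ?posrE ?invr_gt0//.
    by rewrite -div1r.
  have bI1 : `|complex.Im (E1' t)| <= s by apply: le_trans (nc_Im _) (hE 1 t isT).
  have bR1 : `|complex.Re (E1' t)| <= s by apply: le_trans (nc_Re _) (hE 1 t isT).
  have bI2 : `|complex.Im (E2' t)| <= s by apply: le_trans (nc_Im _) (hE 2 t isT).
  case: k k2 => [|[|[|k]]] k2; last by exfalso.
  - have yt : `|y t| <= s by apply: le_trans (nc_Im _) (hE0 _).
    by apply: le_trans (asin_bound _) _; rewrite -/(y t); lra.
  - rewrite -[derive1n 1 _]/((U \o cis)^`()) U1E normrM.
    by apply: (@le_trans _ _ (2 * s)); [rewrite ler_pM|lra].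
  - rewrite -[derive1n 2 _]/((U \o cis)^`(2)) U2E /U2; apply: le_trans (ler_normD _ _) _.
    rewrite !normrM normrN normfV normrX -exprVn -normfV.
    have h1 : `|(x t)^-1| ^+ 2 <= 4.
      have -> : 4 = 2 ^+ 2 :> R by rewrite -natrX.
      by rewrite lerXn2r// nnegrE.
    have h2 : `|complex.Re (E1' t)| * `|complex.Im (E1' t)| <= s / 2.
      by apply: (@le_trans _ _ (s * (1 / 2))); [rewrite ler_pM//; lra|lra].
    have h3 := ler_pM (normr_ge0 _) (normr_ge0 _) xi2 bI2.
    have h4 : `|(x t)^-1| ^+ 2 * (`|complex.Re (E1' t)| * `|complex.Im (E1' t)|) <= 4 * (s / 2).
      by rewrite ler_pM// ?exprn_ge0// mulr_ge0.
    by rewrite -mulrA; lra.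
have gu : mulcis g (C2fun_val u) = Diff2_val h.
  apply/funext => z; have [t <-] := cis_surj z; apply: val_inj.
  rewrite -[LHS]/((g (cis t) : C) * (cis (U (cis t)) : C)).
  rewrite /U -/(y t) -qIm cis_asin; last by rewrite qRe.
  by rewrite cdivE mulrC divfK// circle_neq0.
by apply: val_inj; rewrite /= val_chart gu//; exact: Diff2_diffeo.
Qed.

(** By [local_surj] every nearby h is joined to g by the path s |-> [chart g (s *: u)]. At each of
    its points the path can be read in the chart centred there, where the derivative vanishes by
    hypothesis. *)
Lemma flat_locally_cst (U : set Diff2) (Phi : Diff2 -> C) (g : Diff2) : open U -> U g ->
  (forall g, U g -> forall u : C2fun, cder (fun s : R => Phi (chart g (s *: u))) 0 0) ->
  \forall h \near g, Phi h = Phi g.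
Proof.
move=> Uo Ug flat; have /Diff2_nbhsP[e e0 eU] : nbhs g U by exact: open_nbhs_nbhs.
have [d1 d10 gd1] := chart_near g e0; have [d2 d20 gd2] := mulcis_diffeo g.
have d0 : 0 < Num.min d1 d2 by rewrite lt_min d10.
have [e' e'0 ge'] := local_surj g d0.
apply/Diff2_nbhsP; exists e' => // h /ge'[u]; rewrite lt_min => /andP[u1 u2] <-.
pose f (s : R) := Phi (chart g (s *: u)).
have su (s : R) : s \in `[0, 1]%R -> `|s *: u| <= `|u|.
  by rewrite in_itv/= => /andP[s0 s1]; rewrite normrZ ger0_norm// ler_piMl.
have fD (s : R) : s \in `[0, 1]%R -> cder f s 0.
  move=> s01; have sg : U (chart g (s *: u)) by apply: eU; apply: gd1; apply: le_lt_trans (su s s01) u1.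
  pose F (r : R) := Phi (chart (chart g (s *: u)) (r *: u)).
  have dv : is_derive s (1 : R) (fun x => x - s) 1.
    by apply: is_derive_eq (is_deriveB (is_derive_id s 1) (is_derive_cst s s 1)) _; rewrite subr0.
  have FD : cder F (s - s) 0 by rewrite subrr; exact: flat.
  have := cder_comp (F := F) (v := fun x => x - s) FD dv; rewrite mul0r; apply: cder_near.
  have cn : `|x *: u| @[x --> s] --> `|s *: u|.
    by apply: cvg_norm; apply: cvgZr_tmp; exact: cvg_id.
  have : \forall x \near s, `|x *: u| < d2.
    by apply: (cvgr_lt _ cn); exact: le_lt_trans (su s s01) u2.
  apply: filterS => x xd; rewrite /F /f chart_chart.
  - by rewrite -scalerDl subrKC.
  - by apply: gd2; apply: le_lt_trans (su s s01) u2.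
  - by rewrite -scalerDl subrKC; exact: gd2.
have -> : Phi (chart g u) = f 1 by rewrite /f scale1r.
have -> : Phi g = f 0 by rewrite /f scale0r chart0.
have n0 : `|0 : R| <= 0 by rewrite normr0.
apply: complex_eqP.
  have := lipR (f := fun s => complex.Re (f s)) (f1 := fun=> 0) (K := 0)
    (fun s s01 => (fD s s01).1) (fun _ _ => n0) ler01.
  by rewrite mul0r normr_le0 subr_eq0 => /eqP.
have := lipR (f := fun s => complex.Im (f s)) (f1 := fun=> 0) (K := 0)
  (fun s s01 => (fD s s01).2) (fun _ _ => n0) ler01.
by rewrite mul0r normr_le0 subr_eq0 => /eqP.
Qed.

Lemma flat_cst (U : set Diff2) (Phi : Diff2 -> C) : open U -> connected U ->
  (forall g, U g -> forall u : C2fun, cder (fun s : R => Phi (chart g (s *: u))) 0 0) ->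
  forall g h, U g -> U h -> Phi h = Phi g.
Proof.
move=> Uo Uc flat g h Ug Uh.
have loc k : U k -> \forall l \near k, Phi l = Phi k by move=> Uk; exact: (flat_locally_cst Uo).
pose B := U `&` [set k | Phi k = Phi g].
suff BU : B = U by have [] : B h by rewrite BU.
apply: Uc.
- by exists g.
- exists B; last by rewrite /B setIA setIid.
  rewrite openE => k [Uk kg]; rewrite /interior; have := loc k Uk.
  have := open_nbhs_nbhs (conj Uo Uk : open_nbhs k U).
  apply: filterS2 => l Ul lk; split=> //=.
  by rewrite lk.
(* The set of points of U where Phi differs from [Phi g] is open, again by local constancy; B is
   thus the trace of a closed set. *)
- exists (~` (U `&` [set k | Phi k <> Phi g])).
    apply: open_closedC; rewrite openE => k [Uk kg]; rewrite /interior; have := loc k Uk.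
    have := open_nbhs_nbhs (conj Uo Uk : open_nbhs k U).
    apply: filterS2 => l Ul lk; split=> //=.
    by rewrite lk.
  apply/seteqP; split=> [k [Uk kg]|k [Uk kg]]; first by split=> // -[].
  split=> //=; apply/eqP; apply/negPn/negP => /eqP kg'.
  by apply: kg.
Qed.

End geometry2.

(** * Trigonometric polynomials are dense *)

Section density.
Context {R : realType}.
Local Notation C := R[i].
Local Notation circle := (circle R).
Local Notation Diff2 := (Diff2 R).
Local Notation C2fun := (C2fun R).

(** A Lebesgue number argument: the radius d is a parameter of the property, and compactness of the
    segment is applied with d tending to 0 from the right. *)
Lemma seg_unif (P : R -> R -> Prop) (a b : R) :
  (forall d d' t, 0 < d' -> d' <= d -> P d t -> P d' t) ->
  (forall t, exists2 d, 0 < d & forall t', `|t' - t| < d -> P d t') ->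
  exists2 d, 0 < d & forall t, a <= t <= b -> P d t.
Proof.
move=> Pmono Ploc.
have /compact_near_coveringP/(_ R (0^'+) P) := @segment_compact R a b.
case=> [x _|e /= e0 eP].
  have [d d0 dP] := Ploc x.
  exists ([set t' | `|t' - x| < d], [set i : R | 0 < i < d]) => /=.
    split; first by apply/nbhs_ballP; exists d => //= y; rewrite /ball/= distrC.
    by apply: filterS2 (nbhs_right_gt 0) (nbhs_right_lt d0) => i i0 id /=; rewrite i0 id.
  move=> [t' i] /= [td /andP[i0 id]]; exact: Pmono i0 (ltW id) (dP _ td).
exists (e / 2); first by rewrite divr_gt0.
move=> t tab; apply: (eP (e / 2)) => /=.
- by rewrite sub0r normrN ger0_norm ?divr_ge0 ?(ltW e0)//; lra.
- by rewrite divr_gt0.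
- by rewrite in_itv.
Qed.

Lemma mod2pi (t : R) : exists (n : int) (r : R), t = r + n%:~R * (pi *+ 2) /\ 0 <= r <= pi *+ 2.
Proof.
have T0 := @twopi_gt0 R; pose n := Num.floor (t / (pi *+ 2)).
have /andP[nt tn] := floor_itv (t / (pi *+ 2)).
exists n, (t - n%:~R * (pi *+ 2)); split; first by rewrite subrK.
rewrite subr_ge0 -ler_pdivlMr// nt/=.
move: tn; rewrite ltr_pdivrMr// intrD mulrDl mul1r -/n => tn.
by rewrite lerBlDl ltW.
Qed.

Lemma cos_le (d r : R) : 0 <= d <= pi -> d <= r <= pi *+ 2 - d -> cos r <= cos d.
Proof.
move=> /andP[d0 dp] /andP[dr rd].
have ler_cos : {in `[0, pi]%R &, forall x y : R, y <= x -> cos x <= cos y}.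
  move=> x y x01 y01; rewrite le_eqVlt => /predU1P[->//|yx].
  by rewrite ltW// ltr_cos.
have [rp|/ltW rp] := leP r pi.
  by rewrite ler_cos ?in_itv/= ?d0 ?dp ?rp ?(le_trans d0 dr).
have -> : cos r = cos (pi *+ 2 - r) by rewrite cosD cosN sinN cos2pi sin2pi mul1r mul0r subr0.
by rewrite ler_cos ?in_itv/= ?d0 ?dp//; lra.
Qed.

(** Uniform continuity in the form suited to the kernel [kr]: away from the diagonal the error is
    paid by 1 - cos (s - t), which is bounded below there and has an explicit mean against the
    kernel. *)
Lemma periodic_unif (f : R -> R) (e : R) : (forall t, f (t + pi *+ 2) = f t) -> continuous f ->
  0 < e -> exists2 M : R, 0 <= M & forall s t : R, `|f s - f t| <= e + M * (1 - cos (s - t)).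
Proof.
move=> fp cf e0; have T0 := @twopi_gt0 R; have p0 := @pi_gt0 R.
have [M fM] := periodic_bounded fp cf.
have [d d0 dP] : exists2 d : R, 0 < d & forall t : R, 0 <= t <= pi *+ 2 ->
    forall s : R, `|s - t| < d -> `|f s - f t| <= e.
  apply: (@seg_unif (fun d t => forall s, `|s - t| < d -> `|f s - f t| <= e)).
    by move=> d d' t _ dd' H s sd; apply: H; exact: lt_le_trans sd dd'.
  move=> t; have e2 : 0 < e / 2 by rewrite divr_gt0.
  have /cvgrPdist_lt/(_ (e / 2) e2) := cf t.
  move=> /nbhs_ballP[d /= d0 dP]; exists (d / 2); first by rewrite divr_gt0.
  move=> t' tt' s st'.
  have h1 : `|f t - f t'| < e / 2 by apply: dP; rewrite /ball/= distrC; lra.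
  have h2 : `|f t - f s| < e / 2.
    apply: dP; rewrite /ball/= -[t - s](subrKA t').
    by rewrite (le_lt_trans (ler_normD _ _))// [X in X + _]distrC [X in _ + X]distrC; lra.
  rewrite -(subrKA (f t)) (le_trans (ler_normD _ _))//.
  by apply/ltW; rewrite [ltRHS]splitr [X in X + _]distrC ltrD.
have M0 : 0 <= M by apply: le_trans (fM 0).
pose d' := Num.min d pi; have d'0 : 0 < d' by rewrite lt_min d0.
have d'd : d' <= d by rewrite ge_min lexx.
have d'p : d' <= pi by rewrite ge_min lexx orbT.
have c0 : 0 < 1 - cos d'.
  by rewrite subr_gt0 -[ltRHS]cos0 ltr_cos ?in_itv/= ?lexx ?d'p ?(ltW p0) ?(ltW d'0).
exists (2 * M / (1 - cos d')); first by rewrite divr_ge0 ?mulr_ge0// ltW.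
(* s - t is reduced to r in [0, 2 pi]; s is close to t modulo 2 pi when r is close to either end. *)
move=> s t; have [n [t0 [tE t0b]]] := mod2pi t; have [m [r [rE /andP[r0 rT]]]] := mod2pi (s - t).
have pos : 0 <= 2 * M / (1 - cos d') * (1 - cos (s - t)).
  by rewrite mulr_ge0 ?divr_ge0 ?mulr_ge0 ?(ltW c0)// subr_ge0 cos_le1.
have ft : f t = f t0 by rewrite tE periodicz.
have fs (k : int) : f s = f (t0 + (r + k%:~R * (pi *+ 2))).
  have -> : s = t0 + (r + k%:~R * (pi *+ 2)) + (n + m - k)%:~R * (pi *+ 2).
    rewrite -(subrK t s) rE [in LHS]tE intrB intrD; ring.
  by rewrite periodicz.
have [rd|dr] := ltP r d'.
  apply: ler_wpDr => //; rewrite ft (fs 0) mul0r addr0; apply: dP => //.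
  by rewrite addrC addKr ger0_norm//; exact: lt_le_trans rd d'd.
have [rd|rd] := ltP (pi *+ 2 - d') r.
  apply: ler_wpDr => //; rewrite ft (fs (-1)) mulN1r; apply: dP => //.
  by rewrite addrC addKr ler0_norm; lra.
apply: ler_wpDl; first exact: ltW.
apply: (@le_trans _ _ (2 * M)).
  by rewrite mulr_natl mulr2n (le_trans (ler_normB _ _))// lerD.
rewrite [leRHS]mulrAC ler_pdivlMr// ler_wpM2l ?mulr_ge0// lerD2l lerN2 rE.
rewrite periodicz; last exact: cosD2pi.
by apply: cos_le; rewrite ?(ltW d'0) ?d'p ?dr.
Qed.

Lemma ekE (k : int) (t : R) : ek k t = (cis t : C) ^ k.
Proof. by rewrite cisX. Qed.

Lemma ekB (k : int) (s t : R) : ek k (s - t) = ek k s * ek (- k) t.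
Proof. by rewrite /ek mulrBr cisD mulrNz mulNr. Qed.

(** This is |1 + e^(ir)|^(2n), the de la Vallee Poussin kernel without normalization. It is
    nonnegative, its Fourier coefficients are binomial, and 1 - cos r = 2 - (2 + 2 cos r) / 2
    relates it to the kernel of order n + 1. *)
Definition kr (n : nat) (r : R) : R := (2 + 2 * cos r) ^+ n.

Lemma fejer_ker (n : nat) (r : R) :
  \sum_(m < (n + n).+1) ('C(n + n, m)%:R : C) * ek (m%:Z - n%:Z) r = (kr n r)%:C.
Proof.
set z := (cis r : C); have z0 : z != 0 by exact: cis_neq0.
have E : (2 + 2 * cos r)%:C = (1 + z) ^+ 2 * z^-1 :> C.
  have -> : (1 + z) ^+ 2 * z^-1 = z + 2 + z^-1 by field.
  rewrite circle_inv; apply: complex_eqP; rewrite /=; ring.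
rewrite /kr rmorphXn /= E exprMn -exprM mul2n -addnn exprDn mulr_suml; apply: eq_bigr => m _.
rewrite expr1n mul1r -[X in _ = X * _]mulr_natl -mulrA; congr (_ * _).
by rewrite ekD !ekE -/z -exprnN exprVn -exprnP.
Qed.

(* Convolution with the positive kernel kr n, which concentrates at 0 after
   division by its mean 'C(2n, n). *)
Definition fsum (n : nat) (F : R -> C) (t : R) : C :=
  \sum_(m < (n + n).+1) ('C(n + n, m)%:R : C) * (fc F (m%:Z - n%:Z) * ek (n%:Z - m%:Z) t).

Lemma ccont_ekB k (t : R) : ccont (fun s => ek k (s - t)).
Proof.
have -> : (fun s => ek k (s - t)) = (fun s => ek (- k) t * ek k s).
  by apply/funext => s; rewrite ekB mulrC.
by apply: ccontZ; exact: ccont_ek.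
Qed.

Lemma fsum_int (n : nat) (F : R -> C) (t : R) : ccont F ->
  fsum n F t = ((pi *+ 2)%:C)^-1 * cint (fun s => F s * (kr n (s - t))%:C).
Proof.
move=> Fc; have c1 k : ccont (fun s => F s * ek k (s - t)) by apply: ccontM Fc (ccont_ekB _ _).
transitivity (((pi *+ 2)%:C)^-1 * cint (fun s =>
    \sum_(m < (n + n).+1) ('C(n + n, m)%:R : C) * (F s * ek (m%:Z - n%:Z) (s - t)))).
  rewrite cint_sum => [|m]; last by apply: ccontZ; exact: c1.
  rewrite mulr_sumr; apply: eq_bigr => m _; rewrite cintZ; last exact: c1.
  rewrite [RHS]mulrCA; congr (_ * _); rewrite /fc -mulrA; congr (_ * _).
  rewrite mulrC -cintZ; last by apply: ccontM Fc (ccont_ek _).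
  congr cint; apply/funext => s; rewrite ekB opprB; ring.
congr (_ * cint _); apply/funext => s; rewrite -fejer_ker mulr_sumr.
by apply: eq_bigr => m _; rewrite mulrCA.
Qed.

Lemma fc_cst1 (k : int) : fc (fun=> 1) k = (k == 0)%:R :> C.
Proof.
rewrite /fc; have -> : (fun t => 1 * ek k t) = ek k :> (R -> C) by apply/funext => t; rewrite mul1r.
by rewrite cint_ek; case: eqP => _; rewrite ?mulr0 ?mulVf ?twopiC_neq0.
Qed.

Lemma cont_kr n (t : R) : continuous (fun s => kr n (s - t)).
Proof.
have c : continuous (fun s => 2 + 2 * cos (s - t)).
  move=> s; apply: cvgD; first exact: cvg_cst.
  apply: cvgM; first exact: cvg_cst.
  apply: (cvg_comp (fun s => s - t) cos); last exact: continuous_cos.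
  by apply: cvgB; [exact: cvg_id|exact: cvg_cst].
elim: n => [|n IH] s; first by rewrite /kr; under eq_fun do rewrite expr0; exact: cvg_cst.
have -> : (fun s => kr n.+1 (s - t)) = (fun s => (2 + 2 * cos (s - t)) * kr n (s - t)).
  by apply/funext => x; rewrite /kr exprS.
by apply: cvgM; [exact: c|exact: IH].
Qed.

Lemma rint_kr n (t : R) : rint (fun s => kr n (s - t)) = (pi *+ 2) * 'C(n + n, n)%:R.
Proof.
have := fsum_int n t (ccont_cst (1 : C)); rewrite /fsum (bigD1 (Ordinal (leq_addr n n : (n < (n + n).+1)%N)))//=.
rewrite big1 ?addr0 => [|m mn]; last first.
  rewrite fc_cst1; case: eqP => [/eqP|_]; last by rewrite mul0r mulr0.
  by rewrite subr_eq0 => /eqP[mn']; case/eqP: mn; apply: val_inj.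
rewrite !subrr fc_cst1 eqxx ek0 !mulr1 => E.
have {E} : (pi *+ 2)%:C * 'C(n + n, n)%:R = cint (fun s => 1 * (kr n (s - t))%:C).
  by rewrite E mulVKf// twopiC_neq0.
move=> /(congr1 (@complex.Re R)).
have -> : complex.Re (cint (fun s => 1 * (kr n (s - t))%:C)) = rint (fun s => kr n (s - t)).
  by congr rint; apply/funext => s; rewrite mul1r.
by move=> <-; rewrite -(rmorph_nat (real_complex R)) -rmorphM.
Qed.

(** The ratio of the integrals of two consecutive kernels; it gives 1 - cos the mean 1 / (n + 1)
    against the normalized kernel of order n. *)
Lemma central_bin n : n.+1%:R * 'C(n.+1 + n.+1, n.+1)%:R = 2 * (2 * n%:R + 1) * 'C(n + n, n)%:R :> R.
Proof.
have h1 : (n.+1 * 'C(n.+1 + n.+1, n.+1) = (n.+1 + n.+1) * 'C((n + n).+1, n))%N.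
  by rewrite -mul_bin_diag addSn addnS.
have h2 : (n.+1 * 'C((n + n).+1, n) = (n + n).+1 * 'C(n + n, n))%N.
  have := mul_bin_down (n + n).+1 n; rewrite subSn ?leq_addr// addnK => <-.
  by [].
have n0 : n.+1%:R != 0 :> R by rewrite pnatr_eq0.
have h1' : n.+1%:R * 'C(n.+1 + n.+1, n.+1)%:R = (n.+1 + n.+1)%:R * 'C((n + n).+1, n)%:R :> R.
  by rewrite -!natrM h1.
have h2' : n.+1%:R * 'C((n + n).+1, n)%:R = (n + n).+1%:R * 'C(n + n, n)%:R :> R.
  by rewrite -!natrM h2.
by apply: (mulfI n0); rewrite h1' mulrCA h2' natrD -!natr1 natrD; ring.
Qed.

Lemma fsum_approx (f : R -> R) (e M : R) n (t : R) : continuous f ->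
  (forall s : R, `|f s - f t| <= e + M * (1 - cos (s - t))) ->
  `|complex.Re (fsum n (fun s => (f s)%:C) t) - 'C(n + n, n)%:R * f t| <=
    'C(n + n, n)%:R * (e + M / n.+1%:R).
Proof.
move=> cf fM; have T0 := @twopi_gt0 R; set c : R := 'C(n + n, n)%:R.
have ck := @cont_kr n t; have ck1 := @cont_kr n.+1 t.
have fC : ccont (fun s => (f s)%:C) by split; [exact: cf|move=> s; exact: cvg_cst].
have -> : complex.Re (fsum n (fun s => (f s)%:C) t) = (pi *+ 2)^-1 * rint (fun s => f s * kr n (s - t)).
  rewrite fsum_int//; have -> : ((pi *+ 2)%:C)^-1 = ((pi *+ 2)^-1)%:C :> C by rewrite fmorphV.
  have ReZ (a : R) (z : C) : complex.Re (a%:C * z) = a * complex.Re z.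
    by case: z => x y /=; rewrite mul0r subr0.
  rewrite ReZ; congr (_ * rint _); apply/funext => s.
  by rewrite ReZ.
have cfk : continuous (fun s => f s * kr n (s - t)) by move=> s; apply: cvgM; [exact: cf|exact: ck].
have cck : continuous (fun s => - f t * kr n (s - t)) by move=> s; apply: cvgM; [exact: cvg_cst|exact: ck].
have -> : (pi *+ 2)^-1 * rint (fun s => f s * kr n (s - t)) - c * f t =
    (pi *+ 2)^-1 * rint (fun s => f s * kr n (s - t) + - f t * kr n (s - t)).
  rewrite rintD// rintZ// rint_kr -/c; have T1 : (pi *+ 2 : R) != 0 by rewrite gt_eqF.
  by move: (rint _) (pi *+ 2 : R) T1 => X T T1; field.
(* H is e + M (1 - cos (s - t)) times the kernel, rewritten as a combination of the kernels of
   orders n and n + 1, whose integrals are known. *)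
pose H s := (e + 2 * M) * kr n (s - t) + (- (M / 2)) * kr n.+1 (s - t).
have cH1 : continuous (fun s => (e + 2 * M) * kr n (s - t)) by move=> s; apply: cvgM; [exact: cvg_cst|exact: ck].
have cH2 : continuous (fun s => - (M / 2) * kr n.+1 (s - t)) by move=> s; apply: cvgM; [exact: cvg_cst|exact: ck1].
have cH : continuous H by move=> s; apply: cvgD; [exact: cH1|exact: cH2].
have cG : continuous (fun s => f s * kr n (s - t) + - f t * kr n (s - t)).
  by move=> s; apply: cvgD; [exact: cfk|exact: cck].
have k0 s : 0 <= kr n s by rewrite exprn_ge0//; have := cos_geN1 s; lra.
have GH s : `|f s * kr n (s - t) + - f t * kr n (s - t)| <= H s.
  rewrite -mulrDl normrM (ger0_norm (k0 _)).
  apply: le_trans (ler_wpM2r (k0 _) (fM s)) _.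
  by rewrite /H /kr exprS -/(kr n _); lra.
have HI : rint H = pi *+ 2 * (c * (e + M / n.+1%:R)).
  rewrite rintD// !rintZ// !rint_kr -/c.
  have n0 : n.+1%:R != 0 :> R by rewrite pnatr_eq0.
  have := central_bin n; rewrite -/c => cb.
  have -> : 'C(n.+1 + n.+1, n.+1)%:R = (n.+1%:R)^-1 * (2 * (2 * n%:R + 1) * c) :> R.
    by rewrite -cb mulKf.
  move: n0; rewrite -natr1 => n0; field.
  by rewrite addrC.
have b1 : rint (fun s => f s * kr n (s - t) + - f t * kr n (s - t)) <= rint H.
  by apply: le_rint => // s; have := GH s; rewrite ler_norml => /andP[].
have b2 : - rint H <= rint (fun s => f s * kr n (s - t) + - f t * kr n (s - t)).
  rewrite -mulN1r -rintZ//; apply: le_rint => // s; first by apply: cvgM; [exact: cvg_cst|exact: cH].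
  by rewrite mulN1r; have := GH s; rewrite ler_norml => /andP[].
rewrite normrM gtr0_norm ?invr_gt0// mulrC ler_pdivrMr// mulrC -HI ler_norml.
by rewrite b1 b2.
Qed.

Lemma cder_sum I (r : seq I) (P : pred I) (F D : I -> R -> C) (t : R) :
  (forall i, cder (F i) t (D i t)) ->
  cder (fun t => \sum_(i <- r | P i) F i t) t (\sum_(i <- r | P i) D i t).
Proof.
move=> FD; elim: r => [|i r IH].
  by rewrite big_nil; apply: (cder_ext _ (cder_cst 0 t)) => s; rewrite big_nil.
rewrite big_cons; case: ifP => Pi.
  by apply: (cder_ext _ (cderD (FD i) IH)) => s; rewrite big_cons Pi.
by apply: (cder_ext _ IH) => s; rewrite big_cons Pi.
Qed.

(** Convolution commutes with derivation, so uniform approximation of a function and of its two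
    derivatives, for the same n, is approximation in C^2. *)
Lemma fsum_cder (n : nat) (F D : R -> C) (t : R) : ccont D -> (forall t, cder F t (D t)) ->
  F (pi *+ 2) = F 0 -> cder (fsum n F) t (fsum n D t).
Proof.
move=> Dc FD Fp; rewrite /fsum.
apply: (@cder_sum _ _ _ (fun (m : 'I_(n + n).+1) t => ('C(n + n, m)%:R : C) * (fc F (m%:Z - n%:Z) * ek (n%:Z - m%:Z) t))
  (fun (m : 'I_(n + n).+1) t => ('C(n + n, m)%:R : C) * (fc D (m%:Z - n%:Z) * ek (n%:Z - m%:Z) t))) => m.
apply: cderZ.
rewrite (fc_derive _ Dc FD Fp); set k := (m%:Z - n%:Z).
have -> : - ('i%R * k%:~R) * fc F k * ek (n%:Z - m%:Z) t =
    fc F k * ('i%R * ((n%:Z - m%:Z)%:~R : R)%:C * ek (n%:Z - m%:Z) t) :> C.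
  have -> : (n%:Z - m%:Z) = - k by rewrite /k opprB.
  rewrite rmorph_int mulrNz; ring.
by apply: cderZ; exact: cder_cis.
Qed.

Lemma C2c_pow (m : int) : C2_circle (fun z => (z : C) ^ m).
Proof.
have a : 'i%R * (m%:~R : R)%:C = 'i%R * (m%:~R : R)%:C :> C by [].
have d1 t : cder (fun s => (cis s : C) ^ m) t ('i%R * (m%:~R : R)%:C * ek m t).
  by apply: (cder_ext _ (cder_cis _ t)) => s; rewrite -ekE.
have d2 t : cder (fun t => 'i%R * (m%:~R : R)%:C * ek m t) t
    ('i%R * (m%:~R : R)%:C * ('i%R * (m%:~R : R)%:C * ek m t)).
  by apply: cderZ; exact: cder_cis.
have d3 : ccont (fun t => 'i%R * (m%:~R : R)%:C * ('i%R * (m%:~R : R)%:C * ek m t)).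
  by apply: ccontZ; apply: ccontZ; exact: ccont_ek.
by have [] := cder_C2c (f := fun z => (z : C) ^ m) d1 d2 d3.
Qed.

Lemma C2c_Im (f : circle -> C) : C2_circle f -> C2 ((fun z => complex.Im (f z)) \o cis).
Proof. by move=> [_ h]; exact: h. Qed.

Lemma C2c_Re (f : circle -> C) : C2_circle f -> C2 ((fun z => complex.Re (f z)) \o cis).
Proof. by move=> [h _]; exact: h. Qed.

Lemma tangentE (g : Diff2) (m : int) (z : circle) :
  L_ m g z / ('i%R * (g z : C)) = - 'i%R * (g z : C) ^ m.
Proof.
have g0 := circle_neq0 (g z); rewrite /L_ expfzDr// expr1z invfM invi.
by rewrite mulrC -!mulrA; congr (_ * _); rewrite mulrCA mulVf// mulr1.
Qed.

(** The chart coordinate of L_m is - i g^m, by [tangentE]. Its parts are C^2, so the default values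
    of [tangent_Re] and [tangent_Im] are not taken. *)
Lemma val_tangent (g : Diff2) (m : int) :
  C2fun_val (tangent_Re g (L_ m g)) = (fun z => complex.Im ((g z : C) ^ m)) /\
  C2fun_val (tangent_Im g (L_ m g)) = (fun z => - complex.Re ((g z : C) ^ m)).
Proof.
have [bg gC giC _] := Diff2_diffeo g.
have [pC _ _] := C2_circle_comp (C2c_pow m) gC.
have E1 : (fun z => complex.Re (L_ m g z / ('i%R * (g z : C)))) = (fun z => complex.Im ((g z : C) ^ m)).
  by apply/funext => z; rewrite tangentE; case: (_ ^ m) => a b; rewrite /=; ring.
have E2 : (fun z => complex.Im (L_ m g z / ('i%R * (g z : C)))) = (fun z => - complex.Re ((g z : C) ^ m)).
  by apply/funext => z; rewrite tangentE; case: (_ ^ m) => a b; rewrite /=; ring.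
rewrite /tangent_Re /tangent_Im E1 E2; split; rewrite insubdK//.
  by apply/asboolP; exact: C2c_Im pC.
apply/asboolP; have := C2_lin (-1) (C2c_Re pC) C2_0; congr C2.
by apply/funext => t; rewrite /lin /= mulN1r addr0.
Qed.

Lemma comp_bound (g : Diff2) : exists2 K : R, 0 < K & forall (w : circle -> R) (m : R),
  C2 (w \o cis) -> (forall k t, (k <= 2)%N -> `|derive1n k (w \o cis) t| <= m) ->
  forall k t, (k <= 2)%N -> `|derive1n k ((fun z => w (g z)) \o cis) t| <= K * m.
Proof.
have [bg gC giC _] := Diff2_diffeo g.
have [M1 M10 gM1] := C2c_bounded gC (k := 1) isT.
have [M2 M20 gM2] := C2c_bounded gC (k := 2) isT.
exists (1 + M1 + 2 * M1 ^+ 2 + M2); first by have := sqr_ge0 M1; lra.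
move=> w m wC wm k t k2; have [_ c1 c2] := C2_circle_comp (C2_real wC) gC.
have s1 : `|speed g t| <= M1.
  by apply: le_trans (nc_Im _) _; rewrite ncM ncV nc_circle invr1 mulr1.
have s2 : `|speed' g t| <= M2 + M1 ^+ 2.
  apply: le_trans (nc_Im _) _; apply: le_trans (ncD _ _) _.
  have ncJ (z : C) : nc (conjc z) = nc z by case: z => a b; rewrite /nc /= sqrrN.
  rewrite !ncM !ncJ nc_circle mulr1 lerD// expr2.
  by apply: ler_pM; [exact: nc_ge0|exact: nc_ge0|exact: gM1|exact: gM1].
have m0 : 0 <= m by apply: le_trans (wm 0%N 0 isT).
have M1m := mulr_ge0 (ltW M10) m0; have M2m := mulr_ge0 (ltW M20) m0.
have M11m := mulr_ge0 (sqr_ge0 M1) m0.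
case: k k2 => [|[|[|k]]] k2; last by exfalso.
- have [s sE] := cis_surj (g (cis t)); rewrite /= -sE.
  by have := wm 0%N s isT; rewrite /=; lra.
- have := c1 t; rewrite !angular_real -rmorphM => -[E].
  have -> : derive1n 1 ((fun z => w (g z)) \o cis) t =
    derive1n 1 (w \o cis) (arg (g (cis t))) * speed g t by exact: E.
  rewrite normrM; have := ler_pM (normr_ge0 _) (normr_ge0 _) (wm 1%N (arg (g (cis t))) isT) s1.
  by lra.
have := c2 t; rewrite !angular_real -!rmorphM -rmorphD => -[E].
have -> : derive1n 2 ((fun z => w (g z)) \o cis) t =
  derive1n 2 (w \o cis) (arg (g (cis t))) * speed g t * speed g t +
  derive1n 1 (w \o cis) (arg (g (cis t))) * speed' g t by exact: E.
apply: le_trans (ler_normD _ _) _; rewrite !normrM.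
have h1 := ler_pM (normr_ge0 _) (normr_ge0 _) (wm 1%N (arg (g (cis t))) isT) s2.
have h2 := ler_pM (normr_ge0 _) (normr_ge0 _) (wm 2%N (arg (g (cis t))) isT) s1.
have h3 := ler_pM (mulr_ge0 (normr_ge0 _) (normr_ge0 _)) (normr_ge0 _) h2 s1.
apply: le_trans (lerD h3 h1) _.
have -> : m * M1 * M1 + m * (M2 + M1 ^+ 2) = 2 * (M1 ^+ 2 * m) + M2 * m by ring.
by rewrite !mulrDl -mulrA mul1r; lra.
Qed.

Lemma C2fun_val_sum I (r : seq I) (F : I -> C2fun) (z : circle) :
  C2fun_val (\sum_(i <- r) F i) z = \sum_(i <- r) C2fun_val (F i) z.
Proof. by elim/big_rec2: _ => [//|i y u _ <-]. Qed.

Lemma val_comb (g : Diff2) (m : int) (a b : R) (z : circle) :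
  C2fun_val (a *: tangent_Re g (L_ m g) + b *: tangent_Im g (L_ m g)) z =
  a * complex.Im ((g z : C) ^ m) + b * - complex.Re ((g z : C) ^ m).
Proof.
have lin2 (u v : C2fun) : C2fun_val (a *: u + b *: v) z = a * C2fun_val u z + b * C2fun_val v z by [].
have [t1 t2] := val_tangent g m; apply: etrans (lin2 _ _) _; congr (_ * _ + _ * _).
  exact: (congr1 (fun f => f z) t1).
exact: (congr1 (fun f => f z) t2).
Qed.

(** The function v = u o g^-1 is approximated in C^2 by a trigonometric polynomial; composing with g
    yields powers of g(z), that is the fields L_k at g, and [comp_bound] controls the
    composition. *)
Lemma trig_approx (g : Diff2) (u : C2fun) (e : R) : 0 < e ->
  exists (n : nat) (a b : 'I_n -> R) (k : 'I_n -> int),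
    `|u - \sum_i (a i *: tangent_Re g (L_ (k i) g) + b i *: tangent_Im g (L_ (k i) g))| <= e.
Proof.
move=> e0; have [bg gC giC _] := Diff2_diffeo g; have [gK gV] := cinvK bg.
have [K K0 gB] := comp_bound g.
have uC := C2fun_C2 u; set U := C2fun_val u in uC.
pose v z := U (cinv g z).
have [vC _ _] := C2_circle_comp (C2_real uC) giC.
have {}vC : C2 (v \o cis) by exact: (C2_circle_real vC).
have [v1 v2 v3] := C2_der vC.
pose V k t := derive1n k (v \o cis) t.
have Vp k t : V k (t + pi *+ 2) = V k t.
  elim: k t => [|k IH] t; first by rewrite /V /= cis_per.
  by rewrite /V derive1nS; exact: derive1_periodic.
have Vc k : (k <= 2)%N -> continuous (V k).
  case: k => [|[|[|k]]] k2 t; [exact: is_derive_continuous (v1 t)|exact: is_derive_continuous (v2 t)|exact: v3|by exfalso].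
(* Three orders of derivatives, the constant K of the composition and the error 2 d of [PV] give 3 K
   (2 d) = e. *)
pose d := e / (6 * K); have d0 : 0 < d by rewrite divr_gt0 ?mulr_gt0.
have [M0 M00 h0] := periodic_unif (Vp 0%N) (Vc 0%N isT) d0.
have [M1 M10 h1] := periodic_unif (Vp 1%N) (Vc 1%N isT) d0.
have [M2 M20 h2] := periodic_unif (Vp 2%N) (Vc 2%N isT) d0.
pose M := M0 + M1 + M2.
have hV k s t : (k <= 2)%N -> `|V k s - V k t| <= d + M * (1 - cos (s - t)).
  have c0 : 0 <= 1 - cos (s - t) by rewrite subr_ge0 cos_le1.
  have p0 := mulr_ge0 M00 c0; have p1 := mulr_ge0 M10 c0; have p2 := mulr_ge0 M20 c0.
  case: k => [|[|[|k]]] // _; rewrite /M !mulrDl.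
  - by have := h0 s t; lra.
  - by have := h1 s t; lra.
  - by have := h2 s t; lra.
have [n nM] : exists n : nat, M / n.+1%:R <= d.
  exists (Num.bound (M / d)); rewrite ler_pdivrMr ?ltr0n// -ler_pdivrMl// mulrC.
  have : 0 <= M / d by rewrite divr_ge0 ?addr_ge0 ?(ltW d0).
  move=> /archi_boundP/ltW h; apply: le_trans h _; by rewrite ler_nat.
pose c : R := 'C(n + n, n)%:R; have c0 : 0 < c by rewrite ltr0n bin_gt0 leq_addr.
pose Vk k t : C := (V k t)%:C.
have VC k : (k <= 2)%N -> ccont (Vk k) by move=> k2; split; [exact: Vc|move=> t; exact: cvg_cst].
pose P k t := c^-1 * complex.Re (fsum n (Vk k) t).
have PV k t : (k <= 2)%N -> `|P k t - V k t| <= 2 * d.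
  move=> k2; have := fsum_approx n (Vc k k2) (fun s => hV k s t k2); rewrite -/c -/(Vk k) => H.
  have -> : P k t - V k t = c^-1 * (complex.Re (fsum n (Vk k) t) - c * V k t).
    by rewrite mulrBr mulKf ?gt_eqF.
  rewrite normrM gtr0_norm ?invr_gt0// mulrC ler_pdivrMr//.
  by apply: (le_trans H); rewrite [leLHS]mulrC ler_wpM2r ?(ltW c0)// mulr_natl mulr2n lerD2l.
have dP k t : (k < 2)%N -> is_derive t (1 : R) (P k) (P k.+1 t).
  move=> k2; have cV s : cder (Vk k) s (Vk k.+1 s).
    by case: k k2 => [|[|k]] k2; [apply: cder_real; exact: v1|apply: cder_real; exact: v2|exfalso].
  have pV : Vk k (pi *+ 2) = Vk k 0 by rewrite /Vk -[pi *+ 2]add0r Vp.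
  have [h _] := fsum_cder n t (VC k.+1 k2) cV pV.
  apply: is_derive_eq (is_deriveMr (is_derive_cst c^-1 t 1) h) _.
  by rewrite mul0r add0r.
have cP2 : continuous (P 2%N).
  have cf : ccont (fsum n (Vk 2%N)).
    by apply: ccont_sum => m; apply: ccontZ; apply: ccontZ; exact: ccont_ek.
  by move=> t; apply: cvgM; [exact: cvg_cst|exact: cf.1].
pose co (m : 'I_(n + n).+1) : C := c^-1%:C * ('C(n + n, m)%:R * fc (Vk 0%N) (m%:Z - n%:Z)).
pose kk (m : 'I_(n + n).+1) : int := n%:Z - m%:Z.
(* The signs come from Re (c w) = Re c Re w - Im c Im w and from the coordinates Im g^k and - Re g^k
   of L_k. *)
exists (n + n).+1, (fun m => - complex.Im (co m)), (fun m => - complex.Re (co m)), kk.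
set T := \sum_(i < _) _.
pose p z := \sum_m complex.Re (co m * (z : C) ^ kk m).
have pE t : p (cis t) = P 0%N t.
  rewrite /p /P; have -> : c^-1 * complex.Re (fsum n (Vk 0%N) t) = complex.Re (c^-1%:C * fsum n (Vk 0%N) t).
    by case: (fsum _ _ _) => x y /=; rewrite mul0r subr0.
  rewrite mulr_sumr; have ReS (r : seq 'I_(n + n).+1) (F : 'I_(n + n).+1 -> C) :
      complex.Re (\sum_(i <- r) F i) = \sum_(i <- r) complex.Re (F i).
    by elim/big_rec2: _ => [//|i y x _ <-]; rewrite ReD.
  rewrite ReS; apply: eq_bigr => m _; congr (complex.Re _).
  by rewrite /co ekE; ring.
have TE z : C2fun_val T z = p (g z).
  rewrite /T C2fun_val_sum; apply: eq_bigr => m _.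
  apply: etrans (val_comb g (kk m) _ _ z) _.
  by rewrite ReM; ring.
pose w z := v z - p z.
have wE : w \o cis = (fun t => V 0%N t - P 0%N t) by apply/funext => t; rewrite /w /= pE.
have dw k t : (k < 2)%N -> is_derive t (1 : R) (fun t => V k t - P k t) (V k.+1 t - P k.+1 t).
  move=> k2; apply: is_deriveB; last exact: dP.
  by case: k k2 => [|[|k]] k2; [exact: v1|exact: v2|exfalso].
have cw : continuous (fun t => V 2%N t - P 2%N t) by move=> t; apply: cvgB; [exact: v3|exact: cP2].
have [wC w1 w2] := der_C2 (fun t => dw 0%N t isT) (fun t => dw 1%N t isT) cw.
have {}wC : C2 (w \o cis) by rewrite wE; exact: wC.
have wb k t : (k <= 2)%N -> `|derive1n k (w \o cis) t| <= 2 * d.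
  move=> k2; have -> : derive1n k (w \o cis) t = V k t - P k t.
    case: k k2 => [|[|[|k]]] k2; rewrite wE; last by exfalso.
    - by [].
    - exact: (congr1 (fun f => f t) w1).
    - exact: (congr1 (fun f => f t) w2).
  by rewrite distrC; exact: PV.
apply: (@le_trans _ _ (3 * (K * (2 * d)))); last first.
  have -> : 3 * (K * (2 * d)) = e * ((6 * K) / (6 * K)) by rewrite /d; ring.
  by rewrite divff ?mulr1// gt_eqF// mulr_gt0.
apply: C2fun_ge => k t k2.
have -> : C2fun_val (u - T) = (fun z => w (g z)).
  apply/funext => z; rewrite -[LHS]/(U z - C2fun_val T z) TE /w /v gK//.
exact: gB.
Qed.

(** L has complex values but is only real linear, so the relation for L_m alone does not annihilate
    both coordinates. Those of L_(-m) are the same up to the sign of the first one; the relations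
    for m and - m together suffice. *)
Lemma trig_dense (g : Diff2) (L : C2fun -> C) (K : R) :
  (forall u v, L (u + v) = L u + L v) -> (forall (a : R) u, L (a *: u) = a%:C * L u) ->
  (forall u, nc (L u) <= K * `|u|) ->
  (forall m, L (tangent_Re g (L_ m g)) + 'i%R * L (tangent_Im g (L_ m g)) = 0) ->
  forall u, L u = 0.
Proof.
move=> LD LZ LK L0 u.
have LN v : L (- v) = - L v by rewrite -scaleN1r LZ rmorphN1 mulN1r.
have alg (a b : C) : a + 'i%R * b = 0 -> - a + 'i%R * b = 0 -> a = 0 /\ b = 0.
  move=> h1 h2; have h3 : 2 * a = 0 by rewrite -[RHS](subrr 0) -{1}h1 -h2; ring.
  have a0 : a = 0 by move/eqP: h3; rewrite mulf_eq0 pnatr_eq0 => /eqP.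
  split=> //; move/eqP: h1; rewrite a0 add0r mulf_eq0 => /orP[|/eqP//].
  by rewrite (negbTE (@i_neq0 R)).
have t2 m : L (tangent_Re g (L_ m g)) = 0 /\ L (tangent_Im g (L_ m g)) = 0.
  have conj (z : circle) : (z : C) ^ (- m) = conjc ((z : C) ^ m).
    by have [t <-] := cis_surj z; rewrite -!ekE ekJ.
  have C2E (x y : C2fun) : C2fun_val x = C2fun_val y -> x = y by exact: val_inj.
  have e1 : tangent_Re g (L_ (- m) g) = - tangent_Re g (L_ m g).
    apply: C2E; rewrite (val_tangent g (- m)).1; apply/funext => z.
    rewrite -[RHS]/(- C2fun_val (tangent_Re g (L_ m g)) z) (val_tangent g m).1 conj.
    by case: (_ ^ m).
  have e2 : tangent_Im g (L_ (- m) g) = tangent_Im g (L_ m g).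
    apply: C2E; apply: etrans (val_tangent g (- m)).2 _.
    apply: etrans _ (esym (val_tangent g m).2); apply/funext => z.
    by rewrite conj; case: (_ ^ m).
  apply: alg; first exact: L0.
  by have := L0 (- m); rewrite e1 e2 LN; apply.
(* K may be negative, but then all norms are 0. *)
have K0 : 0 <= K \/ forall v : C2fun, `|v| <= 0.
  have [|k0] := leP 0 K; [by left|right => v].
  rewrite leNgt; apply/negP => v0; have := le_trans (nc_ge0 _) (LK v).
  by rewrite nmulr_rge0// leNgt v0.
apply/eqP; rewrite -nc_eq0 eq_le nc_ge0 andbT.
case: K0 => [K0|v0]; last first.
  have := v0 u; rewrite normr_le0 => /eqP ->.
  by rewrite -(scale0r (0 : C2fun)) LZ mul0r nc0.
rewrite leNgt; apply/negP => Lu; pose e := nc (L u) / (K + 1).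
have K1 : 0 < K + 1 by lra.
have e0 : 0 < e by rewrite divr_gt0.
have [n [a [b [k h]]]] := trig_approx g u e0.
move: h; set T := \sum_(i < _) _ => h.
have LT : L T = 0.
  rewrite /T; elim/big_rec: _ => [|i x _ IH]; first by rewrite -(scale0r (0 : C2fun)) LZ mul0r.
  have LL (c d : R) v w y : L v = 0 -> L w = 0 -> L y = 0 -> L (c *: v + d *: w + y) = 0.
    by move=> h1 h2 h3; rewrite !LD !LZ h1 h2 h3 !mulr0 !addr0.
  exact: LL (t2 (k i)).1 (t2 (k i)).2 IH.
have : nc (L u) <= K * e.
  have -> : L u = L (u - T) by rewrite LD LN LT subr0.
  by apply: le_trans (LK _) _; rewrite ler_wpM2l.
rewrite /e mulrA ler_pdivlMr// mulrC leNgt => /negP; apply.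
by rewrite ltr_pM2r//; lra.
Qed.

End density.

(** * Differentials as first order expansions *)

Section diffeps.
Context {R : realType} {V : normedModType R}.

Lemma diff_eps (F : V -> R) : differentiable F 0 ->
  (exists2 K : R, 0 < K & forall v, `|'d F 0 v| <= K * `|v|) /\
  forall e : R, 0 < e -> \forall v \near (0 : V), `|F v - F 0 - 'd F 0 v| <= e * `|v|.
Proof.
move=> dF; split.
  have /(_ 0)/continuous_linear_bounded := diff_continuous dF.
  move=> /(_ 0)/linear_boundedP/pinfty_ex_gt0[K K0 KP].
  by exists K.
move=> e e0; have /eqaddoP/(_ e e0) := diff_locally dF.
apply: filterS => v; rewrite -[X in `|X|]/(F (v + 0) - (F 0 + 'd F 0 v)).
by rewrite addr0 opprD addrA.
Qed.

Lemma eps_diff (F : V -> R) (L : V -> R) (K : R) :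
  (forall a u v, L (a *: u + v) = a * L u + L v) -> (forall v, `|L v| <= K * `|v|) ->
  (forall e : R, 0 < e -> \forall v \near (0 : V), `|F v - F 0 - L v| <= e * `|v|) ->
  differentiable F 0 /\ forall v, 'd F 0 v = L v.
Proof.
move=> Llin LK Le.
pose LL : {linear V -> R} := HB.pack L (GRing.isLinear.Build R V R _ L Llin).
have LLc : continuous LL.
  apply/bounded_linear_continuous/linear_boundedP.
  exists K; split=> [|r Kr x]; first exact: num_real.
  by apply: le_trans (LK x) _; rewrite ler_wpM2r// ltW.
have FL : F \o shift 0 = functions.cst (F 0) + LL +o_ (0 : V) id.
  apply/eqaddoP => e e0; have := Le e e0.
  apply: filterS => v; rewrite -[X in _ -> `|X| <= _]/(F (v + 0) - (F 0 + L v)).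
  by rewrite addr0 opprD addrA.
have dE := diff_unique LLc FL.
split; last by move=> v; rewrite dE.
by apply/diff_locallyP; rewrite dE.
Qed.

Lemma diff_dir (F : V -> R) (v : V) : differentiable F 0 ->
  is_derive 0 (1 : R) (fun s : R => F (s *: v)) ('d F 0 v).
Proof.
move=> dF; have [[K K0 LK] Fe] := diff_eps dF.
apply: is_derive_eps => e e0; have e1 : 0 < e / (`|v| + 1) by rewrite divr_gt0// ltr_wpDl.
have cs : (s *: v) @[s --> (0 : R)] --> (0 : V).
  by rewrite -[X in _ --> X](scale0r v); apply: cvgZr_tmp; exact: cvg_id.
have h : \forall s \near (0 : R), `|F (s *: v) - F 0 - 'd F 0 (s *: v)| <= e / (`|v| + 1) * `|s *: v|.
  exact: (cs _ (Fe _ e1)).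
apply: filterS h => s; rewrite add0r scale0r linearZ /= normrZ => h; apply: le_trans h _.
rewrite mulrCA mulrC ler_wpM2r// -[leRHS]mulr1 -!mulrA ler_wpM2l ?(ltW e0)//.
by rewrite mulrC ler_pdivrMr ?mul1r ?lerDl// ltr_wpDl.
Qed.

End diffeps.

(** * Uniformity along the circle for functions of class C^1 *)

Section c1.
Context {R : realType}.
Local Notation C := R[i].
Local Notation circle := (circle R).
Local Notation Diff2 := (Diff2 R).
Local Notation C2fun := (C2fun R).
Variables (f : circle -> Diff2 -> R) (U : set Diff2).
Hypotheses (Uo : open U) (fC1 : C1_on U f).

Definition dr (t : R) (h : Diff2) (v : R * C2fun) : R := 'd (rep f t h) (0 : (R * C2fun)%type) v.

Lemma norm0l (u : C2fun) : `|((0 : R), u) : (R * C2fun)%type| = `|u|.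
Proof. by rewrite -[LHS]/(Num.max `|0 : R| `|u|) normr0; apply/max_idPr. Qed.

Lemma norm0r (a : R) : `|(a, (0 : C2fun)) : (R * C2fun)%type| = `|a|.
Proof. by rewrite -[LHS]/(Num.max `|a| `|0 : C2fun|) normr0; apply/max_idPl. Qed.

Lemma dr_per t (n : int) h v : dr (t + n%:~R * (pi *+ 2)) h v = dr t h v.
Proof.
rewrite /dr; suff -> : rep f (t + n%:~R * (pi *+ 2)) h = rep f t h by [].
apply/funext => w; rewrite /rep addrAC; congr (f _ _).
by apply: (@periodicz R _ (fun t => cis t)) => s; exact: cis_per.
Qed.

Lemma dr_linear t h a v w : dr t h (a *: v + w) = a * dr t h v + dr t h w.
Proof. exact: linearP. Qed.

Lemma C1_loc t g : U g -> forall e : R, 0 < e -> exists2 d : R, 0 < d &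
  forall t' h, `|t' - t| < d -> Diff2_ball g d h -> forall v, `|dr t' h v - dr t g v| <= e * `|v|.
Proof.
move=> Ug e e0; have [_ /(_ e e0)] := fC1 t Ug.
move=> [[A B]] /= [/nbhs_ballP[a /= a0 aA] /Diff2_nbhsP[b b0 bB] AB].
exists (Num.min a b); first by rewrite lt_min a0.
move=> t' h; rewrite lt_min => /andP[ta tb] hb v.
apply: (AB (t', h)); split=> /=.
  by apply: aA; rewrite /ball/= distrC.
apply: bB => k s k2; have := hb k s k2; rewrite !nc_lt lt_min => /andP[_]; exact.
Qed.

(** [C1_on] gives continuity of the differential at each (t, g); compactness of a period makes the
    radius independent of t. Both differentials at t' are compared with the one at (t, g), hence e /
    2. *)
Lemma C1_cont g : U g -> forall e : R, 0 < e -> exists2 d : R, 0 < d &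
  forall t h, Diff2_ball g d h -> forall v, `|dr t h v - dr t g v| <= e * `|v|.
Proof.
move=> Ug e e0.
pose P (d t : R) := forall h, Diff2_ball g d h -> forall v, `|dr t h v - dr t g v| <= e * `|v|.
have ballS (d d' : R) h : d' <= d -> Diff2_ball g d' h -> Diff2_ball g d h.
  move=> dd' hd k s k2; have := hd k s k2; rewrite !nc_lt => hk; exact: lt_le_trans hk dd'.
have [d d0 dP] : exists2 d : R, 0 < d & forall t : R, 0 <= t <= pi *+ 2 -> P d t.
  apply: seg_unif.
    by move=> d d' t _ dd' Pd h hd; apply: Pd; exact: ballS hd.
  move=> t; have e2 : 0 < e / 2 by rewrite divr_gt0.
  have [d d0 dP] := C1_loc t Ug e2; exists d => // t' tt' h hd v.
  rewrite -(subrKA (dr t g v)) (le_trans (ler_normD _ _))// [leRHS]mulrC [X in _ * X]splitr mulrDr.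
  apply: lerD; first by rewrite mulrC; exact: dP.
  by rewrite distrC mulrC; apply: dP => //; exact: Diff2_ball_center.
exists d => // t h hd v; have [n [s [-> s01]]] := mod2pi t.
by rewrite !dr_per; apply: dP.
Qed.

Lemma C1_bound g : U g -> exists2 M : R, 0 < M & forall t v, `|dr t g v| <= M * `|v|.
Proof.
(* The bound is written d^-1, so that a common positive d from [seg_unif] is a common bound. *)
move=> Ug; pose P (d t : R) := forall v, `|dr t g v| <= d^-1 * `|v|.
have [d d0 dP] : exists2 d : R, 0 < d & forall t : R, 0 <= t <= pi *+ 2 -> P d t.
  apply: seg_unif.
    move=> d d' t d'0 dd' Pd v; apply: le_trans (Pd v) _; rewrite ler_wpM2r//.
    by rewrite lef_pV2 ?posrE//; exact: lt_le_trans dd'.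
  move=> t; have [d d0 dP] := C1_loc t Ug ltr01.
  have [tD _] := fC1 t Ug; have [[K K0 KD] _] := diff_eps tD.
  have K1 : 0 < K + 1 by lra.
  exists (Num.min d (K + 1)^-1); first by rewrite lt_min d0 invr_gt0.
  move=> t'; rewrite lt_min => /andP[td tK] v.
  have h1 := dP t' g td (Diff2_ball_center g d0) v; have h2 := KD v.
  have : `|dr t' g v| <= (K + 1) * `|v|.
    rewrite -[dr t' g v](subrK (dr t g v)) (le_trans (ler_normD _ _))// mulrDl addrC lerD//.
  move=> h; apply: le_trans h _; rewrite ler_wpM2r//.
  rewrite -[leLHS]invrK lef_pV2 ?posrE ?invr_gt0 ?lt_min ?d0 ?invr_gt0//.
  by rewrite ge_min lexx orbT.
exists d^-1; first by rewrite invr_gt0.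
by move=> t v; have [n [s [-> s01]]] := mod2pi t; rewrite dr_per; apply: dP.
Qed.

Lemma C1_chart g : U g -> forall e : R, 0 < e -> exists2 d : R, 0 < d & forall u : C2fun, `|u| < d ->
  [/\ diffeo2 (mulcis g (C2fun_val u)), U (chart g u) &
    forall t v, `|dr t (chart g u) v - dr t g v| <= e * `|v|].
Proof.
move=> Ug e e0; have [d1 d10 D1] := C1_cont Ug e0.
have /Diff2_nbhsP[d2 d20 D2] : nbhs g U by exact: open_nbhs_nbhs.
have [d3 d30 D3] := chart_near g d10; have [d4 d40 D4] := chart_near g d20.
have [d5 d50 D5] := mulcis_diffeo g.
exists (Num.min d3 (Num.min d4 d5)); first by rewrite !lt_min d30 d40.
move=> u; rewrite !lt_min => /and3P[u3 u4 u5]; split; first exact: D5.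
  by apply: D2; exact: D4.
by move=> t v; apply: D1; exact: D3.
Qed.

Lemma C1_path t h (w : C2fun) : U h ->
  is_derive 0 (1 : R) (fun s : R => f (cis t) (chart h (s *: w))) (dr t h (0, w)).
Proof.
move=> Uh; have [tD _] := fC1 t Uh.
have := diff_dir ((0 : R), w) tD; rewrite /rep.
suff -> : (fun s : R => f (cis (t + (s *: ((0 : R), w)).1)) (chart h (s *: ((0 : R), w)).2)) =
  (fun s : R => f (cis t) (chart h (s *: w))) by [].
by apply/funext => s; rewrite /= scaler0 addr0.
Qed.

Lemma C1_angle t h : U h -> is_derive t (1 : R) (fun s : R => f (cis s) h) (dr t h (1, 0)).
Proof.
move=> Uh; have [tD _] := fC1 t Uh.
have := diff_dir ((1 : R), (0 : C2fun)) tD; rewrite /rep.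
have -> : (fun s : R => f (cis (t + (s *: ((1 : R), (0 : C2fun))).1)) (chart h (s *: ((1 : R), (0 : C2fun))).2)) =
  (fun s : R => f (cis (t + s)) h).
  by apply/funext => s; rewrite /= scaler0 chart0 [s *: 1]mulr1.
move=> H; have dv : is_derive t (1 : R) (fun x : R => x - t) 1.
  by apply: is_derive_eq (is_deriveB (is_derive_id t 1) (is_derive_cst t t 1)) _; rewrite subr0.
have H' : is_derive (t - t) (1 : R) (fun s : R => f (cis (t + s)) h) (dr t h (1, 0)) by rewrite subrr.
have := is_derive_comp (v := fun x => x - t) H' dv; rewrite mulr1.
suff -> : (fun s => f (cis (t + (s - t))) h) = (fun s => f (cis s) h) by [].
by apply/funext => s; rewrite subrKC.
Qed.

Lemma C1_dr_cont g v : U g -> continuous (fun t => dr t g v).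
Proof.
move=> Ug t; apply/cvgrPdist_lt => e e0.
have e1 : 0 < e / (`|v| + 1) by rewrite divr_gt0// ltr_wpDl.
have [d d0 dP] := C1_loc t Ug e1.
apply/nbhs_ballP; exists d => //= t' td; rewrite distrC.
apply: le_lt_trans (dP t' g _ (Diff2_ball_center g d0) v) _.
  by move: td; rewrite /ball/= distrC.
by rewrite mulrAC ltr_pdivrMr ?ltr_wpDl// ltr_pM2l// ltrDl.
Qed.

(* mean value inequality along the segment s |-> chart g (s u) *)
Lemma C1_taylor g : U g -> forall e : R, 0 < e -> exists2 d : R, 0 < d & forall u : C2fun, `|u| < d ->
  forall t, `|f (cis t) (chart g u) - f (cis t) g - dr t g (0, u)| <= e * `|u|.
Proof.
move=> Ug e e0; have [d d0 dP] := C1_chart Ug e0; exists d => // u ud t.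
pose psi (s : R) := f (cis t) (chart g (s *: u)) - dr t g (0, u) * s.
have su (s : R) : s \in `[0, 1]%R -> `|s *: u| < d.
  rewrite in_itv/= => /andP[s0 s1]; apply: le_lt_trans ud.
  by rewrite normrZ ger0_norm// ler_piMl.
have dpsi (s : R) : s \in `[0, 1]%R ->
    is_derive s (1 : R) psi (dr t (chart g (s *: u)) (0, u) - dr t g (0, u)).
  move=> s01; have [sD sU sc] := dP _ (su s s01).
  have h2 := is_derive_mull (dr t g (0, u)) s.
  suff h1 : is_derive s (1 : R) (fun s : R => f (cis t) (chart g (s *: u))) (dr t (chart g (s *: u)) (0, u)).
    exact: is_deriveB h1 h2.
  have dv : is_derive s (1 : R) (fun x : R => x - s) 1.
    by apply: is_derive_eq (is_deriveB (is_derive_id s 1) (is_derive_cst s s 1)) _; rewrite subr0.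
  have H : is_derive (s - s) (1 : R) (fun r : R => f (cis t) (chart (chart g (s *: u)) (r *: u)))
      (dr t (chart g (s *: u)) (0, u)) by rewrite subrr; exact: C1_path.
  have := is_derive_comp (v := fun x => x - s) H dv; rewrite mulr1.
  have cn : `|x *: u| @[x --> s] --> `|s *: u|.
    by apply: cvg_norm; apply: cvgZr_tmp; exact: cvg_id.
  have sd : \forall x \near s, `|x *: u| < d by apply: (cvgr_lt _ cn); exact: su.
  have near_eq : \forall x \near s, (f (cis t) (chart (chart g (s *: u)) ((x - s) *: u)))%:C =
      (f (cis t) (chart g (x *: u)))%:C :> C.
    apply: filterS sd => x xd; rewrite chart_chart.
    - by rewrite -scalerDl subrKC.
    - by exact: sD.
    - by rewrite -scalerDl subrKC; have [] := dP _ xd.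
  by move=> H'; have [h1 _] := cder_near near_eq (cder_real H').
have le (s : R) : s \in `[0, 1]%R -> `|dr t (chart g (s *: u)) (0, u) - dr t g (0, u)| <= e * `|u|.
  move=> s01; have [_ _ sc] := dP _ (su s s01).
  by rewrite -(norm0l u); exact: sc.
have := lipR dpsi le ler01; rewrite subr0 mulr1; apply: le_trans.
by rewrite /psi scale1r scale0r chart0 mulr1 mulr0 subr0 addrAC.
Qed.

End c1.

(** * The coefficients of the system *)

Section amgm.
Context {R : realType} {N : nat}.
Local Notation C := R[i].
Local Notation M := 'M[C]_N.

(** The terms are of order n^(-3/2); for n >= 1 the difference 8 / sqrt n - 8 / sqrt (n + 1)
    dominates them, which the induction telescopes. *)
Lemma wt_sqr_sum K : \sum_(n < K) (wt n / (maxn 1 n)%:R) ^+ 2 <= 10 :> R.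
Proof.
have sq (n : nat) : Num.sqrt (n.+1%:R : R) ^+ 2 = n.+1%:R by rewrite sqr_sqrtr.
have s0 (n : nat) : 0 < Num.sqrt (n.+1%:R : R) by rewrite sqrtr_gt0.
suff H : \sum_(n < K.+1) (wt n / (maxn 1 n)%:R) ^+ 2 <= 10 - 8 / Num.sqrt (K.+1%:R : R).
  apply: (@le_trans _ _ (\sum_(n < K.+1) (wt n / (maxn 1 n)%:R) ^+ 2)).
    by rewrite big_ord_recr lerDl sqr_ge0.
  by apply: le_trans H _; rewrite gerBl divr_ge0// ltW.
elim: K => [|K IH].
  rewrite big_ord_recl big_ord0 addr0 /wt !sqrtr1 divr1 expr1n divr1; lra.
rewrite big_ord_recr /=; apply: le_trans (lerD IH (lexx _)) _.
set a := Num.sqrt K.+1%:R; set b := Num.sqrt K.+2%:R.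
have a0 : 0 < a by exact: s0. have b0 : 0 < b by exact: s0.
have a2 : a ^+ 2 = K.+1%:R by exact: sq. have b2 : b ^+ 2 = K.+2%:R by exact: sq.
have -> : (wt K.+1 / (maxn 1 K.+1)%:R) ^+ 2 = b / a ^+ 4 :> R.
  have -> : maxn 1 K.+1 = K.+1 by lia.
  rewrite exprMn exprVn -a2 -exprM /wt sqr_sqrtr ?sqrtr_ge0//.
have ba : b ^+ 2 = a ^+ 2 + 1 by rewrite a2 b2 -natr1.
have a1 : 1 <= a by rewrite -[leLHS]sqrtr1 ler_sqrt// ler1n.
have b15 : b <= 3 / 2 * a.
  rewrite -(@ler_pXn2r _ 2) ?nnegrE ?mulr_ge0 ?(ltW a0) ?(ltW b0)//.
  by rewrite exprMn ba; nra.
have k1 : b ^+ 2 * (a + b) <= 8 * a ^+ 3 * ((b - a) * (a + b)).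
  have -> : (b - a) * (a + b) = 1 by move: ba; lra.
  rewrite mulr1 ba exprS; nra.
have k2 : b ^+ 2 <= 8 * a ^+ 3 * (b - a).
  by move: k1; rewrite mulrA ler_pM2r// addr_gt0.
rewrite -subr_ge0.
have -> : 10 - 8 / b - (10 - 8 / a + b / a ^+ 4) = (8 * a ^+ 3 * (b - a) - b ^+ 2) / (a ^+ 4 * b).
  by field; rewrite !gt_eqF.
by rewrite divr_ge0 ?subr_ge0// mulr_ge0 ?exprn_ge0 ?(ltW a0) ?(ltW b0).
Qed.

(** Cauchy-Schwarz through x a <= s x^2 / 2 + a^2 / (2 s), with x = [wt n] / max(1, n). The two sums
    contribute at most 5 s and s / 2; the case s = 0 is treated apart. *)
Lemma amgm_sum (a : nat -> R) (s : R) : (forall n, 0 <= a n) -> 0 <= s ->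
  (forall K, \sum_(n < K) a n ^+ 2 <= s ^+ 2) ->
  forall K, \sum_(n < K) wt n * a n / (maxn 1 n)%:R <= 6 * s.
Proof.
move=> a0; rewrite le_eqVlt => /predU1P[<-|s0] as2 K.
  rewrite big1 ?mulr0// => n _.
  have := as2 n.+1; rewrite expr0n big_ord_recr /= => h.
  have /eqP : a n ^+ 2 = 0.
    apply/eqP; rewrite eq_le sqr_ge0 andbT; apply: le_trans h; rewrite lerDr.
    by apply: sumr_ge0 => i _; exact: sqr_ge0.
  by rewrite sqrf_eq0 => /eqP ->; rewrite mulr0 mul0r.
apply: (@le_trans _ _ (\sum_(n < K) (s / 2 * (wt n / (maxn 1 n)%:R) ^+ 2 + a n ^+ 2 / (2 * s)))).
  apply: ler_sum => n _; set x := wt n / (maxn 1 n)%:R.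
  have -> : wt n * a n / (maxn 1 n)%:R = x * a n by rewrite /x mulrAC.
  rewrite -subr_ge0; have -> : s / 2 * x ^+ 2 + a n ^+ 2 / (2 * s) - x * a n = (s * x - a n) ^+ 2 / (2 * s).
    by field; rewrite gt_eqF.
  by rewrite divr_ge0 ?sqr_ge0// mulr_ge0// ltW.
rewrite big_split /= -mulr_sumr -mulr_suml.
have h1 : s / 2 * (\sum_(n < K) (wt n / (maxn 1 n)%:R) ^+ 2) <= s / 2 * 10.
  by rewrite ler_wpM2l ?wt_sqr_sum// divr_ge0// ltW.
have h2 : (\sum_(n < K) a n ^+ 2) / (2 * s) <= s ^+ 2 / (2 * s).
  by rewrite ler_wpM2r ?invr_ge0 ?mulr_ge0 ?(ltW s0).
apply: le_trans (lerD h1 h2) _.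
have -> : s ^+ 2 / (2 * s) = s / 2 by field; rewrite gt_eqF.
lra.
Qed.

Lemma fbd_entries (f : nat -> M) (s : R) : 0 <= s ->
  (forall i j K, \sum_(n < K) nc (f n i j) ^+ 2 <= s ^+ 2) ->
  fbd wt f ((N * N)%:R * (6 * s)).
Proof.
move=> s0 fs K.
have -> : \sum_(n < K) wt n * mnorm (f n) / (maxn 1 n)%:R =
    \sum_(i < N) \sum_(j < N) \sum_(n < K) wt n * nc (f n i j) / (maxn 1 n)%:R :> R.
  under eq_bigr => n _.
    rewrite /mnorm mulr_sumr mulr_suml.
    under eq_bigr => i _ do rewrite mulr_sumr mulr_suml.
  over.
  by rewrite exchange_big; apply: eq_bigr => i _; rewrite exchange_big.
apply: (@le_trans _ _ (\sum_(i < N) \sum_(j < N) 6 * s)).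
  apply: ler_sum => i _; apply: ler_sum => j _.
  by apply: (amgm_sum (a := fun n => nc (f n i j))) (fs i j) _ => // n; exact: nc_ge0.
by rewrite !sumr_const card_ord -mulrnA [leRHS]mulr_natl.
Qed.

(** Square summability of n f_n is what the inequality of Bessel gives for the derivative of a C^1
    function; f_0 is not controlled in this way, hence the hypothesis on it. *)
Lemma wbd_entries (f : nat -> M) (s : R) : 0 <= s -> f 0%N = 0 ->
  (forall i j K, \sum_(n < K) (n%:R * nc (f n i j)) ^+ 2 <= s ^+ 2) ->
  wbd f ((N * N)%:R * (6 * s)).
Proof.
move=> s0 f0 fs K.
have fs' i j k : \sum_(n < k) nc ((n%:R *: f n) i j) ^+ 2 <= s ^+ 2.
  by under eq_bigr do rewrite mxE ncM nc_nat.
apply: le_trans (fbd_entries (f := fun n => n%:R *: f n) s0 fs' K).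
apply: ler_sum => -[[|n] nK] _ /=; first by rewrite f0 mnorm0 mulr0 scaler0 mnorm0 mulr0 mul0r.
have -> : maxn 1 n.+1 = n.+1 by lia.
by rewrite mnormZ nc_nat mulrCA mulrAC divff ?mul1r// pnatr_eq0.
Qed.

End amgm.

Section coefs.
Context {R : realType} {N : nat}.
Local Notation C := R[i].
Local Notation circle := (circle R).
Local Notation Diff2 := (Diff2 R).
Local Notation C2fun := (C2fun R).
Local Notation M := 'M[C]_N.
Variables (U : set Diff2) (A : circle -> Diff2 -> M).
Hypotheses (Uo : open U) (AC1 : C1_on_mx U A).

(** The factor e^(it) is that of dz = i e^(it) dt. Below, [den1] is the angular derivative of this
    density, and [dden] its variation when the diffeomorphism moves along u. *)
Definition den i j (h : Diff2) (t : R) : C := A (cis t) h i j * (cis t : C).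

Definition dA i j (h : Diff2) (t : R) (v : R * C2fun) : C :=
  dr (fun z g => complex.Re (A z g i j)) t h v +i* dr (fun z g => complex.Im (A z g i j)) t h v.

Definition dden i j (h : Diff2) (u : C2fun) (t : R) : C := dA i j h t (0, u) * (cis t : C).

Definition den1 i j (h : Diff2) (t : R) : C :=
  dA i j h t (1, 0) * (cis t : C) + A (cis t) h i j * ('i%R * (cis t : C)).

Lemma ccont_cis : ccont (fun t => (cis t : C)).
Proof.
have -> : (fun t => (cis t : C)) = ek 1 by apply/funext => t; rewrite /ek mul1r.
exact: ccont_ek.
Qed.

Lemma cder_cis1 (t : R) : cder (fun t => (cis t : C)) t ('i%R * (cis t : C)).
Proof.
have := cder_cis 1 t; rewrite mul1r.
have -> : 'i%R * (1 : R)%:C * (cis t : C) = 'i%R * (cis t : C) by rewrite rmorph1 mulr1.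
by apply: cder_ext => s; rewrite mul1r.
Qed.

Lemma A_cder i j h t : U h -> cder (fun t => A (cis t) h i j) t (dA i j h t (1, 0)).
Proof. by move=> Uh; have [f1 f2] := AC1 i j; split; [exact: (C1_angle f1)|exact: (C1_angle f2)]. Qed.

Lemma A_ccont i j h : U h -> ccont (fun t => A (cis t) h i j).
Proof. by move=> Uh; apply: cder_ccont => t; exact: A_cder. Qed.

Lemma den_cder i j h t : U h -> cder (den i j h) t (den1 i j h t).
Proof. by move=> Uh; apply: cderM; [exact: A_cder|exact: cder_cis1]. Qed.

Lemma den_ccont i j h : U h -> ccont (den i j h).
Proof. by move=> Uh; apply: cder_ccont => t; exact: den_cder. Qed.

Lemma dA_ccont i j h v : U h -> ccont (fun t => dA i j h t v).
Proof. by move=> Uh; have [f1 f2] := AC1 i j; split; [exact: (C1_dr_cont f1)|exact: (C1_dr_cont f2)]. Qed.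

Lemma den1_ccont i j h : U h -> ccont (den1 i j h).
Proof.
move=> Uh; apply: ccontD; apply: ccontM.
- exact: dA_ccont.
- exact: ccont_cis.
- exact: A_ccont.
- by apply: ccontZ; exact: ccont_cis.
Qed.

Lemma dden_ccont i j h u : U h -> ccont (dden i j h u).
Proof. by move=> Uh; apply: ccontM; [exact: dA_ccont|exact: ccont_cis]. Qed.

Lemma dA_linear i j h t (a : R) v w : dA i j h t (a *: v + w) = a%:C * dA i j h t v + dA i j h t w.
Proof. by apply: complex_eqP; rewrite ?ReD ?ImD ?ReM ?ImM /= dr_linear mul0r ?subr0 ?addr0. Qed.

Lemma den_per i j h : den i j h (pi *+ 2) = den i j h 0.
Proof. by rewrite /den -[pi *+ 2]add0r cis_per. Qed.

Lemma Bcoef_fc n h i j : U h -> Bcoef A n h i j = - fc (den i j h) n.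
Proof.
move=> Uh; rewrite /Bcoef mxE mulNr; congr (- _).
have -> : contour_mx (fun z => (z : C) ^ n *: A z h) i j =
    cint (fun t => 'i%R * (den i j h t * ek n t)).
  rewrite /contour_mx mxE -[LHS]/(cint (fun t => ((cis t : C) ^ n *: A (cis t) h) i j * ('i%R * (cis t : C)))).
  by congr cint; apply/funext => t; rewrite mxE -ekE /den; ring.
rewrite cintZ; last by apply: ccontM; [exact: den_ccont|exact: ccont_ek].
rewrite /fc mulrA; congr (_ * _).
have p0 : (pi : R)%:C != 0 by rewrite -nc_eq0 nc_real normr_eq0 gt_eqF ?pi_gt0.
have i0 := @i_neq0 R; have t0 : (2 : C) != 0 by rewrite pnatr_eq0.
have -> : (pi *+ 2)%:C = 2 * (pi : R)%:C :> C by rewrite rmorphMn /= mulr_natl.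
rewrite /twoipi; move: ('i%R : C) (pi%:C : C) i0 p0 => x y x0 y0.
by field; rewrite x0 y0.
Qed.

Lemma den_bounds g i j : U g -> exists (m d : R), [/\ 0 < m /\ 0 < d,
  forall u : C2fun, `|u| < d -> U (chart g u) /\ diffeo2 (mulcis g (C2fun_val u)),
  forall u : C2fun, `|u| < d -> forall t, nc (den1 i j (chart g u) t) <= m,
  forall u : C2fun, `|u| < d -> forall t, nc (den i j (chart g u) t - den i j g t) <= m * `|u| &
  forall (u : C2fun) t, nc (dden i j g u t) <= m * `|u|].
Proof.
move=> Ug; have [f1 f2] := AC1 i j.
have [m1 m10 B1] := C1_bound f1 Ug; have [m2 m20 B2] := C1_bound f2 Ug.
have [d1 d10 D1] := C1_chart Uo f1 Ug ltr01; have [d2 d20 D2] := C1_chart Uo f2 Ug ltr01.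
have [d3 d30 D3] := C1_taylor Uo f1 Ug ltr01; have [d4 d40 D4] := C1_taylor Uo f2 Ug ltr01.
have [m3 A1] := periodic_bounded (f := fun t => complex.Re (A (cis t) g i j))
  (fun t => congr1 (fun z => complex.Re (A z g i j)) (cis_per t)) (A_ccont i j Ug).1.
have [m4 A2] := periodic_bounded (f := fun t => complex.Im (A (cis t) g i j))
  (fun t => congr1 (fun z => complex.Im (A z g i j)) (cis_per t)) (A_ccont i j Ug).2.
have E12 : m1 + m2 + 2 = (1 + m1) + (1 + m2) by ring.
have E12' : m1 + m2 + 2 = (m1 + 1) + (m2 + 1) by ring.
have m30 : 0 <= m3 by apply: le_trans (A1 0).
have m40 : 0 <= m4 by apply: le_trans (A2 0).
have bA u t : nc (dA i j g t (0, u)) <= (m1 + m2) * `|u|.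
  apply: le_trans (nc_le _) _; rewrite mulrDl -(norm0l u).
  by apply: lerD; [exact: B1|exact: B2].
have bAc (u : C2fun) t : `|u| < Num.min d3 d4 ->
    nc (A (cis t) (chart g u) i j - A (cis t) g i j) <= (m1 + m2 + 2) * `|u|.
  rewrite lt_min => /andP[u3 u4]; have h3 := D3 u u3 t; have h4 := D4 u u4 t.
  have := B1 t (0, u); have := B2 t (0, u); rewrite norm0l => b2 b1.
  apply: le_trans (nc_le _) _; rewrite ReD ImD ReN ImN.
  have e1 : `|complex.Re (A (cis t) (chart g u) i j) - complex.Re (A (cis t) g i j)| <= (m1 + 1) * `|u|.
    rewrite -[X in `|X|](subrK (dr (fun z g => complex.Re (A z g i j)) t g (0, u))).
    by apply: le_trans (ler_normD _ _) _; rewrite mulrDl addrC; exact: lerD.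
  have e2 : `|complex.Im (A (cis t) (chart g u) i j) - complex.Im (A (cis t) g i j)| <= (m2 + 1) * `|u|.
    rewrite -[X in `|X|](subrK (dr (fun z g => complex.Im (A z g i j)) t g (0, u))).
    by apply: le_trans (ler_normD _ _) _; rewrite mulrDl addrC; exact: lerD.
  apply: le_trans (lerD e1 e2) _; rewrite -mulrDl ler_wpM2r// E12'; exact: lexx.
pose m := (m1 + m2 + 2) + (m3 + m4) + (m1 + m2 + 2).
have E0 : 0 <= m1 + m2 + 2 by clear - m10 m20; lra.
have Em : m1 + m2 + 2 <= m by rewrite /m; clear - m30 m40 m10 m20; lra.
have Em' : m1 + m2 <= m by apply: le_trans Em; rewrite lerDl.
exists m, (Num.min 1 (Num.min (Num.min d1 d2) (Num.min d3 d4))); split.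
- split; first by apply: lt_le_trans Em; clear - m10 m20; lra.
  by rewrite !lt_min ltr01 d10 d20 d30.
- move=> u; rewrite 2!lt_min => /and3P[_ + _]; rewrite lt_min => /andP[u1 u2].
  by have [] := D1 u u1.
- move=> u; rewrite 2!lt_min => /and3P[u0 + u34] t; rewrite lt_min => /andP[u1 u2].
  have [_ _ E1] := D1 u u1; have [_ _ E2] := D2 u u2.
  apply: le_trans (ncD _ _) _; rewrite !ncM nc_i !nc_circle mul1r !mulr1.
  have h1 : nc (dA i j (chart g u) t (1, 0)) <= m1 + m2 + 2.
    apply: le_trans (nc_le _) _ => /=.
    have := E1 t (1, 0); have := E2 t (1, 0); have := B1 t (1, 0); have := B2 t (1, 0).
    rewrite norm0r normr1 !mulr1 => b2 b1 c2 c1.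
    have e1 := le_trans (ler_normD _ _) (lerD c1 b1); rewrite subrK in e1.
    have e2 := le_trans (ler_normD _ _) (lerD c2 b2); rewrite subrK in e2.
    by rewrite E12; exact: lerD e1 e2.
  have h2 : nc (A (cis t) (chart g u) i j) <= (m3 + m4) + (m1 + m2 + 2).
    rewrite -[A (cis t) (chart g u) i j](subrK (A (cis t) g i j)).
    apply: le_trans (ncD _ _) _; rewrite addrC; apply: lerD.
      by apply: le_trans (nc_le _) _; apply: lerD; [exact: A1|exact: A2].
    apply: le_trans (bAc u t u34) _; by rewrite ler_piMr ?(ltW u0).
  by apply: le_trans (lerD h1 h2) _; rewrite /m addrA.
- move=> u; rewrite 2!lt_min => /and3P[u0 _ u34] t.
  rewrite /den -mulrBl ncM nc_circle mulr1; apply: le_trans (bAc u t u34) _.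
  by rewrite ler_wpM2r.
- move=> u t; rewrite /dden ncM nc_circle mulr1; apply: le_trans (bA u t) _.
  by rewrite ler_wpM2r.
Qed.

Lemma den_taylor g i j (e : R) : U g -> 0 < e -> exists2 d : R, 0 < d & forall u : C2fun, `|u| < d ->
  forall t, nc (den i j (chart g u) t - den i j g t - dden i j g u t) <= e * `|u|.
Proof.
move=> Ug e0; have e2 : 0 < e / 2 by rewrite divr_gt0.
have [f1 f2] := AC1 i j.
have [d3 d30 D3] := C1_taylor Uo f1 Ug e2; have [d4 d40 D4] := C1_taylor Uo f2 Ug e2.
exists (Num.min d3 d4); first by rewrite lt_min d30.
move=> u; rewrite lt_min => /andP[u3 u4] t; have h3 := D3 u u3 t; have h4 := D4 u u4 t.
rewrite /den /dden -mulrBl -mulrBl ncM nc_circle mulr1.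
apply: le_trans (nc_le _) _; rewrite !ReD !ImD !ReN !ImN.
by apply: le_trans (lerD h3 h4) _; rewrite -mulrDl -splitr.
Qed.

(** Common constants for all matrix entries: the sum of the m_i, and the inverse of the sum of the 1
    / d_i, with a summand 1 added to stay positive when I is empty. *)
Lemma finite_bounds (I : finType) (P : I -> R -> R -> Prop) :
  (forall i m m' d d', m <= m' -> d' <= d -> P i m d -> P i m' d') ->
  (forall i, exists m d, [/\ 0 < m, 0 < d & P i m d]) ->
  exists m d, [/\ 0 < m, 0 < d & forall i, P i m d].
Proof.
move=> mono Pex.
have /choice[f H] (i : I) : exists md : R * R, [/\ 0 < md.1, 0 < md.2 & P i md.1 md.2].
  by have [m [d h]] := Pex i; exists (m, d).
exists (1 + \sum_i (f i).1), (1 + \sum_i (f i).2^-1)^-1.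
have p1 i : 0 <= (f i).1 by have [/ltW h _ _] := H i.
have p2 i : 0 <= (f i).2^-1 by have [_ /ltW h _] := H i; rewrite invr_ge0.
split.
- by rewrite ltr_wpDr// sumr_ge0.
- by rewrite invr_gt0 ltr_wpDr// sumr_ge0.
move=> i; have [h1 h2 h3] := H i; apply: mono h3.
  by rewrite (bigD1 i)//= addrCA lerDl addr_ge0// sumr_ge0.
rewrite -[leRHS]invrK lef_pV2 ?posrE ?invr_gt0//.
  by rewrite (bigD1 i)//= addrCA lerDl addr_ge0// sumr_ge0.
by rewrite ltr_wpDr// sumr_ge0.
Qed.

Lemma ccontB (F G : R -> C) : ccont F -> ccont G -> ccont (fun t => F t - G t).
Proof.
move=> Fc Gc; have -> : (fun t => F t - G t) = (fun t => F t + -1 * G t).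
  by apply/funext => t; rewrite mulN1r.
by apply: ccontD => //; exact: ccontZ.
Qed.

Definition idx (sg : bool) (k : nat) : int := if sg then - k%:Z else k%:Z.

Lemma idx_inj sg : injective (idx sg).
Proof. by move=> a b; case: sg => /= [/oppr_inj|] []. Qed.

(* Ysum (bsq true h) x solves the system in x in the disk, and
   Ysum (bsq false h) x^-1 solves it outside. *)
Definition bsq (sg : bool) (h : Diff2) (k : nat) : M := if k is 0 then 0 else Bcoef A (idx sg k) h.

Definition dB (h : Diff2) (u : C2fun) (n : int) : M := \matrix_(i, j) - fc (dden i j h u) n.

Definition dbsq (sg : bool) (h : Diff2) (u : C2fun) (k : nat) : M :=
  if k is 0 then 0 else dB h u (idx sg k).

Lemma dden_linear i j h (a : R) u v t :
  dden i j h (a *: u + v) t = a%:C * dden i j h u t + dden i j h v t.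
Proof.
rewrite /dden mulrA -mulrDl -dA_linear; congr (dA i j h t _ * _).
by rewrite -[RHS]/(a *: 0 + 0, a *: u + v) scaler0 addr0.
Qed.

Lemma dB_linear h (a : R) u v n : U h -> dB h (a *: u + v) n = a%:C *: dB h u n + dB h v n.
Proof.
move=> Uh; apply/matrixP => i j; rewrite !mxE.
have c1 := dden_ccont i j u Uh; have c2 := dden_ccont i j v Uh.
have -> : dden i j h (a *: u + v) = fun t => a%:C * dden i j h u t + dden i j h v t.
  by apply/funext => t; exact: dden_linear.
by rewrite fcD ?fcZ//; [rewrite mulrN opprD|exact: ccontZ].
Qed.

Lemma subE (X Y : M) i j : (X - Y) i j = X i j - Y i j.
Proof. by rewrite !mxE. Qed.

(** The inequality of Bessel for the angular derivative of the density bounds n b_n in l^2 and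
    yields [wbd]. The increment and the variation of the density are bounded by |u| without an
    angular derivative, and yield [fbd] only. *)
Lemma coef_bounds g : U g -> exists (m d : R), [/\ 0 < m /\ 0 < d,
  forall u : C2fun, `|u| < d -> U (chart g u) /\ diffeo2 (mulcis g (C2fun_val u)),
  forall sg (u : C2fun), `|u| < d -> wbd (bsq sg (chart g u)) m,
  forall sg (u : C2fun), `|u| < d -> fbd wt (bsq sg (chart g u) - bsq sg g) (m * `|u|) &
  forall sg (u : C2fun), fbd wt (dbsq sg g u) (m * `|u|)].
Proof.
move=> Ug.
have [d0 d00 D0] : exists2 d : R, 0 < d & forall u : C2fun, `|u| < d ->
    U (chart g u) /\ diffeo2 (mulcis g (C2fun_val u)).
  have /Diff2_nbhsP[d1 d10 D1] : nbhs g U by exact: open_nbhs_nbhs.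
  have [d2 d20 D2] := chart_near g d10; have [d3 d30 D3] := mulcis_diffeo g.
  exists (Num.min d2 d3); first by rewrite lt_min d20.
  by move=> u; rewrite lt_min => /andP[u2 u3]; split; [apply: D1; exact: D2|exact: D3].
pose P (ij : 'I_N * 'I_N) (m d : R) := [/\
  forall u : C2fun, `|u| < d -> forall t, nc (den1 ij.1 ij.2 (chart g u) t) <= m,
  forall u : C2fun, `|u| < d -> forall t, nc (den ij.1 ij.2 (chart g u) t - den ij.1 ij.2 g t) <= m * `|u| &
  forall (u : C2fun) t, nc (dden ij.1 ij.2 g u t) <= m * `|u|].
have [m [d [m0 d0' H]]] : exists m d : R, [/\ 0 < m, 0 < d & forall ij, P ij m d].
  apply: finite_bounds.
    move=> ij m m' d d' mm' dd' [h1 h2 h3]; split.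
    - by move=> u ud t; apply: le_trans (h1 u (lt_le_trans ud dd') t) mm'.
    - move=> u ud t; apply: le_trans (h2 u (lt_le_trans ud dd') t) _; by rewrite ler_wpM2r.
    - by move=> u t; apply: le_trans (h3 u t) _; rewrite ler_wpM2r.
  move=> [i j]; have [m [d [[m0 dp] _ h1 h2 h3]]] := den_bounds i j Ug.
  by exists m, d; split.
pose K : R := (N * N)%:R * 6; have K0 : 0 <= K by rewrite mulr_ge0.
have scl (x : R) : 0 <= x -> (N * N)%:R * (6 * (m * x)) <= ((K + 1) * m) * x.
  move=> x0; have mx0 : 0 <= m * x by rewrite mulr_ge0// ltW.
  by rewrite -mulrA mulrA -/K mulrDl mul1r lerDl.
exists ((K + 1) * m), (Num.min d0 d); split.
- by split; [rewrite mulr_gt0// ltr_wpDl|rewrite lt_min d00].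
- by move=> u; rewrite lt_min => /andP[/D0].
- move=> sg u; rewrite lt_min => /andP[u0 ud]; have [Uu _] := D0 u u0.
  rewrite -[X in wbd _ X]mulr1; apply: wbd_le (scl 1 ler01); rewrite mulr1.
  apply: wbd_entries => [|//|i j k]; first exact: ltW.
  have [h1 _ _] := H (i, j).
  apply: le_trans (bessel k (@idx_inj sg) (den1_ccont i j Uu) (h1 u ud)).
  apply: ler_sum => n _; rewrite lerXn2r// ?nnegrE ?mulr_ge0 ?nc_ge0//.
  case: (n : nat) => [|n']; first by rewrite mul0r nc_ge0.
  rewrite /bsq Bcoef_fc// ncN (fc_derive _ (den1_ccont i j Uu) (fun t => den_cder i j t Uu)); last exact: den_per.
  rewrite (ncM (- _)) ncN (ncM 'i%R) nc_i mul1r; suff -> : nc ((idx sg n'.+1)%:~R : C) = n'.+1%:R by [].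
  by rewrite /idx; case: (sg); rewrite ?mulrNz ?ncN nc_nat.
- move=> sg u; rewrite lt_min => /andP[u0 ud]; have [Uu _] := D0 u u0.
  apply: fbd_le (scl _ (normr_ge0 u)); apply: fbd_entries => [|i j k].
    by rewrite mulr_ge0// ltW.
  have [_ h2 _] := H (i, j).
  have cc : ccont (fun t => den i j (chart g u) t - den i j g t).
    by apply: ccontB; exact: den_ccont.
  apply: le_trans (bessel k (@idx_inj sg) cc (h2 u ud)).
  apply: ler_sum => n _; rewrite lerXn2r// ?nnegrE ?nc_ge0//.
  rewrite seqE; case: (n : nat) => [|n']; first by rewrite subrr mxE nc0 nc_ge0.
  rewrite fcB; [|exact: den_ccont|exact: den_ccont].
  rewrite le_eqVlt; apply/orP; left; apply/eqP; apply: etrans (ncN _); congr nc.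
  apply: etrans (subE _ _ _ _) _.
  apply: etrans (congr2 (fun x y => x - y) (Bcoef_fc (idx sg n'.+1) i j Uu) (Bcoef_fc (idx sg n'.+1) i j Ug)) _.
  by rewrite opprB opprK addrC.
- move=> sg u.
  apply: fbd_le (scl _ (normr_ge0 u)); apply: fbd_entries => [|i j k].
    by rewrite mulr_ge0// ltW.
  have [_ _ h3] := H (i, j).
  apply: le_trans (bessel k (@idx_inj sg) (dden_ccont i j u Ug) (h3 u)).
  apply: ler_sum => n _; rewrite lerXn2r// ?nnegrE ?nc_ge0//.
  by case: (n : nat) => [|n'] /=; rewrite mxE ?nc0 ?nc_ge0// ncN.
Qed.

(** The radius depends on n; [fbd_small] makes this sufficient for the whole series. *)
Lemma B_taylor g n (e : R) : U g -> 0 < e -> exists2 d : R, 0 < d & forall u : C2fun, `|u| < d ->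
  mnorm (Bcoef A n (chart g u) - Bcoef A n g - dB g u n) <= e * `|u|.
Proof.
move=> Ug e0; have [m [d [_ d0 H]]] : exists (m d : R), [/\ 0 < m, 0 < d & forall ij : 'I_N * 'I_N,
    forall u : C2fun, `|u| < d -> U (chart g u) /\
    nc (fc (fun t => den ij.1 ij.2 (chart g u) t - den ij.1 ij.2 g t - dden ij.1 ij.2 g u t) n) <=
      e / (N * N).+1%:R * `|u|].
  apply: finite_bounds.
    by move=> ij m m' d d' _ dd' h u ud; apply: h; exact: lt_le_trans dd'.
  move=> [i j]; have e2 : 0 < e / (N * N).+1%:R / 2 by rewrite !divr_gt0.
  have [d d0 D] := den_taylor i j Ug e2; have [m [d' [[_ d'0] D' _ _ _]]] := den_bounds i j Ug.
  exists 1, (Num.min d d'); split; [exact: ltr01|by rewrite lt_min d0|].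
  move=> u; rewrite lt_min => /andP[ud ud']; have [Uu _] := D' u ud'; split; first exact: Uu.
  change (nc (fc (fun t => den i j (chart g u) t - den i j g t - dden i j g u t) n) <=
    e / (N * N).+1%:R * `|u|).
  have -> : e / (N * N).+1%:R * `|u| = 2 * (e / (N * N).+1%:R / 2 * `|u|) by rewrite mulrA [2 * _]mulrC divfK ?pnatr_eq0.
  apply: fc_bound; last exact: D.
  by apply: ccontB; [apply: ccontB; exact: den_ccont|exact: dden_ccont].
exists d => // u ud; apply: (@le_trans _ _ ((N * N)%:R * (e / (N * N).+1%:R * `|u|))).
  apply: mnorm_le_entries => i j; have [Uu h] := H (i, j) u ud.
  have E : fc (fun t => den i j (chart g u) t - den i j g t - dden i j g u t) n =
      fc (den i j (chart g u)) n - fc (den i j g) n - fc (dden i j g u) n.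
    rewrite fcB; [|by apply: ccontB; exact: den_ccont|exact: dden_ccont].
    by rewrite fcB; [|exact: den_ccont|exact: den_ccont].
  have {}h : nc (fc (fun t => den i j (chart g u) t - den i j g t - dden i j g u t) n) <=
    e / (N * N).+1%:R * `|u| by exact: h.
  apply: le_trans h; rewrite E le_eqVlt; apply/orP; left; apply/eqP; apply: etrans (ncN _); congr nc.
  apply: etrans (subE _ _ _ _) _; rewrite opprB opprD addrC /dB mxE; congr (_ + _); first exact: opprK.
  apply: etrans (subE _ _ _ _) _.
  by apply: etrans (congr2 (fun x y => x - y) (Bcoef_fc n i j Uu) (Bcoef_fc n i j Ug)) _.
rewrite mulrA ler_wpM2r// mulrCA ger_pMr// ler_pdivrMr// mul1r ler_nat.
exact: leqnSn.
Qed.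

End coefs.

(** * Differentiability on the diffeomorphism group *)

Section hasdiff.
Context {R : realType} {N : nat}.
Local Notation C := R[i].
Local Notation circle := (circle R).
Local Notation Diff2 := (Diff2 R).
Local Notation C2fun := (C2fun R).
Local Notation M := 'M[C]_N.

Definition rho (u : C2fun) : R := `|u|.

Lemma rho_ge0 u : 0 <= rho u. Proof. exact: normr_ge0. Qed.

Lemma rho_small (e : R) : 0 < e -> \forall u \near (0 : C2fun), rho u <= e.
Proof.
move=> e0; apply/nbhs_norm0P; exists e => //= u /=; exact: ltW.
Qed.

Lemma near_chart (P : C2fun -> Prop) : (\forall u \near (0 : C2fun), P u) <->
  exists2 d : R, 0 < d & forall u : C2fun, `|u| < d -> P u.
Proof.
split=> [/nbhs_norm0P[d /= d0 dP]|[d d0 dP]]; first by exists d.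
by apply/nbhs_norm0P; exists d.
Qed.

Definition rlin (L : C2fun -> M) :=
  (forall (a : R) u v, L (a *: u + v) = a%:C *: L u + L v) /\
  exists2 K : R, 0 < K & forall u, mnorm (L u) <= K * `|u|.

Definition hasdiff (F : Diff2 -> M) (g : Diff2) (L : C2fun -> M) :=
  lapp (nbhs (0 : C2fun)) rho (fun u => F (chart g u)) (F g) L /\ rlin L.

Lemma rlin_lbd L : rlin L -> lbd (nbhs (0 : C2fun)) rho L.
Proof. by move=> [_ [K K0 LK]]; exists K => //; apply: nearW => u; exact: LK. Qed.

Lemma rlin_cst0 : rlin (fun=> 0).
Proof.
split; first by move=> a u v; rewrite scaler0 addr0.
by exists 1 => // u; rewrite mnorm0 mul1r.
Qed.

Lemma rlinD L K : rlin L -> rlin K -> rlin (fun u => L u + K u).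
Proof.
move=> [l1 [c c0 lc]] [k1 [d d0 kd]]; split.
  by move=> a u v; rewrite l1 k1 scalerDr addrACA.
exists (c + d); first by rewrite addr_gt0.
by move=> u; rewrite (le_trans (mnormD _ _))// mulrDl lerD.
Qed.

Lemma rlin_lmul A L : rlin L -> rlin (fun u => A *m L u).
Proof.
move=> [l1 [c c0 lc]]; split.
  by move=> a u v; rewrite l1 mulmxDr scalemxAr.
exists ((mnorm A + 1) * c); first by rewrite mulr_gt0// ltr_wpDl// mnorm_ge0.
by move=> u; rewrite (le_trans (mnormM _ _))// -mulrA ler_pM ?mnorm_ge0 ?lerDl.
Qed.

Lemma rlin_rmul A L : rlin L -> rlin (fun u => L u *m A).
Proof.
move=> [l1 [c c0 lc]]; split.
  by move=> a u v; rewrite l1 mulmxDl scalemxAl.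
exists (c * (mnorm A + 1)); first by rewrite mulr_gt0// ltr_wpDl// mnorm_ge0.
by move=> u; rewrite (le_trans (mnormM _ _))// mulrAC ler_pM ?mnorm_ge0 ?lerDl.
Qed.

Lemma rlinN L : rlin L -> rlin (fun u => - L u).
Proof.
move=> [l1 [c c0 lc]]; split; first by move=> a u v; rewrite l1 opprD scalerN.
by exists c => // u; rewrite mnormN.
Qed.

Lemma hasdiff_cst A g : hasdiff (fun=> A) g (fun=> 0).
Proof. by split; [apply: lapp_cst; exact: rho_ge0|exact: rlin_cst0]. Qed.

Lemma hasdiffM F G g L K : hasdiff F g L -> hasdiff G g K ->
  hasdiff (fun h => F h *m G h) g (fun u => L u *m G g + F g *m K u).
Proof.
move=> [f1 f2] [g1 g2]; split.
  apply: (lappM rho_ge0 rho_small f1 _ g1); exact: rlin_lbd.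
by apply: rlinD; [exact: rlin_rmul|exact: rlin_lmul].
Qed.

Lemma hasdiff_near F G g L : F g = G g ->
  (\forall u \near (0 : C2fun), F (chart g u) = G (chart g u)) -> hasdiff F g L -> hasdiff G g L.
Proof.
move=> FGg FG [f1 f2]; split => //; rewrite -FGg; exact: (lapp_ext FG f1).
Qed.

(** [lapp_inv] asks for a bound on the inverses G near g. It follows from G = g0 - g0 (F - F g) G,
    where the last product has norm at most |G| / 2 once u is small. *)
Lemma hasdiff_inv F g L : (\forall u \near (0 : C2fun), F (chart g u) \in unitmx) -> F g \in unitmx ->
  hasdiff F g L -> hasdiff (fun h => invmx (F h)) g (fun u => - (invmx (F g) *m L u *m invmx (F g))).
Proof.
move=> Fu Fg [f1 f2]; have Lb := rlin_lbd f2.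
split; last by apply: rlinN; apply: rlin_rmul; exact: rlin_lmul.
have [d d0 df] := lapp_lip f1 Lb.
set g0 := invmx (F g); have m0 : 0 < mnorm g0 + 1 by rewrite ltr_wpDl// mnorm_ge0.
have e0 : 0 < (2 * ((mnorm g0 + 1) * d))^-1 by rewrite invr_gt0 !mulr_gt0.
apply: (lapp_inv (c := 2 * (mnorm g0 + 1)) rho_ge0 rho_small f1 Lb).
- by apply: filterS Fu => u; exact: mulmxV.
- exact: mulVmx.
have := rho_small e0; move: Fu df; apply: filterS3 => u Fu df ru.
have fg : F (chart g u) *m invmx (F (chart g u)) = 1%:M by exact: mulmxV.
set G := invmx _ in fg *.
have gB : G = g0 - g0 *m (F (chart g u) - F g) *m G.
  by rewrite mulmxBr (mulVmx Fg) mulmxBl -mulmxA fg mulmx1 mul1mx opprB addrC subrK.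
have h1 : mnorm (g0 *m (F (chart g u) - F g) *m G) <= 1 / 2 * mnorm G.
  apply: le_trans (mnormM _ _) _; rewrite ler_wpM2r ?mnorm_ge0//.
  apply: le_trans (mnormM _ _) _; apply: (@le_trans _ _ ((mnorm g0 + 1) * (d * rho u))).
    by apply: ler_pM; rewrite ?mnorm_ge0 ?lerDl.
  rewrite mulrA; apply: (@le_trans _ _ ((mnorm g0 + 1) * d * (2 * ((mnorm g0 + 1) * d))^-1)).
    by rewrite ler_wpM2l// mulr_ge0 ?(ltW m0) ?(ltW d0).
  by rewrite invfM mulrCA mulfV ?mulr1 ?div1r// gt_eqF// mulr_gt0.
have : mnorm G <= mnorm g0 + 1 / 2 * mnorm G.
  by rewrite {1}gB; apply: le_trans (mnormB _ _) _; rewrite lerD2l.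
have := mnorm_ge0 g0; lra.
Qed.

Lemma rlin0 L : rlin L -> L 0 = 0.
Proof.
move=> [l1 _]; have := l1 0 0 0; rewrite scaler0 addr0 scale0r add0r => _.
have := l1 1 0 0; rewrite scaler0 addr0 scale1r => /eqP.
by rewrite -subr_eq0 opprD addNKr oppr_eq0 => /eqP.
Qed.

Lemma rlinZ L (a : R) u : rlin L -> L (a *: u) = a%:C *: L u.
Proof. by move=> Ll; have := Ll.1 a u 0; rewrite !addr0 (rlin0 Ll) addr0. Qed.

Lemma hasdiff_dir F g L u : hasdiff F g L -> forall i j,
  cder (fun s : R => F (chart g (s *: u)) i j) 0 (L u i j).
Proof.
move=> [f1 f2] i j.
have key (e : R) : 0 < e -> \forall s \near (0 : R),
    nc (F (chart g (s *: u)) i j - F g i j - s%:C * L u i j) <= e * `|s|.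
  move=> e0; have e1 : 0 < e / (`|u| + 1) by rewrite divr_gt0// ltr_wpDl.
  have cs : (s *: u) @[s --> (0 : R)] --> (0 : C2fun).
    by rewrite -[X in _ --> X](scale0r u); apply: cvgZr_tmp; exact: cvg_id.
  have h : \forall s \near (0 : R), mnorm (F (chart g (s *: u)) - F g - L (s *: u)) <=
      e / (`|u| + 1) * rho (s *: u).
    exact: (cs _ (f1 _ e1)).
  apply: filterS h => s h.
  have -> : F (chart g (s *: u)) i j - F g i j - s%:C * L u i j =
      (F (chart g (s *: u)) - F g - L (s *: u)) i j.
    by rewrite (rlinZ _ _ f2) !mxE.
  apply: le_trans (mnorm_entry _ _ _) _; apply: le_trans h _.
  rewrite /rho normrZ mulrCA mulrC ler_wpM2r// -[leRHS]mulr1 -!mulrA ler_wpM2l ?(ltW e0)//.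
  by rewrite mulrC ler_pdivrMr ?mul1r ?lerDl// ltr_wpDl.
split; apply: is_derive_eps => e /key; apply: filterS => s h.
  rewrite add0r scale0r chart0; apply: le_trans h; apply: le_trans (nc_Re _).
  by rewrite !ReD !ReN ReM /= mul0r subr0.
rewrite add0r scale0r chart0; apply: le_trans h; apply: le_trans (nc_Im _).
by rewrite !ImD !ImN ImM /= mul0r addr0.
Qed.

Lemma hasdiff_uniq F g L K : hasdiff F g L -> hasdiff F g K -> L = K.
Proof.
move=> h1 h2; apply/funext => u; apply/matrixP => i j.
exact: cder_uniq (hasdiff_dir u h1 i j) (hasdiff_dir u h2 i j).
Qed.

Lemma hasdiffP F g L : hasdiff F g L -> forall i j,
  differentiable_Diff2 (fun h => F h i j) g /\
  forall u, diff_Diff2 (fun h => F h i j) g u = L u i j.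
Proof.
move=> [f1 [l1 [K K0 LK]]] i j.
have near_e (e : R) : 0 < e -> \forall u \near (0 : C2fun),
    nc (F (chart g u) i j - F g i j - L u i j) <= e * `|u|.
  move=> e0; apply: filterS (f1 e e0) => u h.
  by apply: le_trans h; rewrite -subE -subE mnorm_entry.
have [d1 D1] : differentiable (fun u : C2fun => complex.Re (F (chart g u) i j)) (0 : C2fun) /\
    forall u, 'd (fun u : C2fun => complex.Re (F (chart g u) i j)) (0 : C2fun) u = complex.Re (L u i j).
  apply: (@eps_diff _ _ _ (fun u => complex.Re (L u i j)) K).
  - by move=> a u v; rewrite l1 !mxE ReD ReM /= mul0r subr0.
  - by move=> u; apply: le_trans (nc_Re _) (le_trans (mnorm_entry _ _ _) (LK u)).
  move=> e /near_e; apply: filterS => u; rewrite chart0; apply: le_trans.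
  by apply: le_trans (nc_Re _); rewrite !ReD !ReN.
have [d2 D2] : differentiable (fun u : C2fun => complex.Im (F (chart g u) i j)) (0 : C2fun) /\
    forall u, 'd (fun u : C2fun => complex.Im (F (chart g u) i j)) (0 : C2fun) u = complex.Im (L u i j).
  apply: (@eps_diff _ _ _ (fun u => complex.Im (L u i j)) K).
  - by move=> a u v; rewrite l1 !mxE ImD ImM /= mul0r addr0.
  - by move=> u; apply: le_trans (nc_Im _) (le_trans (mnorm_entry _ _ _) (LK u)).
  move=> e /near_e; apply: filterS => u; rewrite chart0; apply: le_trans.
  by apply: le_trans (nc_Im _); rewrite !ImD !ImN.
split; first by split.
by move=> u; rewrite /diff_Diff2 D1 D2; case: (L u i j).
Qed.

Lemma differentiable_hasdiff (F : Diff2 -> M) g : (forall i j, differentiable_Diff2 (fun h => F h i j) g) ->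
  exists L, hasdiff F g L.
Proof.
move=> dF; pose L u : M := \matrix_(i, j) diff_Diff2 (fun h => F h i j) g u.
exists L; split.
  move=> e e0; apply/near_chart.
  have [m [d [_ d0 H]]] : exists (m d : R), [/\ 0 < m, 0 < d & forall ij : 'I_N * 'I_N,
      forall u : C2fun, `|u| < d -> nc ((F (chart g u) - F g - L u) ij.1 ij.2) <= e / (N * N).+1%:R * `|u|].
    apply: finite_bounds.
      by move=> ij m m' d d' _ dd' h u ud; apply: h; exact: lt_le_trans dd'.
    move=> [i j]; have e2 : 0 < e / (N * N).+1%:R / 2 by rewrite !divr_gt0.
    have [d1 d2] := dF i j; have [_ /(_ _ e2)/near_chart[a a0 D1]] := diff_eps d1.
    have [_ /(_ _ e2)/near_chart[b b0 D2]] := diff_eps d2.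
    exists 1, (Num.min a b); split; [exact: ltr01|by rewrite lt_min a0|].
    move=> u; rewrite lt_min => /andP[ua ub]; have := D1 u ua; have := D2 u ub.
    rewrite !chart0 => h2 h1; apply: le_trans (nc_le _) _.
    rewrite !subE !ReD !ImD !ReN !ImN [L u _ _]mxE /=.
    by apply: le_trans (lerD h1 h2) _; rewrite -mulrDl -splitr.
  exists d => // u ud; apply: (@le_trans _ _ ((N * N)%:R * (e / (N * N).+1%:R * `|u|))).
    by apply: mnorm_le_entries => i j; exact: (H (i, j) u ud).
  rewrite /rho mulrA ler_wpM2r// mulrCA ger_pMr// ler_pdivrMr// mul1r ler_nat.
  exact: leqnSn.
split.
  move=> a u v; apply/matrixP => i j; rewrite !mxE /diff_Diff2 !linearP.
  by apply: complex_eqP; rewrite ?ReD ?ImD ?ReM ?ImM /= mul0r ?subr0 ?addr0.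
have [m [d [m0 _ H]]] : exists (m d : R), [/\ 0 < m, 0 < d & forall ij : 'I_N * 'I_N,
    forall u : C2fun, nc (L u ij.1 ij.2) <= m * `|u|].
  apply: finite_bounds.
    by move=> ij m m' d d' mm' _ h u; apply: le_trans (h u) _; rewrite ler_wpM2r.
  move=> [i j]; have [d1 d2] := dF i j; have [[a a0 D1] _] := diff_eps d1.
  have [[b b0 D2] _] := diff_eps d2.
  exists (a + b), 1; split; [by rewrite addr_gt0|exact: ltr01|].
  move=> u; apply: le_trans (nc_le _) _; rewrite [L u _ _]mxE mulrDl.
  by apply: lerD; [exact: D1|exact: D2].
exists ((N * N)%:R * m + 1); first by rewrite ltr_wpDl// mulr_ge0// ltW.
move=> u; apply: (@le_trans _ _ ((N * N)%:R * (m * `|u|))).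
  by apply: mnorm_le_entries => i j; exact: (H (i, j) u).
by rewrite mulrDl mul1r mulrA lerDl.
Qed.

(* Complex linear extension of L, evaluated on the field L_m. *)
Definition cplx (g : Diff2) (m : int) (L : C2fun -> M) : M :=
  L (tangent_Re g (L_ m g)) + 'i%R *: L (tangent_Im g (L_ m g)).

Lemma lie_cplx F g L m : hasdiff F g L -> lie_mx (L_ m) F g = cplx g m L.
Proof.
move=> h; apply/matrixP => i j; rewrite /lie_mx mxE /lie_derivative /cplx.
have [_ D] := hasdiffP h i j; rewrite [RHS]mxE [in RHS]mxE.
by congr (_ + _ * _); exact: D.
Qed.

Lemma cplxD g m L K : cplx g m (fun u => L u + K u) = cplx g m L + cplx g m K.
Proof. by rewrite /cplx scalerDr addrACA. Qed.

Lemma cplxN g m L : cplx g m (fun u => - L u) = - cplx g m L.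
Proof. by rewrite /cplx scalerN opprD. Qed.

Lemma cplx_lmul g m A L : cplx g m (fun u => A *m L u) = A *m cplx g m L.
Proof. by rewrite /cplx scalemxAr -mulmxDr. Qed.

Lemma cplx_rmul g m A L : cplx g m (fun u => L u *m A) = cplx g m L *m A.
Proof. by rewrite /cplx scalemxAl -mulmxDl. Qed.

Lemma cplx_dense g L : rlin L -> (forall m, cplx g m L = 0) -> forall u, L u = 0.
Proof.
move=> [l1 [K K0 LK]] Lm u; apply/matrixP => i j; rewrite [RHS]mxE.
have Ll : rlin L by split => //; exists K.
apply: (@trig_dense R g (fun u => L u i j) K).
- by move=> v w; have := l1 1 v w; rewrite !scale1r => ->; rewrite mxE.
- by move=> a v; rewrite (rlinZ _ _ Ll) mxE.
- by move=> v; apply: le_trans (mnorm_entry _ _ _) (LK v).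
- by move=> m; have := congr1 (fun X : M => X i j) (Lm m); rewrite /cplx !mxE.
Qed.

Lemma hasdiff_flat_cst (U : set Diff2) (F : Diff2 -> M) : open U -> connected U ->
  (forall g, U g -> hasdiff F g (fun=> 0)) -> forall g h, U g -> U h -> F h = F g.
Proof.
move=> Uo Uc dF g h Ug Uh; apply/matrixP => i j.
apply: (flat_cst (Phi := fun k => F k i j) Uo Uc) => // k Uk u.
by have := hasdiff_dir u (dF k Uk) i j; rewrite mxE.
Qed.

End hasdiff.

(** * Differentiability of the series solutions *)

Section ydiff.
Context {R : realType} {N : nat}.
Local Notation C := R[i].
Local Notation circle := (circle R).
Local Notation Diff2 := (Diff2 R).
Local Notation C2fun := (C2fun R).
Local Notation M := 'M[C]_N.

Lemma dsolD (b f p : nat -> M) : b 0%N = 0 -> dsol b (f + p) = dsol b f + dsol b p.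
Proof.
move=> b0; rewrite /dsol; have [f0 fn] := gsolP (- conv f (ysol b)) b0.
have [p0 pn] := gsolP (- conv p (ysol b)) b0.
apply: gsol_uniq => //; rewrite convDl opprD; split.
  by rewrite -[LHS]/(gsol b (- conv f (ysol b)) 0%N + gsol b (- conv p (ysol b)) 0%N) f0 p0.
move=> n n0; rewrite -[RHS]/((- conv f (ysol b)) n + (- conv p (ysol b)) n) -fn// -pn//.
rewrite thetaD convDr.
rewrite -[LHS]/(theta (gsol b (- conv f (ysol b))) n + theta (gsol b (- conv p (ysol b))) n +
  (conv b (gsol b (- conv f (ysol b))) n + conv b (gsol b (- conv p (ysol b))) n)).
by rewrite addrACA.
Qed.

Lemma mnorm_scalar (c : C) : mnorm (c%:M : M) <= N%:R * nc c.
Proof.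
rewrite -[c%:M]scalemx1 mnormZ mulrC ler_wpM2r ?nc_ge0//.
rewrite /mnorm; apply: (@le_trans _ _ (\sum_(i < N) 1)); last by rewrite sumr_const card_ord.
apply: ler_sum => i _; rewrite (bigD1 i)//= big1 ?addr0 => [|j ji].
  by rewrite mxE eqxx nc1.
by rewrite mxE eq_sym (negbTE ji) nc0.
Qed.

Variables (U : set Diff2) (A : circle -> Diff2 -> M).
Hypotheses (Uo : open U) (AC1 : C1_on_mx U A).

Lemma rlin_dB g n : U g -> rlin (fun u => dB A g u n).
Proof.
move=> Ug; split; first by move=> a u v; exact: (dB_linear AC1).
have [m [d [[m0 d0] cU _ _ fb]]] := coef_bounds Uo AC1 Ug.
have [sg [k nk]] : exists sg k, n = idx sg k.
  by case: n => k; [exists false, k|exists true, k.+1; rewrite /idx NegzE].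
(* [dbsq] is 0 at index 0 by definition and says nothing about the moment of index 0, which is
   bounded directly. *)
case: k nk => [|k] nk.
  have [M0 [M1 [_ _ h]]] : exists (M d : R), [/\ 0 < M, 0 < d & forall ij : 'I_N * 'I_N,
      forall u : C2fun, nc (dB A g u n ij.1 ij.2) <= M * `|u|].
    apply: finite_bounds.
      by move=> ij M0 M1 d1 d2 h1 _ h u; apply: le_trans (h u) _; rewrite ler_wpM2r.
    move=> [i j]; have [M0 [d1 [[M00 d10] _ _ _ h]]] := den_bounds Uo AC1 i j Ug.
    exists (2 * M0), d1; split; [by rewrite mulr_gt0|exact: d10|].
    move=> u; rewrite /dB mxE ncN -mulrA; apply: fc_bound; last exact: h.
    exact: (dden_ccont AC1).
  exists ((N * N)%:R * `|M0| + 1); first by rewrite ltr_wpDl// mulr_ge0.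
  move=> u; apply: (@le_trans _ _ ((N * N)%:R * (`|M0| * `|u|))).
    apply: mnorm_le_entries => i j; apply: le_trans (h (i, j) u) _.
    by rewrite ler_wpM2r// ler_norm.
  by rewrite mulrDl mul1r mulrA lerDl.
exists (m * k.+1%:R); first by rewrite mulr_gt0// ltr0n.
move=> u; have := fb sg u k.+2; rewrite big_ord_recr /= -nk => h.
have h2 : wt k.+1 * mnorm (dB A g u n) / (maxn 1 k.+1)%:R <= m * `|u|.
  apply: le_trans h; rewrite lerDr; apply: sumr_ge0 => i _.
  by rewrite !mulr_ge0 ?invr_ge0 ?wt_ge0 ?mnorm_ge0.
have e1 : maxn 1 k.+1 = k.+1 by lia.
move: h2; rewrite e1 ler_pdivrMr ?ltr0n// mulrAC; apply: le_trans.
by rewrite ler_peMl ?mnorm_ge0 ?wt_ge1.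
Qed.

Lemma rlin_dbsq sg g k : U g -> rlin (fun u => dbsq A sg g u k).
Proof. by move=> Ug; case: k => [|k]; [exact: rlin_cst0|exact: rlin_dB]. Qed.

Lemma Bcoef_hasdiff n g : U g -> hasdiff (Bcoef A n) g (fun u => dB A g u n).
Proof.
move=> Ug; split; last exact: rlin_dB.
move=> e e0; apply/near_chart; have [d d0 D] := B_taylor Uo AC1 n Ug e0.
by exists d => // u; exact: D.
Qed.

Lemma bsq_hasdiff sg k g : U g -> hasdiff (fun h => bsq A sg h k) g (fun u => dbsq A sg g u k).
Proof. by move=> Ug; case: k => [|k]; [exact: hasdiff_cst|exact: Bcoef_hasdiff]. Qed.

(* The variation of the coefficients of b_g (x), when x moves with logarithmic
   velocity k u. *)
Definition kseq sg g (k : C2fun -> C) (u : C2fun) (n : nat) : M :=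
  dbsq A sg g u n + (n%:R * k u) *: bsq A sg g n.

Lemma bsq_wbd sg g : U g -> exists2 m : R, 0 < m & wbd (bsq A sg g) m.
Proof.
move=> Ug; have [m [d [[m0 d0] _ wb _ _]]] := coef_bounds Uo AC1 Ug; exists m => //.
by have := wb sg 0; rewrite normr0 chart0; exact.
Qed.

Lemma kseq_fbd sg g (k : C2fun -> C) : U g -> (forall u, nc (k u) <= `|u|) ->
  exists2 m : R, 0 < m & forall u, fbd wt (kseq sg g k u) (m * `|u|).
Proof.
move=> Ug kb; have [m [d [[m0 d0] _ wb _ fb]]] := coef_bounds Uo AC1 Ug.
exists (m + m); first by rewrite addr_gt0.
move=> u; rewrite mulrDl.
have -> : kseq sg g k u = dbsq A sg g u + (fun n => (n%:R * k u) *: bsq A sg g n) by [].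
apply: (fbdD (@weight_wt R)); first exact: fb.
have wg : wbd (bsq A sg g) m by have := wb sg 0; rewrite normr0 chart0; exact.
apply: fbd_le (ler_wpM2l (ltW m0) (kb u)); apply: fbd_factor => //; first exact: nc_ge0.
by move=> n; rewrite ncM nc_nat.
Qed.

Lemma fbd_dil_le (x : C) (f : nat -> M) c : nc x <= 1 -> fbd wt f c -> fbd wt (dil x f) c.
Proof.
move=> x1; apply: fbd_mono; first exact: weight_wt.
move=> n; rewrite /dil mnormZ ler_piMl ?mnorm_ge0//; exact: ncX_le1.
Qed.

Lemma dsol_bd (b f : nat -> M) beta c : b 0%N = 0 -> wbd b beta -> fbd wt f c ->
  mnorm (msum (dsol b f)) <= vc beta * (c * @yc R N beta).
Proof. by move=> b0 bb fc; apply: mnorm_msum; exact: dsol_wbd. Qed.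

Lemma rlin_dsol (b : nat -> M) beta (f : C2fun -> nat -> M) c : b 0%N = 0 -> wbd b beta -> 0 < c ->
  (forall u, fbd wt (f u) (c * `|u|)) ->
  (forall (a : R) u v, f (a *: u + v) = (fun n => a%:C *: f u n) + f v) ->
  rlin (fun u => msum (dsol b (f u))).
Proof.
move=> b0 bb c0 fb fl; split.
  move=> a u v; rewrite fl dsolD// dsolZ//.
  have w1 := dsol_wbd b0 bb (fb u); have w2 := dsol_wbd b0 bb (fb v).
  rewrite (msumD (wbdZ (a := fun=> a%:C) (d := nc a%:C) (fun=> lexx _) w1) w2); congr (_ + _).
  exact: msumZ w1.
have V0 := vc_ge0 (wbd_ge0 bb); have Y0 : 0 <= @yc R N beta := yc_ge0 (wbd_ge0 bb).
exists (vc beta * (c * @yc R N beta) + 1); first by apply: ltr_wpDl => //; apply: (mulr_ge0 V0); exact: (mulr_ge0 (ltW c0) Y0).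
move=> u; apply: le_trans (dsol_bd b0 bb (fb u)) _.
have -> : vc beta * (c * `|u| * @yc R N beta) = vc beta * (c * @yc R N beta) * `|u| by ring.
by apply: ler_wpM2r; [exact: normr_ge0|rewrite lerDl].
Qed.

(* X^k = x0^k (1 + k kappa) + o, by induction on k *)
Lemma lapp_pow (X : Diff2 -> C) (k : C2fun -> C) g n :
  (forall (a : R) u v, k (a *: u + v) = a%:C * k u + k v) -> (forall u, nc (k u) <= `|u|) ->
  hasdiff (fun h => (X h)%:M : M) g (fun u => (X g * k u)%:M) ->
  hasdiff (fun h => (X h ^+ n)%:M : M) g (fun u => (X g ^+ n * (n%:R * k u))%:M).
Proof.
move=> kl kb Xd; elim: n => [|n IH].
  have -> : (fun u => (X g ^+ 0 * (0%:R * k u))%:M : M) = fun=> 0.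
    by apply/funext => u; rewrite mul0r mulr0 raddf0.
  exact: hasdiff_cst.
have := hasdiffM Xd IH.
have -> : (fun h => (X h)%:M *m (X h ^+ n)%:M : M) = (fun h => (X h ^+ n.+1)%:M).
  by apply/funext => h; rewrite -scalar_mxM exprS.
have -> // : (fun u => (X g * k u)%:M *m (X g ^+ n)%:M + (X g)%:M *m (X g ^+ n * (n%:R * k u))%:M : M) =
  fun u => (X g ^+ n.+1 * (n.+1%:R * k u))%:M.
apply/funext => u; rewrite -!scalar_mxM -raddfD; congr (_%:M).
by rewrite exprS -natr1 /=; ring.
Qed.

(** Coefficients and point of evaluation vary together. The point may lie on the unit circle, the
    edge of the domain of the series; its motion is therefore treated as a variation of the
    coefficients x^n b_n, to which [ysol_diff] applies. A general X covers both the moving boundary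
    points and the fixed points of the disk. *)
Lemma Ysum_hasdiff sg g (X : Diff2 -> C) (k : C2fun -> C) : U g ->
  (forall h, nc (X h) <= 1) ->
  (forall (a : R) u v, k (a *: u + v) = a%:C * k u + k v) -> (forall u, nc (k u) <= `|u|) ->
  (forall e : R, 0 < e -> \forall u \near (0 : C2fun), nc (X (chart g u) - X g - X g * k u) <= e * `|u|) ->
  hasdiff (fun h => Ysum (bsq A sg h) (X h)) g
    (fun u => msum (dsol (dil (X g) (bsq A sg g)) (dil (X g) (kseq sg g k u)))).
Proof.
move=> Ug X1 kl kb Xe; have [m [d [[m0 d0] cU wb fb db]]] := coef_bounds Uo AC1 Ug.
have [c c0 kfb] := kseq_fbd sg Ug kb; have [mg _ _] := bsq_wbd sg Ug.
have wg : wbd (bsq A sg g) m by have := wb sg 0; rewrite normr0 chart0; exact.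
set x0 := X g; have x01 : nc x0 <= 1 by exact: X1.
have b00 : dil x0 (bsq A sg g) 0%N = 0 by exact: dil0.
have b0b : wbd (dil x0 (bsq A sg g)) m by exact: wbd_dil.
have kfb' u : fbd wt (dil x0 (kseq sg g k u)) (c * `|u|) by apply: fbd_dil_le.
have Xd : hasdiff (fun h => (X h)%:M : M) g (fun u => (X g * k u)%:M).
  split.
    move=> e e0; have e1 : 0 < e / (N%:R + 1) by rewrite divr_gt0// ltr_wpDl.
    apply: filterS (Xe _ e1) => u h; rewrite -!raddfB /=.
    apply: le_trans (mnorm_scalar _) _; apply: le_trans (ler_wpM2l (ler0n _ _) h) _.
    rewrite /rho mulrA ler_wpM2r// mulrCA ger_pMr// ler_pdivrMr ?ltr_wpDl// mul1r.
    by rewrite lerDl.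
  split.
    by move=> a u v; rewrite scale_scalar_mx -raddfD /= kl; congr (_%:M); ring.
  exists (N%:R + 1); first by rewrite ltr_wpDl.
  move=> u; apply: le_trans (mnorm_scalar _) _; rewrite ncM mulrDl mul1r.
  apply: (@le_trans _ _ (N%:R * `|u|)); last by rewrite lerDl.
  rewrite ler_wpM2l//; apply: le_trans (kb u).
  by rewrite ler_piMl ?nc_ge0.
split; last first.
  apply: (rlin_dsol b00 b0b c0 kfb') => a u v; apply/funext => n.
  rewrite -[RHS]/(a%:C *: (x0 ^+ n *: kseq sg g k u n) + x0 ^+ n *: kseq sg g k v n).
  rewrite /dil /kseq kl (rlin_dbsq sg n Ug).1; apply/matrixP => i j; rewrite !mxE; ring.
have lipX : exists2 a : R, 0 < a & \forall u \near (0 : C2fun), nc (X (chart g u) - x0) <= a * `|u|.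
  exists 2 => //; apply: filterS (Xe 1 ltr01) => u h.
  rewrite -[X (chart g u) - x0](subrK (x0 * k u)); apply: le_trans (ncD _ _) _.
  have -> : 2 * `|u| = 1 * `|u| + `|u| by ring.
  apply: lerD => //; rewrite ncM; apply: le_trans (kb u); by rewrite ler_piMl ?nc_ge0.
have [a a0 Xa] := lipX.
have rhoE (u : C2fun) : rho u = `|u| by [].
apply: (ysol_diff (F := nbhs (0 : C2fun)) (rho := rho)
  (b := fun u => dil (X (chart g u)) (bsq A sg (chart g u)))
  (f := fun u => dil x0 (kseq sg g k u)) (b0 := dil x0 (bsq A sg g)) (beta := m) (c := m + m * a + c)).
- exact: b00.
- by move=> u; exact: dil0.
- by move=> u; rewrite /dil /kseq /= scaler0 addr0 scaler0.
- by rewrite !addr_ge0 ?mulr_ge0 ?(ltW m0) ?(ltW a0) ?(ltW c0).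
- exact: rho_ge0.
- exact: rho_small.
- exact: b0b.
- apply/near_chart; exists d; first exact: d0.
  by move=> u ud; apply: wbd_dil; [exact: X1|exact: wb].
- have Xn : \forall u \near (0 : C2fun), `|u| < d by apply/near_chart; exists d; [exact: d0|].
  move: Xn Xa; apply: filterS2 => u ud ua.
  (* Increment of the coefficients at the new point, plus displacement of the point for the old
     coefficients. *)
  have -> : dil (X (chart g u)) (bsq A sg (chart g u)) - dil x0 (bsq A sg g) =
      dil (X (chart g u)) (bsq A sg (chart g u) - bsq A sg g) +
      (dil (X (chart g u)) (bsq A sg g) - dil x0 (bsq A sg g)).
    apply/funext => n; rewrite -[LHS]/(X (chart g u) ^+ n *: bsq A sg (chart g u) n - x0 ^+ n *: bsq A sg g n).
    rewrite -[RHS]/(X (chart g u) ^+ n *: (bsq A sg (chart g u) n - bsq A sg g n) +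
      (X (chart g u) ^+ n *: bsq A sg g n - x0 ^+ n *: bsq A sg g n)).
    by rewrite scalerBr addrA subrK.
  apply: (@fbd_le _ _ _ _ (m * `|u| + m * (a * `|u|))).
    apply: (fbdD (@weight_wt R)); first by apply: fbd_dil_le; [exact: X1|exact: fb].
    apply: fbd_le (ler_wpM2l (ltW m0) ua).
    by apply: fbd_dil; [exact: x01|exact: X1|exact: wg].
  rewrite rhoE mulrA -mulrDl ler_wpM2r// lerDl; exact: ltW.
- apply/near_chart; exists 1; first exact: ltr01.
  move=> u _; apply: fbd_le (kfb' u) _.
  by rewrite rhoE ler_wpM2r// lerDr addr_ge0 ?mulr_ge0 ?(ltW m0) ?(ltW a0).
(* For a fixed n this is the product rule for X^n b_n. *)
- move=> n e e0.
  have := (hasdiffM (lapp_pow n kl kb Xd) (bsq_hasdiff sg n Ug)).1 e e0.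
  apply: filterS => u; rewrite !mul_scalar_mx.
  have E : dil x0 (kseq sg g k u) n = (X g ^+ n * (n%:R * k u)) *: bsq A sg g n + X g ^+ n *: dbsq A sg g u n.
    by rewrite /dil /kseq scalerDr scalerA addrC.
  move=> h; apply: le_trans h; rewrite le_eqVlt; apply/orP; left; apply/eqP.
  by congr (mnorm (_ - _)); exact: E.
Qed.

End ydiff.

(** * The deformation equations in terms of sequences *)

Section recursion.
Context {R : realType} {N : nat}.
Local Notation C := R[i].
Local Notation M := 'M[C]_N.
Implicit Types (b f p q v w D : nat -> M).

Lemma dsol_dil x b f : b 0%N = 0 -> dsol (dil x b) (dil x f) = dil x (dsol b f).
Proof.
move=> b0; rewrite /dsol ysol_dil// conv_dil -gsol_dil//; congr (gsol _ _).
by apply/funext => n; rewrite /dil -[RHS]/(x ^+ n *: - conv f (ysol b) n) scalerN.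
Qed.

Lemma theta_dsol b f : b 0%N = 0 -> f 0%N = 0 ->
  theta (dsol b f) = - conv f (ysol b) - conv b (dsol b f).
Proof.
move=> b0 f0; have [d0 dn] := gsolP (- conv f (ysol b)) b0.
apply/funext => -[|n].
  rewrite -[RHS]/(- conv f (ysol b) 0%N - conv b (dsol b f) 0%N).
  have z p q : p 0%N = 0 -> conv p q 0%N = 0 by move=> p0; rewrite /conv big_ord1 p0 mul0mx.
  by rewrite (z f)// (z b)// oppr0 addr0 /theta scale0r.
rewrite -[RHS]/((- conv f (ysol b)) n.+1 - conv b (dsol b f) n.+1) -dn//.
by rewrite addrK.
Qed.

Lemma dsol0 b f : f 0%N = 0 -> dsol b f 0%N = 0.
Proof. by move=> f0; rewrite /dsol /gsol /= -[LHS]/(- conv f (ysol b) 0%N) /conv big_ord1 f0 mul0mx oppr0. Qed.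

Lemma solves_dsol b f d : b 0%N = 0 -> f 0%N = 0 -> d 0%N = 0 ->
  theta d = - conv f (ysol b) - conv b d -> d = dsol b f.
Proof.
move=> b0 f0 d0 td; apply: esym; apply: gsol_uniq => //; split.
  by rewrite d0 -[RHS]/(- conv f (ysol b) 0%N) /conv big_ord1 f0 mul0mx oppr0.
by move=> n _; rewrite td -[LHS]/(- conv f (ysol b) n - conv b d n + conv b d n) subrK.
Qed.

(* x d/dx of x |-> ysol (dil x b) *)
Lemma dsol_theta b (c : C) : b 0%N = 0 ->
  dsol b (fun n => (n%:R * c) *: b n) = c *: theta (ysol b).
Proof.
move=> b0; have E : (fun n => (n%:R * c) *: b n) = c *: theta b.
  by apply/funext => n; rewrite -[RHS]/(c *: (n%:R *: b n)) scalerA mulrC.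
have thZ (p : nat -> M) : theta (c *: p) = c *: theta p.
  by apply/funext => n; rewrite -[LHS]/(n%:R *: (c *: p n)) -[RHS]/(c *: (n%:R *: p n)) !scalerA mulrC.
apply: esym; apply: solves_dsol => //.
- by rewrite b0 scaler0.
- by rewrite -[LHS]/(c *: (0%:R *: ysol b 0%N)) scale0r scaler0.
rewrite E thZ convZl convZr theta_ysol// thetaN theta_conv theta_ysol//.
by rewrite opprD scalerDr !scalerN.
Qed.

(* The logarithmic derivative (y C)' (y C)^-1 of y C for y = ysol b, when b' = f
   and C' C^-1 = K. *)
Definition wseq b f (K : M) : nat -> M := conv (dsol b f + conv (ysol b) (cst K)) (yinv b).

Lemma wseq0 b f K : f 0%N = 0 -> wseq b f K 0%N = K.
Proof.
move=> f0; rewrite /wseq /conv big_ord1 yinv0 mulmx1.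
rewrite -[LHS]/(dsol b f 0%N + conv (ysol b) (cst K) 0%N) dsol0// add0r conv_cstr.
by rewrite ysol0 mul1mx.
Qed.

(** The compatibility of the variation with x d/dx: it results from varying x dY/dx = - b Y when b
    varies by f and w is the logarithmic derivative of Y. *)
Definition wrec b f w := theta w = - f + conv w b - conv b w.

(** The constant K is absent from the relation; it only fixes the entry of index 0, by [wseq0]. *)
Lemma wseq_rec b f K : b 0%N = 0 -> f 0%N = 0 -> wrec b f (wseq b f K).
Proof.
move=> b0 f0; rewrite /wrec {1}/wseq theta_conv theta_yinv// convA -/(wseq b f K).
rewrite thetaD theta_conv theta_cst theta_ysol// theta_dsol//.
have -> : conv (ysol b) 0 = 0.
  by apply/funext => n; rewrite /conv big1// => i _; rewrite mulmx0.
suff -> : conv (- conv f (ysol b) - conv b (dsol b f) + (conv (- conv b (ysol b)) (cst K) + 0)) (yinv b) =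
    - f - conv b (wseq b f K) by rewrite addrAC.
rewrite /wseq (convA b) convDr (convA b (ysol b)) addr0 !convNl !convDl !convNl -(convA f).
by rewrite ysolK// conv1r opprD addrA.
Qed.

(** As b_0 = 0, the commutator at index n only contains entries of index below n, so the entry at 0
    determines the sequence. *)
Lemma wrec_uniq b f v w : b 0%N = 0 -> v 0%N = w 0%N -> wrec b f v -> 
  (forall n, (0 < n)%N -> theta w n = (- f + conv w b - conv b w) n) -> v = w.
Proof.
move=> b0 vw0 vr wr; apply/funext => n; elim/ltn_ind: n => -[//|n] IH.
have e1 : theta v n.+1 = (- f + conv v b - conv b v) n.+1 by rewrite vr.
have e2 := wr n.+1 isT.
have c1 : conv v b n.+1 = conv w b n.+1.
  rewrite !conv_rev; apply: eq_bigr => -[[|i] /= ilt] _; first by rewrite b0 !mulmx0.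
  by rewrite IH// subSS ltnS leq_subr.
have c2 : conv b v n.+1 = conv b w n.+1.
  rewrite /conv; apply: eq_bigr => -[[|i] /= ilt] _; first by rewrite b0 !mul0mx.
  by rewrite IH// subSS ltnS leq_subr.
have : theta v n.+1 = theta w n.+1.
  rewrite e1 e2 -[LHS]/(- f n.+1 + conv v b n.+1 - conv b v n.+1).
  by rewrite -[RHS]/(- f n.+1 + conv w b n.+1 - conv b w n.+1) c1 c2.
rewrite /theta => /(congr1 (fun X => n.+1%:R^-1 *: X)).
by rewrite !scalerA mulVf ?pnatr_eq0// !scale1r.
Qed.

Lemma conv_comm b v n : conv v b n - conv b v n = \sum_(i < n.+1) commutator (v (n - i)%N) (b i).
Proof. by rewrite conv_rev /conv -sumrB. Qed.

(** Exterior side: v_0 = 0 removes the term i = n, so the sum stops at n - 1, and the sign of v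
    reverses the commutators. *)
Lemma comm_sum_minus (B : int -> M) b v (m : int) n : B 0 = 0 -> (0 < n)%N ->
  (forall k, b k = B k%:Z) -> v 0%N = 0 -> (forall j, v j.+1 = - B (m + j.+1%:Z)) ->
  conv v b n - conv b v n =
    \sum_(0 <= k < n) commutator (B k%:Z) (B (m + n%:Z - k%:Z)).
Proof.
move=> B0 n0 bE v0 vE; rewrite conv_comm big_ord_recr /= subnn v0.
rewrite {2}/commutator mul0mx mulmx0 subrr addr0 big_mkord; apply: eq_bigr => i _.
have ilt := ltn_ord i; rewrite bE.
have -> : (n - i = (n - i).-1.+1)%N by lia.
rewrite vE; have -> : m + (n - i).-1.+1%:Z = m + n%:Z - i%:Z by lia.
by rewrite /commutator mulNmx mulmxN opprK addrC.
Qed.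

(** Interior side: v_0 = B_m stays and b_0 = 0 removes the other end, so the sum runs over 1, ...,
    n. The asymmetry with the exterior side reflects the normalization at infinity, where the
    logarithmic derivative vanishes. *)
Lemma comm_sum_plus (B : int -> M) b v (m : int) n : (0 < n)%N ->
  b 0%N = 0 -> (forall k, b k.+1 = B (- k.+1%:Z)) -> (forall j, v j = B (m - j%:Z)) ->
  conv v b n - conv b v n =
    - \sum_(1 <= k < n.+1) commutator (B (- k%:Z)) (B (m - n%:Z + k%:Z)).
Proof.
move=> n0 b0 bE vE; rewrite conv_comm big_ord_recl b0.
rewrite {1}/commutator mul0mx mulmx0 subrr add0r big_add1 /= big_mkord -sumrN; apply: eq_bigr => i _.
have ilt := ltn_ord i; rewrite /bump leq0n add1n bE vE.
have -> : m - (n - i.+1)%N%:Z = m - n%:Z + i.+1%:Z by lia.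
by rewrite /commutator opprB.
Qed.

End recursion.

(** * Uniqueness of Fourier coefficients *)

Section fourier.
Context {R : realType} {N : nat}.
Local Notation C := R[i].
Local Notation M := 'M[C]_N.

(** If all coefficients vanish, so do the polynomials [fsum n F], which after normalization
    approximate F by [fsum_approx]. That estimate concerns real functions, hence the separate
    treatment of the two parts. *)
Lemma fc_zero (F : R -> C) : ccont F -> (forall t, F (t + pi *+ 2) = F t) ->
  (forall n, fc F n = 0) -> forall t, F t = 0.
Proof.
move=> Fc Fp F0.
have fs0 n t : fsum n F t = 0 by rewrite /fsum big1// => k _; rewrite F0 mul0r mulr0.
have ReS n t : complex.Re (fsum n (fun s => (complex.Re (F s))%:C) t) = complex.Re (fsum n F t).
  rewrite !fsum_int//; last by split; [exact: Fc.1|move=> s; exact: cvg_cst].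
  have -> : ((pi *+ 2)%:C)^-1 = ((pi *+ 2)^-1)%:C :> C by rewrite fmorphV.
  have ReZ (a : R) (z : C) : complex.Re (a%:C * z) = a * complex.Re z.
    by case: z => x y /=; rewrite mul0r subr0.
  rewrite !ReZ; congr (_ * rint _); apply/funext => s.
  by rewrite ![_ * (kr _ _)%:C]mulrC !ReZ.
have ImS n t : complex.Re (fsum n (fun s => (complex.Im (F s))%:C) t) = complex.Im (fsum n F t).
  rewrite !fsum_int//; last by split; [exact: Fc.2|move=> s; exact: cvg_cst].
  have -> : ((pi *+ 2)%:C)^-1 = ((pi *+ 2)^-1)%:C :> C by rewrite fmorphV.
  have ReZ (a : R) (z : C) : complex.Re (a%:C * z) = a * complex.Re z.
    by case: z => x y /=; rewrite mul0r subr0.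
  have ImZ (a : R) (z : C) : complex.Im (a%:C * z) = a * complex.Im z.
    by case: z => x y /=; rewrite mul0r addr0.
  rewrite ReZ ImZ; congr (_ * rint _); apply/funext => s.
  by rewrite ![_ * (kr _ _)%:C]mulrC ReZ ImZ.
have key (f : R -> R) : (forall t, f (t + pi *+ 2) = f t) -> continuous f ->
    (forall n t, complex.Re (fsum n (fun s => (f s)%:C) t) = 0) -> forall t, f t = 0.
  move=> fp cf f0 t; apply/eqP; rewrite -normr_le0 leNgt; apply/negP => ft.
  (* Both e and M0 / (n + 1) are at most |f t| / 4, which leads to |f t| <= |f t| / 2. *)
  have e0 : 0 < `|f t| / 4 by rewrite divr_gt0.
  have [M0 M00 hM] := periodic_unif fp cf e0.
  pose n := Num.bound (M0 / (`|f t| / 4)).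
  have nM : M0 / n.+1%:R <= `|f t| / 4.
    rewrite ler_pdivrMr ?ltr0n// -ler_pdivrMl// mulrC.
    have : 0 <= M0 / (`|f t| / 4) by rewrite divr_ge0 ?(ltW e0).
    by move=> /archi_boundP/ltW h; apply: le_trans h _; rewrite ler_nat.
  have := fsum_approx n cf (fun s => hM s t); rewrite f0 sub0r normrN normrM ger0_norm//.
  have c0 : 0 < ('C(n + n, n)%:R : R) by rewrite ltr0n bin_gt0 leq_addr.
  rewrite ler_pM2l//; move: nM; move: (M0 / n.+1%:R) => X nM h; lra.
move=> t; apply: complex_eqP.
  apply: (key (fun t => complex.Re (F t))); first by move=> s; rewrite Fp.
    exact: Fc.1.
  by move=> n s; rewrite ReS fs0.
apply: (key (fun t => complex.Im (F t))); first by move=> s; rewrite Fp.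
  exact: Fc.2.
by move=> n s; rewrite ImS fs0.
Qed.

Lemma ccont_unif (F : R -> C) : (forall e : R, 0 < e -> exists2 G : R -> C, ccont G &
  forall t, nc (F t - G t) <= e) -> ccont F.
Proof.
move=> FG.
have aux (f : R -> R) : (forall e : R, 0 < e -> exists2 g : R -> R, continuous g &
    forall t, `|f t - g t| <= e) -> continuous f.
  move=> fg t; apply/cvgrPdist_le => e e0; have e3 : 0 < e / 3 by rewrite divr_gt0.
  have [g gc gf] := fg _ e3; have /cvgrPdist_le/(_ _ e3) := gc t.
  apply: filterS => s gs; have h1 := gf t; have h2 := gf s.
  have -> : f t - f s = (f t - g t) + (g t - g s) - (f s - g s) by ring.
  apply: le_trans (ler_normB _ _) _; apply: le_trans (lerD (ler_normD _ _) (lexx _)) _.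
  by apply: le_trans (lerD (lerD h1 gs) h2) _; rewrite -[e in leRHS](@divfK _ 3)//; lra.
split; apply: aux => e e0; have [G [G1 G2] GF] := FG e e0.
  exists (fun t => complex.Re (G t)) => // t; apply: le_trans (GF t).
  by apply: le_trans (nc_Re _); rewrite ReD ReN.
exists (fun t => complex.Im (G t)) => // t; apply: le_trans (GF t).
by apply: le_trans (nc_Im _); rewrite ImD ImN.
Qed.

Definition coefz (p : nat -> M) (k : int) : M := if k is Posz a then p a else 0.

(** Here [sg] gives the sign of the exponent: [true] stands for a series in e^(-it). For [bsq] and
    [bpt], on the contrary, [true] is the inside of the disk, with a series in positive powers of
    the boundary point. *)
Definition tser (m : int) (sg : bool) (p : nat -> M) (i j : 'I_N) (t : R) : C :=
  ek m t * msum (dil (ek ((-1) ^+ sg) t) p) i j.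

Section tser.
Variables (m : int) (sg : bool) (p : nat -> M) (c : R) (i j : 'I_N).
Hypothesis pc : wbd p c.

Definition tpart K (t : R) : C := \sum_(k < K) p k i j * ek (m + (-1) ^+ sg * k%:Z) t.

Lemma ccont_tpart K : ccont (tpart K).
Proof. by apply: ccont_sum => k; apply: ccontZ; exact: ccont_ek. Qed.

Lemma ekX (s : int) n (t : R) : ek s t ^+ n = ek (s * n%:Z) t.
Proof. by elim: n => [|n IH]; rewrite ?expr0 ?mulr0 ?ek0// exprS IH -ekD; congr (ek _ _); lia. Qed.

Lemma tser_tail K t : nc (tser m sg p i j t - tpart K t) <= (N * N)%:R * (2 * c) / wt K.
Proof.
have dc : wbd (dil (ek ((-1) ^+ sg) t) p) c by apply: wbd_dil => //; rewrite nc_ek.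
have h := msumP dc K; apply: le_trans h.
have -> : tser m sg p i j t - tpart K t =
    ek m t * (msum (dil (ek ((-1) ^+ sg) t) p) - \sum_(k < K) dil (ek ((-1) ^+ sg) t) p k) i j.
  rewrite subE mulrBr; congr (_ - _); rewrite summxE mulr_sumr; apply: eq_bigr => k _.
  by rewrite /dil mxE ekX ekD; ring.
by rewrite ncM nc_ek mul1r mnormBC; exact: mnorm_entry.
Qed.

Lemma tail_small (e : R) : 0 < e -> exists K, (N * N)%:R * (2 * c) / wt K <= e.
Proof.
move=> e0; have [K hK] := wt_large ((N * N)%:R * (2 * c) / e).
by exists K; rewrite ler_pdivrMr ?wt_gt0// [leRHS]mulrC -ler_pdivrMr//.
Qed.

Lemma ccont_tser : ccont (tser m sg p i j).
Proof.
apply: ccont_unif => e /tail_small[K hK]; exists (tpart K); first exact: ccont_tpart.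
by move=> t; apply: le_trans (tser_tail K t) hK.
Qed.

Lemma tser_per t : tser m sg p i j (t + pi *+ 2) = tser m sg p i j t.
Proof. by rewrite /tser !ek_per. Qed.

Lemma fc_ek a b : fc (ek a : R -> C) b = (a + b == 0)%:R.
Proof.
rewrite /fc; have -> : (fun t => ek a t * ek b t) = ek (a + b) :> (R -> C).
  by apply/funext => t; rewrite ekD.
by rewrite cint_ek; case: eqP => _; rewrite ?mulr0 ?mulVf ?twopiC_neq0.
Qed.

Lemma fc_sum I (r : seq I) (F : I -> R -> C) n : (forall i, ccont (F i)) ->
  fc (fun t => \sum_(i <- r) F i t) n = \sum_(i <- r) fc (F i) n.
Proof.
move=> Fc; elim: r => [|k r IH].
  rewrite big_nil; have -> : (fun t => \sum_(i <- [::]) F i t) = (fun t => 0 * (0 : C)).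
    by apply/funext => t; rewrite big_nil mul0r.
  exact: etrans (@fcZ R 0 (fun=> 0) n (ccont_cst 0)) (mul0r _).
rewrite big_cons -IH -fcD; [|exact: Fc|exact: ccont_sum].
by apply: (congr1 (fun G => fc G n)); apply/funext => t; rewrite big_cons.
Qed.

(** By the convention of [fc], index - n is the coefficient of e^(int), and (-1)^sg (n - m) is the k
    with m + (-1)^sg k = n. Partial sums long enough to reach this index already have the right
    coefficient, and the tails tend to 0. *)
Lemma fc_tser n : fc (tser m sg p i j) (- n) = coefz p ((-1) ^+ sg * (n - m)) i j.
Proof.
set a := (-1) ^+ sg * (n - m).
have part K : (`|a| < K)%N -> fc (tpart K) (- n) = coefz p a i j.
  move=> aK; rewrite fc_sum => [|k]; last by apply: ccontZ; exact: ccont_ek.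
  have -> : \sum_(k < K) fc (fun t => p k i j * ek (m + (-1) ^+ sg * k%:Z) t) (- n) =
      \sum_(k < K) p k i j * (m + (-1) ^+ sg * k%:Z - n == 0)%:R.
    by apply: eq_bigr => k _; rewrite fcZ ?fc_ek//; exact: ccont_ek.
  have E (k : 'I_K) : (m + (-1) ^+ sg * k%:Z - n == 0) = (k%:Z == a).
    by rewrite /a; case: (sg); rewrite ?expr0 ?expr1; apply/eqP/eqP; lia.
  under eq_bigr do rewrite E.
  case: a aK {E} => [a'|a'] aK /=; last first.
    by rewrite big1 ?mxE// => k _; rewrite mulr0.
  rewrite (bigD1 (Ordinal (aK : (a' < K)%N)))//= eqxx mulr1 big1 ?addr0// => k kn.
  by case: eqP => [[ka]|_]; rewrite ?mulr0//; move: kn; rewrite -val_eqE /= ka eqxx.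
apply/eqP; rewrite -subr_eq0 -nc_eq0 eq_le nc_ge0 andbT.
apply: (@le_div_wt _ _ (2 * ((N * N)%:R * (2 * c)))) => K.
set K' := maxn K `|a|.+1; have aK' : (`|a| < K')%N by rewrite leq_max ltnSn orbT.
rewrite -(part K' aK') -fcB; [|exact: ccont_tser|exact: ccont_tpart].
apply: (@le_trans _ _ (2 * ((N * N)%:R * (2 * c) / wt K'))).
  apply: fc_bound; last by move=> t; exact: tser_tail.
  by apply: ccontB; [exact: ccont_tser|exact: ccont_tpart].
have X0 : 0 <= (N * N)%:R * (2 * c) by rewrite mulr_ge0// mulr_ge0// (wbd_ge0 pc).
rewrite -[leRHS]mulrA; apply: ler_wpM2l => //; apply: ler_wpM2l => //.
by rewrite lef_pV2 ?posrE ?wt_gt0// le_wt// leq_maxl.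
Qed.

End tser.

End fourier.

(** * Power series of the system and its solutions *)

Section calA.
Context {R : realType} {N : nat}.
Local Notation C := R[i].
Local Notation circle := (circle R).
Local Notation Diff2 := (Diff2 R).
Local Notation M := 'M[C]_N.

(** [wt K] <= K + 1, and (K + 1) r^K <= 1 + r + ... + r^K <= 1 / (1 - r). *)
Lemma geo_rate (r : R) : 0 <= r -> r < 1 -> exists2 c : R, 0 < c & forall K, r ^+ K <= c / wt K.
Proof.
move=> r0 r1; have d0 : 0 < 1 - r by rewrite subr_gt0.
exists (1 - r)^-1; first by rewrite invr_gt0.
move=> K; rewrite ler_pdivlMr ?wt_gt0// -[leRHS]mul1r ler_pdivlMr//.
have w1 : wt K <= K.+1%:R :> R.
  have w0 := @wt_ge1 R K; have w4 : wt K ^+ 4 = K.+1%:R :> R.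
    by rewrite /wt (exprM _ 2 2) sqr_sqrtr ?sqrtr_ge0// sqr_sqrtr.
  by rewrite -w4 exprS ler_peMr ?exprn_ege1// wt_ge0.
apply: (@le_trans _ _ (K.+1%:R * r ^+ K * (1 - r))).
  by rewrite ler_wpM2r ?(ltW d0)// mulrC ler_wpM2r ?exprn_ge0.
have h : (1 - r) * \sum_(i < K.+1) r ^+ i = 1 - r ^+ K.+1.
  by rewrite -[RHS]opprB subrX1 -mulNr opprB.
apply: (@le_trans _ _ (1 - r ^+ K.+1)); last by rewrite gerBl exprn_ge0.
rewrite -h mulrC ler_wpM2l ?(ltW d0)//.
have -> : K.+1%:R * r ^+ K = \sum_(i < K.+1) r ^+ K by rewrite sumr_const card_ord mulr_natl.
apply: ler_sum => i _; have iK : (i <= K)%N by rewrite -ltnS.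
have -> : r ^+ K = r ^+ (K - i) * r ^+ i by rewrite -exprD subnK.
rewrite ler_piMl ?exprn_ge0//.
by rewrite exprn_ile1// ltW.
Qed.

Lemma geo_in (z x : C) n : z != 0 -> z - x != 0 ->
  (z - x)^-1 = \sum_(k < n) x ^+ k * z ^- k.+1 + x ^+ n * z ^- n * (z - x)^-1.
Proof.
move=> z0 zx; elim: n => [|n IH]; first by rewrite big_ord0 add0r !expr0 invr1 !mul1r.
rewrite {1}IH big_ord_recr /= -addrA; congr (_ + _).
have zn : z ^+ n != 0 by rewrite expf_neq0.
by rewrite !exprS; field; rewrite z0 zn zx.
Qed.

Lemma geo_out (z x : C) n : x != 0 -> z - x != 0 ->
  (z - x)^-1 = - (\sum_(k < n) x ^- k.+1 * z ^+ k) + x ^- n * z ^+ n * (z - x)^-1.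
Proof.
move=> x0 zx; elim: n => [|n IH]; first by rewrite big_ord0 oppr0 add0r !expr0 invr1 !mul1r.
rewrite {1}IH big_ord_recr /= opprD -addrA; congr (_ + _).
have xn : x ^+ n != 0 by rewrite expf_neq0.
by rewrite !exprS; field; rewrite x0 xn zx.
Qed.

Lemma ccontV (F : R -> C) : ccont F -> (forall t, F t != 0) -> ccont (fun t => (F t)^-1).
Proof.
move=> [f1 f2] F0; have cn : continuous (fun t => (complex.Re (F t) ^+ 2 + complex.Im (F t) ^+ 2)^-1).
  move=> t; apply: cvgV; last by apply: cvgD; apply: cvgM; [exact: f1|exact: f1|exact: f2|exact: f2].
  apply/eqP => h; move/eqP: h; rewrite paddr_eq0 ?sqr_ge0// !sqrf_eq0 => /andP[/eqP h1 /eqP h2].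
  by have := F0 t; rewrite (complex_eqP (y := 0) h1 h2) eqxx.
split.
  have -> : (fun t => complex.Re (F t)^-1) = (fun t => complex.Re (F t) * (complex.Re (F t) ^+ 2 + complex.Im (F t) ^+ 2)^-1).
    by apply/funext => t; case: (F t).
  by move=> t; apply: cvgM; [exact: f1|exact: cn].
have -> : (fun t => complex.Im (F t)^-1) = (fun t => - complex.Im (F t) * (complex.Re (F t) ^+ 2 + complex.Im (F t) ^+ 2)^-1).
  by apply/funext => t; case: (F t) => a b /=; rewrite mulNr.
by move=> t; apply: cvgM; [apply: cvgN; exact: f2|exact: cn].
Qed.

Lemma ccont_bounded (F : R -> C) : ccont F -> (forall t, F (t + pi *+ 2) = F t) ->
  exists2 m : R, 0 <= m & forall t, nc (F t) <= m.
Proof.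
move=> [f1 f2] Fp.
have [m1 h1] := periodic_bounded (f := fun t => complex.Re (F t)) (fun t => congr1 (@complex.Re R) (Fp t)) f1.
have [m2 h2] := periodic_bounded (f := fun t => complex.Im (F t)) (fun t => congr1 (@complex.Im R) (Fp t)) f2.
have b t : nc (F t) <= m1 + m2 by apply: le_trans (nc_le _) _; exact: lerD.
by exists (m1 + m2) => //; apply: le_trans (b 0); exact: nc_ge0.
Qed.

Variables (U : set Diff2) (A : circle -> Diff2 -> M).
Hypotheses (Uo : open U) (AC1 : C1_on_mx U A).

Lemma kernel_neq0 (x : C) t : nc x != 1 -> (cis t : C) - x != 0.
Proof.
move=> x1; rewrite subr_eq0; apply/eqP => h; move: x1.
by rewrite -h nc_circle eqxx.
Qed.

Lemma ccont_kernel (x : C) : nc x != 1 -> ccont (fun t => ((cis t : C) - x)^-1).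
Proof.
move=> x1; apply: ccontV => [|t]; last exact: kernel_neq0.
by apply: ccontB; [exact: ccont_cis|exact: ccont_cst].
Qed.

Lemma kernel_bound (x : C) t : nc x != 1 -> nc (((cis t : C) - x)^-1) <= `|1 - nc x|^-1.
Proof.
move=> x1; have d0 : 0 < `|1 - nc x| by rewrite normr_gt0 subr_eq0 eq_sym.
rewrite ncV lef_pV2 ?posrE//; last by rewrite lt_neqAle nc_ge0 andbT eq_sym nc_eq0 kernel_neq0.
have h1 : nc (cis t : C) <= nc ((cis t : C) - x) + nc x by rewrite -{1}((subrK x) (cis t : C)) ncD.
have h2 : nc x <= nc ((cis t : C) - x) + nc (cis t : C).
  by rewrite ncBC -{1}((subrK (cis t : C)) x) ncD.
by rewrite nc_circle in h1 h2; rewrite ler_norml; apply/andP; split; lra.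
Qed.

Lemma calA_fc (x : C) h i j : U h -> nc x != 1 ->
  calA A x h i j = fc (fun t => den A i j h t * ((cis t : C) - x)^-1) 0.
Proof.
move=> Uh x1; rewrite /calA mxE.
have -> : contour_mx (fun z => ((z : C) - x)^-1 *: A z h) i j =
    cint (fun t => 'i%R * (den A i j h t * ((cis t : C) - x)^-1 * ek 0 t)).
  rewrite /contour_mx mxE -[LHS]/(cint (fun t => (((cis t : C) - x)^-1 *: A (cis t) h) i j * ('i%R * (cis t : C)))).
  by congr cint; apply/funext => t; rewrite mxE ek0 /den; ring.
have cc : ccont (fun t => den A i j h t * ((cis t : C) - x)^-1 * ek 0 t).
  by apply: ccontM; [apply: ccontM; [exact: (den_ccont AC1)|exact: ccont_kernel]|exact: ccont_ek].
rewrite cintZ// /fc mulrA; congr (_ * _).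
have p0 : (pi : R)%:C != 0 by rewrite -nc_eq0 nc_real normr_eq0 gt_eqF ?pi_gt0.
have i0 := @i_neq0 R.
have -> : (pi *+ 2)%:C = 2 * (pi : R)%:C :> C by rewrite rmorphMn /= mulr_natl.
rewrite /twoipi; move: ('i%R : C) (pi%:C : C) i0 p0 => a b a0 b0.
by field; rewrite a0 b0.
Qed.

Lemma fc_shift (F : R -> C) a b : fc (fun t => F t * ek a t) b = fc F (a + b).
Proof. by rewrite /fc; congr (_ * cint _); apply/funext => t; rewrite ekD mulrA. Qed.

Lemma zpow_ek (t : R) n : (cis t : C) ^- n = ek (- n%:Z) t.
Proof. by rewrite ekE -exprnN. Qed.

Lemma zpow_ek' (t : R) n : (cis t : C) ^+ n = ek n%:Z t.
Proof. by rewrite ekE -exprnP. Qed.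

(** The Cauchy kernel is expanded by the finite identity [geo_in]. The remainder is x^K times a
    coefficient bounded independently of K, and |x|^K has the required rate by [geo_rate]; sum and
    integral are never exchanged for an infinite series. *)
Lemma calA_entry_in (x : C) h i j : U h -> nc x < 1 -> exists2 c : R, 0 < c & forall K,
  nc ((\sum_(n < K) dil x (shiftseq (bsq A true h)) n) i j + calA A x h i j) <= c / wt K.
Proof.
move=> Uh x1; have xn1 : nc x != 1 by rewrite lt_eqF.
have dc := den_ccont AC1 i j Uh; have kc := ccont_kernel xn1.
have [c0 c00 geo] := geo_rate (nc_ge0 x) x1.
have [m m0 dm] := ccont_bounded dc (fun t => (congr1 (fun z => A z h i j * (z : C)) (cis_per t))).
pose b := `|1 - nc x|^-1; have b0 : 0 <= b by rewrite invr_ge0.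
exists (c0 * (2 * (m * b)) + 1); first by rewrite ltr_wpDl// mulr_ge0 ?(ltW c00)// mulr_ge0// mulr_ge0.
move=> K.
pose rem t := den A i j h t * (ek (- K%:Z) t * ((cis t : C) - x)^-1).
have rc : ccont rem by apply: ccontM dc _; apply: ccontM kc; exact: ccont_ek.
have E : calA A x h i j = \sum_(k < K) x ^+ k * fc (den A i j h) (- k.+1%:Z) + x ^+ K * fc rem 0.
  rewrite calA_fc// -fcZ//.
  have -> : \sum_(k < K) x ^+ k * fc (den A i j h) (- k.+1%:Z) =
      fc (fun t => \sum_(k < K) x ^+ k * (den A i j h t * ek (- k.+1%:Z) t)) 0.
    rewrite fc_sum => [|k]; last by apply: ccontZ; apply: ccontM dc (ccont_ek _).
    apply: eq_bigr => k _; rewrite fcZ; last by apply: ccontM dc (ccont_ek _).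
    by rewrite fc_shift addr0.
  rewrite -fcD; last 2 first.
  - by apply: ccont_sum => k; apply: ccontZ; apply: ccontM dc (ccont_ek _).
  - exact: ccontZ.
  apply: (congr1 (fun G => fc G 0)); apply/funext => t.
  rewrite (geo_in K (cis_neq0 t) (kernel_neq0 t xn1)) mulrDr mulr_sumr; congr (_ + _).
    by apply: eq_bigr => k _; rewrite zpow_ek; ring.
  by rewrite zpow_ek /rem; ring.
have -> : (\sum_(n < K) dil x (shiftseq (bsq A true h)) n) i j + calA A x h i j = x ^+ K * fc rem 0.
  rewrite E addrA summxE -big_split big1 ?add0r// => k _ /=.
  rewrite -[X in X + _]/((x ^+ k *: Bcoef A (idx true k.+1) h) i j) mxE (Bcoef_fc AC1)//.
  by rewrite mulrN addNr.
rewrite ncM ncX; apply: (@le_trans _ _ (c0 / wt K * (2 * (m * b)))).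
  apply: ler_pM; [by rewrite exprn_ge0 ?nc_ge0|exact: nc_ge0|exact: geo|].
  apply: fc_bound => // t; rewrite /rem ncM ncM nc_ek mul1r.
  by apply: ler_pM; [exact: nc_ge0|exact: nc_ge0|exact: dm|exact: kernel_bound].
by rewrite mulrAC ler_wpM2r ?invr_ge0 ?wt_ge0// lerDl.
Qed.

Lemma calA_entry_out (x : C) h i j : U h -> 1 < nc x -> Bcoef A 0 h = 0 -> exists2 c : R, 0 < c & forall K,
  nc (x ^- 2 * (\sum_(n < K) dil x^-1 (shiftseq (bsq A false h)) n) i j - calA A x h i j) <= c / wt K.
Proof.
move=> Uh x1 B0; have xn1 : nc x != 1 by rewrite gt_eqF.
have x0 : x != 0 by rewrite -nc_eq0 gt_eqF// (lt_trans ltr01).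
have dc := den_ccont AC1 i j Uh; have kc := ccont_kernel xn1.
have xi1 : nc x^-1 < 1 by rewrite ncV invf_lt1 ?(lt_trans ltr01).
have [c0 c00 geo] := geo_rate (nc_ge0 x^-1) xi1.
have [m m0 dm] := ccont_bounded dc (fun t => (congr1 (fun z => A z h i j * (z : C)) (cis_per t))).
pose b := `|1 - nc x|^-1; have b0 : 0 <= b by rewrite invr_ge0.
exists (c0 * (2 * (m * b)) + 1); first by rewrite ltr_wpDl// mulr_ge0 ?(ltW c00)// mulr_ge0// mulr_ge0.
move=> K.
pose rem t := den A i j h t * (ek K.+1%:Z t * ((cis t : C) - x)^-1).
have rc : ccont rem by apply: ccontM dc _; apply: ccontM kc; exact: ccont_ek.
have E : calA A x h i j = - (\sum_(k < K.+1) x ^- k.+1 * fc (den A i j h) k%:Z) + x ^- K.+1 * fc rem 0.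
  rewrite calA_fc// -fcZ//.
  have -> : - (\sum_(k < K.+1) x ^- k.+1 * fc (den A i j h) k%:Z) =
      fc (fun t => \sum_(k < K.+1) - x ^- k.+1 * (den A i j h t * ek k%:Z t)) 0.
    rewrite fc_sum => [|k]; last by apply: ccontZ; apply: ccontM dc (ccont_ek _).
    rewrite -sumrN; apply: eq_bigr => k _; rewrite fcZ; last by apply: ccontM dc (ccont_ek _).
    by rewrite fc_shift addr0 mulNr.
  rewrite -fcD; last 2 first.
  - by apply: ccont_sum => k; apply: ccontZ; apply: ccontM dc (ccont_ek _).
  - exact: ccontZ.
  apply: (congr1 (fun G => fc G 0)); apply/funext => t.
  rewrite (geo_out K.+1 x0 (kernel_neq0 t xn1)) mulrDr mulrN mulr_sumr; congr (_ + _).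
    by rewrite -sumrN; apply: eq_bigr => k _; rewrite zpow_ek'; ring.
  by rewrite zpow_ek' /rem; ring.
have -> : x ^- 2 * (\sum_(n < K) dil x^-1 (shiftseq (bsq A false h)) n) i j - calA A x h i j = - (x ^- K.+1 * fc rem 0).
  rewrite E opprD opprK addrA big_ord_recl.
  (* The term of order 1 / x has coefficient B_0 = 0. This is why one more term is expanded than on
     the inside, and why the system is regular at infinity. *)
  have -> : fc (den A i j h) (@ord0 K : nat)%:Z = 0.
    by apply/eqP; rewrite -oppr_eq0 -(Bcoef_fc AC1)// B0 mxE.
  rewrite mulr0 add0r summxE mulr_sumr -big_split big1 ?add0r// => k _ /=.
  rewrite -[dil x^-1 _ _]/((x^-1 ^+ k *: Bcoef A (idx false k.+1) h)) mxE (Bcoef_fc AC1)//.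
  rewrite /bump leq0n add1n !exprS exprVn expr0 mulr1; have xk : x ^+ k != 0 by rewrite expf_neq0.
  by rewrite /idx; field; rewrite x0 xk.
rewrite ncN ncM -exprVn ncX; apply: (@le_trans _ _ (c0 / wt K.+1 * (2 * (m * b)))).
  apply: ler_pM; [by rewrite exprn_ge0 ?nc_ge0|exact: nc_ge0|exact: geo|].
  apply: fc_bound => // t; rewrite /rem ncM ncM nc_ek mul1r.
  by apply: ler_pM; [exact: nc_ge0|exact: nc_ge0|exact: dm|exact: kernel_bound].
rewrite mulrAC; apply: ler_pM.
- by rewrite mulr_ge0 ?(ltW c00)// mulr_ge0// mulr_ge0.
- by rewrite invr_ge0 wt_ge0.
- by rewrite lerDl.
- by rewrite lef_pV2 ?posrE ?wt_gt0// le_wt.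
Qed.

Lemma entries_cvgs (p : nat -> M) (L : M) : (forall i j, exists2 c : R, 0 < c & forall K,
  nc ((\sum_(n < K) p n) i j - L i j) <= c / wt K) -> exists c, cvgs p L c.
Proof.
move=> h; have [m [d [m0 _ H]]] : exists (m d : R), [/\ 0 < m, 0 < d & forall ij : 'I_N * 'I_N,
    forall K, nc ((\sum_(n < K) p n) ij.1 ij.2 - L ij.1 ij.2) <= m / wt K].
  apply: finite_bounds.
    by move=> ij m m' d d' mm' _ h' K; apply: le_trans (h' K) _; rewrite ler_wpM2r ?invr_ge0 ?wt_ge0.
  by move=> [i j]; have [c c0 H] := h i j; exists c, 1; split; [exact: c0|exact: ltr01|exact: H].
exists ((N * N)%:R * m) => K; rewrite -mulrA; apply: mnorm_le_entries => i j.
by rewrite subE; exact: (H (i, j) K).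
Qed.

Lemma calA_in (x : C) h : U h -> nc x < 1 ->
  calA A x h = - msum (dil x (shiftseq (bsq A true h))).
Proof.
move=> Uh x1; have [m m0 wb] := bsq_wbd Uo AC1 true Uh.
have wd : wbd (dil x (shiftseq (bsq A true h))) m by apply: wbd_dil; [exact: ltW|exact: wbd_shift].
have [c cc] : exists c, cvgs (dil x (shiftseq (bsq A true h))) (- calA A x h) c.
  apply: entries_cvgs => i j; have [c c0 H] := calA_entry_in i j Uh x1.
  exists c => // K; have -> : (- calA A x h) i j = - calA A x h i j by rewrite mxE.
  by rewrite opprK; exact: H.
by rewrite (msum_cvgs wd cc) opprK.
Qed.

Lemma calA_out (x : C) h : U h -> 1 < nc x -> Bcoef A 0 h = 0 ->
  calA A x h = x ^- 2 *: msum (dil x^-1 (shiftseq (bsq A false h))).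
Proof.
move=> Uh x1 B0; have [m m0 wb] := bsq_wbd Uo AC1 false Uh.
have x0 : x != 0 by rewrite -nc_eq0 gt_eqF// (lt_trans ltr01).
have xi1 : nc x^-1 < 1 by rewrite ncV invf_lt1 ?(lt_trans ltr01).
have wd : wbd (dil x^-1 (shiftseq (bsq A false h))) m by apply: wbd_dil; [exact: ltW|exact: wbd_shift].
have [c cc] : exists c, cvgs (dil x^-1 (shiftseq (bsq A false h))) (x ^+ 2 *: calA A x h) c.
  apply: entries_cvgs => i j; have [c c0 H] := calA_entry_out i j Uh x1 B0.
  exists (nc x ^+ 2 * c); first by rewrite mulr_gt0// exprn_gt0// (lt_trans ltr01).
  move=> K; rewrite -mulrA; apply: le_trans (ler_wpM2l _ (H K)); last by rewrite exprn_ge0 ?nc_ge0.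
  rewrite -ncX -ncM mulrBr mulrA mulfV ?expf_neq0// mul1r.
  by have -> : (x ^+ 2 *: calA A x h) i j = x ^+ 2 * calA A x h i j by rewrite mxE.
by rewrite (msum_cvgs wd cc) scalerA mulVf ?expf_neq0// scale1r.
Qed.

End calA.

(** * Uniqueness for the linear system *)

Section ode.
Context {R : realType} {N : nat}.
Local Notation C := R[i].
Local Notation M := 'M[C]_N.

Lemma cdiff_cont (G : C -> M) x D : cdiff G x D ->
  forall e : R, 0 < e -> \forall h \near (0 : C), mnorm (G (x + h) - G x) <= e.
Proof.
move=> GD e e0; have [c c0 h] := lapp_lip (FF := nbhs_filter (0 : C)) GD (lbdZ D).
have e1 : 0 < e / c by rewrite divr_gt0.
move: h (nc_small e1); apply: filterS2 => h h1 h2; apply: le_trans h1 _.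
by rewrite mulrC -ler_pdivlMr.
Qed.

(** The quotient (Ysum b)^-1 Y has zero derivative off 0 and is continuous at 0, hence is constant
    by [cdiff0_cst]. The equation is not assumed at 0 in order to include the point at infinity. *)
Lemma ode_uniq (b : nat -> M) (c : R) (Y : C -> M) : b 0%N = 0 -> wbd b c ->
  (forall w, 0 < nc w < 1 -> cdiff Y w (- (msum (dil w (shiftseq b)) *m Y w))) ->
  (forall e : R, 0 < e -> \forall h \near (0 : C), mnorm (Y h - Y 0) <= e) ->
  forall w, nc w < 1 -> Y w = Ysum b w *m Y 0.
Proof.
move=> b0 bc Yd Yc w w1.
have Yu w' : nc w' <= 1 -> Ysum b w' \in unitmx by exact: Ysum_unit b0 bc.
pose Z w := invmx (Ysum b w) *m Y w.
have invb x : nc x < 1 -> \forall h \near (0 : C), Ysum b (x + h) *m invmx (Ysum b (x + h)) = 1%:M /\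
    mnorm (invmx (Ysum b (x + h))) <= @yc R N c.
  move=> x1; have d0 : 0 < 1 - nc x by rewrite subr_gt0.
  apply: filterS (near0_nc d0) => h hd.
  have xh : nc (x + h) <= 1 by apply: le_trans (ncD _ _) _; lra.
  split; first by apply: mulmxV; exact: Yu.
  rewrite /Ysum -(msum_yinvE (dil0 _ b0) (wbd_dil xh bc)); apply: mnorm_msum.
  by apply: yinv_bd; [exact: dil0|exact: wbd_dil].
have invd x : nc x < 1 -> cdiff (fun x => invmx (Ysum b x)) x (invmx (Ysum b x) *m msum (dil x (shiftseq b))).
  move=> x1; have Sd := Ysum_cdiff b0 bc x1.
  have H := lapp_inv (FF := nbhs_filter (0 : C)) (@nc_ge0 R) (@nc_small R) Sd (lbdZ _).
  have := H (fun h => invmx (Ysum b (x + h))) (invmx (Ysum b x)) (@yc R N c).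
  have ia : \forall h \near (0 : C), Ysum b (x + h) *m invmx (Ysum b (x + h)) = 1%:M.
    by move: (invb x x1); apply: filterS => h [].
  have ib : \forall h \near (0 : C), mnorm (invmx (Ysum b (x + h))) <= @yc R N c.
    by move: (invb x x1); apply: filterS => h [].
  move=> /(_ ia (mulVmx (Yu x (ltW x1))) ib).
  move=> H' e e0; apply: filterS (H' e e0) => h.
  have -> // : - (invmx (Ysum b x) *m (h *: - (msum (dil x (shiftseq b)) *m Ysum b x)) *m invmx (Ysum b x)) =
    h *: (invmx (Ysum b x) *m msum (dil x (shiftseq b))).
  rewrite -scalemxAr -scalemxAl -scalerN mulmxN mulNmx opprK mulmxA -(mulmxA _ (Ysum b x)).
  by rewrite (mulmxV (Yu x (ltW x1))) mulmx1.
have Zd x : 0 < nc x < 1 -> cdiff Z x 0.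
  move=> x01; have /andP[_ x1] := x01.
  have := lappM (FF := nbhs_filter (0 : C)) (@nc_ge0 R) (@nc_small R) (invd x x1) (lbdZ _) (Yd x x01) (lbdZ _).
  move=> H e e0; apply: filterS (H e e0) => h.
  have -> // : (h *: (invmx (Ysum b x) *m msum (dil x (shiftseq b)))) *m Y x +
      invmx (Ysum b x) *m (h *: - (msum (dil x (shiftseq b)) *m Y x)) = h *: 0.
  by rewrite -scalemxAl -scalemxAr mulmxN scalerN mulmxA addrN scaler0.
have Zc (e : R) : 0 < e -> \forall h \near (0 : C), mnorm (Z h - Z 0) <= e.
  move=> e0; pose m := mnorm (Y 0) + 1; have m0 : 0 < m by rewrite ltr_wpDl// mnorm_ge0.
  have y0 : 0 <= @yc R N c by apply: yc_ge0; exact: wbd_ge0 bc.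
  have e1 : 0 < e / 2 / m by rewrite !divr_gt0.
  have e2 : 0 < e / 2 / (@yc R N c + 1) by rewrite !divr_gt0// ltr_wpDl.
  have n0 : nc (0 : C) < 1 by rewrite nc0.
  move: (cdiff_cont (invd 0 n0) e1) (Yc _ e2) (invb 0 n0); apply: filterS3 => h.
  rewrite !add0r => h1 h2 [_ h3].
  have -> : Z h - Z 0 = invmx (Ysum b h) *m (Y h - Y 0) + (invmx (Ysum b h) - invmx (Ysum b 0)) *m Y 0.
    by rewrite mulmxBr mulmxBl /Z addrA subrK.
  apply: le_trans (mnormD _ _) _; rewrite [e]splitr; apply: lerD; apply: le_trans (mnormM _ _) _.
    apply: (@le_trans _ _ ((@yc R N c + 1) * (e / 2 / (@yc R N c + 1)))).
      apply: ler_pM; rewrite ?mnorm_ge0//; apply: le_trans h3 _; by rewrite lerDl.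
    by rewrite mulrC divfK// gt_eqF// ltr_wpDl.
  apply: (@le_trans _ _ (e / 2 / m * m)); last by rewrite divfK// gt_eqF.
  by apply: ler_pM; rewrite ?mnorm_ge0// lerDl.
have := cdiff0_cst Zd Zc w1; rewrite /Z (Ysum0 b0) invmx1 mul1mx => <-.
by rewrite mulKVmx// Yu// ltW.
Qed.

End ode.

(** * Variation of the solutions *)

Section wsum.
Context {R : realType} {N : nat}.
Local Notation C := R[i].
Local Notation M := 'M[C]_N.
Implicit Types (b f p q : nat -> M).

Lemma dilD (x : C) p q : dil x (p + q) = dil x p + dil x q.
Proof. by apply/funext => n; rewrite /dil -[LHS]/(x ^+ n *: (p n + q n)) scalerDr. Qed.

Lemma dilZ (x a : C) p : dil x (a *: p) = fun n => a *: dil x p n.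
Proof. by apply/funext => n; rewrite /dil -[LHS]/(x ^+ n *: (a *: p n)) !scalerA mulrC. Qed.

Lemma wbdZ1 (a : C) p c : wbd p c -> wbd (a *: p) (nc a * c).
Proof. exact: (wbdZ (a := fun=> a) (fun=> lexx _)). Qed.

(** Combines two real variations into a complex one: the variations of the coefficients are
    superposed, and the displacements of the point add up to c times x d/dx, by [dsol_theta]. *)
Lemma dsol_comb b (pu pv : nat -> M) (a ku kv c : C) : b 0%N = 0 -> ku + a * kv = c ->
  dsol b (fun n => pu n + (n%:R * ku) *: b n) +
    (fun n => a *: dsol b (fun n => pv n + (n%:R * kv) *: b n) n) =
  dsol b (fun n => pu n + a *: pv n) + c *: theta (ysol b).
Proof.
move=> b0 kc; rewrite -(dsolZ a _ b0) -(dsolD _ _ b0) -(dsol_theta c b0) -(dsolD _ _ b0).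
congr dsol; apply/funext => n.
rewrite -[LHS]/(pu n + (n%:R * ku) *: b n + a *: (pv n + (n%:R * kv) *: b n)).
rewrite -[RHS]/(pu n + a *: pv n + (n%:R * c) *: b n) -kc.
by rewrite scalerDr addrACA; congr (_ + _); rewrite scalerA -scalerDl; congr (_ *: _); ring.
Qed.

Section seqs.
Variables (b f : nat -> M) (beta c0 : R).
Hypotheses (b0 : b 0%N = 0) (bb : wbd b beta) (fb : fbd wt f c0).

Lemma theta_ysol_wbd : exists c, wbd (theta (ysol b)) c.
Proof.
rewrite theta_ysol//; exists (beta * @yc R N beta); apply: wbdN; apply: wbd_conv bb _.
exact: ysol_bd.
Qed.

Lemma wpre_wbd K : exists c, wbd (dsol b f + conv (ysol b) (cst K)) c.
Proof.
eexists; apply: wbdD (dsol_wbd b0 bb fb) _; apply: wbd_conv (ysol_bd b0 bb) (wbd_cst K).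
Qed.

Lemma wseq_wbd K : exists c, wbd (wseq b f K) c.
Proof.
have [c hc] := wpre_wbd K; exists (c * @yc R N beta).
by apply: wbd_conv hc _; exact: yinv_bd.
Qed.

Lemma invmx_Ysum x : nc x <= 1 -> invmx (Ysum b x) = msum (dil x (yinv b)).
Proof.
move=> x1; have u := Ysum_unit b0 bb x1.
have E : Ysum b x *m msum (dil x (yinv b)) = 1%:M.
  rewrite /Ysum ysol_dil// -(msum_conv (wbd_dil x1 (ysol_bd b0 bb)) (wbd_dil x1 (yinv_bd b0 bb))).
  by rewrite conv_dil ysolK// scl_cst msum_cst.
by rewrite -[RHS](mulKmx u) E mulmx1.
Qed.

(** Displacing the point adds c theta y to the variation, and theta y = - b * y. The logarithmic
    derivative thus splits into [wseq], due to the coefficients, and - c b. *)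
Lemma wseq_msum x K (c : C) : nc x <= 1 ->
  (msum (dil x (dsol b f + c *: theta (ysol b))) + Ysum b x *m K) *m invmx (Ysum b x) =
  msum (dil x (wseq b f K)) - c *: msum (dil x b).
Proof.
move=> x1; have yb := ysol_bd b0 bb; have yib := yinv_bd b0 bb.
have [ct hct] := theta_ysol_wbd; have [cw hcw] := wseq_wbd K.
have db := dsol_wbd b0 bb fb.
have E : Ysum b x *m K = msum (dil x (conv (ysol b) (cst K))).
  rewrite -conv_dil scl_cst (msum_conv (wbd_dil x1 yb) (wbd_cst K)) msum_cst.
  by rewrite /Ysum ysol_dil.
have p1 : wbd (dil x (dsol b f + c *: theta (ysol b))) (vc beta * (c0 * @yc R N beta) + nc c * ct).
  by apply: wbd_dil => //; apply: wbdD => //; exact: wbdZ1.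
have p2 : wbd (dil x (conv (ysol b) (cst K))) (@yc R N beta * mnorm K).
  by apply: wbd_dil => //; apply: wbd_conv yb (wbd_cst K).
rewrite E -(msumD p1 p2) -dilD invmx_Ysum//.
have p12 := wbdD p1 p2; rewrite -dilD in p12; rewrite -(msum_conv p12 (wbd_dil x1 yib)).
rewrite conv_dil; have -> : conv (dsol b f + c *: theta (ysol b) + conv (ysol b) (cst K)) (yinv b) =
    wseq b f K + (- c) *: b.
  rewrite addrAC convDl convZl theta_ysol// convNl -convA ysolK// conv1r.
  by rewrite scalerN -scaleNr.
rewrite dilD (msumD (wbd_dil x1 hcw) (wbd_dil x1 (wbdZ1 (- c) bb))); congr (_ + _).
by rewrite dilZ (msumZ _ (wbd_dil x1 bb)) scaleNr.
Qed.

(** Here n is the exponent of e^(int), and [coefz] supplies the zeros of the one-sided series.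
    Functions and coefficients are exchanged by [fc_tser] and [fc_zero]. *)
Lemma laurent_unique (m : int) (wp bp wm bm : nat -> M) (c1 c2 c3 c4 : R) :
  wbd wp c1 -> wbd bp c2 -> wbd wm c3 -> wbd bm c4 ->
  (forall t : R, msum (dil (cis t : C) wp) - (cis t : C) ^ m *: msum (dil (cis t : C) bp) =
     msum (dil (cis t : C)^-1 wm) + (cis t : C) ^ m *: msum (dil (cis t : C)^-1 bm)) <->
  (forall n : int, coefz wp n - coefz bp (n - m) = coefz wm (- n) + coefz bm (m - n)).
Proof.
move=> w1 w2 w3 w4.
have e1 t : (cis t : C) = ek ((-1) ^+ false) t by rewrite ekE.
have e2 t : (cis t : C)^-1 = ek ((-1) ^+ true) t by rewrite ekE expr1.
pose Phi i j t := (tser 0 false wp i j t - tser m false bp i j t) -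
  (tser 0 true wm i j t + tser m true bm i j t).
have PhiE i j t : Phi i j t = (msum (dil (cis t : C) wp) - (cis t : C) ^ m *: msum (dil (cis t : C) bp) -
     (msum (dil (cis t : C)^-1 wm) + (cis t : C) ^ m *: msum (dil (cis t : C)^-1 bm))) i j.
  rewrite /Phi /tser -e1 -e2 ek0 -ekE !mxE; ring.
have Phic i j : ccont (Phi i j).
  apply: ccontB; first by apply: ccontB; [exact: ccont_tser w1|exact: ccont_tser w2].
  by apply: ccontD; [exact: ccont_tser w3|exact: ccont_tser w4].
have Phif i j n : fc (Phi i j) (- n) =
    (coefz wp n - coefz bp (n - m) - (coefz wm (- n) + coefz bm (m - n))) i j.
  have h1 := ccont_tser 0 false i j w1; have h2 := ccont_tser m false i j w2.
  have h3 := ccont_tser 0 true i j w3; have h4 := ccont_tser m true i j w4.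
  rewrite (fcB _ (ccontB h1 h2) (ccontD h3 h4)) (fcB _ h1 h2) (fcD _ h3 h4).
  rewrite (fc_tser 0 false i j w1) (fc_tser m false i j w2) (fc_tser 0 true i j w3) (fc_tser m true i j w4).
  by rewrite expr0 expr1 !mul1r !mulN1r !subr0 opprB !mxE.
split=> H.
  move=> n; apply/eqP; rewrite -subr_eq0; apply/eqP/matrixP => i j; rewrite -Phif mxE.
  have -> : Phi i j = (fun t => 0 * (0 : C)).
    by apply/funext => t; rewrite PhiE (H t) subrr mxE mul0r.
  exact: etrans (@fcZ R 0 (fun=> 0) (- n) (ccont_cst 0)) (mul0r _).
move=> t; apply/eqP; rewrite -subr_eq0; apply/eqP/matrixP => i j; rewrite -PhiE mxE.
apply: fc_zero; first exact: Phic.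
  by move=> s; rewrite /Phi !tser_per.
by move=> n; rewrite -[n]opprK Phif (H (- n)) subrr mxE.
Qed.

End seqs.
End wsum.

(** * Variation of the solutions along L_m *)

Section variation.
Context {R : realType} {N : nat}.
Local Notation C := R[i].
Local Notation circle := (circle R).
Local Notation Diff2 := (Diff2 R).
Local Notation C2fun := (C2fun R).
Local Notation M := 'M[C]_N.
Variables (U : set Diff2) (A : circle -> Diff2 -> M).
Hypotheses (Uo : open U) (AC1 : C1_on_mx U A).

Lemma kseq_cplx sg g (k : C2fun -> C) x u v (c : C) : U g -> nc x <= 1 ->
  (forall u, nc (k u) <= `|u|) -> k u + 'i%R * k v = c ->
  msum (dsol (dil x (bsq A sg g)) (dil x (kseq A sg g k u))) +
    'i%R *: msum (dsol (dil x (bsq A sg g)) (dil x (kseq A sg g k v))) =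
  msum (dil x (dsol (bsq A sg g) (fun n => dbsq A sg g u n + 'i%R *: dbsq A sg g v n) +
    c *: theta (ysol (bsq A sg g)))).
Proof.
move=> Ug x1 kb kc; have [m m0 wb] := bsq_wbd Uo AC1 sg Ug.
have [c1 c10 kf] := kseq_fbd Uo AC1 sg Ug kb.
have b0 : bsq A sg g 0%N = 0 by [].
have w1 := wbd_dil x1 (dsol_wbd b0 wb (kf u)); have w2 := wbd_dil x1 (dsol_wbd b0 wb (kf v)).
rewrite !dsol_dil// in w1 w2 *.
have w3 : wbd ('i%R *: dil x (dsol (bsq A sg g) (kseq A sg g k v))) _ := wbdZ1 'i%R w2.
rewrite -(msumZ _ w2) -[fun n : nat => _]/('i%R *: dil x (dsol (bsq A sg g) (kseq A sg g k v))).
rewrite -(msumD w1 w3); congr msum.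
have -> : ('i%R *: dil x (dsol (bsq A sg g) (kseq A sg g k v)) : nat -> M) =
    dil x (fun n => 'i%R *: dsol (bsq A sg g) (kseq A sg g k v) n).
  by apply/funext => n; rewrite /dil -[LHS]/('i%R *: (x ^+ n *: _)) !scalerA mulrC.
rewrite -dilD; apply: (congr1 (dil x)).
exact: (dsol_comb (fun n => dbsq A sg g u n) (fun n => dbsq A sg g v n) b0 kc).
Qed.

(* The point of the closed disk at which the solution on the side sg is
   evaluated when x is the image of z: x itself, or 1/x. *)
Definition bpt (sg : bool) (z : circle) (h : Diff2) : C := if sg then (h z : C) else (h z : C)^-1.

(** The logarithmic velocity of [bpt]: multiplication by e^(iu) moves h(z) at the rate iu and 1 /
    h(z) at the rate - iu. *)
Definition bvel (sg : bool) (z : circle) (u : C2fun) : C := 'i%R * (((-1) ^+ ~~ sg) * u z)%:C.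

Lemma nc_bpt sg z h : nc (bpt sg z h) = 1.
Proof. by rewrite /bpt; case: sg; rewrite ?ncV nc_circle ?invr1. Qed.

Lemma C2fun_sup (u : C2fun) z : `|u z| <= `|u|.
Proof. by have [t <-] := cis_surj z; exact: (@C2fun_le R u 0 t). Qed.

Lemma bvel_lin sg z (a : R) u v : bvel sg z (a *: u + v) = a%:C * bvel sg z u + bvel sg z v.
Proof.
rewrite /bvel; have -> : (a *: u + v) z = a * u z + v z by [].
by rewrite !rmorphM /= rmorphD /= rmorphM /=; ring.
Qed.

Lemma nc_bvel sg z u : nc (bvel sg z u) <= `|u|.
Proof.
rewrite /bvel ncM nc_i mul1r nc_real normrM; case: sg; rewrite /= ?expr0 ?expr1 ?normrN normr1 mul1r;
exact: C2fun_sup.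
Qed.

Lemma cis_taylor (s : R) : nc ((cis s : C) - 1 - 'i%R * s%:C) <= 2 * s ^+ 2.
Proof.
have sl t : `|sin t| <= `|t| :> R.
  have := lipR_sym (f := sin) (f1 := cos) (K := 1) 0 t (fun t => is_derive_sin t).
  by rewrite sin0 !subr0 mul1r; apply => r; rewrite ler_norml cos_geN1 cos_le1.
have cl t : `|cos t - 1| <= `|t| :> R.
  have := lipR_sym (f := cos) (f1 := fun t => - sin t) (K := 1) 0 t (fun t => is_derive_cos t).
  by rewrite cos0 subr0 mul1r; apply => r; rewrite normrN ler_norml sin_geN1 sin_le1.
have key a : 0 <= a -> `|cos a - 1| <= a ^+ 2 /\ `|sin a - a| <= a ^+ 2 :> R.
  move=> a0; split.
    have := @lipR R cos (fun t => - sin t) a 0 a (fun t _ => is_derive_cos t).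
    rewrite cos0 subr0 -expr2; apply=> // t; rewrite in_itv /= normrN => /andP[t0 ta].
    by apply: le_trans (sl t) _; rewrite ger0_norm.
  have d t : is_derive t (1 : R) (fun t => sin t - t) (cos t - 1).
    exact: is_deriveB.
  have := @lipR R (fun t => sin t - t) (fun t => cos t - 1) a 0 a (fun t _ => d t).
  rewrite sin0 !subr0 -expr2; apply=> // t; rewrite in_itv /= => /andP[t0 ta].
  by apply: le_trans (cl t) _; rewrite ger0_norm.
have [k1 k2] : `|cos s - 1| <= s ^+ 2 /\ `|sin s - s| <= s ^+ 2.
  have [s0|s0] := leP 0 s; first exact: key.
  have [] := key (- s); first by rewrite oppr_ge0 ltW.
  by rewrite cosN sinN sqrrN => h1; rewrite -opprD normrN.
apply: le_trans (nc_le _) _; rewrite mulr_natl mulr2n; apply: lerD.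
  by rewrite !ReD !ReN ReM /= !mul0r mul1r !subr0 ?mulr0 ?subr0.
by rewrite !ImD !ImN ImM /= !mul0r mul1r subr0 ?add0r.
Qed.

Lemma bpt_taylor sg z g (e : R) : 0 < e -> \forall u \near (0 : C2fun),
  nc (bpt sg z (chart g u) - bpt sg z g - bpt sg z g * bvel sg z u) <= e * `|u|.
Proof.
move=> e0; have [d d0 dg] := mulcis_diffeo g.
have m0 : 0 < Num.min d (e / 2) by rewrite lt_min d0 divr_gt0.
apply/near_chart; exists (Num.min d (e / 2)) => // u; rewrite lt_min => /andP[ud ue].
pose s : R := (-1) ^+ (~~ sg) * u z.
have -> : bpt sg z (chart g u) = bpt sg z g * (cis s : C).
  rewrite /bpt {}/s (val_chart (dg u ud)); case: (sg) => /=; first by rewrite expr0 mul1r.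
  rewrite expr1 mulN1r invfM; congr (_ * _).
  by have := esym (ekE (-1) (u z)); rewrite /ek mulN1r.
have -> : bpt sg z g * (cis s : C) - bpt sg z g - bpt sg z g * bvel sg z u =
   bpt sg z g * ((cis s : C) - 1 - 'i%R * s%:C) by rewrite /bvel -/s; ring.
rewrite ncM nc_bpt mul1r; apply: le_trans (cis_taylor s) _.
have sE : s ^+ 2 = `|u z| ^+ 2.
  by rewrite /s exprMn -signr_odd sqrr_sign mul1r real_normK// num_real.
rewrite sE; have uz := C2fun_sup u z.
apply: (@le_trans _ _ (2 * (`|u| * `|u|))).
  by rewrite ler_wpM2l// expr2 ler_pM.
rewrite mulrA; apply: ler_wpM2r; first exact: normr_ge0.
by rewrite -ler_pdivlMl// mulrC ltW.
Qed.

Definition Dbsq sg g m n : M := cplx g m (fun u => dbsq A sg g u n).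

Lemma Dbsq0 sg g m : Dbsq sg g m 0%N = 0.
Proof. by rewrite /Dbsq /cplx scaler0 addr0. Qed.

Lemma Dbsq_lie sg g m n : U g -> Dbsq sg g m n.+1 = lie_mx (L_ m) (Bcoef A (idx sg n.+1)) g.
Proof. by move=> Ug; rewrite (lie_cplx m (Bcoef_hasdiff Uo AC1 (idx sg n.+1) Ug)). Qed.

Lemma Dbsq_fbd sg g m : U g -> exists c, fbd wt (Dbsq sg g m) c.
Proof.
move=> Ug; have [c [d [_ _ _ _ fb]]] := coef_bounds Uo AC1 Ug.
rewrite /Dbsq /cplx; move: (tangent_Re _ _) (tangent_Im _ _) => u v.
exists (c * `|u| + c * `|v|); have := fbdD (@weight_wt R) (fb sg u) (_ : fbd wt (fun n => 'i%R *: dbsq A sg g v n) (c * `|v|)).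
apply; apply: (fbd_mono (@weight_wt R) _ (fb sg v)) => n.
by rewrite mnormZ nc_i mul1r.
Qed.

Definition Wsq sg g m K : nat -> M := wseq (bsq A sg g) (Dbsq sg g m) K.

Lemma Wsq_wbd sg g m K : U g -> exists c, wbd (Wsq sg g m K) c.
Proof.
move=> Ug; have [c fc] := Dbsq_fbd sg m Ug; have [b b0 bb] := bsq_wbd Uo AC1 sg Ug.
by apply: wseq_wbd bb fc K.
Qed.

Definition Psi sg z g : M := Ysum (bsq A sg g) (bpt sg z g).

Definition dPsi sg z g (u : C2fun) : M :=
  msum (dsol (dil (bpt sg z g) (bsq A sg g)) (dil (bpt sg z g) (kseq A sg g (bvel sg z) u))).

Lemma Psi_unit sg z g : U g -> Psi sg z g \in unitmx.
Proof.
move=> Ug; have [b b0 bb] := bsq_wbd Uo AC1 sg Ug.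
by apply: (Ysum_unit _ bb) => //; rewrite nc_bpt.
Qed.

Lemma Psi_hasdiff sg z g : U g -> hasdiff (Psi sg z) g (dPsi sg z g).
Proof.
move=> Ug; apply: (@Ysum_hasdiff R N U A Uo AC1 sg g (bpt sg z) (bvel sg z) Ug).
- by move=> h; rewrite nc_bpt.
- exact: bvel_lin.
- exact: nc_bvel.
- by move=> e e0; exact: bpt_taylor.
Qed.

(** The coordinates Im g^m and - Re g^m of L_m give the velocity i Im g^m + i i (- Re g^m) = g^m:
    along L_m the point g(z) moves with logarithmic velocity g(z)^m, and 1 / g(z) with the opposite
    one. *)
Lemma dPsi_cplx sg z g m : U g -> cplx g m (dPsi sg z g) =
  msum (dil (bpt sg z g) (dsol (bsq A sg g) (Dbsq sg g m) +
    ((-1) ^+ (~~ sg) * (g z : C) ^ m) *: theta (ysol (bsq A sg g)))).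
Proof.
move=> Ug; have [v1 v2] := val_tangent g m.
rewrite /cplx /dPsi /Dbsq /cplx; move: (tangent_Re _ _) (tangent_Im _ _) v1 v2 => u v v1 v2.
apply: (@kseq_cplx sg g (bvel sg z) _ u v _ Ug); first by rewrite nc_bpt.
  exact: nc_bvel.
rewrite /bvel v1 v2; case: sg; rewrite /= ?expr0 ?expr1 ?mul1r ?mulN1r; case: (_ ^ m) => a b;
by apply: complex_eqP; rewrite /=; ring.
Qed.

Lemma dPsi_Wsq sg z g m K : U g ->
  (cplx g m (dPsi sg z g) + Psi sg z g *m K) *m invmx (Psi sg z g) =
  msum (dil (bpt sg z g) (Wsq sg g m K)) -
    ((-1) ^+ (~~ sg) * (g z : C) ^ m) *: msum (dil (bpt sg z g) (bsq A sg g)).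
Proof.
move=> Ug; have [c fc] := Dbsq_fbd sg m Ug; have [b b0 bb] := bsq_wbd Uo AC1 sg Ug.
by rewrite dPsi_cplx//; apply: (wseq_msum _ bb fc) => //; rewrite nc_bpt.
Qed.

End variation.

(** * The deformation equations as a matching condition *)

Section equations.
Context {R : realType} {N : nat}.
Local Notation C := R[i].
Local Notation circle := (circle R).
Local Notation Diff2 := (Diff2 R).
Local Notation C2fun := (C2fun R).
Local Notation M := 'M[C]_N.
Variables (U : set Diff2) (A : circle -> Diff2 -> M).
Hypotheses (Uo : open U) (AC1 : C1_on_mx U A).
Hypothesis A0 : forall g, U g -> contour_mx (A ^~ g) = 0.

Lemma subr_addP (a b c d e : M) : b + d = e -> (a - b = c + d <-> a = c + e).
Proof.
move=> <-; split=> [h|->]; first by rewrite -[a](subrK b) h -addrA (addrC d).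
by rewrite addrA addrAC addrK.
Qed.

Lemma Bcoef0 g : U g -> Bcoef A 0 g = 0.
Proof.
move=> Ug; rewrite /Bcoef; have -> : (fun z : circle => (z : C) ^ 0 *: A z g) = A ^~ g.
  by apply/funext => z; rewrite expr0z scale1r.
by rewrite A0// scaler0.
Qed.

Lemma coefz_bsq g (k : int) : U g ->
  coefz (bsq A true g) (- k) + coefz (bsq A false g) k = Bcoef A k g.
Proof.
move=> Ug; case: k => [[|k]|k].
- by rewrite oppr0 /= addr0 Bcoef0.
- by rewrite /= add0r.
- by rewrite -[- Negz k]/(k.+1%:Z) /= addr0 /bsq /idx NegzE.
Qed.

Definition deformation g m n :=
  lie_mx (L_ m) (Bcoef A n%:Z) g =
      \sum_(0 <= k < n) commutator (Bcoef A k%:Z g) (Bcoef A (m + n%:Z - k%:Z) g)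
      + n%:R *: Bcoef A (m + n%:Z) g
    /\
    lie_mx (L_ m) (Bcoef A (- n%:Z)) g =
      - (\sum_(1 <= k < n.+1)
           commutator (Bcoef A (- k%:Z) g) (Bcoef A (m - n%:Z + k%:Z) g))
      - n%:R *: Bcoef A (m - n%:Z) g.

(* Equality of the Fourier coefficients of the two sides of matching_boundary. *)
Definition matching g m K :=
  (forall j, Wsq A true g m K j = Bcoef A (m - j%:Z) g) /\
  (forall j, Wsq A false g m 0 j.+1 = - Bcoef A (m + j.+1%:Z) g).

Lemma Wsq0 sg g m K : Wsq A sg g m K 0%N = K.
Proof. by apply: wseq0; exact: Dbsq0. Qed.

Lemma matchingP g m K : U g -> matching g m K <-> (forall n : int,
  coefz (Wsq A true g m K) n - coefz (bsq A true g) (n - m) =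
  coefz (Wsq A false g m 0) (- n) + coefz (bsq A false g) (m - n)).
Proof.
move=> Ug; have e (n : int) : coefz (bsq A true g) (n - m) + coefz (bsq A false g) (m - n) = Bcoef A (m - n) g.
  by rewrite -coefz_bsq// opprB.
have E (n : int) : (coefz (Wsq A true g m K) n - coefz (bsq A true g) (n - m) =
  coefz (Wsq A false g m 0) (- n) + coefz (bsq A false g) (m - n)) <->
  (coefz (Wsq A true g m K) n = coefz (Wsq A false g m 0) (- n) + Bcoef A (m - n) g).
  exact: subr_addP.
split=> [[h1 h2] n|H].
  apply/E; case: n => [[|n]|n].
  - by rewrite oppr0 /= (Wsq0 false) add0r h1.
  - by rewrite /= add0r h1.
  - by rewrite -[- Negz n]/(n.+1%:Z) /= h2 addNr.
split=> j.
  have /E := H j%:Z; case: j => [|j] /=; first by rewrite oppr0 /= (Wsq0 false) add0r.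
  by rewrite add0r.
have /E := H (Negz j); rewrite -[- Negz j]/(j.+1%:Z) /= => /esym/eqP.
by rewrite addr_eq0 => /eqP.
Qed.

Lemma thetaE (p : nat -> M) n : theta p n = n%:R *: p n. Proof. by []. Qed.

(** The recursion [wseq_rec], with the two explicit sequences inserted, is the pair of equations. K
    is left free because the variation of the constant C(gamma) is not known in advance. *)
Lemma matching_deformation g m K n : U g -> matching g m K -> (1 <= n)%N -> deformation g m n.
Proof.
move=> Ug [h1 h2] n1; have b0 sg : bsq A sg g 0%N = 0 by [].
have B0 := Bcoef0 Ug; have bE' k : bsq A true g k.+1 = Bcoef A (- k.+1%:Z) g by exact: erefl.
have bE k : bsq A false g k = Bcoef A k%:Z g by case: k => [|k]; rewrite ?B0.
have D sg : Dbsq A sg g m n = lie_mx (L_ m) (Bcoef A (idx sg n)) g.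
  by case: n n1 => // k _; exact: (Dbsq_lie Uo AC1).
have rec sg K' : n%:R *: Wsq A sg g m K' n = - lie_mx (L_ m) (Bcoef A (idx sg n)) g +
    (conv (Wsq A sg g m K') (bsq A sg g) n - conv (bsq A sg g) (Wsq A sg g m K') n).
  have := congr1 (fun p => p n) (wseq_rec K' (b0 sg) (Dbsq0 A sg g m)).
  by rewrite thetaE => ->; rewrite -D -[LHS]/(- Dbsq A sg g m n + _ - _) addrA.
split.
  have := rec false 0; rewrite (comm_sum_minus (B := fun k => Bcoef A k g) B0 n1 bE (Wsq0 false g m 0) h2).
  have aux (x l s : M) : - x = - l + s -> l = s + x.
    by move=> h; rewrite -[x]opprK h opprD opprK addrCA subrr addr0.
  by case: n n1 {rec D} => // k _; rewrite h2 scalerN => /aux.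
have := rec true K; rewrite (comm_sum_plus (B := fun k => Bcoef A k g) n1 (b0 true) bE' h1).
have aux (x l s : M) : x = - l - s -> l = - s - x.
  by move=> ->; rewrite opprB opprK addKr.
by rewrite h1 => /aux.
Qed.

(** By the equations the explicit sequences satisfy the recursion of [Wsq], and they agree with it
    at index 0, which dictates K = B_m; [wrec_uniq] concludes. *)
Lemma deformation_matching g m : U g -> (forall n, (1 <= n)%N -> deformation g m n) ->
  matching g m (Bcoef A m g).
Proof.
move=> Ug H; have b0 sg : bsq A sg g 0%N = 0 by [].
have B0 := Bcoef0 Ug; have bE' k : bsq A true g k.+1 = Bcoef A (- k.+1%:Z) g by exact: erefl.
have bE k : bsq A false g k = Bcoef A k%:Z g by case: k => [|k]; rewrite ?B0.
have D sg n : (0 < n)%N -> Dbsq A sg g m n = lie_mx (L_ m) (Bcoef A (idx sg n)) g.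
  by case: n => // k _; exact: (Dbsq_lie Uo AC1).
pose v1 (j : nat) : M := Bcoef A (m - j%:Z) g.
pose v2 (j : nat) : M := if j is 0 then 0 else - Bcoef A (m + j%:Z) g.
have e1 : Wsq A true g m (Bcoef A m g) = v1.
  apply: (wrec_uniq (b0 true)); first by rewrite Wsq0 /v1 subr0.
    exact: wseq_rec (b0 true) (Dbsq0 A true g m).
  move=> n n0; have [_ E] := H n n0; rewrite thetaE.
  rewrite -[RHS]/(- Dbsq A true g m n + conv v1 (bsq A true g) n - conv (bsq A true g) v1 n) -addrA.
  rewrite (comm_sum_plus (B := fun k => Bcoef A k g) n0 (b0 true) bE' (fun j => erefl)).
  by rewrite D// E opprD !opprK addrAC subrr add0r.
have e2 : Wsq A false g m 0 = v2.
  apply: (wrec_uniq (b0 false)); first by rewrite Wsq0.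
    exact: wseq_rec (b0 false) (Dbsq0 A false g m).
  move=> n n0; have [E _] := H n n0; rewrite thetaE.
  rewrite -[RHS]/(- Dbsq A false g m n + conv v2 (bsq A false g) n - conv (bsq A false g) v2 n) -addrA.
  rewrite (comm_sum_minus (B := fun k => Bcoef A k g) B0 n0 bE erefl (fun j => erefl)).
  rewrite D// E opprD addrAC addNr add0r; case: (n) n0 => // k _.
  by rewrite /v2 scalerN.
by split=> j; rewrite ?e1 ?e2.
Qed.

(** By [dPsi_Wsq] both sides are Laurent series in g(z); since g is onto, g(z) runs through the
    whole circle, as [laurent_unique] needs. *)
Lemma matching_boundary g m K : U g -> matching g m K <-> forall z,
  (cplx g m (dPsi A true z g) + Psi A true z g *m K) *m invmx (Psi A true z g) =
  cplx g m (dPsi A false z g) *m invmx (Psi A false z g).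
Proof.
move=> Ug; have [c1 w1] := Wsq_wbd Uo AC1 true m K Ug; have [c3 w3] := Wsq_wbd Uo AC1 false m 0 Ug.
have [c2 _ w2] := bsq_wbd Uo AC1 true Ug; have [c4 _ w4] := bsq_wbd Uo AC1 false Ug.
have [gb _ _ _] := Diff2_diffeo g; have [gK Kg] := cinvK gb.
have E z : ((cplx g m (dPsi A true z g) + Psi A true z g *m K) *m invmx (Psi A true z g) =
    cplx g m (dPsi A false z g) *m invmx (Psi A false z g)) <->
  (msum (dil (g z : C) (Wsq A true g m K)) - (g z : C) ^ m *: msum (dil (g z : C) (bsq A true g)) =
     msum (dil (g z : C)^-1 (Wsq A false g m 0)) + (g z : C) ^ m *: msum (dil (g z : C)^-1 (bsq A false g))).
  have h1 := dPsi_Wsq Uo AC1 true z m K Ug; have h2 := dPsi_Wsq Uo AC1 false z m 0 Ug.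
  rewrite mulmx0 addr0 /= expr1 mulN1r scaleNr opprK in h2.
  rewrite /= expr0 mul1r in h1.
  by rewrite h1 h2.
split=> [/(matchingP m K Ug)/(laurent_unique m w1 w2 w3 w4) H z|H].
  by apply/E; have [t <-] := cis_surj (g z); exact: H.
apply/(matchingP m K Ug)/(laurent_unique m w1 w2 w3 w4) => t.
by have /E := H (cinv g (cis t)); rewrite Kg.
Qed.

End equations.

(** * The two implications *)

Section main.
Context {R : realType} {N : nat}.
Local Notation C := R[i].
Local Notation circle := (circle R).
Local Notation Diff2 := (Diff2 R).
Local Notation C2fun := (C2fun R).
Local Notation M := 'M[C]_N.

Lemma cdiff_near (G H : C -> M) x D : (\forall h \near (0 : C), G (x + h) = H (x + h)) ->
  cdiff G x D -> cdiff H x D.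
Proof.
move=> GH Gd; have E : G x = H x by have := nbhs_singleton GH; rewrite addr0.
by rewrite /cdiff -E; exact: (lapp_ext GH Gd).
Qed.

Lemma near_lt1 (x : C) : nc x < 1 -> \forall h \near (0 : C), nc (x + h) < 1.
Proof.
move=> x1; have d0 : 0 < 1 - nc x by rewrite subr_gt0.
by apply: filterS (near0_nc d0) => h hd; apply: le_lt_trans (ncD _ _) _; lra.
Qed.

Lemma near_gt (x : C) (r : R) : r < nc x -> \forall h \near (0 : C), r < nc (x + h).
Proof.
move=> x1; have d0 : 0 < nc x - r by rewrite subr_gt0.
apply: filterS (near0_nc d0) => h hd.
have : nc x <= nc (x + h) + nc h by rewrite -{1}(addrK h x) -(ncN h) ncD.
lra.
Qed.

(** X1, X2, X3 are the variations of P1, Z, P2 under P1 Z = P2 G with G fixed. Division on the right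
    by P1 Z gives the boundary relation with K = X2 Z^-1. *)
Lemma mulmx_direct (X1 X2 X3 P1 P2 Z : M) : Z \in unitmx -> P1 \in unitmx ->
  X1 *m Z + P1 *m X2 = X3 *m (invmx P2 *m (P1 *m Z)) ->
  (X1 + P1 *m (X2 *m invmx Z)) *m invmx P1 = X3 *m invmx P2.
Proof.
move=> Zu P1u e; have -> : X1 + P1 *m (X2 *m invmx Z) = (X1 *m Z + P1 *m X2) *m invmx Z.
  by rewrite mulmxDl -!mulmxA mulmxV// mulmx1.
by rewrite e !mulmxA !mulmxK.
Qed.

(** The left-hand side of the conclusion is the variation of P2^-1 P1. *)
Lemma mulmx_converse (X1 X2 P1 P2 B : M) : P1 \in unitmx ->
  (X1 + P1 *m B) *m invmx P1 = X2 *m invmx P2 ->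
  - (invmx P2 *m X2 *m invmx P2) *m P1 + invmx P2 *m X1 = - (invmx P2 *m P1 *m B).
Proof.
move=> u1 e; have E : invmx P2 *m X2 *m invmx P2 *m P1 = invmx P2 *m (X1 + P1 *m B).
  by rewrite -(mulmxA _ X2) -e -!mulmxA mulVmx// mulmx1.
by rewrite mulNmx E mulmxDr opprD addrAC addNr add0r mulmxA.
Qed.

Lemma cplx_quotient g m (L K : C2fun -> M) (P Q S : M) :
  cplx g m (fun u => - (P *m L u *m Q) *m S + P *m K u) =
  - (P *m cplx g m L *m Q) *m S + P *m cplx g m K.
Proof.
rewrite /cplx; move: (tangent_Re _ _) (tangent_Im _ _) => u v.
rewrite !mulmxDr !mulmxDl opprD mulmxDl scalerDr addrACA; congr (_ + _ + _).
by rewrite !mulNmx scalerN; congr (- _); rewrite -scalemxAr -!scalemxAl.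
by rewrite -scalemxAr.
Qed.

Variables (U : set Diff2) (A : circle -> Diff2 -> M).
Hypotheses (Uo : open U) (Uc : connected U) (Uid : U Diff2_id) (AC1 : C1_on_mx U A).
Hypothesis A0 : forall g, U g -> contour_mx (A ^~ g) = 0.

Lemma near_U g : U g -> \forall u \near (0 : C2fun), U (chart g u).
Proof.
move=> Ug; have [m [d [[m0 d0] cU _ _ _]]] := coef_bounds Uo AC1 Ug.
by apply/near_chart; exists d; [exact: d0|move=> u ud; exact: (cU u ud).1].
Qed.

Section direct.
Variable Y : P1 (R := R) -> Diff2 -> M.
Hypothesis Yfs : fundamental_solution A U Y.
Hypothesis YM : M_invariant U Y.
Hypothesis Y1 : forall g, U g -> Y infty g = 1%:M.

Lemma sol_in g x : U g -> nc x < 1 ->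
  Y (affine_pt x) g = Ysum (bsq A true g) x *m Y (affine_pt 0) g.
Proof.
move=> Ug x1; have [_ Yh Yd _ _] := Yfs Ug; have [c _ wb] := bsq_wbd Uo AC1 true Ug.
have dY w : nc w < 1 -> cdiff (fun y => Y (affine_pt y) g) w
    (- (msum (dil w (shiftseq (bsq A true g))) *m Y (affine_pt w) g)).
  move=> w1; have Dw : (D_plus `|` D_minus) (affine_pt w) by left; apply/D_plusE.
  rewrite -mulNmx -(calA_in Uo AC1 Ug w1) -(Yd w Dw); apply: derive_cdiff; exact: (Yh _ Dw).
apply: (ode_uniq (Y := fun y => Y (affine_pt y) g) _ wb) x1 => //.
  by move=> w /andP[_ w1]; exact: dY.
move=> e e0; have n0 : nc (0 : C) < 1 by rewrite nc0.
by have := cdiff_cont (dY 0 n0) e0; apply: filterS => h; rewrite add0r.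
Qed.

(** In the coordinate w = 1 / x the factor x^-2 of [calA_out] cancels against dx / dw. At w = 0 the
    equation is not given, but holomorphy yields the continuity required by [ode_uniq], and the
    value 1 there removes the constant. *)
Lemma sol_out g x : U g -> 1 < nc x -> Y (affine_pt x) g = Ysum (bsq A false g) x^-1.
Proof.
move=> Ug x1; have [_ Yh Yd _ _] := Yfs Ug; have [c _ wb] := bsq_wbd Uo AC1 false Ug.
pose H (w : C) := Y (if w == 0 then infty else affine_pt w^-1) g.
have dY w : 0 < nc w < 1 -> cdiff H w (- (msum (dil w (shiftseq (bsq A false g))) *m H w)).
  move=> /andP[w0 w1]; have wn0 : w != 0 by rewrite -nc_eq0 gt_eqF.
  have wi : 1 < nc w^-1 by rewrite ncV invf_gt1.
  have Dw : (D_plus `|` D_minus) (affine_pt w^-1) by right; apply/D_minusE.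
  have d1 := derive_cdiff (Yh _ Dw : derivable (fun y => Y (affine_pt y) g) w^-1 1).
  rewrite (Yd _ Dw) (calA_out Uo AC1 Ug wi (Bcoef0 A0 Ug)) in d1.
  have := cdiff_inv wn0 d1; rewrite -scalemxAl scalerA invrK.
  have -> : w ^- 2 * w^-1 ^- 2 = 1 by rewrite exprVn invrK mulVf// expf_neq0.
  rewrite scale1r {2}/H (negbTE wn0); apply: cdiff_near.
  by apply: filterS (near_gt w0) => h hw; rewrite /H; case: eqP => // wh; move: hw; rewrite wh nc0 ltxx.
have Hc (e : R) : 0 < e -> \forall h \near (0 : C), mnorm (H h - H 0) <= e.
  have DI : (D_plus `|` D_minus) (@infty R) by right; left.
  have d0 := derive_cdiff (Yh _ DI : derivable H 0 1).
  by move=> e0; have := cdiff_cont d0 e0; apply: filterS => h; rewrite add0r.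
have x0 : x != 0 by rewrite -nc_eq0 gt_eqF// (lt_trans ltr01).
have xi : nc x^-1 < 1 by rewrite ncV invf_lt1 ?(lt_trans ltr01).
have := ode_uniq _ wb dY Hc xi; rewrite /H eqxx Y1// mulmx1 invr_eq0 (negbTE x0) invrK.
by apply.
Qed.

Lemma sol_monodromy z g : U g ->
  monodromy Y (g z) g = invmx (Psi A false z g) *m (Psi A true z g *m Y (affine_pt 0) g).
Proof.
move=> Ug; have [c _ wb] := bsq_wbd Uo AC1 true Ug; have [c' _ wb'] := bsq_wbd Uo AC1 false Ug.
rewrite /monodromy.
have [_ ->] := bv_plus (F := Y ^~ g) (g z) (erefl : bsq A true g 0%N = 0) wb (fun x x1 => sol_in Ug x1).
by have [_ ->] := bv_minus (F := Y ^~ g) (g z) (erefl : bsq A false g 0%N = 0) wb' (fun x x1 => sol_out Ug x1).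
Qed.

Lemma sol_deformation g m n : U g -> (1 <= n)%N -> deformation A g m n.
Proof.
move=> Ug n1; have [Yu _ _ Yd _] := Yfs Ug; set C := Y (affine_pt 0) in Yu Yd *.
have D0 : (D_plus `|` D_minus) (affine_pt (0 : R[i])).
  by left; apply/D_plusE; rewrite nc0 ltr01.
have [L CL] := differentiable_hasdiff (Yd _ D0).
have Cu : Y (affine_pt 0) g \in unitmx := Yu _ D0.
apply: (matching_deformation Uo AC1 A0 (K := cplx g m L *m invmx (Y (affine_pt 0) g)) Ug _ n1).
apply/(matching_boundary Uo AC1 A0 m _ Ug) => z.
(* At the point h(z) the monodromy for h is the one for the identity at z, since h^-1 undoes h; so G
   does not depend on h and has zero variation. *)
pose G := monodromy Y z Diff2_id.
have E h : U h -> Psi A true z h *m Y (affine_pt 0) h = Psi A false z h *m G.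
  move=> Uh; have [hb _ _ _] := Diff2_diffeo h; have [hK _] := cinvK hb.
  have := YM (h z) Uh; rewrite hK sol_monodromy// => e.
  have Pu := Psi_unit Uo AC1 false z Uh.
  exact: etrans (esym (mulKVmx Pu _)) (congr1 (mulmx (Psi A false z h)) e).
have h1 := hasdiffM (Psi_hasdiff Uo AC1 true z Ug) CL.
have h2 := hasdiffM (Psi_hasdiff Uo AC1 false z Ug) (hasdiff_cst G g).
have h3 : hasdiff (fun h => Psi A false z h *m G) g
    (fun u => dPsi A true z g u *m Y (affine_pt 0) g + Psi A true z g *m L u).
  apply: hasdiff_near h1; first exact: E.
  by apply: filterS (near_U Ug) => u; exact: E.
(* The two sides of [E] agree near g, so uniqueness of the differential equates their variations. *)
have := congr1 (cplx g m) (hasdiff_uniq h3 h2).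
rewrite !cplxD !cplx_rmul !cplx_lmul => e.
rewrite mulmx0 addr0 in e.
have Pu : Psi A true z g \in unitmx by exact: (Psi_unit Uo AC1).
have Pu' : Psi A false z g \in unitmx by exact: (Psi_unit Uo AC1).
have GE : G = invmx (Psi A false z g) *m (Psi A true z g *m Y (affine_pt 0) g).
  by rewrite (E g Ug) mulKmx.
by apply: (mulmx_direct Cu Pu); rewrite -GE.
Qed.

End direct.

Section converse.
Hypothesis def : forall g m n, U g -> (1 <= n)%N -> deformation A g m n.

(* Up to the normalization of the inner solution, the monodromy at the point g z. *)
Definition jump z g : M := invmx (Psi A false z g) *m Psi A true z g.

Lemma jump_unit z g : U g -> jump z g \in unitmx.
Proof.
move=> Ug; rewrite /jump unitmx_mul unitmx_inv; apply/andP; split; exact: (Psi_unit Uo AC1).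
Qed.

(** The factor B_m on the right is common to all z, and therefore cancels in quotients of jumps. *)
Lemma jump_hasdiff z g : U g -> exists2 L, hasdiff (jump z) g L &
  forall m, cplx g m L = - (jump z g *m Bcoef A m g).
Proof.
move=> Ug; have Pu := Psi_unit Uo AC1 true z Ug; have Pu' := Psi_unit Uo AC1 false z Ug.
have nu : \forall u \near (0 : C2fun), Psi A false z (chart g u) \in unitmx.
  by apply: filterS (near_U Ug) => u; exact: (Psi_unit Uo AC1).
have h := hasdiffM (hasdiff_inv nu Pu' (Psi_hasdiff Uo AC1 false z Ug)) (Psi_hasdiff Uo AC1 true z Ug).
eexists; first exact: h.
move=> m; rewrite cplx_quotient.
have /(matching_boundary Uo AC1 A0 m _ Ug)/(_ z) :=
  deformation_matching Uo AC1 A0 Ug (fun n n1 => def m Ug n1).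
exact: mulmx_converse Pu.
Qed.

(** If L_m P = - P B and L_m Q = - Q B, then L_m (P Q^-1) = - P B Q^-1 + P Q^-1 Q B Q^-1 = 0. *)
Lemma jump_quotient z z' g h : U g -> U h ->
  jump z h *m invmx (jump z' h) = jump z g *m invmx (jump z' g).
Proof.
move=> Ug Uh; apply: (hasdiff_flat_cst (F := fun h => jump z h *m invmx (jump z' h)) Uo Uc) Ug Uh => {g h} g Ug.
have [L Ld Lm] := jump_hasdiff z Ug; have [L' Ld' Lm'] := jump_hasdiff z' Ug.
have nu : \forall u \near (0 : C2fun), jump z' (chart g u) \in unitmx.
  by apply: filterS (near_U Ug) => u; exact: jump_unit.
have u' := jump_unit z' Ug.
have H := hasdiffM Ld (hasdiff_inv nu u' Ld').
have E := cplx_dense (g := g) H.2 _.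
have -> : (fun=> 0) = fun u => L u *m invmx (jump z' g) +
    jump z g *m - (invmx (jump z' g) *m L' u *m invmx (jump z' g)).
  apply/funext => u; apply: esym; apply: E => m.
  rewrite cplxD cplx_rmul cplx_lmul cplxN cplx_rmul cplx_lmul Lm Lm'.
  move: (jump z g) (jump z' g) u' (Bcoef A m g) => Q Q' Q'u B.
  by rewrite (mulmxN (invmx Q')) (mulmxA (invmx Q')) mulVmx// mul1mx !mulNmx opprK mulmxA addNr.
exact: H.
Qed.

Let xi0 : circle := cis 0.

Definition normalization g : M := invmx (jump xi0 g) *m jump xi0 Diff2_id.

(** The value 0 on the circle is a filler: boundary values are limits from either side. *)
Definition solution (p : P1 (R := R)) (g : Diff2) : M :=
  if p is Some x then
    if nc x < 1 then Ysum (bsq A true g) x *m normalization g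
    else if 1 < nc x then Ysum (bsq A false g) x^-1 else 0
  else 1%:M.

Lemma solution_in g x : nc x < 1 -> solution (affine_pt x) g = Ysum (bsq A true g) x *m normalization g.
Proof. by move=> x1; rewrite /= x1. Qed.

Lemma solution_out g x : 1 < nc x -> solution (affine_pt x) g = Ysum (bsq A false g) x^-1.
Proof. by move=> x1; rewrite /= ltNge (ltW x1) x1. Qed.

Lemma normalization_unit g : U g -> normalization g \in unitmx.
Proof.
move=> Ug; rewrite /normalization unitmx_mul unitmx_inv.
by apply/andP; split; [exact: jump_unit Ug|exact: jump_unit Uid].
Qed.

(** By [jump_quotient] the product of [jump z g] and the inverse of [jump xi0 g] keeps its value at
    the identity, where the factor [jump xi0 Diff2_id] cancels the inverse. *)
Lemma jump_normalization z g : U g -> jump z g *m normalization g = jump z Diff2_id.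
Proof.
move=> Ug; rewrite /normalization mulmxA (jump_quotient z xi0 Uid Ug) -mulmxA.
by rewrite mulVmx ?mulmx1//; exact: jump_unit.
Qed.

Lemma solution_bv g z : U g ->
  (bv_cvg D_plus (solution ^~ g) z /\
   bv D_plus (solution ^~ g) z = Ysum (bsq A true g) (z : C) *m normalization g) /\
  (bv_cvg D_minus (solution ^~ g) z /\
   bv D_minus (solution ^~ g) z = Ysum (bsq A false g) (z : C)^-1).
Proof.
move=> Ug; have [c _ wb] := bsq_wbd Uo AC1 true Ug; have [c' _ wb'] := bsq_wbd Uo AC1 false Ug.
split.
  exact: (bv_plus (F := solution ^~ g) z (erefl : bsq A true g 0%N = 0) wb (fun x x1 => solution_in g x1)).
exact: (bv_minus (F := solution ^~ g) z (erefl : bsq A false g 0%N = 0) wb' (fun x x1 => solution_out g x1)).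
Qed.

Lemma solution_monodromy z g : U g -> monodromy solution (g z) g = jump z Diff2_id.
Proof.
move=> Ug; have [[_ e1] [_ e2]] := solution_bv (g z) Ug.
rewrite /monodromy e1 e2 mulmxA; exact: jump_normalization.
Qed.

Lemma solution_cdiff g x : U g -> (D_plus `|` D_minus) (affine_pt x) ->
  cdiff (fun y => solution (affine_pt y) g) x (calA A x g *m solution (affine_pt x) g).
Proof.
move=> Ug; have [c _ wb] := bsq_wbd Uo AC1 true Ug; have [c' _ wb'] := bsq_wbd Uo AC1 false Ug.
have b0 sg : bsq A sg g 0%N = 0 by [].
case=> [/D_plusE x1|/D_minusE x1].
  rewrite solution_in// (calA_in Uo AC1 Ug x1) mulNmx mulmxA -mulNmx.
  set D := - (msum (dil x (shiftseq (bsq A true g))) *m Ysum (bsq A true g) x).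
  have d : lapp (nbhs (0 : C)) nc (fun h => Ysum (bsq A true g) (x + h) *m normalization g)
      (Ysum (bsq A true g) x *m normalization g) (fun h => (h *: D) *m normalization g).
    exact: lapp_rmul (Ysum_cdiff (b0 true) wb x1).
  have E : (fun h : C => (h *: D) *m normalization g) = fun h : C => h *: (D *m normalization g).
    by apply/funext => h; rewrite -scalemxAl.
  rewrite E in d; apply: (@cdiff_near (fun y => Ysum (bsq A true g) y *m normalization g)) d.
  by apply: filterS (near_lt1 x1) => h hx; rewrite solution_in.
have x0 : x != 0 by rewrite -nc_eq0 gt_eqF// (lt_trans ltr01).
have xi : nc x^-1 < 1 by rewrite ncV invf_lt1 ?(lt_trans ltr01).
have d := cdiff_inv x0 (Ysum_cdiff (b0 false) wb' xi).
have E : calA A x g *m solution (affine_pt x) g =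
    - (x ^- 2 *: - (msum (dil x^-1 (shiftseq (bsq A false g))) *m Ysum (bsq A false g) x^-1)).
  rewrite (solution_out g x1) (calA_out Uo AC1 Ug x1 (Bcoef0 A0 Ug)) scalerN opprK.
  by apply: esym; exact: scalemxAl.
rewrite E; apply: cdiff_near d.
by apply: filterS (near_gt x1) => h hx; rewrite solution_out.
Qed.

Lemma solution_infty g : U g ->
  derivable (fun w : C => solution (if w == 0 then infty else affine_pt w^-1) g) 0 1.
Proof.
move=> Ug; have [c _ wb] := bsq_wbd Uo AC1 false Ug.
have b0 : bsq A false g 0%N = 0 by [].
have n0 : nc (0 : C) < 1 by rewrite nc0 ltr01.
have d := Ysum_cdiff b0 wb n0.
suff /cdiff_derive[] : cdiff (fun w : C => solution (if w == 0 then infty else affine_pt w^-1) g) 0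
  (- (msum (dil 0 (shiftseq (bsq A false g))) *m Ysum (bsq A false g) 0)) by [].
apply: cdiff_near d; apply: filterS (near_lt1 n0) => w; rewrite add0r => w1.
case: eqVneq => [->|w0]; first by rewrite Ysum0.
by rewrite solution_out ?invrK// ncV invf_gt1// lt_neqAle nc_ge0 andbT eq_sym nc_eq0.
Qed.

Lemma normalization_hasdiff g : U g -> exists L, hasdiff normalization g L.
Proof.
move=> Ug; have [L Ld _] := jump_hasdiff xi0 Ug.
have nu : \forall u \near (0 : C2fun), jump xi0 (chart g u) \in unitmx.
  by apply: filterS (near_U Ug) => u; exact: jump_unit.
eexists; exact: hasdiffM (hasdiff_inv nu (jump_unit xi0 Ug) Ld) (hasdiff_cst _ g).
Qed.

(** The case of zero velocity in [Ysum_hasdiff]. *)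
Lemma Ysum_hasdiff_cst sg g x : U g -> nc x <= 1 ->
  exists L, hasdiff (fun h => Ysum (bsq A sg h) x) g L.
Proof.
move=> Ug x1; eexists.
apply: (@Ysum_hasdiff R N U A Uo AC1 sg g (fun=> x) (fun=> 0) Ug).
- by [].
- by move=> a u v; rewrite mulr0 addr0.
- by move=> u; rewrite nc0.
- move=> e e0; apply/near_chart; exists 1; first exact: ltr01.
  by move=> u _; rewrite subrr mulr0 subr0 nc0 mulr_ge0// ltW.
Qed.

Lemma solution_hasdiff g p : U g -> (D_plus `|` D_minus) p -> exists L, hasdiff (solution p) g L.
Proof.
move=> Ug; case: p => [x|_]; last by exists (fun=> 0); exact: hasdiff_cst.
case=> [/D_plusE x1|/D_minusE x1].
  have [L Ld] := normalization_hasdiff Ug; have [K Kd] := Ysum_hasdiff_cst true Ug (ltW x1).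
  have -> : solution (affine_pt x) = fun h => Ysum (bsq A true h) x *m normalization h.
    by apply/funext => h; exact: solution_in.
  by eexists; exact: hasdiffM Kd Ld.
have xi : nc x^-1 <= 1 by rewrite ncV invf_le1 ?(lt_trans ltr01)// ltW.
have [K Kd] := Ysum_hasdiff_cst false Ug xi; exists K.
have -> // : solution (affine_pt x) = fun h => Ysum (bsq A false h) x^-1.
by apply/funext => h; exact: solution_out.
Qed.

Lemma solution_unit g p : U g -> (D_plus `|` D_minus) p -> solution p g \in unitmx.
Proof.
move=> Ug; have [c _ wb] := bsq_wbd Uo AC1 true Ug; have [c' _ wb'] := bsq_wbd Uo AC1 false Ug.
have b0 sg : bsq A sg g 0%N = 0 by [].
case: p => [x|_]; last exact: unitmx1.
case=> [/D_plusE x1|/D_minusE x1].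
  rewrite -/(affine_pt x) solution_in// unitmx_mul normalization_unit// andbT.
  exact: Ysum_unit (b0 true) wb (ltW x1).
rewrite -/(affine_pt x) solution_out//; apply: Ysum_unit (b0 false) wb' _.
by rewrite ncV invf_le1 ?(lt_trans ltr01)// ltW.
Qed.

Lemma solution_fundamental : fundamental_solution A U solution.
Proof.
move=> g Ug; split.
- by move=> p; exact: solution_unit.
- case=> [x Dx|_]; last exact: solution_infty.
  by have [] := cdiff_derive (solution_cdiff Ug Dx).
- by move=> x Dx; have [] := cdiff_derive (solution_cdiff Ug Dx).
- by move=> p Dp a b; have [L Ld] := solution_hasdiff Ug Dp; have [] := hasdiffP Ld a b.
- have [c _ wb] := bsq_wbd Uo AC1 true Ug; have [c' _ wb'] := bsq_wbd Uo AC1 false Ug.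
  have b0 sg : bsq A sg g 0%N = 0 by [].
  move=> D [->|->] z; have [[h1 e1] [h2 e2]] := solution_bv z Ug.
    split; first exact: h1.
    rewrite e1 unitmx_mul normalization_unit// andbT; apply: Ysum_unit (b0 true) wb _.
    by rewrite nc_circle.
  split; first exact: h2.
  by rewrite e2; apply: Ysum_unit (b0 false) wb' _; rewrite ncV nc_circle invr1.
Qed.

(** Every point of the circle is the image under g of its preimage, and [solution_monodromy] applies
    to g there and to the identity at the preimage, with the same result. *)
Lemma solution_M_invariant : M_invariant U solution.
Proof.
move=> z g Ug; have [gb _ _ _] := Diff2_diffeo g; have [gK Kg] := cinvK gb.
rewrite -{1}(Kg z) solution_monodromy// -(solution_monodromy _ Uid).
by [].
Qed.

End converse.

End main.

Theorem theorem2 (R : realType) (N : nat)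
  (U : set (Diff2 R)) (G0 : circle R -> 'M[R[i]]_N)
  (A : circle R -> Diff2 R -> 'M[R[i]]_N)
  (U_open : open U) (U_connected : connected U) (U_id : U Diff2_id)
  (G0_tilde : loop_tilde G0)
  (G0_U : forall g, U g -> loop_tilde (G0 \o cinv g))
  (A_C1 : C1_on_mx U A)
  (A_int0 : forall g, U g -> contour_mx (A ^~ g) = 0) :
  (exists Y : P1 -> Diff2 R -> 'M[R[i]]_N,
    [/\ fundamental_solution A U Y,
        M_invariant U Y &
        forall g, U g -> Y infty g = 1%:M])
  <->
  (forall (g : Diff2 R) (m : int) (n : nat), U g -> (1 <= n)%N ->
    lie_mx (L_ m) (Bcoef A n%:Z) g =
      \sum_(0 <= k < n) commutator (Bcoef A k%:Z g) (Bcoef A (m + n%:Z - k%:Z) g)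
      + n%:R *: Bcoef A (m + n%:Z) g
    /\
    lie_mx (L_ m) (Bcoef A (- n%:Z)) g =
      - (\sum_(1 <= k < n.+1)
           commutator (Bcoef A (- k%:Z) g) (Bcoef A (m - n%:Z + k%:Z) g))
      - n%:R *: Bcoef A (m - n%:Z) g).
Proof.
split=> [[Y [Yfs YM Y1]] g m n Ug n1|H].
  exact: (sol_deformation U_open A_C1 A_int0 Yfs YM Y1 m Ug n1).
exists (solution A); split.
- exact: (solution_fundamental U_open U_id A_C1 A_int0 H).
- exact: (solution_M_invariant U_open U_connected U_id A_C1 A_int0 H).
- by [].
Qed.
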